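(* Let $M$ be a closed Riemannian manifold and let $\mu$ be a Borel probability measure on $\mathrm{Diff}^1_{\mathrm{vol}}(M)$. Suppose that: (1) the associated two-point motion enjoys annealed exponential mixing on $\mathcal{B}=\mathcal{H}^p_0(M\times M)$ for some $p\ge 0$, or on $\mathcal{B}=C^\alpha_0(M\times M)$ for some $\alpha>0$; that is, there are $C\ge 0$ and $\theta>0$ such that for all $A,B\in\mathcal{B}$ and all $N\in\mathbb{N}$, $$\left|\mathbb{E}\left(\iint A(x,y)\,B(F^N_\omega x,F^N_\omega y)\,dx\,dy\right)\right|\le C\|A\|_{\mathcal{B}}\|B\|_{\mathcal{B}}e^{-\theta N};$$ (2) for each zero-mean function $B\in C^\infty(M\times M)$ there exists $\eta>0$ such that for each $\xi\in\mathbb{R}$, as $N\to\infty$, $$\mathbb{E}\left(\iint e^{i\xi S^N_B(x,y)/\sqrt N}\,dx\,dy\right)=e^{-\mathbb{D}(B)\xi^2/2}+O(N^{-\eta}),$$ where for fixed $B$ and $\xi$ the implied constant does not depend on $N$. Then for each $s>0$, with probability $1$ (i.e. for $\mu^{\mathbb{N}}$-almost every $\omega$) the following holds for every $A\in\mathcal{H}^s_0(M)$ simultaneously: if $x$ is distributed on $M$ according to normalized volume, then $N^{-1/2}S_N(A)(x,\omega)$ converges in distribution as $N\to\infty$ to a normal random variable with mean zero and variance $\mathcal{D}(A)$. The same conclusion holds with $\mathcal{H}^s_0(M)$ replaced by $C^s_0(M)$, the space of zero-mean $s$-Hölder functions.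
   Context: $\mathrm{Diff}^1_{\mathrm{vol}}(M)$ is the group of $C^1$ volume-preserving diffeomorphisms; $dx$ is volume normalized to total mass $1$. A word $\omega=(\omega_0,\omega_1,\dots)$ is distributed according to $\mu^{\mathbb{N}}$; $\mathbb{E}$ is expectation over $\omega$ only. $F^N_\omega=\omega_{N-1}\circ\cdots\circ\omega_0$, $F^0_\omega=\mathrm{id}$. For $X=M$ or $M\times M$: $\mathcal{H}^s_0(X)$ is the space of zero-mean real functions in the $L^2$-Sobolev space of order $s$ with its usual norm; $C^\alpha_0(X)$ is the space of zero-mean real functions of Hölder class $C^\alpha$. Notation: for $A:M\to\mathbb{R}$, $S_N(A)(x,\omega)=\sum_{n=0}^{N-1}A(F^n_\omega x)$ and $$\mathcal{D}(A)=\int A^2\,dx+2\sum_{k=1}^\infty\mathbb{E}\left(\int A(x)A(F^k_\omega x)\,dx\right).$$ For $B:M\times M\to\mathbb{R}$, $S^N_B(x,y)=\sum_{n=0}^{N-1}B(F^n_\omega x,F^n_\omega y)$ and $$\mathbb{D}(B)=\iint B^2\,dx\,dy+2\sum_{k=1}^\infty\mathbb{E}\left(\iint B(x,y)B(F^k_\omega x,F^k_\omega y)\,dx\,dy\right).$$ A normal random variable of variance $0$ means the constant $0$. *)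

(* Defs.v *)
From HB Require Import structures.
From mathcomp Require Import all_boot all_order all_algebra.
From mathcomp Require Import complex.
From mathcomp Require Import all_classical all_reals all_analysis.

Set Implicit Arguments.
Unset Strict Implicit.
Unset Printing Implicit Defensive.

Import Order.TTheory GRing.Theory Num.Theory.
Import numFieldNormedType.Exports.

Local Open Scope classical_set_scope.
Local Open Scope ring_scope.

Section euclidean.
Context {R : realType}.

Definition basis_vec d (l : 'I_d) : 'rV[R]_d := delta_mx 0 l.

Definition dotp d (v w : 'rV[R]_d) : R := \sum_(l < d) v 0 l * w 0 l.

(* Class C^k on an open set U; only the values of f on U matter. *)
Fixpoint Ck d (k : nat) (U : set 'rV[R]_d) (f : 'rV[R]_d -> R) : Prop :=
  (forall z, U z -> {for z, continuous f}) /\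
  (if k is k'.+1 then
     forall l : 'I_d, (forall z, U z -> derivable f z (basis_vec l)) /\
                      Ck k' U ('D_(basis_vec l) f)
   else True).

Definition Cinf d (U : set 'rV[R]_d) (f : 'rV[R]_d -> R) : Prop :=
  forall k, Ck k U f.

Definition pderivs d (a : seq 'I_d) (f : 'rV[R]_d -> R) : 'rV[R]_d -> R :=
  foldr (fun l h => 'D_(basis_vec l) h) f a.

(* Integral over R^d against Lebesgue measure, as an iterated integral; by
   Fubini-Tonelli this is the Lebesgue integral as soon as f is Borel and
   either nonnegative or integrable, the only cases in which it is used. *)
Fixpoint intRd d : ('rV[R]_d -> \bar R) -> \bar R :=
  match d return ('rV[R]_d -> \bar R) -> \bar R with
  | 0 => fun f => f 0
  | d'.+1 => fun f =>
      (\int[lebesgue_measure]_(t in [set: R])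
         intRd (fun v : 'rV[R]_d' =>
           f (row_mx (t%:M : 'M[R]_1) v : 'rV[R]_(1 + d'))))%E
  end.

(* | int f(z) exp(-2 i pi <z, xi>) dz |^2 *)
Definition fourier_sqmod d (f : 'rV[R]_d -> R) (xi : 'rV[R]_d) : R :=
  fine (intRd (fun z => (f z * cos (2 * pi * dotp z xi))%:E)) ^+ 2 +
  fine (intRd (fun z => (f z * sin (2 * pi * dotp z xi))%:E)) ^+ 2.

(* Square of the H^s(R^d) norm, for f square integrable with compact support *)
Definition sobolev_sqnorm_Rd d (s : R) (f : 'rV[R]_d -> R) : \bar R :=
  intRd (fun xi => ((1 + (2 * pi) ^+ 2 * dotp xi xi) `^ s
                    * fourier_sqmod f xi)%:E).

(* C^{k,b}(R^d) norm; at z = z' the quotient is 0, as x / 0 = 0. *)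
Definition holder_norm_Rd d (k : nat) (b : R) (f : 'rV[R]_d -> R) : \bar R :=
  (ereal_sup [set (`|pderivs a f z|)%:E
               | a in [set a : seq 'I_d | (size a <= k)%N] & z in setT] +
   maxe 0 (ereal_sup [set y | exists (a : seq 'I_d) (z z' : 'rV[R]_d),
     size a = k /\
     y = (`|pderivs a f z - pderivs a f z'| / `|z - z'| `^ b)%:E]))%E.

End euclidean.

(* A finite family of charts [phi i : dom i -> R^dim], with inverses [psi i]
   and cutoff functions [chi i] (a partition of unity, see below); for now bare
   data, so that the product of two systems can be formed directly. *)
Record chartSystem (R : realType) (T : Type) := ChartSystem {
  dim : nat;
  idx : finType;
  dom : idx -> set T;
  phi : idx -> T -> 'rV[R]_dim;
  psi : idx -> 'rV[R]_dim -> T;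
  chi : idx -> T -> R
}.

Section chart_systems.
Context {R : realType}.

Definition codom_chart (T : Type) (X : chartSystem R T) (i : idx X) :
  set 'rV[R]_(dim X) := phi i @` dom i.

Definition prod_charts (T T' : Type) (X : chartSystem R T)
    (Y : chartSystem R T') : chartSystem R (T * T') :=
  @ChartSystem R (T * T')%type (dim X + dim Y) (idx X * idx Y)%type
    (fun i => dom i.1 `*` dom i.2)
    (fun i z => row_mx (phi i.1 z.1) (phi i.2 z.2))
    (fun i v => (psi i.1 (lsubmx v), psi i.2 (rsubmx v)))
    (fun i z => chi i.1 z.1 * chi i.2 z.2).

Definition smooth_fun (T : Type) (X : chartSystem R T) (u : T -> R) : Prop :=
  forall i : idx X, Cinf (codom_chart i) (u \o psi i).

(* chi_i u read in the i-th chart, extended by 0 to R^dim *)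
Definition localize (T : Type) (X : chartSystem R T) (i : idx X) (u : T -> R) :
  'rV[R]_(dim X) -> R := (fun z => chi i (psi i z) * u (psi i z)) \_ (codom_chart i).

Record normedFunSpace (T : Type) := NormedFunSpace {
  fs_mem : set (T -> R);
  fs_norm : (T -> R) -> R
}.

Definition sobolev_sqnorm (T : Type) (X : chartSystem R T) (s : R)
    (u : T -> R) : \bar R :=
  (\sum_(i : idx X) sobolev_sqnorm_Rd s (localize i u))%E.

Definition holder_norm (T : Type) (X : chartSystem R T) (k : nat) (b : R)
    (u : T -> R) : \bar R :=
  (\sum_(i : idx X) holder_norm_Rd k b (localize i u))%E.

Section function_spaces.
Context {disp : measure_display} {T : measurableType disp}.
Variables (X : chartSystem R T) (m : {measure set T -> \bar R}).

Definition zero_mean (u : T -> R) : Prop := \int[m]_(x in setT) u x = 0.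

(* H^s_0, through Borel representatives of its classes *)
Definition sobolev0 (s : R) : normedFunSpace T := NormedFunSpace
  [set u : T -> R | [/\ measurable_fun setT u,
               m.-integrable setT (fun x => (u x ^+ 2)%:E),
               (sobolev_sqnorm X s u < +oo)%E & zero_mean u]]
  (fun u => Num.sqrt (fine (sobolev_sqnorm X s u))).

Definition holder0 (k : nat) (b : R) : normedFunSpace T := NormedFunSpace
  [set u : T -> R | [/\ (forall i : idx X, Ck k setT (localize i u)),
               (holder_norm X k b u < +oo)%E & zero_mean u]]
  (fun u => fine (holder_norm X k b u)).

End function_spaces.

(* The Hoelder class C^s is C^{k,b} with s = k + b. For integral s both
   C^{s,0} = C^s and C^{s-1,1} (Lipschitz derivatives) are allowed. *)
Definition holder_exponents (s : R) (k : nat) (b : R) : Prop :=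
  [/\ 0 < s, s = k%:R + b & 0 <= b <= 1].

End chart_systems.

Notation borel M := (g_sigma_algebraType (@open M)).

(* A compact manifold has a finite atlas with a subordinate smooth partition of
   unity. Other choices of these give equivalent norms above. *)
Record closedRiemannian (R : realType) := ClosedRiemannian {
  carrier :> ptopologicalType;
  atlas : chartSystem R carrier;
  metric : idx atlas -> 'rV[R]_(dim atlas) -> 'M[R]_(dim atlas);
  vol : {measure set (borel carrier) -> \bar R};

  carrier_hausdorff : hausdorff_space carrier;
  carrier_compact : compact [set: carrier];

  chart_dom_open : forall i : idx atlas, open (dom i);
  chart_codom_open : forall i : idx atlas, open (codom_chart i);
  chart_cover : forall x : carrier, exists i : idx atlas, dom i x;
  chart_phiK : forall (i : idx atlas) x, dom i x -> psi i (phi i x) = x;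
  chart_phi_continuous : forall (i : idx atlas) x, dom i x ->
    {for x, continuous (phi i)};
  chart_psi_continuous : forall (i : idx atlas) z, codom_chart i z ->
    {for z, continuous (psi i)};
  chart_transition : forall (i j : idx atlas) (l : 'I_(dim atlas)),
    Cinf (phi i @` (dom i `&` dom j)) (fun z => phi j (psi i z) 0 l);

  metric_smooth : forall (i : idx atlas) (l l' : 'I_(dim atlas)),
    Cinf (codom_chart i) (fun z => metric i z l l');
  metric_sym : forall (i : idx atlas) z, codom_chart i z ->
    (metric i z)^T = metric i z;
  metric_pos : forall (i : idx atlas) z, codom_chart i z ->
    forall v : 'rV[R]_(dim atlas), v != 0 -> 0 < (v *m metric i z *m v^T) 0 0;
  (* [jacobian] acts on row vectors from the right *)
  metric_transition : forall (i j : idx atlas) z,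
    (phi i @` (dom i `&` dom j)) z ->
    let J := jacobian (phi j \o psi i) z in
    metric i z = J *m metric j (phi j (psi i z)) *m J^T;

  (* vol is the Riemannian volume: sqrt(det g) dz in each chart *)
  vol_chart : forall (i : idx atlas) (A : set (borel carrier)),
    measurable A -> A `<=` dom i ->
    vol A = intRd (fun z => (Num.sqrt (\det (metric i z))
                             * \1_(phi i @` A) z)%:E);

  chi_smooth : forall i : idx atlas, smooth_fun atlas (chi i);
  chi_ge0 : forall (i : idx atlas) x, 0 <= chi i x;
  chi_sum1 : forall x : carrier, \sum_(i : idx atlas) chi i x = 1;
  chi_support : forall i : idx atlas,
    closure [set x | chi i x != 0] `<=` dom i
}.

Section manifold.
Context {R : realType} (M : closedRiemannian R).

(* normalized volume; vol is finite and nonzero, so that the default \d_point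
   in [mnormalize] is irrelevant *)
Definition dx : probability (borel M) R :=
  mnormalize (@vol R M) (\d_(point : borel M)).

Definition dxdy : {measure set (borel M * borel M) -> \bar R} := (dx \x dx)%E.

Definition atlas2 : chartSystem R (M * M) := prod_charts (atlas M) (atlas M).

Definition sobolev0_M (s : R) : normedFunSpace (borel M) :=
  @sobolev0 R _ (borel M) (atlas M) dx s.

Definition holder0_M (k : nat) (b : R) : normedFunSpace (borel M) :=
  @holder0 R _ (borel M) (atlas M) dx k b.

Definition sobolev0_MM (s : R) : normedFunSpace (borel M * borel M) :=
  @sobolev0 R _ (borel M * borel M)%type atlas2 dxdy s.

Definition holder0_MM (k : nat) (b : R) : normedFunSpace (borel M * borel M) :=
  @holder0 R _ (borel M * borel M)%type atlas2 dxdy k b.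

(* coordinate l of f, read from chart i to chart j *)
Definition in_charts (f : M -> M) (i j : idx (atlas M)) (l : 'I_(dim (atlas M)))
  : 'rV[R]_(dim (atlas M)) -> R := fun z => phi j (f (psi i z)) 0 l.

Definition C1_map (f : M -> M) : Prop :=
  continuous f /\
  forall (i j : idx (atlas M)) l,
    Ck 1 (phi i @` (dom i `&` f @^-1` dom j)) (in_charts f i j l).

Definition C1_vol_diffeo (f : M -> M) : Prop :=
  [/\ C1_map f,
      exists g : M -> M, [/\ cancel f g, cancel g f & C1_map g] &
      forall A : set (borel M), measurable A -> dx (f @^-1` A) = dx A].

Record diff1_vol := Diff1Vol {
  diff_fun :> M -> M;
  diff_funP : C1_vol_diffeo diff_fun
}.

Lemma C1_map_id : C1_map id.
Proof.
split; first by move=> x.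
by move=> i j l; exact: (@chart_transition R M i j l 1).
Qed.

Lemma C1_vol_diffeo_id : C1_vol_diffeo id.
Proof.
split; first exact: C1_map_id.
  by exists id; split => //; exact: C1_map_id.
by move=> A mA; rewrite preimage_id.
Qed.

HB.instance Definition _ := gen_eqMixin diff1_vol.
HB.instance Definition _ := gen_choiceMixin diff1_vol.
HB.instance Definition _ := isPointed.Build diff1_vol (Diff1Vol C1_vol_diffeo_id).

(* subbasic neighborhood of f in the C^1 topology, for K compact in dom i such
   that f(K) is included in dom j *)
Definition C1_ball (f : diff1_vol) (i j : idx (atlas M)) (K : set M) (e : R) :
  set diff1_vol :=
  [set h | h @` K `<=` dom j /\
    forall x, K x -> forall l,
      `|in_charts h i j l (phi i x) - in_charts f i j l (phi i x)| < e /\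
      forall l', `|'D_(basis_vec l') (in_charts h i j l) (phi i x)
                   - 'D_(basis_vec l') (in_charts f i j l) (phi i x)| < e].

Definition C1_subbasic (f : diff1_vol) (V : set diff1_vol) : Prop :=
  exists (i j : idx (atlas M)) (K : set M) (e : R),
    [/\ compact K, K `<=` dom i, f @` K `<=` dom j, 0 < e &
        V = C1_ball f i j K e].

Definition C1_open (U : set diff1_vol) : Prop :=
  forall f, U f -> exists (n : nat) (V : 'I_n -> set diff1_vol),
    (forall a, C1_subbasic f (V a)) /\ \bigcap_(a in setT) V a `<=` U.

Definition borelDiff := g_sigma_algebraType C1_open.

Definition cylinders : set (set (nat -> borelDiff)) :=
  [set C | exists (n : nat) (A : set borelDiff),
     measurable A /\ C = [set w | A (w n)]].

Definition words := g_sigma_algebraType cylinders.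

(* P = mu^N: these cylinder values determine P *)
Definition is_product_power (mu : probability borelDiff R)
    (P : probability words R) : Prop :=
  forall (n : nat) (A : nat -> set borelDiff), (forall k, measurable (A k)) ->
    P [set w : words | forall k, (k < n)%N -> A k (w k)] =
    (\prod_(0 <= k < n) fine (mu (A k)))%:E.

Fixpoint rcomp (w : words) (n : nat) (x : M) : M :=
  if n is n'.+1 then (w n' : diff1_vol) (rcomp w n' x) else x.

Definition rcomp2 (w : words) (n : nat) (z : M * M) : M * M :=
  (rcomp w n z.1, rcomp w n z.2).

End manifold.

Section limit_theorems.
Context {R : realType} {dW dT : measure_display} {W : measurableType dW}
  {T : measurableType dT}.
Variables (P : probability W R) (m : {measure set T -> \bar R}).
Variable F : W -> nat -> T -> T.

Definition birkhoff (A : T -> R) (N : nat) (x : T) (w : W) : R :=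
  \sum_(0 <= n < N) A (F w n x).

Definition correlation (A B : T -> R) (k : nat) : R :=
  \int[P]_(w in setT) \int[m]_(x in setT) (A x * B (F w k x)).

Definition variance_partial (A : T -> R) (n : nat) : R :=
  \int[m]_(x in setT) (A x ^+ 2) + 2 * \sum_(1 <= k < n.+1) correlation A A k.

(* the quantity D(A), when the series converges *)
Definition asymp_variance (A : T -> R) : R := limn (variance_partial A).

Definition annealed_exp_mixing (B : normedFunSpace T) : Prop :=
  exists C theta : R, [/\ 0 <= C, 0 < theta &
    forall f g : T -> R, fs_mem B f -> fs_mem B g -> forall N : nat,
      `|correlation f g N|
        <= C * fs_norm B f * fs_norm B g * expR (- (theta * N%:R))].

Definition annealed_charfun (A : T -> R) (N : nat) (xi : R) : R[i] :=
  Complex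
    (\int[P]_(w in setT) \int[m]_(x in setT)
       cos (xi * birkhoff A N x w / Num.sqrt N%:R))
    (\int[P]_(w in setT) \int[m]_(x in setT)
       sin (xi * birkhoff A N x w / Num.sqrt N%:R)).

Definition annealed_CLT_rate (A : T -> R) : Prop :=
  exists2 eta : R, 0 < eta & forall xi : R, exists K : R,
    \forall N \near \oo,
      ComplexField.Normc.normc (annealed_charfun A N xi
         - (expR (- (asymp_variance A * xi ^+ 2 / 2)))%:C%C)
      <= K * N%:R `^ (- eta).

(* integral of h against the normal law N(0, v), for v >= 0 *)
Definition gaussian_mean (v : R) (h : R -> R) : R :=
  if v == 0 then h 0
  else \int[normal_prob 0 (Num.sqrt v)]_(y in [set: R]) h y.

Definition cvg_to_centered_normal (Y : nat -> T -> R) (v : R) : Prop :=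
  forall h : R -> R, continuous h -> (exists K : R, forall y, `|h y| <= K) ->
    (\int[m]_(x in setT) h (Y N x)) @[N --> \oo] --> gaussian_mean v h.

(* The convergence of the series D(A) and D(A) >= 0 are part of the claim. *)
Definition CLT_at (w : W) (A : T -> R) : Prop :=
  [/\ cvgn (variance_partial A), 0 <= asymp_variance A &
      cvg_to_centered_normal
        (fun N x => (Num.sqrt N%:R)^-1 * birkhoff A N x w)
        (asymp_variance A)].

End limit_theorems.

(* Main.v *)
(* A function of class H^s or C^s is approximated in L^2, at a polynomial rate
   in n, by combinations with polynomially large coefficients of the first
   poly(n) members of a countable family of smooth zero-mean bumps ("atoms").
   Two-point mixing, tested on tensor squares of atoms, says that the quenched
   correlations of two atoms at time k are exponentially small in mean square.
   Summing them over all atoms of level k^a gives a sequence g_k of functions of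
   the word whose averages along the shift are, by independence and
   Borel-Cantelli, almost surely O(k^-2) uniformly in the averaging time, while
   the correlation of A with itself is at most K(A) (g_k + k^-2) for every
   approximable A at once. So, off one null set, an L^2-small error in A changes
   N^(-1/2) S_N(A) little in L^2, uniformly in N, and a countable set of
   functions suffices: rational combinations f of atoms. For those, assumption
   (2) for f(x) and for f(x) - f(y) bounds the mean square deviation of the
   quenched characteristic function from exp(-D(f)/2) by O(N^-eta); Borel-Cantelli
   gives convergence along the times j^n, and the variance bound fills the gaps.
   Applying this to xi A for every xi, Levy's continuity theorem concludes. *)

Require Import Defs.
From HB Require Import structures.
From mathcomp Require Import all_boot all_order all_algebra.
From mathcomp Require Import complex.
From mathcomp Require Import all_classical all_reals all_analysis measurable_realfun.
From mathcomp Require Import zify ring lra.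

Set Implicit Arguments.
Unset Strict Implicit.
Unset Printing Implicit Defensive.

Import Order.TTheory GRing.Theory Num.Theory.
Import numFieldNormedType.Exports.

Local Open Scope classical_set_scope.
Local Open Scope ring_scope.

(** * Real integrals and Borel maps *)

(** The exceptional set of words has to be fixed before [A]. Every bound on the correlations of [A]
    is therefore a product of a deterministic constant depending on [A] and a random factor
    [total_corr] built from the atoms alone; only the latter is controlled almost surely. At level
    k^a the approximation error k^(-a t / 2) is below k^-2, while every loss polynomial in the level
    is absorbed by exp(- theta k). Smallness of a function in L^2 does not make its constant small.
    Hence the variance of a block is cut at a time k0: earlier correlations are at most the squared
    L^2 norm, later ones sum to O(1 / k0). Fixing k0 before the approximation makes both parts
    small. The function classes meet the atoms through one quantity, the L^2 distance between a
    localized function and its translates: a Sobolev bound controls it by a Plancherel inequality, a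
    Hoelder bound directly. In the other direction, the norms in the mixing hypothesis are bounded
    on tensor products of atoms by sup norms of finitely many derivatives. *)

Section real_integrals.
Context d (T : measurableType d) (R : realType).
Variable m : {measure set T -> \bar R}.
Implicit Types f g h : T -> R.

Definition intg f := m.-integrable [set: T] (fun x => (f x)%:E).

Lemma intg_meas f : intg f -> measurable_fun setT f.
Proof. by move=> /measurable_int /measurable_EFinP. Qed.

Lemma intg_dom g f : measurable_fun setT f -> (forall x, `|f x| <= g x) ->
  intg g -> intg f.
Proof.
move=> mf fg; apply: le_integrable => //; first exact/measurable_EFinP.
by move=> x _; rewrite lee_fin (le_trans (fg x))// ler_norm.
Qed.

Lemma intg_eq g f : f =1 g -> intg g -> intg f.
Proof. by move=> /funext ->. Qed.

Lemma intgD f g : intg f -> intg g -> intg (fun x => f x + g x).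
Proof. by move=> fi gi; exact: (integrableD measurableT fi gi). Qed.

Lemma intgN f : intg f -> intg (fun x => - f x).
Proof. by move=> fi; exact: (integrableN fi). Qed.

Lemma intgB f g : intg f -> intg g -> intg (fun x => f x - g x).
Proof. by move=> fi gi; apply: intgD => //; exact: intgN. Qed.

Lemma intgZ k f : intg f -> intg (fun x => k * f x).
Proof. by move=> fi; exact: (integrableZl measurableT k fi). Qed.

Lemma intg0 : intg (fun=> 0).
Proof. exact: integrable0. Qed.

Lemma intg_sum I (s : seq I) (h : I -> T -> R) :
  (forall i, intg (h i)) -> intg (fun x => \sum_(i <- s) h i x).
Proof.
move=> hi; elim: s => [|i s ih].
  by apply: intg_eq intg0 => x; rewrite big_nil.
by apply: intg_eq (intgD (hi i) ih) => x; rewrite big_cons.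
Qed.

Lemma intg_norm f : intg f -> intg (fun x => `|f x|).
Proof. by move=> fi; exact: (integrable_abse fi). Qed.

Lemma eq_Rint f g : f =1 g -> \int[m]_x f x = \int[m]_x g x.
Proof. by move=> /funext ->. Qed.

Lemma RintD f g : intg f -> intg g ->
  \int[m]_x (f x + g x) = \int[m]_x f x + \int[m]_x g x.
Proof. by move=> fi gi; rewrite RintegralD. Qed.

Lemma RintZ k f : intg f -> \int[m]_x (k * f x) = k * \int[m]_x f x.
Proof. by move=> fi; rewrite RintegralZl. Qed.

Lemma RintN f : intg f -> \int[m]_x (- f x) = - \int[m]_x f x.
Proof.
by move=> fi; rewrite -mulN1r -RintZ//; apply: eq_Rint => x; rewrite mulN1r.
Qed.

Lemma RintB f g : intg f -> intg g ->
  \int[m]_x (f x - g x) = \int[m]_x f x - \int[m]_x g x.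
Proof. by move=> fi gi; rewrite RintegralB. Qed.

Lemma Rint0 : \int[m]_x (0 : R) = 0.
Proof. by rewrite /Rintegral integral0. Qed.

Lemma Rint_sum I (s : seq I) (h : I -> T -> R) : (forall i, intg (h i)) ->
  \int[m]_x (\sum_(i <- s) h i x) = \sum_(i <- s) \int[m]_x h i x.
Proof.
move=> hi; elim: s => [|i s ih].
  by rewrite big_nil -[RHS]Rint0; apply: eq_Rint => x; rewrite big_nil.
rewrite big_cons -ih -RintD//; last exact: intg_sum.
by apply: eq_Rint => x; rewrite big_cons.
Qed.

Lemma Rint_le f g : intg f -> intg g -> (forall x, f x <= g x) ->
  \int[m]_x f x <= \int[m]_x g x.
Proof. by move=> fi gi fg; apply: le_Rintegral. Qed.

Lemma Rint_ge0 f : (forall x, 0 <= f x) -> 0 <= \int[m]_x f x.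
Proof. by move=> f0; apply: Rintegral_ge0. Qed.

Lemma Rint_norm_le f : intg f -> `|\int[m]_x f x| <= \int[m]_x `|f x|.
Proof. by move=> fi; apply: le_normr_Rintegral. Qed.

Lemma EFin_Rint f : intg f ->
  ((\int[m]_x f x)%R%:E = \int[m]_x (f x)%:E)%E.
Proof. by move=> fi; rewrite fineK//; exact: integrable_fin_num. Qed.

Lemma intg_le_lty f : measurable_fun setT f -> (forall x, 0 <= f x) ->
  (\int[m]_x (f x)%:E < +oo)%E -> intg f.
Proof.
move=> mf f0 foo; apply/integrableP; split; first exact/measurable_EFinP.
by under eq_integral do rewrite /= ger0_norm ?f0//.
Qed.

Definition sqint f := measurable_fun setT f /\ intg (fun x => f x ^+ 2).

Lemma sqint_mul f g : sqint f -> sqint g -> intg (fun x => f x * g x).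
Proof.
move=> [mf fi] [mg gi]; apply: intg_dom (intgD fi gi) => //=.
  exact: measurable_funM.
move=> x; rewrite ler_norml.
by have := sqr_ge0 (f x - g x); have := sqr_ge0 (f x + g x); nra.
Qed.

Lemma sqintD f g : sqint f -> sqint g -> sqint (fun x => f x + g x).
Proof.
move=> [mf fi] [mg gi]; split; first exact: measurable_funD.
apply: intg_dom (intgZ 2 (intgD fi gi)) => //=.
  by apply: measurable_funX; exact: measurable_funD.
by move=> x; rewrite ger0_norm ?sqr_ge0//; have := sqr_ge0 (f x - g x); nra.
Qed.

Lemma sqintZ k f : sqint f -> sqint (fun x => k * f x).
Proof.
move=> [mf fi]; split; first exact: measurable_funM.
by apply: intg_eq (intgZ (k ^+ 2) fi) => x; rewrite exprMn.
Qed.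

Lemma sqintN f : sqint f -> sqint (fun x => - f x).
Proof.
move=> [mf fi]; split; first exact: measurable_funN.
by apply: intg_eq fi => x; rewrite sqrrN.
Qed.

Lemma sqintB f g : sqint f -> sqint g -> sqint (fun x => f x - g x).
Proof. by move=> fi gi; apply: sqintD => //; exact: sqintN. Qed.

Lemma sqint_sum I (s : seq I) (h : I -> T -> R) :
  (forall i, sqint (h i)) -> sqint (fun x => \sum_(i <- s) h i x).
Proof.
move=> hi; elim: s => [|i s ih].
  under eq_fun do rewrite big_nil.
  by split => //; apply: intg_eq intg0 => x; rewrite expr0n.
by under eq_fun do rewrite big_cons; exact: sqintD.
Qed.

Lemma Rint_cauchy_schwarz f g : sqint f -> sqint g ->
  (\int[m]_x (f x * g x)) ^+ 2 <=
  (\int[m]_x (f x ^+ 2)) * (\int[m]_x (g x ^+ 2)).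
Proof.
move=> fi gi; have fgi := sqint_mul fi gi.
set c := \int[m]_x (f x * g x); set a := \int[m]_x (f x ^+ 2); set b := \int[m]_x (g x ^+ 2).
have a0 : 0 <= a by apply: Rint_ge0 => x; rewrite sqr_ge0.
have b0 : 0 <= b by apply: Rint_ge0 => x; rewrite sqr_ge0.
have key t : 0 <= a - 2 * t * c + t ^+ 2 * b.
  have : 0 <= \int[m]_x ((f x - t * g x) ^+ 2) by apply: Rint_ge0 => x; rewrite sqr_ge0.
  rewrite (_ : \int[m]_x _ =
    \int[m]_x (f x ^+ 2 + - (2 * t) * (f x * g x) + t ^+ 2 * (g x ^+ 2))); last first.
    by apply: eq_Rint => x; ring.
  rewrite RintD; [|by apply: intgD; [exact: fi.2|exact: intgZ]|by apply: intgZ; exact: gi.2].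
  rewrite RintD; [|exact: fi.2|exact: intgZ].
  by rewrite !RintZ// ?mulNr//; exact: gi.2.
have [b_eq0|b_neq0] := eqVneq b 0.
  have [->|c0] := eqVneq c 0; first by rewrite expr0n/= mulr_ge0.
  (* When b = 0 the polynomial in t is affine, and this t gives it the value -1. *)
  have := key ((a + 1) / (2 * c)); rewrite b_eq0 mulr0 addr0.
  rewrite (_ : 2 * _ * c = a + 1); last by field.
  lra.
have bp : 0 < b by rewrite lt_neqAle eq_sym b_neq0.
have := key (c / b).
rewrite (_ : _ + _ = (a * b - c ^+ 2) / b); last by field.
by rewrite pmulr_lge0 ?invr_gt0// subr_ge0.
Qed.

Lemma Rint_sqrD f g : sqint f -> sqint g ->
  \int[m]_x ((f x + g x) ^+ 2) <=
  2 * \int[m]_x (f x ^+ 2) + 2 * \int[m]_x (g x ^+ 2).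
Proof.
move=> fi gi; rewrite -!RintZ; [|exact: gi.2|exact: fi.2].
rewrite -RintD; [|by apply: intgZ; exact: fi.2|by apply: intgZ; exact: gi.2].
apply: Rint_le => [||x]; first exact: (sqintD fi gi).2.
  by apply: intgD; apply: intgZ; [exact: fi.2|exact: gi.2].
have := sqr_ge0 (f x - g x); nra.
Qed.

End real_integrals.

Section finite_measures.
Context d (T : measurableType d) (R : realType).
Variable m : {finite_measure set T -> \bar R}.

Lemma intg_cst (k : R) : intg m (fun=> k).
Proof. by apply: finite_measure_integrable_cst. Qed.

Lemma intg_bnd (f : T -> R) (K : R) : measurable_fun setT f ->
  (forall x, `|f x| <= K) -> intg m f.
Proof. by move=> mf fK; apply: intg_dom mf fK (intg_cst K). Qed.

Lemma sqint_bnd (f : T -> R) (K : R) : measurable_fun setT f ->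
  (forall x, `|f x| <= K) -> sqint m f.
Proof.
move=> mf fK; split => //; apply: (@intg_bnd _ (K ^+ 2)).
  exact: measurable_funX.
move=> x; rewrite normrX ler_sqr ?nnegrE//; exact: le_trans (fK x).
Qed.

Lemma sqint_intg (f : T -> R) : sqint m f -> intg m f.
Proof.
move=> fi; apply: (intg_eq (g := fun x => f x * 1)); first by move=> x; rewrite mulr1.
by apply: sqint_mul => //; apply: (@sqint_bnd _ 1) => // x; rewrite normr1.
Qed.

End finite_measures.

Section probability_integrals.
Context d (T : measurableType d) (R : realType).
Variable m : probability T R.

Lemma Rint_cst (k : R) : \int[m]_x k = k.
Proof. by rewrite Rintegral_cst//= probability_setT mulr1. Qed.

Lemma Rint_bnd (f : T -> R) (K : R) : measurable_fun setT f ->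
  (forall x, `|f x| <= K) -> `|\int[m]_x f x| <= K.
Proof.
move=> mf fK; have fi : intg m f by exact: intg_bnd mf fK.
apply: le_trans (Rint_norm_le fi) _; rewrite -[leRHS]Rint_cst.
by apply: Rint_le => //; [exact: intg_norm|exact: intg_cst].
Qed.

Lemma Rint_sqr_le (f : T -> R) : sqint m f ->
  (\int[m]_x f x) ^+ 2 <= \int[m]_x (f x ^+ 2).
Proof.
move=> fi; have := @Rint_cauchy_schwarz _ T R m f (fun=> 1) fi.
have s1 : sqint m (fun=> 1) by apply: (@sqint_bnd _ _ _ m _ 1) => // x; rewrite normr1.
move=> /(_ s1); rewrite expr1n Rint_cst mulr1.
by rewrite (@eq_Rint _ _ _ _ (fun x => f x * 1) f)// => x; rewrite mulr1.
Qed.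

End probability_integrals.

Section fubini_real.
Context d1 d2 (T1 : measurableType d1) (T2 : measurableType d2) (R : realType).
Variables (m1 : {sigma_finite_measure set T1 -> \bar R})
  (m2 : {sigma_finite_measure set T2 -> \bar R}).
Variable f : T1 * T2 -> R.
Local Notation m12 := (m1 \x m2)%E.
Hypothesis fi : intg m12 f.
(* needed because [\int] of a non-integrable slice is a junk value *)
Hypothesis fx : forall x, intg m2 (fun y => f (x, y)).

Lemma intg_Rint1 : intg m1 (fun x => \int[m2]_y f (x, y)).
Proof.
have := integrable_fubini_F fi; apply: eq_integrable => //= x _.
by rewrite /fubini_F EFin_Rint.
Qed.

Lemma Rint_fubini1 : \int[m12]_z f z = \int[m1]_x (\int[m2]_y f (x, y)).
Proof.
rewrite /Rintegral -(integral12_prod_meas1 fi); congr fine.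
by apply: eq_integral => x _; rewrite /fubini_F -EFin_Rint.
Qed.

Hypothesis fy : forall y, intg m1 (fun x => f (x, y)).

Lemma Rint_fubini2 : \int[m12]_z f z = \int[m2]_y (\int[m1]_x f (x, y)).
Proof.
rewrite /Rintegral -(integral21_prod_meas1 fi); congr fine.
by apply: eq_integral => x _; rewrite /fubini_G -EFin_Rint.
Qed.

End fubini_real.

Section borel_measurability.

Lemma borel_open (X : ptopologicalType) (A : set X) :
  open A -> measurable (A : set (borel X)).
Proof. by move=> oA; exact: sub_sigma_algebra. Qed.

Lemma borel_closed (X : ptopologicalType) (A : set X) :
  closed A -> measurable (A : set (borel X)).
Proof.
move=> cA; rewrite -[A]setCK; apply: measurableC; apply: borel_open.
exact: closed_openC.
Qed.

Context d (T : measurableType d).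

Lemma measurable_to_borel (X : ptopologicalType) (f : T -> borel X) :
  (forall U : set X, open U -> measurable (f @^-1` U)) -> measurable_fun setT f.
Proof.
move=> fU; have h := @measurability _ _ T (borel X) setT f (@open X) erefl.
apply: h => _ [U oU <-].
by rewrite setTI; exact: fU.
Qed.

Lemma measurable_to_real (R : realType) (f : T -> R) :
  (forall U : set R, open U -> measurable (f @^-1` U)) -> measurable_fun setT f.
Proof.
move=> fU; apply: (@measurability _ _ _ _ _ _ (@RGenOpens.G R)).
  exact: RGenOpens.measurableE.
by move=> _ [_ [a [b ->]] <-]; rewrite setTI; apply: fU; exact: interval_open.
Qed.

End borel_measurability.

Section borel_continuous.

Lemma continuous_borel_real (R : realType) (X : ptopologicalType) (f : X -> R) :
  continuous f -> measurable_fun setT (f : borel X -> R).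
Proof.
move=> cf; apply: measurable_to_real => U oU; apply: borel_open.
by move/continuousP : cf; apply.
Qed.

Lemma continuous_borel (X Y : ptopologicalType) (f : X -> Y) :
  continuous f -> measurable_fun setT (f : borel X -> borel Y).
Proof.
move=> cf; apply: measurable_to_borel => U oU; apply: borel_open.
by move/continuousP : cf; apply.
Qed.

End borel_continuous.

(** * Borel structure of row vectors *)

Section row_vectors.
Context (R : realType).

Lemma rV_norm_lt n (z : 'rV[R]_n) (e : R) : 0 < e ->
  (forall l, `|z 0 l| < e) -> `|z| < e.
Proof.
move=> e0 ze; rewrite -[`|z|]/(mx_norm z) mx_normrE; apply/bigmax_ltP; split => //=.
by move=> [i j] _ /=; rewrite (ord1 i).
Qed.

Lemma rV_norm_le n (z : 'rV[R]_n) (e : R) : 0 <= e ->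
  (forall l, `|z 0 l| <= e) -> `|z| <= e.
Proof.
move=> e0 ze; rewrite -[`|z|]/(mx_norm z) mx_normrE; apply/bigmax_leP; split => //=.
by move=> [i j] _ /=; rewrite (ord1 i).
Qed.

Lemma rV_coord_le n (z : 'rV[R]_n) l : `|z 0 l| <= `|z|.
Proof.
rewrite -[`|z|]/(mx_norm z) mx_normrE.
by apply/bigmax_geP; right => /=; exists (0, l).
Qed.

Lemma open_rV_ball n (O : set 'rV[R]_n) z : open O -> O z ->
  exists2 e : R, 0 < e & forall y, `|z - y| < e -> O y.
Proof.
move=> oO Oz; have /nbhs_ballP[e /= e0 zeO] := open_nbhs_nbhs (conj oO Oz).
by exists e => // y zy; apply: zeO; rewrite -ball_normE.
Qed.

(** A countable basis of cubes, with rational centre and radius 1 / (k + 1). It turns open sets into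
    countable unions of sets defined by coordinates, here for measurability into row vectors and
    later, through charts, for a countable basis of the manifold. *)
Definition rat_box n (c : 'rV[rat]_n * nat) : set 'rV[R]_n :=
  [set z | forall l, `|z 0 l - ratr (c.1 0 l)| < c.2.+1%:R^-1].

Lemma rat_box_approx n (z : 'rV[R]_n) (e : R) : 0 < e ->
  exists2 c, rat_box c z & forall y, rat_box c y -> `|z - y| < e.
Proof.
move=> e0; have [k ke] : exists k : nat, k.+1%:R^-1 < e / 2 :> R.
  have [k _ /(_ k)] := near_infty_natSinv_lt (PosNum (divr_gt0 e0 (ltr0n R 2))).
  by move=> /(_ (leqnn k)) /= ?; exists k.
have zq l : exists q : rat, `|z 0 l - ratr q| < k.+1%:R^-1.
  have k0 : (0 : R) < k.+1%:R^-1 by rewrite invr_gt0.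
  move: (z 0 l) k0 => t; set r := _^-1 => r0.
  have [|q] := @rat_in_itvoo R (t - r) (t + r); first lra.
  by rewrite in_itv/= => /andP[? ?]; exists q; rewrite ltr_norml; apply/andP; split; lra.
have [q zq'] := choice zq.
exists (\row_l q l, k) => [l|y yc]; first by rewrite /= mxE.
apply: rV_norm_lt => // l; rewrite !mxE.
have := yc l; have := zq' l; rewrite /= mxE.
move: (z 0 l) (y 0 l) (ratr _) => t u v; move: ke; set r := _^-1 => re.
by rewrite !ltr_norml => /andP[? ?] /andP[? ?]; apply/andP; split; lra.
Qed.

Lemma open_rat_box n (O : set 'rV[R]_n) : open O ->
  O = \bigcup_(c in [set c | rat_box c `<=` O]) rat_box c.
Proof.
move=> oO; apply/seteqP; split => [z Oz|z [c cO cz]]; last exact: cO.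
have [e e0 zeO] := open_rV_ball oO Oz; have [c cz ce] := rat_box_approx z e0.
by exists c => //= y /ce; exact: zeO.
Qed.

Lemma measurable_rV d (T : measurableType d) n (f : T -> borel 'rV[R]_n) :
  (forall l, measurable_fun setT (fun x => f x 0 l)) -> measurable_fun setT f.
Proof.
move=> mf; apply: measurable_to_borel => O oO; rewrite (open_rat_box oO).
rewrite bigcup_mkcond preimage_bigcup.
apply: countable_bigcupT_measurable => [|c]; first exact: countableP.
case: ifPn => _; last by rewrite preimage_set0.
 rewrite (_ : _ @^-1` _ = \big[setI/setT]_(l < n)
   (f ^~ 0 ^~ l @^-1` [set t | `|t - ratr (c.1 0 l)| < c.2.+1%:R^-1])); last first.
  rewrite -bigcap_seq; apply/seteqP; split => x fx.
    by move=> l _; exact: fx.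
  by move=> l; apply: (fx l); rewrite /= mem_index_enum.
apply: bigsetI_measurable => l _; rewrite -[X in measurable X]setTI; apply: mf => //.
apply: open_measurable.
rewrite (_ : [set t | _] = ball (ratr (c.1 0 l) : R) (c.2.+1%:R^-1)).
  exact: ball_open.
by apply/seteqP; split => t /=; rewrite -ball_normE/= distrC.
Qed.

Lemma measurable_coord n (l : 'I_n) :
  measurable_fun setT (fun z : borel 'rV[R]_n => z 0 l).
Proof. by apply: continuous_borel_real; exact: coord_continuous. Qed.

(** The block row that [intRd] uses to peel off one coordinate, retyped as a map from a product of
    Borel spaces so that measures can be pushed forward along it. *)
Definition cons_rV n (p : R * borel 'rV[R]_n) : borel 'rV[R]_n.+1 :=
  row_mx (p.1%:M : 'M[R]_1) (p.2 : 'rV[R]_n) : 'rV[R]_(1 + n).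

Lemma cons_rV0 n p : @cons_rV n p 0 0 = p.1.
Proof.
rewrite /cons_rV (_ : 0 = lshift n (0 : 'I_1)); last exact/val_inj.
by etransitivity; [exact: row_mxEl|rewrite mxE eqxx mulr1n].
Qed.

Lemma cons_rVS n p l : @cons_rV n p 0 (lift 0 l) = p.2 0 l.
Proof.
rewrite /cons_rV (_ : lift 0 l = rshift 1 l); last exact/val_inj.
by etransitivity; [exact: row_mxEr|].
Qed.

Lemma measurable_cons_rV n : measurable_fun setT (@cons_rV n).
Proof.
apply: measurable_rV => l; have [j ->|->] := unliftP 0 l.
  under eq_fun do rewrite cons_rVS.
  exact: (measurableT_comp (measurable_coord j) measurable_snd).
by under eq_fun do rewrite cons_rV0; exact: measurable_fst.
Qed.

End row_vectors.

Definition uncons_rV (R : realType) n (z : borel 'rV[R]_n.+1) :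
  R * borel 'rV[R]_n := (z 0 0, \row_l z 0 (lift 0 l)).

Lemma cons_rVK (R : realType) n : cancel (@cons_rV R n) (@uncons_rV R n).
Proof.
move=> [t v]; rewrite /uncons_rV cons_rV0; congr (_, _).
by apply/rowP => l; rewrite mxE cons_rVS.
Qed.

Lemma measurable_uncons_rV (R : realType) n :
  measurable_fun setT (@uncons_rV R n).
Proof.
apply: measurable_fun_pair; first exact: measurable_coord.
apply: measurable_rV => l; under eq_fun do rewrite mxE.
exact: measurable_coord.
Qed.

(** * Lebesgue measure, one coordinate at a time *)

Section lebesgue_step.
Context (R : realType) (n : nat).
Variable m : {sigma_finite_measure set (borel 'rV[R]_n) -> \bar R}.
Local Notation mu1 := (@lebesgue_measure R).

Definition lam_step : set (borel 'rV[R]_n.+1) -> \bar R :=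
  pushforward (mu1 \x m)%E (@cons_rV R n).

Let measurable_cons_preimage A : measurable A ->
  measurable (@cons_rV R n @^-1` A).
Proof. by move=> mA; rewrite -[X in measurable X]setTI; exact: measurable_cons_rV. Qed.

Let lam_step0 : lam_step set0 = 0%E.
Proof. by rewrite /lam_step /pushforward preimage_set0 measure0. Qed.

Let lam_step_ge0 A : (0 <= lam_step A)%E.
Proof. by rewrite /lam_step /pushforward; apply: integral_ge0 => x _. Qed.

Let lam_step_sigma : semi_sigma_additive lam_step.
Proof.
move=> F mF tF mUF; rewrite /lam_step /pushforward preimage_bigcup.
apply: measure_semi_sigma_additive.
- by move=> k; exact: measurable_cons_preimage.
- apply/trivIsetP => /= i j _ _ ij; rewrite -preimage_setI.
  by move/trivIsetP : tF => /(_ _ _ _ _ ij) ->//; rewrite preimage_set0.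
- by rewrite -preimage_bigcup; exact: measurable_cons_preimage.
Qed.

HB.instance Definition _ := isMeasure.Build _ _ _ lam_step
  lam_step0 lam_step_ge0 lam_step_sigma.

Let lam_step_sigma_finite : sigma_finite setT lam_step.
Proof.
have /sigma_finiteP[F [TF ndF Foo]] := sigma_finiteT mu1.
have /sigma_finiteP[G [TG ndG Goo]] := sigma_finiteT m.
exists (fun k => @uncons_rV R n @^-1` (F k `*` G k)).
  rewrite -preimage_bigcup -[LHS](preimage_setT (@uncons_rV R n)); congr (_ @^-1` _).
  apply/seteqP; split => // -[x y] _.
  have [k _ Fkx] : (\bigcup_k F k) x by rewrite -TF.
  have [l _ Gly] : (\bigcup_k G k) y by rewrite -TG.
  exists (maxn k l) => //; split => /=.
    by move: x Fkx; exact/subsetPset/ndF/leq_maxl.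
  by move: y Gly; exact/subsetPset/ndG/leq_maxr.
move=> k; have [mF Fk] := Foo k; have [mG Gk] := Goo k; split.
  rewrite -[X in measurable X]setTI; apply: measurable_uncons_rV => //.
  exact: measurableX.
rewrite /lam_step /pushforward (_ : _ @^-1` _ = F k `*` G k).
  by rewrite product_measure1E// lte_mul_pinfty// ge0_fin_numE.
rewrite -comp_preimage (_ : _ \o _ = id) ?preimage_id//.
by apply/funext => p /=; exact: cons_rVK.
Qed.

HB.instance Definition _ := @Measure_isSigmaFinite.Build _ _ _ lam_step
  lam_step_sigma_finite.

Lemma lam_stepE (f : borel 'rV[R]_n.+1 -> \bar R) : measurable_fun setT f ->
  (forall z, (0 <= f z)%E) ->
  (\int[lam_step]_z f z = \int[mu1]_t \int[m]_v f (cons_rV (t, v)))%E.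
Proof.
move=> mf f0; rewrite ge0_integral_pushforward//; last exact: measurable_cons_rV.
rewrite (_ : _ @^-1` _ = setT)//.
rewrite fubini_tonelli1//=.
by apply: measurableT_comp => //; exact: measurable_cons_rV.
Qed.

End lebesgue_step.

(** The recursion must carry sigma-finiteness, needed for the next product measure, together with
    the identification of the integral. Measure and specification are therefore built at once;
    dimension 0 is the point mass. *)
Lemma lam_exists (R : realType) n :
  {m : {sigma_finite_measure set (borel 'rV[R]_n) -> \bar R} |
    forall f : borel 'rV[R]_n -> \bar R, measurable_fun setT f ->
      (forall z, (0 <= f z)%E) -> (\int[m]_z f z = intRd f)%E}.
Proof.
elim: n => [|n [m mE]].
  exists (\d_(0 : borel 'rV[R]_0)) => f mf f0.
  by rewrite integral_dirac//= diracT mul1e.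
exists (lam_step m) => f mf f0; rewrite lam_stepE//=.
apply: eq_integral => t _; rewrite mE//.
apply: measurableT_comp => //.
by apply: (measurableT_comp (@measurable_cons_rV R n)); exact: pair1_measurable.
Qed.

Definition lam (R : realType) n := projT1 (@lam_exists R n).

(** * Lebesgue measure on row vectors *)

Section integral_transfer.
Context d d' (X : measurableType d) (Y : measurableType d') (R : realType).
Variables (m : {measure set X -> \bar R}) (m' : {measure set Y -> \bar R}).
Variable phi : X -> Y.
Hypothesis mphi : measurable_fun setT phi.
Hypothesis mE : forall f : Y -> \bar R, measurable_fun setT f ->
  (forall y, (0 <= f y)%E) -> (\int[m']_y f y = \int[m]_x f (phi x))%E.

(** Tonelli-type constructions give a change of variables for nonnegative functions; positive and
    negative parts extend it to signed ones. *)
Lemma integral_transfer (f : Y -> \bar R) : measurable_fun setT f ->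
  (\int[m']_y f y = \int[m]_x f (phi x))%E.
Proof.
move=> mf; rewrite integralE [RHS]integralE !mE//; last 2 first.
- exact: measurable_funeneg.
- exact: measurable_funepos.
congr (_ - _)%E; apply: eq_integral => x _; apply/esym.
  exact: (congr1 (@^~ x) (funepos_comp f phi)).
exact: (congr1 (@^~ x) (funeneg_comp f phi)).
Qed.

Lemma intg_transfer (f : Y -> R) : measurable_fun setT f ->
  intg m (fun x => f (phi x)) <-> intg m' f.
Proof.
move=> mf; have mf' : measurable_fun setT (EFin \o f) by exact/measurable_EFinP.
have e : (\int[m']_y `|(f y)%:E| = \int[m]_x `|(f (phi x))%:E|)%E.
  by rewrite mE//; exact: measurableT_comp.
split => /integrableP[mi ioo]; apply/integrableP; split => //.
- by rewrite e.
- by apply: (measurableT_comp mf').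
- by rewrite -e.
Qed.

Lemma Rint_transfer (f : Y -> R) : measurable_fun setT f ->
  \int[m']_y f y = \int[m]_x f (phi x).
Proof. by move=> mf; rewrite /Rintegral integral_transfer//; exact/measurable_EFinP. Qed.

End integral_transfer.

Section lebesgue_affine.
Context (R : realType).
Local Notation mu1 := (@lebesgue_measure R).
Local Notation mR := (measurableTypeR R).

Let measurable_sym (b : bool) (a : R) :
  measurable_fun (setT : set mR) (fun t : mR => a + (-1) ^+ b * t : mR).
Proof. by apply: measurable_funD => //; exact: measurable_funM. Qed.

(** The boolean treats translations and reflections together. Lebesgue measure is determined by
    half-open intervals; a reflection exchanges the open and the closed end, which leaves the length
    unchanged. *)
Lemma lebesgue_sym (b : bool) (a : R) (A : set R) : measurable A ->
  mu1 ((fun t => a + (-1) ^+ b * t) @^-1` A) = mu1 A.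
Proof.
pose mm : {measure set (measurableTypeR R) -> \bar R} :=
  measure_function_pushforward__canonical__measure_function_Measure mu1
    (measurable_sym b a).
suff h X : ocitv X -> mu1 X = mm X.
  by move=> mA; rewrite -[LHS]/(mm A); apply/esym/(lebesgue_measure_unique h).
move=> [[x y] _ <-]; rewrite /mm/= /pushforward.
case: b {mm} => /=.
  rewrite (_ : _ @^-1` _ = `[a - y, a - x[%classic).
    rewrite !lebesgue_measure_itv/= !lte_fin ltrBlDr.
    rewrite (_ : a - x + y = a + (y - x)); last by ring.
    rewrite ltrDl subr_gt0; case: ifP => // _.
    by rewrite -!EFinB; congr (_%:E); ring.
  by apply/seteqP; split => t/=; rewrite !in_itv/= expr1 mulN1r => /andP[? ?]; apply/andP; split; lra.
rewrite (_ : _ @^-1` _ = `]x - a, y - a]%classic).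
  rewrite !lebesgue_measure_itv/= !lte_fin ltrD2r; case: ifP => // _.
  by rewrite -!EFinB; congr (_%:E); ring.
by apply/seteqP; split => t/=; rewrite !in_itv/= expr0 mul1r => /andP[? ?]; apply/andP; split; lra.
Qed.

Lemma integral_lebesgue_sym (b : bool) (a : R) (f : mR -> \bar R) :
  measurable_fun setT f -> (forall y, (0 <= f y)%E) ->
  (\int[mu1]_t f t = \int[mu1]_t f (a + (-1) ^+ b * t)%R)%E.
Proof.
move=> mf f0.
rewrite -[RHS](@ge0_integral_pushforward _ _ _ _ R _ (measurable_sym b a) mu1 setT f)//.
by apply: eq_measure_integral => A mA _; rewrite /= /pushforward lebesgue_sym.
Qed.

End lebesgue_affine.

Section lebesgue_rV.
Context (R : realType).
Local Notation mu1 := (@lebesgue_measure R).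

Lemma lamE n (f : borel 'rV[R]_n -> \bar R) : measurable_fun setT f ->
  (forall z, (0 <= f z)%E) -> (\int[lam R n]_z f z = intRd f)%E.
Proof. exact: (projT2 (@lam_exists R n)). Qed.

Lemma lam_cons n (f : borel 'rV[R]_n.+1 -> \bar R) : measurable_fun setT f ->
  (forall z, (0 <= f z)%E) ->
  (\int[lam R n.+1]_z f z = \int[mu1 \x lam R n]_p f (cons_rV p))%E.
Proof.
move=> mf f0; rewrite lamE//= fubini_tonelli1//; last first.
  exact: (measurableT_comp mf (@measurable_cons_rV R n)).
apply: eq_integral => t _; rewrite /fubini_F lamE//.
apply: measurableT_comp => //.
by apply: (measurableT_comp (@measurable_cons_rV R n)); exact: pair1_measurable.
Qed.

Lemma integral_lam_cons n (f : borel 'rV[R]_n.+1 -> \bar R) :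
  measurable_fun setT f ->
  (\int[lam R n.+1]_z f z = \int[mu1 \x lam R n]_p f (cons_rV p))%E.
Proof. exact: (@integral_transfer _ _ _ _ R (mu1 \x lam R n)%E (lam R n.+1)
  _ (@lam_cons n)). Qed.

Lemma intg_lam_cons n (f : borel 'rV[R]_n.+1 -> R) : measurable_fun setT f ->
  intg (mu1 \x lam R n)%E (fun p => f (cons_rV p)) <-> intg (lam R n.+1) f.
Proof. exact: (@intg_transfer _ _ _ _ R (mu1 \x lam R n)%E (lam R n.+1)
  _ (@measurable_cons_rV R n) (@lam_cons n)). Qed.

Lemma Rint_lam_cons n (f : borel 'rV[R]_n.+1 -> R) : measurable_fun setT f ->
  \int[lam R n.+1]_z f z = \int[(mu1 \x lam R n)%E]_p f (cons_rV p).
Proof. exact: (@Rint_transfer _ _ _ _ R (mu1 \x lam R n)%E (lam R n.+1)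
  _ (@lam_cons n)). Qed.

Lemma measurable_intRd n d (T : measurableType d)
    (f : T * borel 'rV[R]_n -> \bar R) : measurable_fun setT f ->
  measurable_fun setT (fun t => intRd (fun v => f (t, v))).
Proof.
elim: n d T f => [|n ih] d T f mf /=.
  exact: (measurableT_comp mf (pair2_measurable _)).
pose g (p : T * R) := intRd (fun v => f (p.1, cons_rV (p.2, v))).
have mg : measurable_fun setT g.
  apply: (ih _ _ (fun q : (T * R) * borel 'rV[R]_n => f (q.1.1, cons_rV (q.1.2, q.2)))).
  apply: measurableT_comp => //; apply: measurable_fun_pair.
    by apply: measurableT_comp; exact: measurable_fst.
  apply: (measurableT_comp (@measurable_cons_rV R n)).
  apply: measurable_fun_pair; last exact: measurable_snd.
  by apply: (measurableT_comp measurable_snd); exact: measurable_fst.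
under eq_fun do rewrite integralE.
apply: emeasurable_funB.
  rewrite (_ : (fun x => _) = fubini_F mu1 g^\+%E).
    by apply: measurable_fun_fubini_tonelli_F => //; exact: measurable_funepos.
  apply/funext => x; apply: eq_integral => s _.
  exact: (congr1 (@^~ s) (funepos_comp g (pair x))).
rewrite (_ : (fun x => _) = fubini_F mu1 g^\-%E).
  by apply: measurable_fun_fubini_tonelli_F => //; exact: measurable_funeneg.
apply/funext => x; apply: eq_integral => s _.
exact: (congr1 (@^~ s) (funeneg_comp g (pair x))).
Qed.

(** For signed [f] the inner iterated integral is the right one only for almost every first
    coordinate, where Fubini makes the slice integrable. Comparing almost everywhere equal functions
    requires the inner integral to be measurable on its own, hence [measurable_intRd]. *)
Lemma intRd_integral n (f : borel 'rV[R]_n -> R) : intg (lam R n) f ->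
  (intRd (fun z => (f z)%:E) = \int[lam R n]_z (f z)%:E)%E.
Proof.
elim: n f => [|n ih] f fi.
  have mf := intg_meas fi.
  have mf' : measurable_fun setT (EFin \o f) by exact/measurable_EFinP.
  rewrite integralE lamE//; last exact: measurable_funepos.
  rewrite lamE//; last exact: measurable_funeneg.
  exact: (congr1 (@^~ 0) (funeposneg (EFin \o f))).
have mf := intg_meas fi.
have mf' : measurable_fun setT (EFin \o f) by exact/measurable_EFinP.
have fi' : intg (mu1 \x lam R n)%E (fun p => f (cons_rV p)).
  by apply/intg_lam_cons.
rewrite integral_lam_cons//.
rewrite -(integral12_prod_meas1 fi')/=.
apply: ae_eq_integral => //.
- apply: (@measurable_intRd _ _ _ (fun p => (f (cons_rV p))%:E)).
  exact: (measurableT_comp mf' (@measurable_cons_rV R n)).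
- exact: measurable_fubini_F fi'.
have := ae_integrable1 fi'; apply: filterS => t ti _.
by rewrite ih.
Qed.

Lemma fine_intRd n (f : borel 'rV[R]_n -> R) : intg (lam R n) f ->
  fine (intRd (fun z => (f z)%:E)) = \int[lam R n]_z f z.
Proof. by move=> fi; rewrite intRd_integral. Qed.

(* [a + e z] with [e = 1] or [e = -1] *)
Lemma integral_lam_sym n (b : bool) (a : 'rV[R]_n)
    (f : borel 'rV[R]_n -> \bar R) :
  measurable_fun setT f -> (forall z, (0 <= f z)%E) ->
  (\int[lam R n]_z f z = \int[lam R n]_z f (a + (-1) ^+ b *: z)%R)%E.
Proof.
have msym k (c : 'rV[R]_k) : measurable_fun setT
    (fun z : borel 'rV[R]_k => c + (-1) ^+ b *: (z : 'rV[R]_k) : borel 'rV[R]_k).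
  apply: measurable_rV => l; under eq_fun do rewrite !mxE.
  apply: measurable_funD => //; apply: measurable_funM => //.
  exact: measurable_coord.
elim: n a f => [|n ih] a f mf f0.
  rewrite lamE// lamE//=; last exact: (measurableT_comp mf (msym _ _)).
  by congr (f _); apply/rowP => -[].
pose a' : 'rV[R]_n := (uncons_rV a).2.
rewrite lam_cons// lam_cons//; last exact: (measurableT_comp mf (msym _ _)).
have mfc : measurable_fun setT (fun p => f (@cons_rV R n p)).
  exact: (measurableT_comp mf (@measurable_cons_rV R n)).
have mfs : measurable_fun setT (fun p => f (a + (-1) ^+ b *: @cons_rV R n p)).
  exact: (measurableT_comp (measurableT_comp mf (msym _ a)) (@measurable_cons_rV R n)).
rewrite (@fubini_tonelli1 _ _ _ _ _ mu1 (lam R n) _ mfc (fun p => f0 _)).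
rewrite (@fubini_tonelli1 _ _ _ _ _ mu1 (lam R n) _ mfs (fun p => f0 _)).
rewrite (integral_lebesgue_sym b (a 0 0)); last 2 first.
- exact: (measurable_fun_fubini_tonelli_F _ mfc).
- by move=> t; exact: integral_ge0.
apply: eq_integral => t _; rewrite /fubini_F (ih a'); last 2 first.
- by apply: (measurableT_comp mfc); exact: pair1_measurable.
- by [].
apply: eq_integral => v _; congr (f _); apply/rowP => l.
have E k (c w : 'rV[R]_k) i : (c + (-1) ^+ b *: w) 0 i = c 0 i + (-1) ^+ b * w 0 i.
  by rewrite !mxE.
rewrite E; have [j ->|->] := unliftP 0 l; last by rewrite !cons_rV0.
by rewrite !cons_rVS/= E mxE.
Qed.

Lemma measurable_shift n (a : 'rV[R]_n) : measurable_fun setT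
  (fun z : borel 'rV[R]_n => (a + (z : 'rV[R]_n)) : borel 'rV[R]_n).
Proof.
apply: measurable_rV => l; under eq_fun do rewrite !mxE.
by apply: measurable_funD => //; exact: measurable_coord.
Qed.

Lemma measurable_reflect n (a : 'rV[R]_n) : measurable_fun setT
  (fun z : borel 'rV[R]_n => (a - (z : 'rV[R]_n)) : borel 'rV[R]_n).
Proof.
apply: measurable_rV => l; under eq_fun do rewrite !mxE.
by apply: measurable_funB => //; exact: measurable_coord.
Qed.

Lemma integral_shift n (a : 'rV[R]_n) (f : borel 'rV[R]_n -> \bar R) :
  measurable_fun setT f -> (forall z, (0 <= f z)%E) ->
  (\int[lam R n]_z f z = \int[lam R n]_z f (a + z)%R)%E.
Proof.
move=> mf f0; rewrite (integral_lam_sym false a)//.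
by apply: eq_integral => z _; rewrite expr0 scale1r.
Qed.

Lemma Rint_cons n (f : borel 'rV[R]_n.+1 -> R) : intg (lam R n.+1) f ->
  (forall t, intg (lam R n) (fun v => f (cons_rV (t, v)))) ->
  \int[lam R n.+1]_z f z = \int[mu1]_t \int[lam R n]_v f (cons_rV (t, v)).
Proof.
move=> fi fs; have mf := intg_meas fi.
rewrite Rint_lam_cons//.
rewrite (@Rint_fubini1 _ _ _ _ _ mu1 (lam R n) (fun p => f (cons_rV p)))//.
by apply/intg_lam_cons.
Qed.

Lemma integral_lam_prod n (g : 'I_n -> R -> R) :
  (forall l, measurable_fun setT (g l)) -> (forall l t, 0 <= g l t) ->
  (forall l, intg mu1 (g l)) ->
  intg (lam R n) (fun z => \prod_l g l (z 0 l)) /\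
  \int[lam R n]_z (\prod_l g l (z 0 l)) = \prod_l \int[mu1]_t g l t.
Proof.
elim: n g => [|n ih] g mg g0 gi.
  have e : (\int[lam R 0]_z (\prod_(l < 0) g l (z 0 l))%:E = 1%:E)%E.
    under eq_integral do rewrite big_ord0.
    by rewrite lamE.
  rewrite big_ord0 /Rintegral e; split => //.
  apply: intg_le_lty; last by rewrite e ltry.
  - by under eq_fun do [rewrite big_ord0]; exact: measurable_cst.
  - by move=> z; rewrite big_ord0.
have [hi hE] := ih (fun l => g (lift 0 l)) (fun l => mg _) (fun l => g0 _) (fun l => gi _).
have mG k (h : 'I_k -> R -> R) : (forall l, measurable_fun setT (h l)) ->
    measurable_fun setT (fun z : borel 'rV[R]_k => \prod_l h l (z 0 l)).
  move=> mh; apply: measurable_prod => l _.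
  by apply: (measurableT_comp (mh l)); exact: measurable_coord.
pose G := fun z : borel 'rV[R]_n.+1 => \prod_l g l (z 0 l).
have GE t v : G (cons_rV (t, v)) = g 0 t * \prod_l g (lift 0 l) (v 0 l).
  by rewrite /G big_ord_recl cons_rV0/=; congr (_ * _); apply: eq_bigr => l _; rewrite cons_rVS.
have G0 z : 0 <= G z by apply: prodr_ge0.
have EG : (\int[lam R n.+1]_z (G z)%:E =
    (\int[mu1]_t g ord0 t * \prod_l \int[mu1]_t g (lift ord0 l) t)%:E)%E.
  rewrite lam_cons//; last by apply/measurable_EFinP; exact: mG.
  have mGc : measurable_fun setT (fun p => (G (@cons_rV R n p))%:E).
    by apply/measurable_EFinP; apply: (measurableT_comp (mG _ _ mg) (@measurable_cons_rV R n)).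
  rewrite (@fubini_tonelli1 _ _ _ _ _ mu1 (lam R n) _ mGc) => [|p]; last by rewrite lee_fin.
  under eq_integral => t _.
    rewrite /fubini_F; under eq_integral do rewrite GE EFinM.
    rewrite ge0_integralZl//; last 3 first.
    - by apply/measurable_EFinP; exact: (mG n (fun l => g (lift 0 l)) (fun l => mg _)).
    - by move=> v _; rewrite lee_fin; exact: prodr_ge0.
    - by rewrite lee_fin.
    rewrite -EFin_Rint// hE -EFinM mulrC EFinM.
    over.
  rewrite ge0_integralZl//; last 3 first.
    by apply/measurable_EFinP; exact: (mg ord0).
    by move=> t _; rewrite lee_fin.
    by rewrite lee_fin; apply: prodr_ge0 => l _; exact: Rint_ge0.
  by rewrite -EFin_Rint// -EFinM mulrC.
have Gi : intg (lam R n.+1) G by apply: intg_le_lty => //; [exact: mG|rewrite EG ltry].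
by split => //; apply: EFin_inj; rewrite EFin_Rint// EG big_ord_recl.
Qed.

End lebesgue_rV.

(** * Gaussian characteristic functions *)

Section dominated_convergence_real.
Context d (T : measurableType d) (R : realType).
Variable m : {measure set T -> \bar R}.

Lemma Rint_dct (f_ : nat -> T -> R) (f g : T -> R) :
  (forall n, measurable_fun setT (f_ n)) ->
  (forall x, f_ n x @[n --> \oo] --> f x) ->
  (forall n x, `|f_ n x| <= g x) -> intg m g ->
  intg m f /\ (\int[m]_x f_ n x) @[n --> \oo] --> \int[m]_x f x.
Proof.
move=> mf_ ff fg gi.
have mf : measurable_fun setT f.
  by apply: (measurable_fun_cvg mf_) => x _; exact: ff.
have [] := @dominated_convergence _ T R m setT measurableT
  (fun n x => (f_ n x)%:E) (EFin \o f) (EFin \o g).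
- by move=> n; exact/measurable_EFinP.
- exact/measurable_EFinP.
- by apply: aeW => x _; apply: cvg_EFin; [exact: nearW|exact: ff].
- exact: gi.
- by apply: aeW => x n _; rewrite lee_fin.
move=> fi _ cf; split => //.
apply: fine_cvg; rewrite -/(intg m f) in fi.
by rewrite EFin_Rint.
Qed.

End dominated_convergence_real.

Section real_derivatives.
Context (R : realType).
Implicit Types (f g : R -> R) (x a b : R).

Lemma is_derive1_continuous f x a : is_derive x (1 : R) f a -> {for x, continuous f}.
Proof.
by move=> [dfx _]; apply/differentiable_continuous; exact/derivable1_diffP.
Qed.

Lemma is_derive1_mul f g x a b : is_derive x (1 : R) f a ->
  is_derive x (1 : R) g b ->
  is_derive x (1 : R) (fun y => f y * g y) (a * g x + f x * b).
Proof.
move=> df dg; apply: (is_derive_eq (is_deriveM df dg)).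
by rewrite addrC /GRing.scale/= [g x * a]mulrC.
Qed.

Lemma is_derive1_chain f g x a b : is_derive (g x) (1 : R) f a ->
  is_derive x (1 : R) g b -> is_derive x (1 : R) (fun y => f (g y)) (a * b).
Proof. by move=> df dg; exact: is_derive1_comp. Qed.

Lemma is_derive1_linear c x : is_derive x (1 : R) (fun y : R => c * y) c.
Proof.
have h := is_derive1_mul (is_derive_cst c x (1 : R)) (is_derive_id x (1 : R)).
by apply: (is_derive_eq h); rewrite mul0r add0r mulr1.
Qed.

Lemma is_derive1_gauss c x : is_derive x (1 : R) (fun y : R => expR (c * y ^+ 2))
  (2 * c * x * expR (c * x ^+ 2)).
Proof.
have id1 := is_derive_id x (1 : R).
have sq : is_derive x (1 : R) (fun y : R => c * y ^+ 2) (2 * c * x).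
  have := is_derive1_mul (is_derive1_linear c x) id1.
  rewrite (_ : (fun y => c * y * id y) = (fun y : R => c * y ^+ 2)).
    by move=> h; apply: (is_derive_eq h); rewrite /id; ring.
  by apply/funext => y; rewrite /id; ring.
have := @is_derive1_chain expR (fun y => c * y ^+ 2) x _ _ (is_derive_expR (c * x ^+ 2)) sq.
by move=> h; apply: (is_derive_eq h); rewrite mulrC.
Qed.

Local Notation mu1 := (@lebesgue_measure R).

Lemma Rint_FTC (F f : R -> R) (a b : R) : a < b ->
  (forall x, is_derive x (1 : R) F (f x)) -> continuous f ->
  \int[mu1]_(x in `[a, b]) f x = F b - F a.
Proof.
move=> ab dF cf; have cF : continuous F.
  by move=> x; exact: is_derive1_continuous (dF x).
rewrite /Rintegral (@continuous_FTC2 R f F)//.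
- exact: continuous_subspaceT.
- split; first by move=> x _; have [] := dF x.
  + by apply: cvg_at_right_filter; exact: cF.
  + by apply: cvg_at_left_filter; exact: cF.
- by move=> x _; rewrite derive1E; have [] := dF x.
Qed.

Lemma Rint_derive_eq0 (F f : R -> R) : (forall x, is_derive x (1 : R) F (f x)) ->
  continuous f -> intg mu1 f -> F n%:R @[n --> \oo] --> (0 : R) ->
  F (- n%:R) @[n --> \oo] --> (0 : R) -> \int[mu1]_x f x = 0.
Proof.
move=> dF cf fi Fp Fn; have mf := intg_meas fi.
pose D n := `[- n.+1%:R, n.+1%:R]%classic : set R.
pose fn n := f \_ (D n).
have fnE n : \int[mu1]_x fn n x = F n.+1%:R - F (- n.+1%:R).
  have lt : - n.+1%:R < n.+1%:R :> R by rewrite gtrN.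
  by rewrite -Rintegral_mkcond; exact: Rint_FTC.
have [_] : intg mu1 f /\ (\int[mu1]_x fn n x) @[n --> \oo] --> \int[mu1]_x f x.
  apply: (Rint_dct _ _ _ (intg_norm fi)).
  - move=> n; have mD : measurable (D n) by exact: measurable_itv.
    by apply: (iffLR (measurable_restrictT f mD)); exact: measurable_funTS.
  - move=> x; apply: cvg_near_cst; near=> n.
    rewrite /fn patchE ifT// inE /D /= in_itv/= -ler_norml.
    have : `|x| < n%:R by near: n; exact: nbhs_infty_gtr.
    by move=> /ltW /le_trans -> //; rewrite ler_nat.
  - by move=> n x; rewrite /fn patchE; case: ifP => // _; rewrite normr0.
under eq_fun do rewrite fnE.
move=> h; have h2 : (F n.+1%:R - F (- n.+1%:R)) @[n --> \oo] --> (0 - 0 : R).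
  apply: cvgB.
    by rewrite (cvg_shiftS (fun n => F n%:R)).
  by rewrite (cvg_shiftS (fun n => F (- n%:R))).
by rewrite -(cvg_lim (@Rhausdorff R) h) (cvg_lim (@Rhausdorff R) h2) subr0.
Unshelve. all: by end_near. Qed.

Lemma Rint_odd (f : R -> R) : measurable_fun setT f ->
  (forall x, f (- x) = - f x) -> intg mu1 f -> \int[mu1]_x f x = 0.
Proof.
move=> mf fo fi.
have mE := @integral_lebesgue_sym R true 0.
have : \int[mu1]_x f x = \int[mu1]_x f (0 + (-1) ^+ true * x).
  exact: (@Rint_transfer _ _ _ _ R mu1 mu1 _ mE).
have -> : \int[mu1]_x f (0 + (-1) ^+ true * x) = \int[mu1]_x (- f x).
  by apply: eq_Rint => x; rewrite add0r expr1 mulN1r fo.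
rewrite RintN//; lra.
Qed.

End real_derivatives.

Lemma measurable_cosR (R : realType) : measurable_fun setT (@cos R).
Proof. by apply: continuous_measurable_fun; exact: continuous_cos. Qed.

Lemma measurable_sinR (R : realType) : measurable_fun setT (@sin R).
Proof. by apply: continuous_measurable_fun; exact: continuous_sin. Qed.

Section gaussian_characteristic_function.
Context (R : realType).
Local Notation mu1 := (@lebesgue_measure R).
Implicit Types s t x : R.

Local Notation npdf := (normal_pdf (0 : R)).

Lemma normal_pdf0E s x : s != 0 ->
  npdf s x = normal_peak s * expR (- (s ^+ 2 *+ 2)^-1 * x ^+ 2).
Proof.
move=> s0; rewrite normal_pdfE// /normal_fun subr0; congr (_ * expR _).
by rewrite !mulNr mulrC.
Qed.

Lemma is_derive_normal_pdf s x : s != 0 ->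
  is_derive x (1 : R) (npdf s) (- (s ^- 2 * (x * npdf s x))).
Proof.
move=> s0; rewrite (_ : npdf s = fun x => normal_peak s * expR (- (s ^+ 2 *+ 2)^-1 * x ^+ 2)).
  have := is_derive1_mul (is_derive_cst (normal_peak s) x (1 : R))
    (is_derive1_gauss (- (s ^+ 2 *+ 2)^-1) x).
  by move=> h; apply: (is_derive_eq h); rewrite /cst/=; set e := expR _; field.
by apply/funext => y; exact: normal_pdf0E.
Qed.

Lemma intg_normal_pdf s : intg mu1 (npdf s).
Proof. by have := @integrable_normal_pdf R 0 s. Qed.

Lemma Rint_normal_pdf s : \int[mu1]_x npdf s x = 1.
Proof. by rewrite /Rintegral integral_normal_pdf. Qed.

(** With y = x^2 / (4 s^2), the Gaussian factor is exp(-y) exp(-y), and |x| <= |s| (1 + y) <= |s|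
    exp(y) uses up one of the two. What remains is a Gaussian of width sqrt 2 times larger. This
    yields integrability of |x| against the density and an explicit first moment. *)
Lemma normal_pdf_mean_bound s : s != 0 -> exists2 C : R, 0 <= C &
  C = `|s| * Num.sqrt 2 /\
  forall x, `|x| * npdf s x <= C * npdf (Num.sqrt 2 * s) x.
Proof.
move=> s0; have q0 : Num.sqrt 2 * s != 0 by rewrite mulf_neq0// sqrtr_eq0 -ltNge.
pose p := normal_peak s / normal_peak (Num.sqrt 2 * s).
have p0 : 0 < p by rewrite divr_gt0 ?normal_peak_gt0.
exists (`|s| * p) => [|]; first by rewrite mulr_ge0// ltW.
split=> [|x].
  congr (_ * _); rewrite /p /normal_peak invrK exprMn sqr_sqrtr//.
  have -> : 2 * s ^+ 2 * pi *+ 2 = 2 * (s ^+ 2 * pi *+ 2) by ring.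
  rewrite sqrtrM// mulrC mulfK// gt_eqF// sqrtr_gt0.
  by rewrite pmulrn_lgt0// mulr_gt0 ?pi_gt0// exprn_even_gt0.
rewrite !normal_pdf0E// /p.
have pk : normal_peak (Num.sqrt 2 * s) != 0 by rewrite gt_eqF// normal_peak_gt0.
rewrite (_ : `|s| * _ * _ = normal_peak s * (`|s| *
  expR (- ((Num.sqrt 2 * s) ^+ 2 *+ 2)^-1 * x ^+ 2))); last by field.
rewrite mulrCA ler_wpM2l ?normal_peak_ge0//.
rewrite exprMn sqr_sqrtr//.
rewrite (_ : - (s ^+ 2 *+ 2)^-1 * x ^+ 2 =
  - (2 * s ^+ 2 *+ 2)^-1 * x ^+ 2 - (2 * s ^+ 2 *+ 2)^-1 * x ^+ 2); last by field.
rewrite !mulNr; set y := _^-1 * _; rewrite expRD mulrA ler_pM2r ?expR_gt0//.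
have : 1 + y <= expR y by exact: expR_ge1Dx.
rewrite expRN ler_pdivrMr ?expR_gt0// => ey.
have s1 : 0 < `|s| by rewrite normr_gt0.
have : `|x| <= `|s| * (1 + y).
  rewrite /y -(real_normK (num_real s)) -(real_normK (num_real x)).
  rewrite -subr_ge0 (_ : _ - _ = `|s| * (1 - `|x| / `|s| / 2) ^+ 2).
    by rewrite mulr_ge0// sqr_ge0.
  by field; rewrite gt_eqF.
by move=> /le_trans; apply; rewrite ler_wpM2l.
Qed.

Lemma measurable_npdf s : measurable_fun setT (npdf s).
Proof. exact: measurable_normal_pdf. Qed.

Lemma intg_normal_pdf_mean s : s != 0 -> intg mu1 (fun x => `|x| * npdf s x).
Proof.
move=> s0; have [C C0 [_ h]] := normal_pdf_mean_bound s0.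
apply: intg_dom (intgZ C (intg_normal_pdf (Num.sqrt 2 * s))).
  by apply: measurable_funM; [exact: normr_measurable|exact: measurable_npdf].
by move=> x; rewrite ger0_norm ?mulr_ge0 ?normal_pdf_ge0.
Qed.

Let measurable_trig (h : R -> R) t c : continuous h ->
  measurable_fun setT (fun x : R => h (t * x + c)).
Proof.
move=> ch; apply: measurableT_comp; first exact: continuous_measurable_fun.
by apply: measurable_funD => //; exact: measurable_funM.
Qed.

Lemma intg_normal_pdf_bnd s (h : R -> R) : measurable_fun setT h ->
  (forall x, `|h x| <= 1) -> intg mu1 (fun x => h x * npdf s x).
Proof.
move=> mh h1; apply: intg_dom (intg_normal_pdf s).
  by apply: measurable_funM => //; exact: measurable_npdf.
by move=> x; rewrite normrM (ger0_norm (normal_pdf_ge0 _ _ _)) ler_piMl ?normal_pdf_ge0.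
Qed.

Let cosx_measurable t c : measurable_fun setT (fun x => cos (t * x + c)).
Proof. by apply: measurable_trig; exact: continuous_cos. Qed.

Let sinx_measurable t c : measurable_fun setT (fun x => sin (t * x + c)).
Proof. by apply: measurable_trig; exact: continuous_sin. Qed.

Lemma intg_cos_normal_pdf s t : intg mu1 (fun x => cos (t * x) * npdf s x).
Proof.
apply: intg_normal_pdf_bnd => [|x]; last exact: cos_max.
by have := cosx_measurable t 0; under eq_fun do rewrite addr0.
Qed.

Lemma intg_sin_normal_pdf s t : intg mu1 (fun x => sin (t * x) * npdf s x).
Proof.
apply: intg_normal_pdf_bnd => [|x]; last exact: sin_max.
by have := sinx_measurable t 0; under eq_fun do rewrite addr0.
Qed.

Lemma normal_pdf0_even s x : s != 0 -> npdf s (- x) = npdf s x.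
Proof. by move=> s0; rewrite !normal_pdf0E// sqrrN. Qed.

Lemma Rint_sin_normal_pdf s t : s != 0 ->
  \int[mu1]_x (sin (t * x) * npdf s x) = 0.
Proof.
move=> s0; have i := intg_sin_normal_pdf s t.
apply: Rint_odd => //; first exact: intg_meas i.
by move=> x; rewrite mulrN sinN normal_pdf0_even// mulNr.
Qed.

Let F s t := \int[mu1]_x (cos (t * x) * npdf s x).

Let is_derive_cosx x t : is_derive t (1 : R) (fun t => cos (t * x)) (- (x * sin (t * x))).
Proof.
have dl : is_derive t (1 : R) (fun t : R => t * x) x.
  by have := is_derive1_linear x t; under eq_fun do rewrite mulrC.
have := @is_derive1_chain R (@cos R) (fun t => t * x) t _ _ (is_derive_cos _) dl.
by move=> h; apply: (is_derive_eq h); rewrite mulNr mulrC.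
Qed.

Let is_derive_F s t : s != 0 ->
  is_derive t (1 : R) (F s) (- \int[mu1]_x (x * sin (t * x) * npdf s x)).
Proof.
move=> s0; pose f (t x : R) := cos (t * x) * npdf s x.
have df u x : is_derive u (1 : R) (f ^~ x) (- (x * sin (u * x) * npdf s x)).
  have := is_derive1_mul (is_derive_cosx x u) (is_derive_cst (npdf s x) u (1 : R)).
  by move=> h; apply: (is_derive_eq h); rewrite /cst/=; ring.
have d1E u x : partial1of2 f u x = - (x * sin (u * x) * npdf s x).
  by rewrite /partial1of2 derive1E; have [_ ->] := df u x.
have It : `]t - 1, t + 1[%classic t by rewrite /= in_itv/=; apply/andP; split; lra.
have intf u : `]t - 1, t + 1[%classic u -> mu1.-integrable setT (EFin \o f u).
  by move=> _; exact: intg_cos_normal_pdf.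
have dF u x : `]t - 1, t + 1[%classic u -> setT x -> derivable (f ^~ x) u 1.
  by move=> _ _; have [] := df u x.
have G0 x : 0 <= `|x| * npdf s x by rewrite mulr_ge0// normal_pdf_ge0.
have Gub u x : `]t - 1, t + 1[%classic u -> setT x ->
    `|partial1of2 f u x| <= `|x| * npdf s x.
  move=> _ _; rewrite d1E normrN !normrM (ger0_norm (normal_pdf_ge0 _ _ _)).
  by rewrite ler_wpM2r ?normal_pdf_ge0// ler_piMr// sin_max.
have h := @derivable_under_integral R _ _ mu1 f setT measurableT t _ _ It intf
  dF _ G0 (intg_normal_pdf_mean s0) Gub.
have e := @differentiation_under_integral R _ _ mu1 f setT measurableT t _ _ It intf
  dF _ G0 (intg_normal_pdf_mean s0) Gub.
apply: DeriveDef => //.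
rewrite -derive1E e -RintN; last first.
  apply: intg_dom (intg_normal_pdf_mean s0) => [|x].
    apply: measurable_funM; last exact: measurable_npdf.
    apply: measurable_funM => //.
    by have := sinx_measurable t 0; under eq_fun do rewrite addr0.
  rewrite !normrM (ger0_norm (normal_pdf_ge0 _ _ _)).
  by rewrite ler_wpM2r ?normal_pdf_ge0// ler_piMr// sin_max.
by apply: eq_Rint => x; rewrite d1E.
Qed.

(** The derivative of sin(t x) times the density has integral zero, the density being its own
    derivative up to the factor -x / s^2. *)
Let normal_by_parts s t : s != 0 ->
  \int[mu1]_x (x * sin (t * x) * npdf s x) = s ^+ 2 * t * F s t.
Proof.
move=> s0.
have is_x : intg mu1 (fun x => x * sin (t * x) * npdf s x).
  apply: intg_dom (intg_normal_pdf_mean s0) => [|x].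
    apply: measurable_funM; last exact: measurable_npdf.
    apply: measurable_funM => //.
    by have := sinx_measurable t 0; under eq_fun do rewrite addr0.
  rewrite !normrM (ger0_norm (normal_pdf_ge0 _ _ _)).
  by rewrite ler_wpM2r ?normal_pdf_ge0// ler_piMr// sin_max.
have ic := intg_cos_normal_pdf s t.
pose h x := sin (t * x) * npdf s x.
pose h' x := t * (cos (t * x) * npdf s x) - s ^- 2 * (x * sin (t * x) * npdf s x).
have hi : intg mu1 h' by apply: intgB; exact: intgZ.
have dh x : is_derive x (1 : R) h (h' x).
  have ds : is_derive x (1 : R) (fun x => sin (t * x)) (cos (t * x) * t).
    exact: (@is_derive1_chain R (@sin R) (fun x => t * x) x _ _ (is_derive_sin _) (is_derive1_linear t x)).
  have := is_derive1_mul ds (is_derive_normal_pdf x s0).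
  by move=> k; apply: (is_derive_eq k); rewrite /h'; ring.
have cpdf := continuous_normal_pdf (m := 0) s0.
have ctr (g : R -> R) : continuous g -> continuous (fun x => g (t * x)).
  move=> cg x; apply: (@continuous_comp _ _ _ (fun x => t * x) g); last exact: cg.
  exact: mulrl_continuous.
have ch' : continuous h'.
  move=> x; apply: cvgB; apply: cvgM; try exact: cvg_cst.
    by apply: cvgM; [exact/ctr/continuous_cos|exact: cpdf].
  apply: cvgM; last exact: cpdf.
  by apply: cvgM; [exact: cvg_id|exact/ctr/continuous_sin].
have decay (e : R) : `|e| = 1 -> h (e * n%:R) @[n --> \oo] --> (0 : R).
  move=> e1; apply/cvgr0Pnorm_le => eps eps0.
  pose p := normal_peak s * (s ^+ 2 *+ 2).
  near=> n; rewrite /h normrM (ger0_norm (normal_pdf_ge0 _ _ _)).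
  have n0 : 0 < n%:R :> R by rewrite ltr0n; near: n; exact: nbhs_infty_gt.
  have pn : p <= eps * n%:R.
    by rewrite mulrC -ler_pdivrMr//; near: n; exact: nbhs_infty_ger.
  apply: (@le_trans _ _ (npdf s (e * n%:R))).
    by rewrite ler_piMl ?normal_pdf_ge0// sin_max.
  rewrite normal_pdf0E// exprMn -(real_normK (num_real e)) e1 expr1n mul1r.
  rewrite mulNr expRN ler_pdivrMr ?expR_gt0//.
  have s2 : 0 < s ^+ 2 *+ 2 by rewrite mulrn_wgt0// exprn_even_gt0.
  have n1 : 1 <= n%:R :> R by rewrite ler1n; near: n; exact: nbhs_infty_gt.
  have : eps * (n%:R / (s ^+ 2 *+ 2)) <= eps * expR ((s ^+ 2 *+ 2)^-1 * n%:R ^+ 2).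
    rewrite ler_pM2l//; apply: le_trans (expR_ge1Dx _).
    rewrite mulrC (le_trans (y := (s ^+ 2 *+ 2)^-1 * n%:R ^+ 2)) ?lerDr//.
    by rewrite ler_pM2l ?invr_gt0// ler_eXnr.
  by apply: le_trans; rewrite mulrA ler_pdivlMr.
have h0 : \int[mu1]_x h' x = 0.
  apply: (Rint_derive_eq0 dh) => //.
    have := decay 1 (normr1 _); rewrite (_ : (fun n => _) = (fun n => h n%:R))//.
    by apply/funext => n; rewrite mul1r.
  have := decay (- 1) (normrN1 _).
  rewrite (_ : (fun n => _) = (fun n => h (- n%:R)))//.
  by apply/funext => n; rewrite mulN1r.
move: h0; rewrite /h' RintB ?RintZ//; [|exact: intgZ|exact: intgZ].
rewrite -/(F s t) => /eqP; rewrite subr_eq0 => /eqP tF.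
by rewrite -mulrA tF mulrA divff ?mul1r// expf_neq0.
Unshelve. all: by end_near. Qed.

(** Differentiation under the integral and [normal_by_parts] give F' = - s^2 t F; [G] is F times the
    integrating factor, hence constant, and F(0) = 1. *)
Lemma Rint_cos_normal_pdf s t : s != 0 ->
  \int[mu1]_x (cos (t * x) * npdf s x) = expR (- (s ^+ 2 / 2) * t ^+ 2).
Proof.
move=> s0; rewrite -/(F s t); pose c := s ^+ 2 / 2.
pose G u := F s u * expR (c * u ^+ 2).
have dG u : is_derive u (1 : R) G 0.
  have := is_derive1_mul (is_derive_F u s0) (is_derive1_gauss c u).
  move=> h; apply: (is_derive_eq h); rewrite normal_by_parts// /c.
  by set e := expR _; set f := F _ _; field.
have : G t = G 0 by exact: is_derive_0_is_cst.
rewrite /G expr0n/= mulr0 expR0 mulr1.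
have -> : F s 0 = 1.
  rewrite -(Rint_normal_pdf s); apply: eq_Rint => x.
  by rewrite mul0r cos0 mul1r.
by move=> G1; rewrite mulNr -/c expRN -[RHS]mul1r -G1 mulfK// gt_eqF// expR_gt0.
Qed.

End gaussian_characteristic_function.

(** * Fubini's theorem for a bounded kernel between two integrable functions *)

Section fubini_bounded_kernel.
Context d1 d2 (T1 : measurableType d1) (T2 : measurableType d2) (R : realType).
Variables (m1 : {sigma_finite_measure set T1 -> \bar R})
  (m2 : {sigma_finite_measure set T2 -> \bar R}).
Variables (f1 : T1 -> R) (f2 : T2 -> R) (b : T1 * T2 -> R) (K : R).
Hypotheses (i1 : intg m1 f1) (i2 : intg m2 f2).
Hypotheses (mb : measurable_fun setT b) (bK : forall z, `|b z| <= K).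

Let mf1 : measurable_fun setT (fun z : T1 * T2 => f1 z.1).
Proof. exact: (measurableT_comp (intg_meas i1) measurable_fst). Qed.

Let mf2 : measurable_fun setT (fun z : T1 * T2 => f2 z.2).
Proof. exact: (measurableT_comp (intg_meas i2) measurable_snd). Qed.

Lemma intg_tensor_kernel :
  intg (m1 \x m2)%E (fun z => f1 z.1 * (f2 z.2 * b z)).
Proof.
have h : intg (m1 \x m2)%E (fun z => `|f1 z.1| * `|f2 z.2|).
  apply: intg_le_lty.
    by apply: measurable_funM; apply: measurableT_comp.
    by move=> z; exact: mulr_ge0.
  have mm : measurable_fun setT (fun z : T1 * T2 => (`|f1 z.1| * `|f2 z.2|)%:E).
    by apply/measurable_EFinP; apply: measurable_funM; apply: measurableT_comp.
  rewrite fubini_tonelli1//=.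
  rewrite (_ : fubini_F _ _ =
      (fun x => (\int[m2]_y `|f2 y|)%R%:E * `|f1 x|%:E)%E); last first.
    apply/funext => x; rewrite /fubini_F EFin_Rint; last exact: intg_norm.
    under eq_integral do rewrite /= EFinM.
    rewrite ge0_integralZl// ?lee_fin//; first by rewrite muleC.
    by apply/measurable_EFinP; apply: measurableT_comp; [|exact: intg_meas i2].
  rewrite ge0_integralZl//.
  - rewrite -EFin_Rint; last exact: intg_norm.
    by rewrite -EFinM ltry.
  - by apply/measurable_EFinP; apply: measurableT_comp; [|exact: intg_meas i1].
  - by rewrite lee_fin; apply: Rint_ge0.
apply: intg_dom (intgZ K h) => [|z].
  by apply: measurable_funM => //; exact: measurable_funM.
by rewrite !normrM mulrA mulrC ler_wpM2r.
Qed.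

Let s1 x : intg m2 (fun y => f1 x * (f2 y * b (x, y))).
Proof.
apply: intg_dom (intgZ (`|f1 x| * K) (intg_norm i2)) => [|y].
  apply: measurable_funM => //; apply: measurable_funM; first exact: intg_meas i2.
  exact: (measurableT_comp mb (pair1_measurable _)).
by rewrite !normrM -mulrA ler_wpM2l// mulrC ler_wpM2r.
Qed.

Let s2 y : intg m1 (fun x => f1 x * (f2 y * b (x, y))).
Proof.
apply: intg_dom (intgZ (`|f2 y| * K) (intg_norm i1)) => [|x].
  apply: measurable_funM; first exact: intg_meas i1.
  apply: measurable_funM => //.
  exact: (measurableT_comp mb (pair2_measurable _)).
by rewrite !normrM mulrC ler_wpM2r// ler_wpM2l.
Qed.

Lemma intg_kernel1 x : intg m2 (fun y => f2 y * b (x, y)).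
Proof.
apply: intg_dom (intgZ K (intg_norm i2)) => [|y].
  apply: measurable_funM; first exact: intg_meas i2.
  exact: (measurableT_comp mb (pair1_measurable _)).
by rewrite !normrM mulrC ler_wpM2r.
Qed.

Lemma intg_kernel2 y : intg m1 (fun x => f1 x * b (x, y)).
Proof.
apply: intg_dom (intgZ K (intg_norm i1)) => [|x].
  apply: measurable_funM; first exact: intg_meas i1.
  exact: (measurableT_comp mb (pair2_measurable _)).
by rewrite !normrM mulrC ler_wpM2r.
Qed.

Lemma intg_Rint_kernel :
  intg m1 (fun x => f1 x * \int[m2]_y (f2 y * b (x, y))).
Proof.
apply: intg_eq (intg_Rint1 intg_tensor_kernel s1) => x /=.
by rewrite RintZ//; exact: intg_kernel1.
Qed.

(** Boundedness of [b] makes every slice integrable, not just almost every one, so no default value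
    of an integral interferes. The exchanges behind the Gaussian Fourier identity and Levy's theorem
    have this form. *)
Lemma Rint_swap_kernel : \int[m1]_x (f1 x * \int[m2]_y (f2 y * b (x, y))) =
  \int[m2]_y (f2 y * \int[m1]_x (f1 x * b (x, y))).
Proof.
transitivity (\int[m1]_x \int[m2]_y (f1 x * (f2 y * b (x, y)))).
  by apply: eq_Rint => x; rewrite RintZ//; exact: intg_kernel1.
rewrite -(Rint_fubini1 intg_tensor_kernel s1) (Rint_fubini2 intg_tensor_kernel s2).
apply: eq_Rint => y; rewrite -RintZ; last exact: intg_kernel2.
by apply: eq_Rint => x /=; rewrite mulrCA.
Qed.

End fubini_bounded_kernel.

(** * Continuity of translations in L^2 *)

Section translation_continuity.
Context (R : realType) (n : nat).
Local Notation V := 'rV[R]_n.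
Local Notation lm := (lam R n).

Lemma intg_shift (y : V) (f : borel V -> R) : intg lm f ->
  intg lm (fun z => f (y + z)).
Proof.
move=> fi; have mf := intg_meas fi.
by apply/(@intg_transfer _ _ _ _ R lm lm _ (measurable_shift y)
  (@integral_shift R n y)).
Qed.

Lemma Rint_shift (y : V) (f : borel V -> R) : measurable_fun setT f ->
  \int[lm]_z f (y + z) = \int[lm]_z f z.
Proof.
by move=> mf; rewrite [RHS](@Rint_transfer _ _ _ _ R lm lm _ (@integral_shift R n y)).
Qed.

Lemma sqint_shift (y : V) (f : borel V -> R) : sqint lm f ->
  sqint lm (fun z => f (y + z)).
Proof.
move=> [mf fi]; split; first exact: (measurableT_comp mf (measurable_shift y)).
exact: (intg_shift y fi).
Qed.

Definition shift_sqdist (f : borel V -> R) (y : V) : R :=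
  \int[lm]_z ((f z - f (y + z)) ^+ 2).

Definition shift_cvg (f : borel V -> R) := forall e : R, 0 < e ->
  exists2 r : R, 0 < r & forall y : V, `|y| < r -> shift_sqdist f y <= e.

Lemma shift_sqdist_ge0 f y : 0 <= shift_sqdist f y.
Proof. by apply: Rint_ge0 => z; rewrite sqr_ge0. Qed.

Lemma shift_sqdist_le4 f y : sqint lm f ->
  shift_sqdist f y <= 4 * \int[lm]_z (f z ^+ 2).
Proof.
move=> fi; have := Rint_sqrD fi (sqintN (sqint_shift y fi)).
rewrite -/(shift_sqdist f y) => /le_trans; apply.
rewrite (_ : \int[lm]_z (- f (y + z)) ^+ 2 = \int[lm]_z (f z ^+ 2)); first lra.
rewrite -(Rint_shift y (f := fun z => f z ^+ 2)); last exact: intg_meas fi.2.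
by apply: eq_Rint => z; rewrite sqrrN.
Qed.

Lemma shift_sqdistD f g y : sqint lm f -> sqint lm g ->
  shift_sqdist (fun z => f z + g z) y <= 2 * shift_sqdist f y + 2 * shift_sqdist g y.
Proof.
move=> fi gi.
have := Rint_sqrD (sqintB fi (sqint_shift y fi)) (sqintB gi (sqint_shift y gi)).
apply: le_trans; rewrite le_eqVlt; apply/orP; left; apply/eqP.
by apply: eq_Rint => z; congr (_ ^+ 2); ring.
Qed.

Lemma shift_cvgD f g : sqint lm f -> sqint lm g -> shift_cvg f -> shift_cvg g ->
  shift_cvg (fun z => f z + g z).
Proof.
move=> fi gi cf cg e e0; have e4 : 0 < e / 4 by rewrite divr_gt0.
have [r r0 fr] := cf _ e4; have [r' r'0 gr] := cg _ e4.
exists (Num.min r r') => [|y]; first by rewrite lt_min r0.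
rewrite lt_min => /andP[/fr h1 /gr h2].
by apply: le_trans (shift_sqdistD y fi gi) _; lra.
Qed.

Lemma shift_cvgZ c f : sqint lm f -> shift_cvg f -> shift_cvg (fun z => c * f z).
Proof.
move=> fi cf e e0.
have c0 : 0 < c ^+ 2 + 1 by rewrite ltr_wpDl ?sqr_ge0.
have [r r0 fr] := cf _ (divr_gt0 e0 c0).
exists r => // y /fr h; apply: (@le_trans _ _ ((c ^+ 2) * shift_sqdist f y)).
  rewrite -RintZ; last exact: (sqintB fi (sqint_shift y fi)).2.
  rewrite le_eqVlt; apply/orP; left; apply/eqP; apply: eq_Rint => z; ring.
move: h; rewrite ler_pdivlMr// => /(le_trans _); apply.
by rewrite mulrC ler_wpM2l ?shift_sqdist_ge0// lerDl.
Qed.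

Lemma shift_cvg_sum I (s : seq I) (f : I -> borel V -> R) :
  (forall i, sqint lm (f i)) -> (forall i, shift_cvg (f i)) ->
  shift_cvg (fun z => \sum_(i <- s) f i z).
Proof.
move=> fi cf; elim: s => [|i s ih].
  move=> e e0; exists 1 => // y _; rewrite /shift_sqdist.
  under eq_Rint do rewrite !big_nil subrr expr0n.
  by rewrite Rint0 ltW.
under eq_fun do rewrite big_cons.
by apply: shift_cvgD => //; exact: sqint_sum.
Qed.

Lemma shift_cvg_closed f : sqint lm f ->
  (forall e : R, 0 < e -> exists g, [/\ sqint lm g, shift_cvg g &
    \int[lm]_z ((f z - g z) ^+ 2) <= e]) -> shift_cvg f.
Proof.
move=> fi fg e e0; have e4 : 0 < e / 16 by rewrite divr_gt0.
have [g [gi cg fge]] := fg _ e4.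
have [r r0 gr] := cg _ e4; exists r => // y /gr h.
have := shift_sqdistD y (sqintB fi gi) gi.
rewrite (_ : shift_sqdist (fun z => f z - g z + g z) y = shift_sqdist f y).
  by have := shift_sqdist_le4 y (sqintB fi gi); lra.
by apply: eq_Rint => z; congr (_ ^+ 2); ring.
Qed.

Lemma sqint_indic (A : set (borel V)) : measurable A -> (lm A < +oo)%E ->
  sqint lm \1_A.
Proof.
move=> mA Aoo; have mi : measurable_fun setT (\1_A : borel V -> R) by exact: measurable_indic.
split => //; apply: (intg_eq (g := \1_A)).
  by move=> z; rewrite indicE; case: (_ \in _); rewrite ?expr1n ?expr0n.
apply: intg_le_lty => //.
by rewrite integral_indic// setIT.
Qed.

Lemma Rint_indic (A : set (borel V)) : measurable A ->
  \int[lm]_z \1_A z = fine (lm A).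
Proof. by move=> mA; rewrite /Rintegral integral_indic// setIT. Qed.

(** The squared distance is twice the measure of U minus the overlap of U with its translate.
    Openness makes the overlap integrand converge pointwise to the indicator. Dominated convergence
    is sequential, so the claim is negated to obtain a sequence of shifts of norm below 1 / (k +
    1). *)
Lemma shift_cvg_open (U : set V) : open U -> (lm U < +oo)%E ->
  shift_cvg \1_(U : set (borel V)).
Proof.
move=> oU Uoo; have mU : measurable (U : set (borel V)) by exact: borel_open.
have ui := sqint_indic mU Uoo; pose u : borel V -> R := \1_U.
have u01 z : u z = 0 \/ u z = 1.
  by rewrite /u indicE; case: (_ \in _); [right|left].
have uu z : u z ^+ 2 = u z by case: (u01 z) => ->; rewrite ?expr0n ?expr1n.
have ui1 : intg lm u by apply: intg_eq ui.2 => z; rewrite -[LHS]uu.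
pose a y := \int[lm]_z (u z * u (y + z)).
have dE y : shift_sqdist u y = 2 * (fine (lm U) - a y).
  rewrite /shift_sqdist (_ : \int[lm]_z _ =
     \int[lm]_z (u z + u (y + z) + - 2 * (u z * u (y + z)))); last first.
    by apply: eq_Rint => z; rewrite sqrrB !uu -mulr_natl; ring.
  have i2 := sqint_mul ui (sqint_shift y ui).
  rewrite RintD ?RintZ//; [|by apply: intgD => //; exact: intg_shift|exact: intgZ].
  rewrite RintD//; last exact: intg_shift.
  rewrite Rint_shift; last exact: intg_meas ui1.
  rewrite Rint_indic// -/(a y); ring.
apply: contrapT => /existsNP[e /not_implyP[e0 /forall2NP h]].
have ex k : exists y : V, `|y| < k.+1%:R^-1 /\ e < shift_sqdist u y.
  have [|/existsNP[y /not_implyP[yk ye]]] := h (k.+1%:R^-1).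
    by rewrite invr_gt0.
  by exists y; split => //; rewrite ltNge; exact/negP.
have [y_ yP] := choice ex.
have [_] : intg lm u /\ a (y_ k) @[k --> \oo] --> \int[lm]_z u z.
  apply: (Rint_dct _ _ _ ui1).
  - by move=> k; exact: intg_meas (sqint_mul ui (sqint_shift (y_ k) ui)).
  - move=> z; have [Uz|Uz] := pselect (U z); last first.
      rewrite /u indicE memNset//; under eq_fun do rewrite mul0r.
      exact: cvg_cst.
    apply: cvg_near_cst; have [r r0 zr] := open_rV_ball oU Uz.
    near=> k; rewrite /u !indicE !mem_set ?mul1r//.
    apply: zr; rewrite opprD addrA addrC addrA addNr add0r normrN.
    have [/lt_trans + _] := yP k; apply; near: k.
    exact: (near_infty_natSinv_lt (PosNum r0)).
  - move=> k z; rewrite normrM.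
    by case: (u01 z) (u01 (y_ k + z)) => -> [] ->; rewrite ?normr0 ?normr1 ?mulr0 ?mulr1 ?mul0r.
rewrite Rint_indic// => ac.
have : (2 * (fine (lm U) - a (y_ k))) @[k --> \oo] --> 2 * (fine (lm U) - fine (lm U)).
  by apply: cvgMr; apply: cvgB => //; exact: cvg_cst.
rewrite subrr mulr0 => /cvgr0Pnorm_lt /(_ _ e0) [k _ /(_ k (leqnn _))]/=.
rewrite -dE ger0_norm ?shift_sqdist_ge0//.
by have [_ /lt_trans h2 /h2] := yP k; rewrite ltxx.
Unshelve. all: by end_near. Qed.

Definition cbox (r : R) : set (borel V) := [set z : V | `|z| <= r].

Lemma measurable_norm : measurable_fun setT (fun z : borel V => `|z : V|).
Proof. by apply: continuous_borel_real; exact: norm_continuous. Qed.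

Lemma measurable_cbox r : measurable (cbox r).
Proof.
have mc : measurable (`]-oo, r]%classic : set R) by exact: measurable_itv.
have := measurable_norm measurableT mc.
by rewrite setTI; congr (measurable _); apply/seteqP; split => z /=; rewrite in_itv.
Qed.

Lemma lam_cbox_lty r : (lm (cbox r) < +oo)%E.
Proof.
pose g (l : 'I_n) : R -> R := \1_(`[- r, r]%classic).
have mg l : measurable_fun setT (g l) by apply: measurable_indic; exact: measurable_itv.
have g0 l t : 0 <= g l t by rewrite /g indicE.
have gi l : intg (@lebesgue_measure R) (g l).
  apply: intg_le_lty; [exact: mg|exact: g0|rewrite /g integral_indic ?setIT//].
  have /= -> := @lebesgue_measure_itv R `[(- r)%R, r].
  by case: ifP => _; rewrite ?ltry// -EFinB ltry.
have [h _] := integral_lam_prod mg g0 gi.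
have := h => /integrableP[_]; apply: le_lt_trans.
rewrite -[X in lm X]setIT -integral_indic//; last exact: measurable_cbox.
apply: ge0_le_integral => //.
- by apply/measurable_EFinP; apply: measurable_indic; exact: measurable_cbox.
- by do 2 apply: measurableT_comp => //; exact: intg_meas h.
move=> z _; rewrite lee_fin ger0_norm; last exact: prodr_ge0.
rewrite indicE; case: (boolP (_ \in _)) => [|_]; last exact: prodr_ge0.
rewrite inE /cbox/= => zr; rewrite big1// => l _.
by rewrite /g indicE mem_set//= in_itv/= -ler_norml (le_trans (rV_coord_le z l)).
Qed.

Lemma intg_cbox (f : borel V -> R) K r : measurable_fun setT f ->
  (forall z, `|f z| <= K) -> (forall z : V, r < `|z| -> f z = 0) -> intg lm f.
Proof.
move=> mf fK fr; have mc := measurable_cbox r.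
have h : intg lm (\1_(cbox r)).
  by apply: intg_le_lty => //; rewrite integral_indic// setIT; exact: lam_cbox_lty.
apply: intg_dom (intgZ K h) => // z.
have [zr|zr] := leP `|z : V| r; last first.
  by rewrite fr// normr0 indicE mulr_ge0// (le_trans _ (fK z)).
by rewrite indicE mem_set ?mulr1.
Qed.

Lemma sqint_cbox (f : borel V -> R) K r : measurable_fun setT f ->
  (forall z, `|f z| <= K) -> (forall z : V, r < `|z| -> f z = 0) -> sqint lm f.
Proof.
move=> mf fK fr; split => //; apply: (@intg_cbox _ (K ^+ 2) r).
- exact: measurable_funX.
- by move=> z; rewrite normrX ler_sqr ?nnegrE// (le_trans _ (fK z)).
- by move=> z /fr ->; rewrite expr0n.
Qed.

Let B (r : R) : set (borel V) := [set z : V | `|z| < r].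

Let oB r : open (B r : set V).
Proof.
have := @norm_continuous _ V => /continuousP /(_ _ (@open_lt R r)).
exact.
Qed.

Let mB r : measurable (B r).
Proof. by move: (B r : set V) (@oB r) => U oU; exact: borel_open. Qed.

Let Boo r A : measurable A -> (lm (A `&` B r) < +oo)%E.
Proof.
move=> mA; apply: le_lt_trans (lam_cbox_lty r); apply: le_measure; rewrite ?inE.
- exact: measurableI mA (mB r).
- exact: measurable_cbox.
- by move=> z [_]; exact: ltW.
Qed.

(** Dynkin's argument from open sets. Intersecting with a ball keeps all measures finite, so that
    complements become differences in L^2 and disjoint unions become L^2 limits. *)
Lemma shift_cvg_measurable r (A : set (borel V)) : measurable A ->
  shift_cvg \1_(A `&` B r).
Proof.
have si S : measurable S -> sqint lm \1_(S `&` B r).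
  by move=> mS; apply: sqint_indic; [by apply: measurableI => //; exact: mB|exact: Boo].
move=> mA; apply: (@dynkin_induction _ (borel V) (@open V)
  (fun A => shift_cvg \1_(A `&` B r)) _ _ _ _ _ _ _ mA) => //.
- exact: openI.
- by apply: shift_cvg_open; [rewrite setTI; exact: oB|exact: Boo].
- move=> U oU /=; apply: shift_cvg_open; first by apply: openI => //; exact: oB.
  by apply: Boo; exact: borel_open.
- move=> S mS cS.
  rewrite (_ : \1_(~` S `&` B r) =
     (fun z => \1_(setT `&` B r) z + -1 * \1_(S `&` B r) z)); last first.
    apply/funext => z; rewrite !indicE !in_setI in_setC in_setT/=.
    by case: (z \in S); case: (z \in B r); rewrite /= ?mulr0 ?mulr1 ?addr0 ?subrr ?add0r ?oppr0.
  apply: shift_cvgD; [exact: si|by apply: sqintZ; exact: si| |].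
    by apply: shift_cvg_open; [rewrite setTI; exact: oB|exact: Boo].
  by apply: shift_cvgZ => //; exact: si.
- move=> F mF tF cF; apply: shift_cvg_closed; first by apply: si; exact: bigcupT_measurable.
  pose f : borel V -> R := \1_(\bigcup_k F k `&` B r).
  pose g k (z : borel V) : R := \sum_(0 <= i < k) \1_(F i `&` B r) z.
  have gi k : sqint lm (g k) by apply: sqint_sum => i; exact: si.
  have fgz z : exists k0, forall k, g k z = if (k0 < k)%N then f z else 0.
    have [[[k0 _ Fz] Bz]|nz] := pselect ((\bigcup_k F k `&` B r) z); last first.
      exists 0%N => k; rewrite /f indicE memNset// if_same /g big1_seq// => i _.
      by rewrite indicE memNset// => -[Fi Bz]; apply: nz; split => //; exists i.
    exists k0 => k; rewrite /g /f indicE mem_set; last by split => //; exists k0.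
    have z0 i : (\1_(F i `&` B r) z : R) = (i == k0)%:R.
      rewrite indicE; have [->|ik] := eqVneq i k0; first by rewrite mem_set.
      rewrite memNset// => -[Fi _]; move: ik; apply/negP; rewrite negbK; apply/eqP.
      by apply: contrapT => ik; move/trivIsetP : tF => /(_ i k0 I I) /(_ (introN eqP ik)); rewrite -subset0; apply; exact: conj Fi Fz.
    under eq_bigr do rewrite z0.
    rewrite -natr_sum; case: ifPn => k0k.
      rewrite (big_rem k0) ?mem_index_iota//= eqxx big1_seq// => i /andP[_].
      rewrite (rem_filter _ (iota_uniq _ _)) mem_filter => /andP[/= ik _].
      by rewrite (negbTE ik).
    rewrite big1_seq// => i; rewrite mem_index_iota => /andP[_ /= ik].
    by rewrite ltn_eqF// (leq_trans ik)// leqNgt.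
  have [_] : intg lm (fun=> 0) /\ (\int[lm]_z ((f z - g k z) ^+ 2)) @[k --> \oo] --> \int[lm]_z (0 : R).
    apply: (@Rint_dct _ _ _ _ _ _ (fun z => \1_(setT `&` B r) z ^+ 2)); last first.
    - exact: (si _ measurableT).2.
    - move=> k z; have [k0 ->] := fgz z.
      have fB : 0 <= f z <= \1_(setT `&` B r) z.
        rewrite /f !indicE ler0n ler_nat/= setTI in_setI.
        by case: (z \in B r); rewrite ?andbT ?andbF//; case: (_ \in _).
      case: ifP => _; rewrite ?subrr ?subr0 ger0_norm ?sqr_ge0//.
        by rewrite expr0n sqr_ge0.
      by case/andP: fB => f0 fB; rewrite ler_sqr ?nnegrE// (le_trans f0).
    - move=> z; have [k0 gE] := fgz z; apply: cvg_near_cst; near=> k.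
      rewrite gE ifT ?subrr ?expr0n//; near: k; exact: nbhs_infty_gt.
    - move=> k; apply: measurable_funX; apply: measurable_funB; last exact: (gi k).1.
      exact: (si _ (bigcupT_measurable _ mF)).1.
  rewrite Rint0 => fg e e0.
  have /cvgr0Pnorm_le /(_ _ e0) [k _ /(_ k (leqnn _)) /= h] := fg.
  exists (g k); split => //.
    by apply: shift_cvg_sum => // i; exact: si.
  by apply: le_trans h; rewrite ler_norm.
Unshelve. all: by end_near. Qed.

(** Rounding [f] down to multiples of 1 / M gives a finite combination of indicators. The squared
    error is at most 1 / M^2 <= 1 / M on the ball of measure [L], and M >= L / e + 1 makes its
    integral at most [e]. *)
Lemma shift_cvg_bnd (f : borel V -> R) (K r : R) : measurable_fun setT f ->
  (forall z, `|f z| <= K) -> (forall z : V, r <= `|z| -> f z = 0) -> shift_cvg f.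
Proof.
move=> mf fK fr.
have K0 : 0 <= K by rewrite (le_trans _ (fK 0)).
have fi : sqint lm f by apply: (@sqint_cbox f K r) => // z /ltW; exact: fr.
have [N KN] : exists N : nat, K <= N%:R.
  by exists (Num.truncn K).+1; rewrite ltW// truncnS_gt.
apply: shift_cvg_closed => // e e0.
pose L := fine (lm (B r)).
have L0 : 0 <= L by apply: fine_ge0.
have [M ML] : exists M : nat, L / e + 1 <= M%:R.
  by exists (Num.truncn (L / e + 1)).+1; rewrite ltW// truncnS_gt.
have M1 : 1 <= M%:R :> R by apply: le_trans ML; rewrite lerDr divr_ge0// ltW.
have M0 : 0 < M%:R :> R by apply: lt_le_trans M1.
pose x (z : borel V) := (f z + N%:R) * M%:R.
have x0 z : 0 <= x z.
  by rewrite mulr_ge0// -lerBlDr sub0r; have := fK z; rewrite ler_norml => /andP[+ _]; apply: le_trans; rewrite lerN2.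
have xub z : x z < (2 * N * M).+1%:R.
  rewrite -natr1 (@le_lt_trans _ _ ((2 * N * M)%:R))// ?ltrDl//.
  rewrite natrM ler_wpM2r// natrM mulr_natl mulr2n lerD2r.
  by have := fK z; rewrite ler_norml => /andP[_ +] => /le_trans; apply.
have mx : measurable_fun setT x by apply: measurable_funM => //; exact: measurable_funD.
pose A (j : nat) := x @^-1` `[j%:R, j.+1%:R[%classic.
have mA j : measurable (A j).
  by rewrite -[A j]setTI; apply: mx => //; exact: measurable_itv.
have AE z j : (z \in A j) = (Num.truncn (x z) == j).
  apply/idP/idP; rewrite inE /A/= in_itv/=.
    by move=> h; apply/eqP/truncn_def.
  by move=> /eqP <-; rewrite truncn_le ?truncnS_gt// x0.
pose g (z : borel V) : R :=
  \sum_(0 <= j < (2 * N * M).+1) (j%:R / M%:R - N%:R) * \1_(A j `&` B r) z.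
have sgi j : sqint lm (\1_(A j `&` B r)).
  by apply: sqint_indic; [by apply: measurableI => //; exact: mB|exact: Boo].
have gi : sqint lm g by apply: sqint_sum => j; exact: sqintZ.
exists g; split => //.
  by apply: shift_cvg_sum => j; [exact: sqintZ|apply: shift_cvgZ => //; exact: shift_cvg_measurable].
have fg z : (f z - g z) ^+ 2 <= M%:R^-1 * \1_(setT `&` B r) z.
  rewrite indicE setTI; case: (boolP (z \in B r)) => [zB|zB]; last first.
    have /fr -> : r <= `|z : V| by rewrite leNgt; apply/negP => zr; move/negP : zB; apply; rewrite inE.
    rewrite /g big1_seq ?subr0 ?expr0n ?mulr0// => j _.
    by rewrite indicE in_setI (negbTE zB) andbF mulr0.
  have gE : g z = (Num.truncn (x z))%:R / M%:R - N%:R.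
    rewrite /g (bigD1_seq (Num.truncn (x z))) ?iota_uniq//=; last first.
      by rewrite mem_index_iota/= -(ltr_nat R) (le_lt_trans _ (xub z))// truncn_le// x0.
    rewrite indicE in_setI zB AE eqxx/= mulr1 big1 ?addr0// => j jx.
    by rewrite indicE in_setI AE eq_sym (negbTE jx)/= mulr0.
  rewrite mulr1 gE (_ : f z - _ = (x z - (Num.truncn (x z))%:R) / M%:R); last first.
    by rewrite /x; field; rewrite gt_eqF.
  have t0 : 0 <= x z - (Num.truncn (x z))%:R by rewrite subr_ge0 truncn_le// x0.
  have t1 : x z - (Num.truncn (x z))%:R <= 1.
    by rewrite lerBlDl natr1 ltW// truncnS_gt.
  rewrite exprMn -[leRHS]mul1r ler_pM ?sqr_ge0 ?expr_le1//.
  by rewrite expr2 ler_piMr ?invr_ge0// invf_le1.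
apply: (@le_trans _ _ (\int[lm]_z (M%:R^-1 * \1_(setT `&` B r) z))).
  apply: Rint_le => //; first exact: (sqintB fi gi).2.
  apply: intgZ; apply: (@intg_cbox _ 1 r).
  - by apply: measurable_indic; apply: measurableI => //; exact: mB.
  - by move=> z; rewrite indicE; case: (_ \in _); rewrite ?normr1 ?normr0.
  - move=> z rz; rewrite indicE memNset// => -[_ /= zr].
    by move: rz; rewrite ltNge ltW.
rewrite RintZ; last first.
  apply: (@intg_cbox _ 1 r).
  - by apply: measurable_indic; apply: measurableI => //; exact: mB.
  - by move=> z; rewrite indicE; case: (_ \in _); rewrite ?normr1 ?normr0.
  - move=> z rz; rewrite indicE memNset// => -[_ /= zr].
    by move: rz; rewrite ltNge ltW.
rewrite setTI Rint_indic; last exact: mB.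
rewrite -/L mulrC ler_pdivrMr// mulrC -ler_pdivrMr//; apply: le_trans ML; lra.
Qed.

Lemma shift_cvg_sqint (f : borel V -> R) : sqint lm f -> shift_cvg f.
Proof.
move=> fi; have [mf f2i] := fi; apply: shift_cvg_closed => // e e0.
pose D k : set (borel V) := [set z : V | `|z| < k%:R /\ `|f z| < k%:R].
have mD k : measurable (D k).
  apply: measurableI; first exact: (mB k%:R).
  have mn : measurable_fun setT (fun z => `|f z|) by exact: measurableT_comp.
  have mc : measurable (`]-oo, k%:R[%classic : set R) by exact: measurable_itv.
  by have := mn measurableT _ mc; rewrite setTI; congr (measurable _).
pose g k := f \_ (D k).
have mg k : measurable_fun setT (g k).
  by apply: (iffLR (measurable_restrictT f (mD k))); exact: measurable_funTS.
have gk k : shift_cvg (g k).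
  apply: (@shift_cvg_bnd _ k%:R k%:R) => // z; rewrite /g patchE.
    by case: ifP => [|_]; [rewrite inE => -[_ /ltW]|rewrite normr0].
  by move=> kz; rewrite memNset// => -[]; rewrite ltNge kz.
have gi k : sqint lm (g k).
  apply: (@sqint_cbox _ k%:R k%:R) => // z; rewrite /g patchE.
    by case: ifP => [|_]; [rewrite inE => -[_ /ltW]|rewrite normr0].
  by move=> kz; rewrite memNset// => -[]; rewrite ltNge ltW.
have [_] : intg lm (fun=> 0) /\ (\int[lm]_z ((f z - g k z) ^+ 2)) @[k --> \oo] --> \int[lm]_z (0 : R).
  apply: (@Rint_dct _ _ _ _ _ _ (fun z => f z ^+ 2)) => //.
  - by move=> k; apply: measurable_funX; exact: measurable_funB.
  - move=> z; apply: cvg_near_cst; near=> k.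
    rewrite /g patchE mem_set ?subrr ?expr0n//; split; near: k; exact: nbhs_infty_gtr.
  - move=> k z; rewrite ger0_norm ?sqr_ge0// /g patchE.
    by case: ifP => _; rewrite ?subr0// subrr expr0n sqr_ge0.
rewrite Rint0 => /cvgr0Pnorm_le /(_ _ e0) [k _ /(_ k (leqnn _)) /= h].
by exists (g k); split => //; apply: le_trans h; rewrite ler_norm.
Unshelve. all: by end_near. Qed.

End translation_continuity.

(** * Plancherel's theorem and Sobolev moduli of continuity *)

Section tonelli_real.
Context d1 d2 (T1 : measurableType d1) (T2 : measurableType d2) (R : realType).
Variables (m1 : {sigma_finite_measure set T1 -> \bar R})
  (m2 : {sigma_finite_measure set T2 -> \bar R}).
Variable h : T1 * T2 -> R.
Hypotheses (mh : measurable_fun setT h) (h0 : forall z, 0 <= h z).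
Hypothesis hx : forall x, intg m2 (fun y => h (x, y)).
Hypothesis hy : forall y, intg m1 (fun x => h (x, y)).
Hypothesis hi : intg m2 (fun y => \int[m1]_x h (x, y)).

Lemma Rint_tonelli : intg m1 (fun x => \int[m2]_y h (x, y)) /\
  \int[m1]_x \int[m2]_y h (x, y) = \int[m2]_y \int[m1]_x h (x, y).
Proof.
have mE : measurable_fun setT (EFin \o h) by exact/measurable_EFinP.
have E0 z : (0 <= (EFin \o h) z)%E by rewrite lee_fin.
have E : (\int[m1]_x (\int[m2]_y h (x, y))%:E =
          \int[m2]_y (\int[m1]_x h (x, y))%:E)%E.
  have := @fubini_tonelli _ _ T1 T2 R m1 m2 (EFin \o h) mE E0.
  rewrite /fubini_F /fubini_G => H.
  under eq_integral do rewrite EFin_Rint//.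
  by rewrite H; apply: eq_integral => y _; rewrite EFin_Rint.
have mF : measurable_fun setT (fun x => \int[m2]_y h (x, y)).
  have := measurable_fun_fubini_tonelli_F (m2 := m2) _ mE E0.
  rewrite /fubini_F; under eq_fun do rewrite -EFin_Rint//.
  by move/measurable_EFinP.
split; last by rewrite /Rintegral E.
apply: intg_le_lty => //; first by move=> x; apply: Rint_ge0.
by rewrite E -EFin_Rint// ltry.
Qed.

End tonelli_real.

Section lipschitz_trig.
Context (R : realType).

Lemma is_derive1_lipschitz (f f' : R -> R) (K : R) :
  (forall x, is_derive x (1 : R) f (f' x)) -> (forall x, `|f' x| <= K) ->
  forall x y, `|f x - f y| <= K * `|x - y|.
Proof.
move=> df fK; have key x y : x < y -> `|f x - f y| <= K * `|x - y|.
  move=> xy; have cf : {within `[x, y], continuous f}.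
    by apply: continuous_subspaceT => z; exact: is_derive1_continuous (df z).
  have [c _ E] := MVT xy (fun x _ => df x) cf.
  by rewrite distrC E normrM [`|x - y|]distrC ler_wpM2r.
move=> x y; have [xy|yx|->] := ltgtP x y; first exact: key.
  by rewrite distrC [`|x - y|]distrC; exact: key.
by rewrite !subrr normr0 mulr0.
Qed.

Lemma cos_lipschitz (x y : R) : `|cos x - cos y| <= `|x - y|.
Proof.
rewrite -[leRHS]mul1r; apply: (@is_derive1_lipschitz cos (fun x => - sin x)) => z.
  by rewrite normrN sin_max.
Qed.

Lemma sin_lipschitz (x y : R) : `|sin x - sin y| <= `|x - y|.
Proof.
rewrite -[leRHS]mul1r; apply: (@is_derive1_lipschitz sin cos) => z.
  exact: cos_max.
Qed.

Lemma one_sub_cos_le (t : R) : 2 - 2 * cos t <= t ^+ 2.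
Proof.
have -> : cos t = 1 - 2 * sin (t / 2) ^+ 2.
  rewrite [in LHS](_ : t = t / 2 + t / 2); last by field.
  by rewrite cosD -!expr2; have := cos2Dsin2 (t / 2); lra.
have h : `|sin (t / 2)| <= `|t / 2|.
  by have := sin_lipschitz (t / 2) 0; rewrite sin0 !subr0.
have : sin (t / 2) ^+ 2 <= (t / 2) ^+ 2 by rewrite -(real_normK (num_real (sin _))) -(real_normK (num_real (t / 2))) ler_sqr ?nnegrE.
rewrite exprMn exprVn; lra.
Qed.

(** The left side is |1 - exp(i t)|^2. The bound interpolates between t^2 for small t and 4 for
    large t, and is what limits the order of smoothness that differences of translates can see to
    1. *)
Lemma one_sub_cos_powR_le (t r : R) : 0 <= r <= 1 ->
  2 - 2 * cos t <= 4 * (t ^+ 2) `^ r.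
Proof.
move=> /andP[r0 r1]; have [t1|t1] := leP (t ^+ 2) 1.
  apply: le_trans (one_sub_cos_le t) _.
  have [->|t0] := eqVneq (t ^+ 2) 0; first by rewrite mulr_ge0// powR_ge0.
  have tp : 0 < t ^+ 2 by rewrite lt_neqAle eq_sym t0 sqr_ge0.
  have h : t ^+ 2 <= (t ^+ 2) `^ r.
    rewrite -[X in X <= _]lnK ?posrE// /powR (negbTE t0) ler_expR.
    by rewrite ler_niMl// ln_le0.
  by apply: le_trans h _; rewrite ler_peMl ?powR_ge0// ler1n.
have : 1 <= (t ^+ 2) `^ r by rewrite -(powRr0 (t ^+ 2)) ler_powR// ltW.
by have := cos_max t; rewrite ler_norml => /andP[? _]; lra.
Qed.

End lipschitz_trig.

Section dot_product.
Context (R : realType) (n : nat).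
Local Notation V := 'rV[R]_n.

Lemma dotpDl (u v w : V) : dotp (u + v) w = dotp u w + dotp v w.
Proof. by rewrite /dotp -big_split; apply: eq_bigr => l _ /=; rewrite mxE mulrDl. Qed.

Lemma dotpNl (u w : V) : dotp (- u) w = - dotp u w.
Proof. by rewrite /dotp -sumrN; apply: eq_bigr => l _; rewrite mxE mulNr. Qed.

Lemma dotpBl (u v w : V) : dotp (u - v) w = dotp u w - dotp v w.
Proof. by rewrite dotpDl dotpNl. Qed.

Lemma dotpZl c (v w : V) : dotp (c *: v) w = c * dotp v w.
Proof. by rewrite /dotp mulr_sumr; apply: eq_bigr => l _; rewrite mxE mulrA. Qed.

Lemma dotp_ge0 (v : V) : 0 <= dotp v v.
Proof. by apply: sumr_ge0 => l _; rewrite -expr2 sqr_ge0. Qed.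

Lemma norm_sqr_le_dotp (v : V) : `|v| ^+ 2 <= dotp v v.
Proof.
rewrite -[leRHS]sqr_sqrtr ?dotp_ge0// ler_sqr ?nnegrE//.
apply: rV_norm_le => // l; rewrite -sqrtr_sqr ler_wsqrtr//.
by rewrite /dotp (bigD1 l)//= -expr2 lerDl sumr_ge0// => i _; rewrite -expr2 sqr_ge0.
Qed.

Lemma dotp_norm_le (v w : V) : `|dotp v w| <= n%:R * (`|v| * `|w|).
Proof.
apply: le_trans (ler_norm_sum _ _ _) _.
apply: (@le_trans _ _ (\sum_(l < n) (`|v| * `|w|))).
  by apply: ler_sum => l _; rewrite normrM ler_pM ?rV_coord_le.
by rewrite sumr_const card_ord mulr_natl.
Qed.

Lemma measurable_dotp2 d (T : measurableType d) (f g : T -> borel V) :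
  measurable_fun setT f -> measurable_fun setT g ->
  measurable_fun setT (fun x => dotp (f x) (g x)).
Proof.
move=> mf mg; apply: measurable_sum => l; apply: measurable_funM.
  exact: (measurableT_comp (measurable_coord l) mf).
exact: (measurableT_comp (measurable_coord l) mg).
Qed.

End dot_product.

(** * Gaussian weights in several variables *)

Section gaussian_rV.
Context (R : realType).
Local Notation mu1 := (@lebesgue_measure R).

Definition gaussw n (s : R) (z : borel 'rV[R]_n) : R := \prod_l normal_pdf 0 s (z 0 l).

Lemma gaussw_ge0 n s z : 0 <= @gaussw n s z.
Proof. by apply: prodr_ge0 => l _; exact: normal_pdf_ge0. Qed.

Lemma intg_gaussw n s : intg (lam R n) (@gaussw n s).
Proof.
have [] // := @integral_lam_prod R n (fun=> normal_pdf 0 s).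
- by move=> l; exact: measurable_npdf.
- by move=> l t; exact: normal_pdf_ge0.
- by move=> l; exact: intg_normal_pdf.
Qed.

Lemma Rint_gaussw n s : \int[lam R n]_z gaussw s z = 1.
Proof.
have [|||_ ->] := @integral_lam_prod R n (fun=> normal_pdf 0 s).
- by move=> l; exact: measurable_npdf.
- by move=> l t; exact: normal_pdf_ge0.
- by move=> l; exact: intg_normal_pdf.
by rewrite big1// => l _; rewrite Rint_normal_pdf.
Qed.

Lemma measurable_gaussw n s : measurable_fun setT (@gaussw n s).
Proof. exact: intg_meas (intg_gaussw n s). Qed.

Lemma gaussw_le n s z : s != 0 -> @gaussw n s z <= normal_peak s ^+ n.
Proof.
move=> s0; rewrite -[X in _ ^+ X]card_ord -prodr_const.
by apply: ler_prod => l _; rewrite normal_pdf_ge0 normal_pdf_ub.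
Qed.

Lemma intg_gaussw_bnd n s (h : borel 'rV[R]_n -> R) : measurable_fun setT h ->
  (forall z, `|h z| <= 1) -> intg (lam R n) (fun z => h z * gaussw s z).
Proof.
move=> mh h1; apply: intg_dom (intg_gaussw n s) => [|z].
  by apply: measurable_funM => //; exact: measurable_gaussw.
by rewrite normrM (ger0_norm (gaussw_ge0 _ _)) ler_piMl ?gaussw_ge0.
Qed.

Lemma measurable_cos_dotp n (a : 'rV[R]_n) (p : R) :
  measurable_fun setT (fun z : borel 'rV[R]_n => cos (dotp a z + p)).
Proof.
apply: measurableT_comp; first exact: measurable_cosR.
apply: measurable_funD => //.
by apply: (@measurable_dotp2 _ _ _ _ (fun=> a : borel 'rV[R]_n) id).
Qed.

(** The phase [p] makes the induction work: fixing the first coordinate adds a multiple of it to the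
    phase. The sine part of the outer integral vanishes by parity. *)
Lemma Rint_cos_gaussw n (s p : R) (a : 'rV[R]_n) : s != 0 ->
  \int[lam R n]_z (cos (dotp a z + p) * gaussw s z) =
  cos p * \prod_l expR (- (s ^+ 2 / 2) * a 0 l ^+ 2).
Proof.
move=> s0; elim: n p a => [|n ih] p a.
  rewrite big_ord0 mulr1 /Rintegral.
  have i : intg (lam R 0) (fun z => cos (dotp a z + p) * gaussw s z).
    by apply: intg_gaussw_bnd => [|z]; [exact: measurable_cos_dotp|exact: cos_max].
  by rewrite -intRd_integral//= /dotp /gaussw !big_ord0 add0r mulr1.
have ii q b : intg (lam R n) (fun z => cos (dotp b z + q) * gaussw s z).
  by apply: intg_gaussw_bnd => [|z]; [exact: measurable_cos_dotp|exact: cos_max].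
pose a' : 'rV[R]_n := \row_l a 0 (lift 0 l).
have dE t v : dotp a (cons_rV (t, v)) = a 0 0 * t + dotp a' v.
  rewrite /dotp big_ord_recl cons_rV0; congr (_ + _).
  by apply: eq_bigr => l _; rewrite cons_rVS mxE.
have gE t v : gaussw s (@cons_rV R n (t, v)) = normal_pdf 0 s t * gaussw s v.
  rewrite /gaussw big_ord_recl cons_rV0; congr (_ * _).
  by apply: eq_bigr => l _; rewrite cons_rVS.
have E t v : cos (dotp a (cons_rV (t, v)) + p) * gaussw s (@cons_rV R n (t, v)) =
    normal_pdf 0 s t * (cos (dotp a' v + (a 0 0 * t + p)) * gaussw s v).
  by rewrite dE gE (_ : _ + _ + p = dotp a' v + (a 0 0 * t + p)); ring.
rewrite Rint_cons; last 2 first.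
- by apply: intg_gaussw_bnd => [|z]; [exact: measurable_cos_dotp|exact: cos_max].
- by move=> t; under eq_fun do rewrite E; exact: intgZ.
set P := \prod_(l < n.+1) _.
have PE : P = expR (- (s ^+ 2 / 2) * a 0 0 ^+ 2) * \prod_l expR (- (s ^+ 2 / 2) * a' 0 l ^+ 2).
  by rewrite /P big_ord_recl; congr (_ * _); apply: eq_bigr => l _; rewrite mxE.
set P' := \prod_(l < n) _ in PE.
transitivity (\int[mu1]_t (P' * cos p * (cos (a 0 0 * t) * normal_pdf 0 s t) +
     - (P' * sin p) * (sin (a 0 0 * t) * normal_pdf 0 s t))).
  apply: eq_Rint => t; under eq_Rint do rewrite E.
  by rewrite RintZ// ih -/P' cosD; ring.
rewrite RintD; [|by apply: intgZ; exact: intg_cos_normal_pdf|by apply: intgZ; exact: intg_sin_normal_pdf].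
rewrite !RintZ; [|exact: intg_sin_normal_pdf|exact: intg_cos_normal_pdf].
by rewrite Rint_cos_normal_pdf// Rint_sin_normal_pdf// PE; ring.
Qed.

Lemma Rint_norm_normal_pdf_le s : 0 < s ->
  \int[mu1]_t (`|t| * normal_pdf 0 s t) <= 2 * s.
Proof.
move=> s0; have sn0 : s != 0 by rewrite gt_eqF.
have q2 : (Num.sqrt 2 : R) ^+ 2 = 2 by rewrite sqr_sqrtr.
have q0 : 0 < Num.sqrt 2 :> R by rewrite sqrtr_gt0.
have -> : 2 * s = \int[mu1]_t (2 * s * normal_pdf 0 (Num.sqrt 2 * s) t).
  by rewrite RintZ ?Rint_normal_pdf ?mulr1//; exact: intg_normal_pdf.
apply: Rint_le; [exact: intg_normal_pdf_mean|by apply: intgZ; exact: intg_normal_pdf|].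
move=> x; have [C C0 [CE h]] := normal_pdf_mean_bound sn0.
apply: le_trans (h x) _; rewrite ler_wpM2r ?normal_pdf_ge0// CE.
rewrite gtr0_norm// mulrC ler_wpM2r ?ltW//.
by nra.
Qed.

(** Markov's inequality: off the box the sum of the absolute values of the coordinates exceeds [r],
    and each of them has mean at most 2 s. *)
Lemma gaussw_tail n (s r : R) : 0 < s -> 0 < r ->
  \int[lam R n]_z (\1_(~` cbox r) z * gaussw s z) <= n%:R * (2 * s / r).
Proof.
move=> s0 r0.
pose g (l i : 'I_n) (t : R) := if i == l then `|t| * normal_pdf 0 s t else normal_pdf 0 s t.
have mg l i : measurable_fun setT (g l i).
  rewrite /g; case: (i == l); last exact: measurable_npdf.
  by apply: measurable_funM; [exact: normr_measurable|exact: measurable_npdf].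
have g0 l i t : 0 <= g l i t.
  by rewrite /g; case: ifP => _; rewrite ?mulr_ge0// normal_pdf_ge0.
have gi l i : intg mu1 (g l i).
  rewrite /g; case: (i == l); last exact: intg_normal_pdf.
  by apply: intg_normal_pdf_mean; rewrite gt_eqF.
have gE l (z : borel 'rV[R]_n) : \prod_i g l i (z 0 i) = `|z 0 l| * gaussw s z.
  rewrite /gaussw (bigD1 l)//= [in RHS](bigD1 l)//= /g eqxx mulrA; congr (_ * _).
  by apply: eq_bigr => i /negbTE ->.
have iz l : intg (lam R n) (fun z => `|z 0 l| * gaussw s z).
  by have [h _] := integral_lam_prod (mg l) (g0 l) (gi l); apply: intg_eq h => z; rewrite gE.
have izE l : \int[lam R n]_z (`|z 0 l| * gaussw s z) <= 2 * s.
  have [_] := integral_lam_prod (mg l) (g0 l) (gi l).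
  rewrite (eq_Rint _ (gE l)) => ->.
  rewrite (bigD1 l)//= big1 => [|i il].
    by rewrite mulr1 /g eqxx; exact: Rint_norm_normal_pdf_le.
  by rewrite /g (negbTE il) Rint_normal_pdf.
apply: (@le_trans _ _ (\int[lam R n]_z (r^-1 * \sum_l (`|z 0 l| * gaussw s z)))).
  apply: Rint_le.
  - apply: intg_gaussw_bnd => [|z].
      by apply: measurable_indic; apply: measurableC; exact: measurable_cbox.
    by rewrite indicE; case: (_ \in _); rewrite ?normr1 ?normr0.
  - by apply: intgZ; exact: intg_sum.
  - move=> z; rewrite -mulr_suml mulrA ler_wpM2r ?gaussw_ge0// indicE.
    case: (boolP (z \in _)) => [zr|_]; last first.
      by apply: mulr_ge0; [rewrite invr_ge0 ltW|apply: sumr_ge0].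
    rewrite mulrC ler_pdivlMr// mul1r leNgt; apply/negP => sz.
    move: zr; rewrite inE; apply; rewrite /cbox/=; apply: rV_norm_le; rewrite ?ltW// => l.
    apply: le_trans (ltW sz); rewrite (bigD1 l)//= lerDl sumr_ge0//.
rewrite RintZ; last exact: intg_sum.
rewrite Rint_sum// mulrC mulrA ler_pM2r ?invr_gt0//.
apply: le_trans (ler_sum _ (fun l _ => izE l)) _.
by rewrite sumr_const card_ord [leRHS]mulr_natl.
Qed.

End gaussian_rV.

(** * Mollification by a probability density *)

Section convolution_approximation.
Context (R : realType) (n : nat).
Local Notation V := 'rV[R]_n.
Local Notation lm := (lam R n).

Lemma measurable_add_rV : measurable_fun setT
  (fun p : borel V * borel V => ((p.2 : V) + (p.1 : V)) : borel V).
Proof.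
apply: measurable_rV => l; under eq_fun do rewrite mxE.
by apply: measurable_funD; apply: (measurableT_comp (measurable_coord l)).
Qed.

Variables (f k : borel V -> R) (K : R).
Hypotheses (fi : intg lm f) (f2i : sqint lm f).
Hypotheses (ki : intg lm k) (k0 : forall u, 0 <= k u) (kK : forall u, k u <= K).
Hypothesis k1 : \int[lm]_u k u = 1.

Let h (p : borel V * borel V) := (f p.1 - f ((p.2 : V) + (p.1 : V))) ^+ 2 * k p.2.

Let mf := intg_meas fi.
Let mk := intg_meas ki.

Let mh : measurable_fun setT h.
Proof.
apply: measurable_funM; last exact: (measurableT_comp mk measurable_snd).
apply: measurable_funX; apply: measurable_funB; last exact: (measurableT_comp mf measurable_add_rV).
exact: (measurableT_comp mf measurable_fst).
Qed.

Let h0 p : 0 <= h p.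
Proof. by rewrite mulr_ge0// sqr_ge0. Qed.

Let K0 : 0 <= K. Proof. exact: le_trans (k0 0) (kK 0). Qed.

Let ki_bnd (g : borel V -> R) : intg lm g -> intg lm (fun u => g u * k u).
Proof.
move=> gi; apply: intg_dom (intgZ K (intg_norm gi)) => [|u].
  by apply: measurable_funM => //; exact: intg_meas gi.
by rewrite normrM mulrC ler_wpM2r// ger0_norm.
Qed.

Let swap1 (x : V) (g : borel V -> R) : intg lm g -> intg lm (fun u => g ((u : V) + x)).
Proof. by move=> /(intg_shift x); apply: intg_eq => u; rewrite addrC. Qed.

Lemma intg_conv (x : V) : intg lm (fun u => f ((u : V) + x) * k u).
Proof. by apply: ki_bnd; exact: swap1. Qed.

Let dx_i (x : V) : intg lm (fun u => (f x - f ((u : V) + x)) * k u).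
Proof.
have := intgB (intgZ (f x) ki) (intg_conv x).
by apply: intg_eq => u; rewrite mulrBl.
Qed.

Let adx_i (x : V) : intg lm (fun u => `|f x - f ((u : V) + x)| * k u).
Proof.
have := intg_norm (dx_i x).
by apply: intg_eq => u; rewrite normrM [X in _ = _ * X]ger0_norm.
Qed.

Let hx x : intg lm (fun u => h (x, u)).
Proof.
have i2 : intg lm (fun u => f ((u : V) + x) ^+ 2 * k u).
  by apply: (ki_bnd (g := fun u => f ((u : V) + x) ^+ 2)); exact: (swap1 x f2i.2).
have := intgD (intgB (intgZ (f x ^+ 2) ki) (intgZ (2 * f x) (intg_conv x))) i2.
by apply: intg_eq => u; rewrite /h /=; ring.
Qed.

Let hy u : intg lm (fun x => h (x, u)).
Proof.
have := intgZ (k u) (sqintB f2i (sqint_shift u f2i)).2.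
by apply: intg_eq => x; rewrite /h /= mulrC.
Qed.

Let hyE u : \int[lm]_x h (x, u) = k u * shift_sqdist f u.
Proof.
rewrite -RintZ; last exact: (sqintB f2i (sqint_shift u f2i)).2.
by apply: eq_Rint => x; rewrite /h /= mulrC.
Qed.

Let mshift : measurable_fun setT (fun u => k u * shift_sqdist f u).
Proof.
have mE : measurable_fun setT (EFin \o h) by exact/measurable_EFinP.
have E0 z : (0 <= (EFin \o h) z)%E by rewrite lee_fin.
have := measurable_fun_fubini_tonelli_G (m1 := lm) _ mE E0.
rewrite /fubini_G; under eq_fun do rewrite -EFin_Rint// hyE.
by move/measurable_EFinP.
Qed.

Lemma intg_shift_sqdist : intg lm (fun u => k u * shift_sqdist f u).
Proof.
apply: intg_dom (intgZ (4 * \int[lm]_z (f z ^+ 2)) ki) => // u.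
rewrite ger0_norm ?mulr_ge0 ?shift_sqdist_ge0// mulrC ler_wpM2r//.
exact: shift_sqdist_le4.
Qed.

(** Dominates the difference between [f] and its mollification pointwise. With the absolute value
    inside the integral it also dominates errors of schemes that are merely comparable to a
    convolution, such as the grid approximation below. *)
Definition conv_err (x : borel V) := \int[lm]_u (`|f x - f ((u : V) + x)| * k u).

Lemma intg_conv_err (x : V) : intg lm (fun u => `|f x - f ((u : V) + x)| * k u).
Proof. exact: adx_i. Qed.

Lemma conv_err_ge0 x : 0 <= conv_err x.
Proof. by apply: Rint_ge0 => u; rewrite mulr_ge0. Qed.

Lemma conv_sub_le x : `|f x - \int[lm]_u (f ((u : V) + x) * k u)| <= conv_err x.
Proof.
have -> : f x - \int[lm]_u (f ((u : V) + x) * k u) =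
    \int[lm]_u ((f x - f ((u : V) + x)) * k u).
  rewrite -[X in X - _ = _]mulr1 -k1 -RintZ// -RintB; [|exact: intgZ|exact: intg_conv].
  by apply: eq_Rint => u; rewrite mulrBl.
apply: le_trans (Rint_norm_le (dx_i x)) _.
apply: Rint_le => [||u]; [exact: intg_norm|exact: adx_i|].
by rewrite normrM (ger0_norm (k0 u)).
Qed.

Let conv_err_sqr_le x : conv_err x ^+ 2 <= \int[lm]_u h (x, u).
Proof.
set c := conv_err x.
have i1 := intgZ (- (2 * c)) (adx_i x); have i2 := intgZ (c ^+ 2) ki.
have : 0 <= \int[lm]_u (h (x, u) + (- (2 * c) * (`|f x - f ((u : V) + x)| * k u) + c ^+ 2 * k u)).
  apply: Rint_ge0 => u; rewrite /h /=.
  rewrite (_ : _ + _ = (`|f x - f ((u : V) + x)| - c) ^+ 2 * k u).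
    by rewrite mulr_ge0// sqr_ge0.
  by rewrite -(real_normK (num_real (f x - _))); ring.
rewrite (RintD (hx x) (intgD i1 i2)) (RintD i1 i2) (RintZ _ (adx_i x)) (RintZ _ ki).
by rewrite k1 -/(conv_err x) -/c; lra.
Qed.

Lemma measurable_conv_err : measurable_fun setT conv_err.
Proof.
have mg : measurable_fun setT
    (fun p : borel V * borel V => `|f p.1 - f ((p.2 : V) + (p.1 : V))| * k p.2).
  apply: measurable_funM; last exact: (measurableT_comp mk measurable_snd).
  apply: measurableT_comp; first exact: normr_measurable.
  apply: measurable_funB; last exact: (measurableT_comp mf measurable_add_rV).
  exact: (measurableT_comp mf measurable_fst).
have mE := (measurable_EFinP _ _).2 mg.
have E0 (z : borel V * borel V) :
    (0 <= (EFin \o (fun p : borel V * borel V =>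
             (`|f p.1 - f ((p.2 : V) + (p.1 : V))| * k p.2)%R)) z)%E.
  by rewrite lee_fin mulr_ge0.
have := measurable_fun_fubini_tonelli_F (m2 := lm) _ mE E0.
rewrite /fubini_F /=; under eq_fun do rewrite -EFin_Rint//.
by move/measurable_EFinP.
Qed.

(** Jensen's inequality for the density [k], proved as nonnegativity of a variance, bounds the
    square of the error at x by the mean of squared differences; Tonelli then integrates over x
    first. *)
Lemma conv_sqdist_le : sqint lm conv_err /\
  \int[lm]_x (conv_err x ^+ 2) <= \int[lm]_u (k u * shift_sqdist f u).
Proof.
have hi : intg lm (fun u => \int[lm]_x h (x, u)).
  by apply: intg_eq intg_shift_sqdist => u; rewrite hyE.
have [i e] := Rint_tonelli mh h0 hx hy hi.
have i2 : intg lm (fun x => conv_err x ^+ 2).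
  apply: intg_dom i => [|x]; first by apply: measurable_funX; exact: measurable_conv_err.
  by rewrite ger0_norm ?sqr_ge0.
split; first by split => //; exact: measurable_conv_err.
have -> : \int[lm]_u (k u * shift_sqdist f u) = \int[lm]_u \int[lm]_x h (x, u).
  by apply: eq_Rint => u; rewrite hyE.
by rewrite -e; exact: Rint_le.
Qed.

End convolution_approximation.

Section plancherel.
Context (R : realType) (n : nat).
Local Notation V := 'rV[R]_n.
Local Notation lm := (lam R n).

Definition fcos (g : borel V -> R) (xi : borel V) : R :=
  \int[lm]_z (g z * cos (2 * pi * dotp z xi)).
Definition fsin (g : borel V -> R) (xi : borel V) : R :=
  \int[lm]_z (g z * sin (2 * pi * dotp z xi)).

Lemma measurable_cosd d (T : measurableType d) (f g : T -> borel V) :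
  measurable_fun setT f -> measurable_fun setT g ->
  measurable_fun setT (fun x => cos (2 * pi * dotp (f x) (g x))).
Proof.
move=> mf mg.
apply: measurableT_comp; first exact: measurable_cosR.
by apply: measurable_funM => //; exact: measurable_dotp2.
Qed.

Lemma measurable_sind d (T : measurableType d) (f g : T -> borel V) :
  measurable_fun setT f -> measurable_fun setT g ->
  measurable_fun setT (fun x => sin (2 * pi * dotp (f x) (g x))).
Proof.
move=> mf mg.
apply: measurableT_comp; first exact: measurable_sinR.
by apply: measurable_funM => //; exact: measurable_dotp2.
Qed.

Variable g : borel V -> R.
Hypothesis gi : intg lm g.

Lemma intg_cosd xi : intg lm (fun z => g z * cos (2 * pi * dotp z xi)).
Proof.
apply: intg_dom (intg_norm gi) => [|z]; last by rewrite normrM ler_piMr// cos_max.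
apply: measurable_funM; first exact: intg_meas gi.
exact: (@measurable_cosd _ _ id (fun=> xi : borel V)).

Qed.

Lemma intg_sind xi : intg lm (fun z => g z * sin (2 * pi * dotp z xi)).
Proof.
apply: intg_dom (intg_norm gi) => [|z]; last by rewrite normrM ler_piMr// sin_max.
apply: measurable_funM; first exact: intg_meas gi.
exact: (@measurable_sind _ _ id (fun=> xi : borel V)).

Qed.

Lemma fourier_sqmodE xi : fourier_sqmod g xi = fcos g xi ^+ 2 + fsin g xi ^+ 2.
Proof. by rewrite /fourier_sqmod !fine_intRd//; [exact: intg_sind|exact: intg_cosd]. Qed.

Lemma fourier_sqmod_ge0 xi : 0 <= fourier_sqmod g xi.
Proof. by rewrite fourier_sqmodE addr_ge0// sqr_ge0. Qed.

Lemma fcos_le xi : `|fcos g xi| <= \int[lm]_z `|g z|.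
Proof.
apply: le_trans (Rint_norm_le (intg_cosd xi)) _.
apply: Rint_le => [||z]; [exact: intg_norm (intg_cosd xi)|exact: intg_norm|].
by rewrite normrM ler_piMr// cos_max.
Qed.

Lemma fsin_le xi : `|fsin g xi| <= \int[lm]_z `|g z|.
Proof.
apply: le_trans (Rint_norm_le (intg_sind xi)) _.
apply: Rint_le => [||z]; [exact: intg_norm (intg_sind xi)|exact: intg_norm|].
by rewrite normrM ler_piMr// sin_max.
Qed.

(** Fubini gives measurability only for transforms of integrable functions, so the transform is
    first multiplied by a Gaussian weight; the weight is positive and is divided out again. *)
Let meas_unweight (h : borel V -> R) :
  measurable_fun setT (fun xi : borel V => gaussw 1 xi * h xi) -> measurable_fun setT h.
Proof.
move=> mh; pose w (xi : borel V) := \prod_(l < n) ((normal_peak (1 : R))^-1 * expR (xi 0 l ^+ 2 / 2)).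
have mw : measurable_fun setT w.
  apply: measurable_prod => l _; apply: measurable_funM => //.
  apply: measurableT_comp; first exact: measurable_expR.
  by apply: measurable_funM => //; apply: measurable_funX; exact: measurable_coord.
have wE xi : w xi * gaussw 1 xi = 1.
  rewrite /w -big_split big1// => l _ /=; rewrite normal_pdf0E ?oner_neq0//.
  rewrite mulrACA mulVf ?gt_eqF ?normal_peak_gt0 ?oner_neq0// mul1r -expRD.
  by rewrite -[RHS]expR0; congr expR; rewrite expr1n; field.
have := measurable_funM mw mh.
by apply: eq_measurable_fun => xi _ /=; rewrite mulrA wE mul1r.
Qed.

Lemma measurable_fcos : measurable_fun setT (fcos g).
Proof.
apply: meas_unweight; apply: (intg_meas (m := lm)).
pose b (p : borel V * borel V) := cos (2 * pi * dotp (p.2 : V) (p.1 : V)).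
have mb : measurable_fun setT b by exact: (@measurable_cosd _ _ snd fst).
have b1 z : `|b z| <= 1 by exact: cos_max.
have := intg_Rint_kernel (intg_gaussw n (1 : R)) gi mb b1.
by apply: intg_eq.
Qed.

Lemma measurable_fsin : measurable_fun setT (fsin g).
Proof.
apply: meas_unweight; apply: (intg_meas (m := lm)).
pose b (p : borel V * borel V) := sin (2 * pi * dotp (p.2 : V) (p.1 : V)).
have mb : measurable_fun setT b by exact: (@measurable_sind _ _ snd fst).
have b1 z : `|b z| <= 1 by exact: sin_max.
have := intg_Rint_kernel (intg_gaussw n (1 : R)) gi mb b1.
by apply: intg_eq.
Qed.

Lemma measurable_fourier_sqmod : measurable_fun setT (fourier_sqmod g : borel V -> R).
Proof.
apply: (@eq_measurable_fun _ _ _ _ _ (fun xi => fcos g xi ^+ 2 + fsin g xi ^+ 2)).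
  by move=> xi _; rewrite fourier_sqmodE.
by apply: measurable_funD; apply: measurable_funX; [exact: measurable_fcos|exact: measurable_fsin].
Qed.

Let q (p : borel V * borel V) := cos (2 * pi * dotp (p.1 : V) (p.2 : V)) * fcos g p.2 +
  sin (2 * pi * dotp (p.1 : V) (p.2 : V)) * fsin g p.2.

Let mq : measurable_fun setT q.
Proof.
apply: measurable_funD; apply: measurable_funM.
- exact: (@measurable_cosd _ _ fst snd).
- exact: (measurableT_comp measurable_fcos measurable_snd).
- exact: (@measurable_sind _ _ fst snd).
- exact: (measurableT_comp measurable_fsin measurable_snd).
Qed.

Let qK p : `|q p| <= 2 * \int[lm]_z `|g z|.
Proof.
rewrite [leRHS]mulr_natl mulr2n; apply: le_trans (ler_normD _ _) _.
rewrite !normrM lerD//.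
  by apply: le_trans (fcos_le p.2); rewrite ler_piMl// cos_max.
by apply: le_trans (fsin_le p.2); rewrite ler_piMl// sin_max.
Qed.

Let qE (x xi : borel V) : q (x, xi) =
  \int[lm]_y (g y * cos (2 * pi * dotp ((x : V) - (y : V)) xi)).
Proof.
rewrite /q /= -(RintZ _ (intg_cosd xi)) -(RintZ _ (intg_sind xi)).
rewrite -RintD; [|exact: intgZ (intg_cosd xi)|exact: intgZ (intg_sind xi)].
by apply: eq_Rint => y; rewrite dotpBl mulrBr cosB; ring.
Qed.

Let qg (xi : borel V) : \int[lm]_x (g x * q (x, xi)) = fourier_sqmod g xi.
Proof.
rewrite fourier_sqmodE [in RHS]expr2 [X in _ + X]expr2 -(RintZ _ (intg_cosd xi)) -(RintZ _ (intg_sind xi)).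
rewrite -RintD; [|exact: intgZ (intg_cosd xi)|exact: intgZ (intg_sind xi)].
by apply: eq_Rint => y; rewrite /q /=; ring.
Qed.

(** The squared modulus of the transform is the double integral of g(x) g(y) cos(2 pi (x - y) xi).
    Two exchanges put the integral over xi innermost, where it is a Gaussian characteristic
    function. *)
Lemma gauss_fourier_identity (s : R) : s != 0 ->
  \int[lm]_xi (gaussw s xi * fourier_sqmod g xi) =
  \int[lm]_x (g x * \int[lm]_y (g y *
     \prod_l expR (- (s ^+ 2 / 2) * (2 * pi * ((x : V) - (y : V)) 0 l) ^+ 2))).
Proof.
move=> s0; have gw := intg_gaussw n s.
transitivity (\int[lm]_xi (gaussw s xi * \int[lm]_x (g x * q (x, xi)))).
  by apply: eq_Rint => xi; rewrite qg.
rewrite -(Rint_swap_kernel gi gw mq qK); apply: eq_Rint => x; congr (_ * _).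
pose b (p : borel V * borel V) := cos (2 * pi * dotp ((x : V) - (p.1 : V)) (p.2 : V)).
have mb : measurable_fun setT b.
  apply: measurableT_comp; first exact: measurable_cosR.
  apply: measurable_funM => //.
  have msub : measurable_fun setT (fun p : borel V * borel V => ((x : V) - (p.1 : V)) : borel V).
    exact: (measurableT_comp (measurable_reflect x) measurable_fst).
  exact: (measurable_dotp2 msub measurable_snd).
have b1 z : `|b z| <= 1 by exact: cos_max.
transitivity (\int[lm]_xi (gaussw s xi * \int[lm]_y (g y * b (y, xi)))).
  by apply: eq_Rint => xi; rewrite qE.
rewrite -(Rint_swap_kernel gi gw mb b1); apply: eq_Rint => y; congr (_ * _).
have := Rint_cos_gaussw 0 ((2 * pi) *: ((x : V) - (y : V))) s0.
rewrite cos0 mul1r => E.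
transitivity (\prod_l expR (- (s ^+ 2 / 2) * ((2 * pi) *: ((x : V) - (y : V))) 0 l ^+ 2)).
  rewrite -E; apply: eq_Rint => xi; rewrite mulrC addr0 dotpZl; congr (_ * _).
by apply: eq_bigr => l _; rewrite mxE.
Qed.

Hypothesis g2 : sqint lm g.
Hypothesis Fi : intg lm (fourier_sqmod g).

(** Width of the Gaussian dual to one of width [s] for the Fourier kernel exp(-2 i pi z xi); the
    peaks of the two densities multiply to one. *)
Let sg (s : R) : R := (2 * pi * s)^-1.

Let peak_mul (s : R) : 0 < s -> normal_peak s * normal_peak (sg s) = 1.
Proof.
move=> s0; have p0 := pi_gt0 R.
rewrite /normal_peak /sg -invfM -sqrtrM; last first.
  by rewrite mulrn_wge0// mulr_ge0 ?sqr_ge0// ltW.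
rewrite (_ : _ * _ = 1); first by rewrite sqrtr1 invr1.
by move: pi p0 => p p0; field; rewrite !gt_eqF.
Qed.

Let gauss_sg (s : R) (z : borel V) : 0 < s -> gaussw (sg s) z =
  normal_peak (sg s) ^+ n * \prod_l expR (- (s ^+ 2 / 2) * (2 * pi * z 0 l) ^+ 2).
Proof.
move=> s0; have p0 := pi_gt0 R.
rewrite -[X in _ ^+ X]card_ord -prodr_const -big_split; apply: eq_bigr => l _ /=.
rewrite normal_pdf0E; last by rewrite /sg invr_eq0 !mulf_neq0 ?gt_eqF.
by congr (_ * expR _); rewrite /sg; move: pi p0 => p p0; field; rewrite !gt_eqF.
Qed.

Lemma gauss_quadratic_le (s : R) : 0 < s ->
  intg lm (fun x => g x * \int[lm]_u (g ((u : V) + (x : V)) * gaussw (sg s) u)) /\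
  \int[lm]_x (g x * \int[lm]_u (g ((u : V) + (x : V)) * gaussw (sg s) u)) <=
  \int[lm]_xi fourier_sqmod g xi.
Proof.
move=> s0; have sn0 : s != 0 by rewrite gt_eqF.
have pk0 : 0 <= normal_peak (sg s) by exact: normal_peak_ge0.
pose G (z : V) := \prod_l expR (- (s ^+ 2 / 2) * (2 * pi * z 0 l) ^+ 2).
have Gsym z : G (- z) = G z.
  by apply: eq_bigr => l _; rewrite mxE mulrN sqrrN.
have mw : measurable_fun setT (@gaussw R n (sg s)) by exact: measurable_gaussw.
have mG : measurable_fun setT (G : borel V -> R).
  apply: measurable_prod => l _; apply: measurableT_comp; first exact: measurable_expR.
  apply: measurable_funM => //; apply: measurable_funX; apply: measurable_funM => //.
  exact: measurable_coord.
have G1 z : `|G z| <= 1.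
  rewrite ger0_norm; last by apply: prodr_ge0 => l _; exact: expR_ge0.
  apply: prodr_ile1 => l _; rewrite expR_ge0 -expR0 ler_expR.
  by rewrite mulNr oppr_le0 mulr_ge0 ?sqr_ge0// divr_ge0 ?sqr_ge0.
have msub (x : V) : measurable_fun setT (fun y : borel V => ((x - (y : V)) : borel V)).
  exact: measurable_reflect.
have GI (x : V) : intg lm (fun y => g y * G (x - (y : V))).
  apply: intg_dom (intg_norm gi) => [|z]; last by rewrite normrM ler_piMr.
  apply: measurable_funM; first exact: intg_meas gi.
  exact: (measurableT_comp mG (msub x)).
have E (x : borel V) : \int[lm]_u (g ((u : V) + (x : V)) * gaussw (sg s) u) =
    normal_peak (sg s) ^+ n * \int[lm]_y (g y * G ((x : V) - (y : V))).
  rewrite -RintZ//.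
  transitivity (\int[lm]_y (g y * gaussw (sg s) ((x : V) - (y : V) : borel V))).
    rewrite -[RHS](Rint_shift x); last first.
      apply: measurable_funM; first exact: intg_meas gi.
      exact: (measurableT_comp mw (msub x)).
    apply: eq_Rint => u; rewrite addrC; congr (_ * _).
    rewrite opprD addNKr; apply: eq_bigr => l _; rewrite mxE normal_pdf0_even//.
    by rewrite invr_eq0 !mulf_neq0// gt_eqF// pi_gt0.
  by apply: eq_Rint => y; rewrite gauss_sg// -/(G _); ring.
have S : \int[lm]_x (g x * \int[lm]_y (g y * G ((x : V) - (y : V)))) =
   \int[lm]_xi (gaussw s xi * fourier_sqmod g xi) by rewrite gauss_fourier_identity.
have iGF : intg lm (fun xi => gaussw s xi * fourier_sqmod g xi).
  apply: intg_dom (intgZ (normal_peak s ^+ n) Fi) => [|xi].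
    by apply: measurable_funM; [exact: measurable_gaussw|exact: measurable_fourier_sqmod].
  rewrite ger0_norm ?mulr_ge0 ?gaussw_ge0 ?fourier_sqmod_ge0//.
  by rewrite ler_wpM2r ?fourier_sqmod_ge0// gaussw_le.
have iGG : intg lm (fun x => g x * \int[lm]_y (g y * G ((x : V) - (y : V)))).
  pose b (p : borel V * borel V) := G ((p.1 : V) - (p.2 : V)).
  have mb : measurable_fun setT b.
    apply: measurable_prod => l _; apply: measurableT_comp; first exact: measurable_expR.
    apply: measurable_funM => //; apply: measurable_funX; apply: measurable_funM => //.
    under eq_fun do rewrite !mxE.
    by apply: measurable_funB; apply: (measurableT_comp (measurable_coord l)).
  exact: (intg_Rint_kernel gi gi mb (fun p => G1 _)).
split.
  apply: intg_eq (intgZ (normal_peak (sg s) ^+ n) iGG) => x.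
  by rewrite E mulrCA.
under eq_Rint do rewrite E mulrCA.
rewrite RintZ// S -RintZ//; apply: Rint_le => //; first exact: intgZ.
move=> xi; rewrite mulrA ler_piMl ?fourier_sqmod_ge0//.
apply: (@le_trans _ _ (normal_peak (sg s) ^+ n * normal_peak s ^+ n)).
  by rewrite ler_wpM2l ?exprn_ge0// gaussw_le.
by rewrite -exprMn mulrC peak_mul// expr1n.
Qed.

Let conv_small (e : R) : 0 < e -> exists2 s : R, 0 < s &
  \int[lm]_u (gaussw (sg s) u * shift_sqdist g u) <= e.
Proof.
move=> e0; have [r r0 hr] := shift_cvg_sqint g2 (divr_gt0 e0 (ltr0Sn _ 1)).
set S := 4 * \int[lm]_z (g z ^+ 2) + 1.
have S0 : 0 < S by rewrite ltr_wpDl// mulr_ge0// Rint_ge0// => z; exact: sqr_ge0.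
have p0 := pi_gt0 R.
(* At width 1 / D and radius r / 2, [gaussw_tail] is at most 4 n / (D r); times S this is (e / 2) n
   / (n + 1). *)
pose D := 8 * S * (n%:R + 1) / r / e.
have D0 : 0 < D by rewrite !divr_gt0// !mulr_gt0// ltr_wpDl.
exists (D / (2 * pi)); first by rewrite divr_gt0// mulr_gt0.
have sE : sg (D / (2 * pi)) = D^-1.
  by rewrite /sg; move: pi p0 => p p0; field; rewrite !gt_eqF.
rewrite sE.
pose r2 := r / 2; have r20 : 0 < r2 by rewrite divr_gt0.
have i1 := intg_shift_sqdist gi g2 (intg_gaussw n D^-1) (fun u => gaussw_ge0 D^-1 u).
have i2 : intg lm (fun z => \1_(~` cbox r2) z * gaussw D^-1 z).
  apply: intg_gaussw_bnd => [|z].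
    by apply: measurable_indic; apply: measurableC; exact: measurable_cbox.
  by rewrite indicE; case: (_ \in _); rewrite ?normr1 ?normr0.
apply: (@le_trans _ _ (\int[lm]_u (e / 2 * gaussw D^-1 u + S * (\1_(~` cbox r2) u * gaussw D^-1 u)))).
  apply: Rint_le => [//||u]; first by apply: intgD; apply: intgZ => //; exact: intg_gaussw.
  have g0 := gaussw_ge0 D^-1 u.
  rewrite mulrA -mulrDl mulrC ler_wpM2r// indicE.
  case: (boolP (u \in _)) => [ur|ur].
    rewrite mulr1; apply: le_trans (shift_sqdist_le4 u g2) _.
    by rewrite ler_wpDl ?divr_ge0 ?(ltW e0)// lerDl.
  rewrite mulr0 addr0; apply: hr; move: ur; rewrite notin_setE /= => /contrapT; rewrite /cbox /= => h.
  by apply: le_lt_trans h _; rewrite /r2 ltr_pdivrMr// ltr_pMr// ltr1n.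
rewrite RintD; [|by apply: intgZ; exact: intg_gaussw|exact: intgZ].
rewrite (RintZ _ (intg_gaussw n _)) (RintZ _ i2) Rint_gaussw mulr1.
have t := @gaussw_tail R n D^-1 r2; rewrite invr_gt0 in t.
have : S * (n%:R * (2 * D^-1 / r2)) <= e / 2.
  rewrite /D /r2 [leLHS](_ : _ = (e / 2) * (n%:R / (n%:R + 1))).
    by rewrite ler_piMr ?divr_ge0 ?(ltW e0)// ler_pdivrMr ?ltr_wpDl// mul1r lerDl.
  by field; rewrite !gt_eqF// ltr_wpDl.
move=> h; have := ler_wpM2l (ltW S0) (t D0 r20); lra.
Qed.

(** Pairing g with its mollification never exceeds the integral of the squared transform. If that
    integral missed a by d > 0, the pairing of g with its mollification error would be at least d;
    but by Cauchy-Schwarz its square is at most a times the squared error, which a narrow mollifier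
    brings below d^2 / (2 a). *)
Lemma plancherel_le : \int[lm]_x (g x ^+ 2) <= \int[lm]_xi fourier_sqmod g xi.
Proof.
set a := \int[lm]_x (g x ^+ 2); set F := \int[lm]_xi _.
have F0 : 0 <= F by apply: Rint_ge0 => xi; exact: fourier_sqmod_ge0.
rewrite leNgt; apply/negP => Fa; have a0 : 0 < a by exact: le_lt_trans Fa.
pose d := a - F; have d0 : 0 < d by rewrite subr_gt0.
have e0 : 0 < d ^+ 2 / (2 * a) by rewrite divr_gt0 ?exprn_gt0 ?mulr_gt0.
have [s s0 hs] := conv_small e0.
have sg0 : sg s != 0 by rewrite invr_eq0 !mulf_neq0// gt_eqF// pi_gt0.
have w0 (u : borel V) := gaussw_ge0 (sg s) u.
have wK (u : borel V) := gaussw_le u sg0.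
have w1 := Rint_gaussw n (sg s); have wi := intg_gaussw n (sg s).
have [ec2 ecle] := conv_sqdist_le gi g2 wi w0 wK w1.
pose c (x : borel V) := \int[lm]_u (g ((u : V) + (x : V)) * gaussw (sg s) u).
have [gci] := gauss_quadratic_le s0; rewrite -/F => q1.
have an : sqint lm (fun x => `|g x|).
  split; first by apply: measurableT_comp; [exact: normr_measurable|exact: g2.1].
  by apply: intg_eq g2.2 => x; rewrite real_normK// num_real.
have ecs := Rint_cauchy_schwarz an ec2.
have lo : d <= \int[lm]_x (`|g x| * conv_err g (gaussw (sg s)) x).
  apply: (@le_trans _ _ (\int[lm]_x (g x ^+ 2 - g x * c x))).
    by rewrite (RintB g2.2 gci) /d lerB.
  apply: Rint_le => [||x]; [exact: intgB g2.2 gci|exact: sqint_mul|].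
  rewrite expr2 -mulrBr; apply: le_trans (ler_norm _) _.
  by rewrite normrM ler_wpM2l//; exact: conv_sub_le.
have : d ^+ 2 <= a * (d ^+ 2 / (2 * a)).
  move: lo ecs; set X := \int[lm]_x (`|g x| * _) => lo ecs.
  apply: (@le_trans _ _ (X ^+ 2)).
    by rewrite !expr2; exact: (ler_pM (ltW d0) (ltW d0) lo lo).
  apply: le_trans ecs _; apply: ler_pM.
  - by apply: Rint_ge0 => x; exact: sqr_ge0.
  - by apply: Rint_ge0 => x; exact: sqr_ge0.
  - by rewrite (@eq_Rint _ _ _ _ _ (fun x => g x ^+ 2))// => x; rewrite real_normK// num_real.
  - exact: le_trans ecle hs.
rewrite (_ : a * _ = d ^+ 2 / 2); last by field; rewrite gt_eqF.
by rewrite leNgt ltr_pdivrMr// ltr_pMr ?exprn_gt0// ltr1n.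
Qed.

End plancherel.

(** * From Sobolev norms to L^2 moduli of continuity *)

Section sobolev_modulus.
Context (R : realType) (n : nat).
Local Notation V := 'rV[R]_n.
Local Notation lm := (lam R n).
Variable f : borel V -> R.
Hypotheses (fi : intg lm f) (f2 : sqint lm f).

Lemma fcos_shift (y xi : V) : fcos (fun z : borel V => f (y + (z : V))) xi =
  cos (2 * pi * dotp y xi) * fcos f xi + sin (2 * pi * dotp y xi) * fsin f xi.
Proof.
have mf := intg_meas fi.
rewrite /fcos /fsin -(RintZ _ (intg_cosd fi xi)) -(RintZ _ (intg_sind fi xi)).
rewrite -RintD; [|exact: intgZ (intg_cosd fi xi)|exact: intgZ (intg_sind fi xi)].
rewrite -[RHS](Rint_shift y).
  apply: eq_Rint => z.
  rewrite [in LHS](_ : dotp z xi = dotp (y + (z : V)) xi - dotp y xi).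
    by rewrite mulrBr cosB; ring.
  by rewrite dotpDl addrC addKr.
by apply: measurable_funD; apply: measurable_funM => //; apply: measurable_funM => //;
  [exact: (@measurable_cosd _ _ _ _ id (fun=> xi : borel V))|
   exact: (@measurable_sind _ _ _ _ id (fun=> xi : borel V))].
Qed.

Lemma fsin_shift (y xi : V) : fsin (fun z : borel V => f (y + (z : V))) xi =
  cos (2 * pi * dotp y xi) * fsin f xi - sin (2 * pi * dotp y xi) * fcos f xi.
Proof.
have mf := intg_meas fi.
rewrite /fcos /fsin -(RintZ _ (intg_cosd fi xi)) -(RintZ _ (intg_sind fi xi)).
rewrite -RintB; [|exact: intgZ (intg_sind fi xi)|exact: intgZ (intg_cosd fi xi)].
rewrite -[RHS](Rint_shift y).
  apply: eq_Rint => z.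
  rewrite [in LHS](_ : dotp z xi = dotp (y + (z : V)) xi - dotp y xi).
    by rewrite mulrBr sinB; ring.
  by rewrite dotpDl addrC addKr.
by apply: measurable_funB; apply: measurable_funM => //; apply: measurable_funM => //;
  [exact: (@measurable_sind _ _ _ _ id (fun=> xi : borel V))|
   exact: (@measurable_cosd _ _ _ _ id (fun=> xi : borel V))].
Qed.

Lemma fourier_sqmod_shift (y xi : V) :
  fourier_sqmod (fun z : borel V => f z - f (y + (z : V))) xi =
  (2 - 2 * cos (2 * pi * dotp y xi)) * fourier_sqmod f xi.
Proof.
have si := intg_shift y fi; have di := intgB fi si.
rewrite (fourier_sqmodE di) (fourier_sqmodE fi).
have -> : fcos (fun z : borel V => f z - f (y + (z : V))) xi =
    fcos f xi - fcos (fun z : borel V => f (y + (z : V))) xi.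
  rewrite /fcos -RintB; [|exact: intg_cosd fi xi|exact: intg_cosd si xi].
  by apply: eq_Rint => z; rewrite mulrBl.
have -> : fsin (fun z : borel V => f z - f (y + (z : V))) xi =
    fsin f xi - fsin (fun z : borel V => f (y + (z : V))) xi.
  rewrite /fsin -RintB; [|exact: intg_sind fi xi|exact: intg_sind si xi].
  by apply: eq_Rint => z; rewrite mulrBl.
rewrite fcos_shift fsin_shift; have := cos2Dsin2 (2 * pi * dotp y xi).
set c := cos _; set s := sin _ => cs.
have {}cs : s ^+ 2 = 1 - c ^+ 2 by rewrite -cs addrC addKr.
transitivity ((1 - 2 * c + c ^+ 2 + s ^+ 2) * (fcos f xi ^+ 2 + fsin f xi ^+ 2)); first by ring.
by rewrite cs; ring.
Qed.

Lemma sobolev_intg (s : R) : (sobolev_sqnorm_Rd s f < +oo)%E ->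
  intg lm (fun xi => (1 + (2 * pi) ^+ 2 * dotp xi xi) `^ s * fourier_sqmod f xi).
Proof.
have m : measurable_fun setT (fun xi : borel V =>
    (1 + (2 * pi) ^+ 2 * dotp xi xi) `^ s * fourier_sqmod f xi).
  apply: measurable_funM; last exact: measurable_fourier_sqmod.
  apply: (measurableT_comp (measurable_powR s)); apply: measurable_funD => //.
  by apply: measurable_funM => //; exact: (@measurable_dotp2 _ _ _ _ id id).
have p (xi : borel V) : 0 <= (1 + (2 * pi) ^+ 2 * dotp xi xi) `^ s * fourier_sqmod f xi.
  by rewrite mulr_ge0 ?powR_ge0 ?fourier_sqmod_ge0.
rewrite /sobolev_sqnorm_Rd -lamE//; last exact/measurable_EFinP.
exact: intg_le_lty.
Qed.

(** The transform of the difference f - f(y + .) has squared modulus (2 - 2 cos(2 pi y.xi)) times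
    that of f. The interpolated cosine bound with exponent t = min(s, 1) extracts |y|^(2 t) and
    leaves the weight to the power t, at most the power s. Plancherel's inequality returns to
    L^2. *)
Lemma sobolev_modulus (s : R) : 0 < s -> (sobolev_sqnorm_Rd s f < +oo)%E ->
  exists2 K : R, 0 <= K &
    forall y : V, shift_sqdist f y <= K * (`|y| ^+ 2) `^ (Num.min s 1).
Proof.
move=> s0 /sobolev_intg Si; set t := Num.min s 1.
have t0 : 0 < t by rewrite lt_min s0 ltr01.
have t1 : t <= 1 by rewrite ge_min lexx orbT.
have ts : t <= s by rewrite ge_min lexx.
set I := \int[lm]_xi ((1 + (2 * pi) ^+ 2 * dotp xi xi) `^ s * fourier_sqmod f xi).
have I0 : 0 <= I.
  by apply: Rint_ge0 => xi; rewrite mulr_ge0 ?powR_ge0 ?fourier_sqmod_ge0.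
exists (4 * (n%:R ^+ 2) `^ t * I) => [|y]; first by rewrite !mulr_ge0 ?powR_ge0.
have di := intgB fi (intg_shift y fi); have d2 := sqintB f2 (sqint_shift y f2).
have bd (xi : borel V) : fourier_sqmod (fun z : borel V => f z - f (y + (z : V))) xi <=
    4 * (n%:R ^+ 2) `^ t * (`|y| ^+ 2) `^ t *
    ((1 + (2 * pi) ^+ 2 * dotp xi xi) `^ s * fourier_sqmod f xi).
  rewrite fourier_sqmod_shift mulrA ler_wpM2r ?fourier_sqmod_ge0//.
  apply: le_trans (@one_sub_cos_powR_le _ _ t _) _; first by rewrite ltW.
  rewrite -[X in _ <= X * _]mulrA -[leRHS]mulrA ler_wpM2l//.
  have w1 : 1 <= 1 + (2 * pi) ^+ 2 * dotp xi xi by rewrite lerDl mulr_ge0 ?sqr_ge0 ?dotp_ge0.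
  have w0 := le_trans ler01 w1.
  apply: (@le_trans _ _ ((n%:R ^+ 2 * (`|y| ^+ 2 * (1 + (2 * pi) ^+ 2 * dotp xi xi))) `^ t)).
    apply: ge0_ler_powR; rewrite ?nnegrE ?sqr_ge0 ?(ltW t0)//.
      by rewrite !mulr_ge0 ?sqr_ge0.
    have h : `|dotp y xi| ^+ 2 <= (n%:R * (`|y| * `|xi : V|)) ^+ 2.
      by rewrite ler_sqr ?nnegrE ?mulr_ge0// dotp_norm_le.
    rewrite real_normK ?num_real// in h.
    rewrite exprMn; apply: le_trans (ler_wpM2l (sqr_ge0 _) h) _.
    rewrite [leLHS](_ : _ = n%:R ^+ 2 * (`|y| ^+ 2 * ((2 * pi) ^+ 2 * `|xi : V| ^+ 2))); last by ring.
    rewrite ler_wpM2l ?sqr_ge0// ler_wpM2l ?sqr_ge0// ler_wpDl//.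
    by rewrite ler_wpM2l ?sqr_ge0// norm_sqr_le_dotp.
  rewrite (@powRM _ (n%:R ^+ 2)) ?sqr_ge0 ?mulr_ge0 ?sqr_ge0//.
  rewrite (@powRM _ (`|y| ^+ 2)) ?sqr_ge0//.
  by rewrite -[leRHS]mulrA ler_wpM2l ?powR_ge0// ler_wpM2l ?powR_ge0// ler_powR.
have Fi : intg lm (fourier_sqmod (fun z : borel V => f z - f (y + (z : V)))).
  apply: intg_dom (intgZ (4 * (n%:R ^+ 2) `^ t * (`|y| ^+ 2) `^ t) Si) => [|xi].
    exact: measurable_fourier_sqmod.
  by rewrite ger0_norm ?fourier_sqmod_ge0.
apply: le_trans (plancherel_le di d2 Fi) _.
rewrite -mulrA [I * _]mulrC mulrA -RintZ//.
by apply: Rint_le => //; exact: intgZ.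
Qed.

End sobolev_modulus.

(** * Smooth functions and bumps *)

Section directional_smoothness.
Context (R : realType) (V : normedModType R) (I : Type) (e : I -> V).

(** [Ck] with the coordinate directions replaced by any family of directions in a normed space, so
    that one set of closure lemmas serves both functions of a real variable and functions of row
    vectors. *)
Fixpoint smoothk (k : nat) (U : set V) (f : V -> R) : Prop :=
  (forall z, U z -> {for z, continuous f}) /\
  (if k is k'.+1 then
     forall i, (forall z, U z -> derivable f z (e i)) /\ smoothk k' U ('D_(e i) f)
   else True).

Definition smoothoo U f := forall k, smoothk k U f.

Lemma is_derive_line (f : V -> R) x v a :
  is_derive x v f a <-> is_derive (0 : R) (1 : R) (fun h : R => f (h *: v + x)) a.
Proof.
have E : 'D_v f x = 'D_1 (fun h : R => f (h *: v + x)) (0 : R).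
  rewrite /derive; set g1 := fun h => h^-1 *: _; set g2 := fun h => h^-1 *: _.
  suff -> : g1 = g2 by [].
  by rewrite funeqE /g1 /g2 => h /=; rewrite addr0 scale0r add0r [_%:A]mulr1.
split=> -[d eq]; apply: DeriveDef; rewrite -?eq ?E//.
  exact/(derivable1P f x v).
exact/(derivable1P f x v).
Qed.

Lemma is_derive_chain (phi : R -> R) (u : V -> R) z v a b :
  is_derive (u z) (1 : R) phi a -> is_derive z v u b ->
  is_derive z v (phi \o u) (a * b).
Proof.
move=> dphi /is_derive_line du; apply/is_derive_line.
have := @is_derive1_chain _ phi (fun h : R => u (h *: v + z)) 0 a b.
by rewrite scale0r add0r; apply.
Qed.

Lemma is_derive_mul (f g : V -> R) x v a b : is_derive x v f a -> is_derive x v g b ->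
  is_derive x v (fun y => f y * g y) (a * g x + f x * b).
Proof.
move=> df dg; apply: (is_derive_eq (is_deriveM df dg)).
by rewrite /= addrC [a * _]mulrC.
Qed.

Lemma is_derive_add (f g : V -> R) x v a b : is_derive x v f a -> is_derive x v g b ->
  is_derive x v (fun y => f y + g y) (a + b).
Proof. by move=> df dg; exact: is_deriveD. Qed.

Lemma is_derive_inv (f : V -> R) x v a : f x != 0 -> is_derive x v f a ->
  is_derive x v (fun y => (f y)^-1) (- a * (f x)^-1 ^+ 2).
Proof.
move=> f0 [df dE]; apply: DeriveDef; first exact: derivableV.
transitivity (- (f x) ^- 2 *: 'D_v f x); first exact: deriveV.
by rewrite dE /GRing.scale/= exprVn !mulNr mulrC.
Qed.

Variable U : set V.
Hypothesis oU : open U.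

Lemma smoothk_cont k f : smoothk k U f -> forall z, U z -> {for z, continuous f}.
Proof. by case: k => [|k] []. Qed.

Lemma smoothkW k f : smoothk k.+1 U f -> smoothk k U f.
Proof.
elim: k f => [|k ih] f [cf df]; first by split.
by split=> // i; have [d s] := df i; split=> //; exact: ih.
Qed.

Lemma smoothk_eq k f g : (forall z, U z -> f z = g z) -> smoothk k U f -> smoothk k U g.
Proof.
have nr z h h' : U z -> (forall z, U z -> h z = h' z) -> \near z, (h z : R) = h' z.
  by move=> Uz hh; apply: filterS (open_nbhs_nbhs (conj oU Uz)) => y /hh.
have ct h h' : (forall z, U z -> (h z : R) = h' z) ->
    (forall z, U z -> {for z, continuous h}) -> forall z, U z -> {for z, continuous h'}.
  move=> hh ch z Uz; rewrite /prop_for /continuous_at -(hh z Uz).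
  by apply: cvg_trans (ch z Uz); apply: near_eq_cvg; exact: (nr _ _ _ Uz hh).
elim: k f g => [|k ih] f g fg [cf df]; first by split=> //; exact: ct cf.
split; first exact: ct cf.
move=> i; have [d s] := df i; split.
  by move=> z Uz; apply: near_eq_derivable (d z Uz); exact: (nr _ _ _ Uz fg).
apply: ih s => z Uz; apply: near_eq_derive; exact: (nr _ _ _ Uz fg).
Qed.

Lemma smoothk_der k f (g : I -> V -> R) :
  (forall z, U z -> {for z, continuous f}) ->
  (forall i z, U z -> is_derive z (e i) f (g i z)) ->
  (forall i, smoothk k U (g i)) -> smoothk k.+1 U f.
Proof.
move=> cf df dg; split=> // i; split=> [z Uz|]; first by have [] := df i z Uz.
by apply: smoothk_eq (dg i) => z Uz; have [_ ->] := df i z Uz.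
Qed.

Lemma smoothk_is_derive k f i z : smoothk k.+1 U f -> U z ->
  is_derive z (e i) f ('D_(e i) f z).
Proof. by move=> [_ /(_ i) [d _]] Uz; apply: derivableP; exact: d. Qed.

Lemma smoothk_D k f i : smoothk k.+1 U f -> smoothk k U ('D_(e i) f).
Proof. by move=> [_ /(_ i) []]. Qed.

Lemma smoothk_cst k (c : R) : smoothk k U (fun=> c).
Proof.
elim: k c => [|k ih] c; first by split=> // z _; exact: cst_continuous.
exact: (@smoothk_der k _ (fun _ _ => 0) (fun z _ => @cst_continuous _ _ c z)
  (fun i z _ => is_derive_cst c z (e i)) (fun=> ih 0)).
Qed.

Lemma smoothk_add k f g : smoothk k U f -> smoothk k U g ->
  smoothk k U (fun z => f z + g z).
Proof.
elim: k f g => [|k ih] f g sf sg.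
  by split=> // z Uz; apply: continuousD; [exact: (smoothk_cont sf)|exact: (smoothk_cont sg)].
apply: (@smoothk_der _ _ (fun i z => 'D_(e i) f z + 'D_(e i) g z)) => [z Uz|i z Uz|i].
- by apply: continuousD; [exact: (smoothk_cont sf)|exact: (smoothk_cont sg)].
- by apply: is_derive_add; [exact: (smoothk_is_derive _ sf)|exact: (smoothk_is_derive _ sg)].
- by apply: ih; exact: smoothk_D.
Qed.

Lemma smoothk_mul k f g : smoothk k U f -> smoothk k U g ->
  smoothk k U (fun z => f z * g z).
Proof.
elim: k f g => [|k ih] f g sf sg.
  by split=> // z Uz; apply: continuousM; [exact: (smoothk_cont sf)|exact: (smoothk_cont sg)].
apply: (@smoothk_der _ _ (fun i z => 'D_(e i) f z * g z + f z * 'D_(e i) g z)) => [z Uz|i z Uz|i].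
- by apply: continuousM; [exact: (smoothk_cont sf)|exact: (smoothk_cont sg)].
- by apply: is_derive_mul; [exact: (smoothk_is_derive _ sf)|exact: (smoothk_is_derive _ sg)].
- by apply: smoothk_add; apply: ih => //; by [exact: smoothk_D|exact: smoothkW].
Qed.

Lemma smoothk_scale k c f : smoothk k U f -> smoothk k U (fun z => c * f z).
Proof. by move=> sf; apply: smoothk_mul => //; exact: smoothk_cst. Qed.

Lemma smoothk_opp k f : smoothk k U f -> smoothk k U (fun z => - f z).
Proof. by move=> /(smoothk_scale (-1)); apply: smoothk_eq => z _; rewrite mulN1r. Qed.

Lemma smoothk_sub k f g : smoothk k U f -> smoothk k U g ->
  smoothk k U (fun z => f z - g z).
Proof. by move=> sf sg; apply: smoothk_add => //; exact: smoothk_opp. Qed.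

Lemma smoothk_sum k (J : Type) (s : seq J) (f : J -> V -> R) :
  (forall j, smoothk k U (f j)) -> smoothk k U (fun z => \sum_(j <- s) f j z).
Proof.
move=> sf; elim: s => [|j s ih].
  by apply: smoothk_eq (smoothk_cst k 0) => z _; rewrite big_nil.
by apply: smoothk_eq (smoothk_add (sf j) ih) => z _; rewrite big_cons.
Qed.

Lemma smoothk_prod k (J : Type) (s : seq J) (f : J -> V -> R) :
  (forall j, smoothk k U (f j)) -> smoothk k U (fun z => \prod_(j <- s) f j z).
Proof.
move=> sf; elim: s => [|j s ih].
  by apply: smoothk_eq (smoothk_cst k 1) => z _; rewrite big_nil.
by apply: smoothk_eq (smoothk_mul (sf j) ih) => z _; rewrite big_cons.
Qed.

Lemma smoothk_inv k f : (forall z, U z -> f z != 0) -> smoothk k U f ->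
  smoothk k U (fun z => (f z)^-1).
Proof.
move=> f0; elim: k => [|k ih] sf.
  by split=> // z Uz; apply: continuousV; [exact: f0|exact: (smoothk_cont sf)].
apply: (@smoothk_der _ _ (fun i z => - 'D_(e i) f z * (f z)^-1 ^+ 2)) => [z Uz|i z Uz|i].
- by apply: continuousV; [exact: f0|exact: (smoothk_cont sf)].
- by apply: is_derive_inv; [exact: f0|exact: (smoothk_is_derive _ sf)].
- have s2 := ih (smoothkW sf).
  have s1 := smoothk_opp (smoothk_D i sf).
  by apply: smoothk_eq (smoothk_mul s1 (smoothk_mul s2 s2)) => z _; rewrite expr2.
Qed.

(** The outer function comes with the whole sequence of its derivatives: differentiating the
    composition at index j calls for index j + 1, so the induction on k has to hold for all j. *)
Lemma smoothk_comp k (phi : nat -> R -> R) u :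
  (forall j x, is_derive x (1 : R) (phi j) (phi j.+1 x)) -> smoothk k U u ->
  forall j, smoothk k U (phi j \o u).
Proof.
move=> dphi; have cphi j x : {for x, continuous (phi j)} by exact: is_derive1_continuous (dphi j x).
have cc j z : {for z, continuous u} -> {for z, continuous (phi j \o u)}.
  by move=> cu; apply: continuous_comp => //; exact: cphi.
elim: k => [|k ih] su j; first by split=> // z Uz; apply: cc; exact: (smoothk_cont su).
apply: (@smoothk_der _ _ (fun i z => phi j.+1 (u z) * 'D_(e i) u z)) => [z Uz|i z Uz|i].
- by apply: cc; exact: (smoothk_cont su).
- by apply: is_derive_chain => //; exact: (smoothk_is_derive _ su).
- by apply: smoothk_mul; [exact: ih (smoothkW su) j.+1|exact: smoothk_D].
Qed.

End directional_smoothness.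

Section smoothness_domains.
Context (R : realType) (V : normedModType R) (I : Type) (e : I -> V).

Lemma smoothk_sub_dom k (U W : set V) f : U `<=` W -> smoothk e k W f -> smoothk e k U f.
Proof.
move=> UW; elim: k f => [|k ih] f [cf df]; first by split=> // z /UW; exact: cf.
split=> [z /UW|i]; first exact: cf.
by have [d s] := df i; split=> [z /UW|]; [exact: d|exact: ih].
Qed.

Lemma smoothk_union k (U W : set V) f : smoothk e k U f -> smoothk e k W f ->
  smoothk e k (U `|` W) f.
Proof.
elim: k f => [|k ih] f [cf df] [cf' df']; first by split=> // z [/cf|/cf'].
split=> [z [/cf|/cf']//|i]; have [d s] := df i; have [d' s'] := df' i.
by split=> [z [/d|/d']//|]; exact: ih.
Qed.

End smoothness_domains.

Lemma smoothk_Ck (R : realType) d k (U : set 'rV[R]_d) f :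
  Ck k U f <-> smoothk (@basis_vec R d) k U f.
Proof.
elim: k f => [|k ih] f //=; split=> -[cf df]; split=> // l.
  by have [? /ih] := df l.
by have [? /ih] := df l.
Qed.

Lemma bounded_compact_support (R : realType) (T : topologicalType) (K : set T) (f : T -> R) :
  compact K -> {within K, continuous f} -> (forall x, ~ K x -> f x = 0) ->
  exists2 C : R, 0 <= C & forall x, `|f x| <= C.
Proof.
move=> cK cf f0; have := compact_bounded (continuous_compact cf cK).
move=> [M [_ /(_ (`|M| + 1))]]; rewrite (le_lt_trans (ler_norm M)) ?ltrDl// => /(_ isT) h.
exists (`|M| + 1) => [|x]; first by rewrite addr_ge0.
have [Kx|/f0 ->] := pselect (K x); last by rewrite normr0 addr_ge0.
by apply: h; exists x.
Qed.

(** * A smooth bump whose integer translates sum to one *)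

Section smooth_step.
Context (R : realType).

Definition smooth1 (f : R -> R) := smoothoo (fun _ : unit => 1 : R) setT f.

(** The functions t^-j exp(-1 / t) on the positive half-line. Together they are stable under
    differentiation, which proves all of them smooth at once. *)
Definition flat (j : nat) (t : R) : R :=
  if 0 < t then t^-1 ^+ j * expR (- t^-1) else 0.

Lemma flat_ge0 j t : 0 <= flat j t.
Proof.
by rewrite /flat; case: ifPn => // t0; rewrite mulr_ge0 ?expR_ge0// exprn_ge0// invr_ge0 ltW.
Qed.

(** With x = 1 / t this says x^j exp(-x) <= j!, a single term of the exponential series. Combined
    with [flatS] it makes the difference quotient at 0 vanish; it is also the source of the bound of
    a polynomial times a decaying exponential. *)
Lemma flat_le j t : flat j t <= j`!%:R.
Proof.
rewrite /flat; case: ifPn => // t0.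
rewrite expRN ler_pdivrMr ?expR_gt0//; case: j => [|j].
  by rewrite expr0 mul1r -expR0 ler_expR invr_ge0 ltW.
have i0 : 0 <= t^-1 by rewrite invr_ge0 ltW.
rewrite mulrC -ler_pdivrMr ?ltr0n ?fact_gt0//.
by apply: le_trans (expR_ge1Dxn j i0); rewrite lerDr.
Qed.

Lemma flatS j t : flat j t = t * flat j.+1 t.
Proof.
rewrite /flat; case: ifPn => t0; last by rewrite mulr0.
by rewrite exprS mulrA mulrA divff ?mul1r// gt_eqF.
Qed.

Lemma is_derive_flat j t : is_derive t (1 : R) (flat j) (- j%:R * flat j.+1 t + flat j.+2 t).
Proof.
have [t0|t0|->] := ltgtP t 0.
- have -> : - j%:R * flat j.+1 t + flat j.+2 t = 0.
    by rewrite /flat !ltNge (ltW t0)/= mulr0 addr0.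
  apply: (@near_eq_is_derive _ _ _ (cst (0 : R))).
  near=> y; rewrite /flat ifF//; apply/negbTE; rewrite -leNgt; apply: ltW.
  by near: y; exact: lt_nbhsl.
- apply: (@near_eq_is_derive _ _ _ (fun y : R => y^-1 ^+ j * expR (- y^-1))).
    near=> y; rewrite /flat ifT//; near: y; exact: lt_nbhsr.
  have tn0 : t != 0 by rewrite gt_eqF.
  have di := @is_derive_inv R _ (@id R) t 1 1 tn0 (is_derive_id t (1 : R)).
  have dE : is_derive t (1 : R) (fun y : R => expR (- y^-1)) (expR (- t^-1) * t^-1 ^+ 2).
    have := @is_derive1_chain _ expR (fun y : R => - y^-1) t _ _ (is_derive_expR _) (is_deriveN di).
    by rewrite mulN1r opprK.
  have dX : is_derive t (1 : R) (fun y : R => y^-1 ^+ j) (- j%:R * t^-1 ^+ j.+1).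
    have := @is_deriveX R _ (fun y : R => y^-1) j t 1 _ di.
    rewrite (_ : (fun y : R => y^-1) ^+ j = fun y : R => y^-1 ^+ j); last first.
      by apply/funext => y; rewrite fctE.
    move=> h; apply: (is_derive_eq h); rewrite /GRing.scale /=.
    case: j {h} => [|j]; first by rewrite !mul0r oppr0 mul0r.
    by rewrite -[j.+2]addn2 exprD; ring.
  apply: (is_derive_eq (is_derive_mul dX dE)).
  by rewrite /flat t0 !exprS; ring.
have -> : - j%:R * flat j.+1 0 + flat j.+2 0 = 0 by rewrite /flat ltxx mulr0 addr0.
have h : (fun h : R => h^-1 *: (flat j (h *: 1 + 0) - flat j 0)) @ 0^' --> (0 : R).
  apply/cvgr0Pnorm_le => e e0; near=> h.
  have hn0 : h != 0 by near: h; exact: nbhs_dnbhs_neq.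
  rewrite /flat ltxx -/(flat j _) subr0 addr0 [_ *: 1]mulr1.
  rewrite [X in `|X|](_ : _ = h * flat j.+2 h); last first.
    by rewrite /GRing.scale/= (flatS j) (flatS j.+1) mulKf.
  rewrite normrM.
  apply: (@le_trans _ _ (`|h| * j.+2`!%:R)).
    by rewrite ler_wpM2l// ger0_norm ?flat_ge0// flat_le.
  rewrite -ler_pdivlMr ?ltr0n ?fact_gt0//; near: h; apply: dnbhs0_le.
  by rewrite divr_gt0// ltr0n fact_gt0.
by apply: DeriveDef; [apply/cvg_ex; exists 0|exact: (cvg_lim (@Rhausdorff R) h)].
Unshelve. all: by end_near. Qed.

Lemma smooth1_flat j : smooth1 (flat j).
Proof.
move=> k; elim: k j => [|k ih] j.
  by split=> // z _; exact: is_derive1_continuous (is_derive_flat j z).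
apply: (smoothk_der openT (g := fun _ t => - j%:R * flat j.+1 t + flat j.+2 t)) => [z _|_ z _|_].
- exact: is_derive1_continuous (is_derive_flat j z).
- exact: is_derive_flat.
- apply: smoothk_add => //; first exact: openT.
  by apply: smoothk_scale => //; exact: openT.
Qed.

Definition tower (f : R -> R) (j : nat) : R -> R := iter j (fun g : R -> R => 'D_(1 : R) g) f.

Lemma smooth1_tower f j : smooth1 f -> smooth1 (tower f j).
Proof.
elim: j => [//|j ih] /ih s k; exact: (smoothk_D tt (s k.+1)).
Qed.

Lemma is_derive_tower f j x : smooth1 f -> is_derive x (1 : R) (tower f j) (tower f j.+1 x).
Proof. by move=> s; exact: (smoothk_is_derive tt (smooth1_tower j s 1%N)). Qed.

Lemma smooth1_affine (a b : R) : smooth1 (fun t => a * t + b).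
Proof.
move=> k; apply: smoothk_add; [exact: openT| |exact: smoothk_cst _ openT _ _].
apply: smoothk_scale; first exact: openT.
case: k => [|k]; first by split=> // z _; exact: cvg_id.
have ci z : [set: R] z -> {for z, continuous (@id R)} by move=> _; exact: cvg_id.
have di (i : unit) z : [set: R] z -> is_derive z (1 : R) (@id R) 1 by move=> _; exact: is_derive_id.
have si (i : unit) := smoothk_cst (fun _ : unit => 1 : R) (@openT R) k 1.
exact: (@smoothk_der _ _ unit (fun=> 1 : R) setT openT k (@id R) (fun _ _ => 1) ci di si).
Qed.

Lemma smooth1_comp_affine f a b : smooth1 f -> smooth1 (fun t => f (a * t + b)).
Proof.
move=> s k.
exact: (smoothk_comp openT (fun j x => is_derive_tower j x s) (smooth1_affine a b k) 0).
Qed.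

Definition step (t : R) : R := flat 0 t / (flat 0 t + flat 0 (1 - t)).

Let den_gt0 t : 0 < flat 0 t + flat 0 (1 - t).
Proof.
have [t0|t0] := ltP 0 t.
  by rewrite ltr_wpDr ?flat_ge0// /flat t0 mulr_gt0 ?expR_gt0// exprn_gt0 ?invr_gt0.
rewrite ltr_wpDl ?flat_ge0// /flat ifT; last by lra.
by rewrite mulr_gt0 ?expR_gt0.
Qed.

Lemma step_le0 t : t <= 0 -> step t = 0.
Proof. by move=> t0; rewrite /step [in X in X / _]/flat ltNge t0 mul0r. Qed.

Lemma step_ge1 t : 1 <= t -> step t = 1.
Proof.
move=> t1; have := den_gt0 t; rewrite /step [X in _ + X]/flat ifF ?addr0; last first.
  by apply/negbTE; rewrite -leNgt; lra.
by move=> d0; rewrite divff// gt_eqF.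
Qed.

Lemma step_ge0 t : 0 <= step t.
Proof. by rewrite divr_ge0 ?flat_ge0// ltW. Qed.

Lemma step_le1 t : step t <= 1.
Proof. by rewrite ler_pdivrMr// mul1r lerDl flat_ge0. Qed.

Lemma smooth1_step : smooth1 step.
Proof.
move=> k; have s0 := smooth1_flat 0; have s1 := smooth1_comp_affine (-1) 1 s0.
have s2 : smoothk (fun _ : unit => 1 : R) k setT (fun t => flat 0 t + flat 0 (1 - t)).
  apply: smoothk_add; [exact: openT|exact: s0|].
  by apply: smoothk_eq (s1 k) => [|z _]; [exact: openT|rewrite mulN1r addrC].
apply: smoothk_mul; [exact: openT|exact: s0|].
by apply: smoothk_inv => [|z _|//]; [exact: openT|rewrite gt_eqF].
Qed.

(** A difference of consecutive steps, so that sums over integer translates telescope into a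
    partition of unity. *)
Definition bump (t : R) : R := step (t + 1) - step t.

Lemma bump_norm_le1 t : `|bump t| <= 1.
Proof.
have := step_ge0 (t + 1); have := step_ge0 t; have := step_le1 (t + 1); have := step_le1 t.
by rewrite /bump ler_norml => *; apply/andP; split; lra.
Qed.

Lemma bump_eq0 t : 1 < `|t| -> bump t = 0.
Proof.
rewrite lter_normr => /orP[t1|t1]; first by rewrite /bump !step_ge1 ?subrr//; lra.
by rewrite /bump !step_le0 ?subrr//; lra.
Qed.

Lemma bump_sum (m : nat) t : \sum_(0 <= i < m) bump (t - i%:R) = step (t + 1) - step (t + 1 - m%:R).
Proof.
elim: m => [|m ih]; first by rewrite big_geq// subr0 subrr.
rewrite big_nat_recr//= ih /bump.
rewrite (_ : t - m%:R + 1 = t + 1 - m%:R); last by ring.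
by rewrite (_ : t + 1 - m.+1%:R = t - m%:R); [ring|rewrite -natr1; ring].
Qed.

Lemma smooth1_bump : smooth1 bump.
Proof.
move=> k; have := smooth1_comp_affine 1 1 smooth1_step k => s1.
apply: smoothk_sub; [exact: openT| |exact: smooth1_step].
by apply: smoothk_eq s1 => [|z _]; [exact: openT|rewrite mul1r].
Qed.

Lemma tower_bump_eq0 j t : 1 < `|t| -> tower bump j t = 0.
Proof.
elim: j t => [|j ih] t t1; first exact: bump_eq0.
rewrite /= -/(tower bump j) (@near_eq_derive _ _ _ _ (cst 0)) ?derive_cst//.
near=> y; apply: ih; near: y.
apply: (@open_nbhs_nbhs _ t); split=> //.
apply: (open_comp (f := fun x : R => `|x|) (D := [set y | 1 < y])) => [y _|]; first exact: norm_continuous.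
exact: open_gt.
Unshelve. all: by end_near. Qed.

Lemma tower_bump_bnd j : exists2 C : R, 0 <= C & forall t, `|tower bump j t| <= C.
Proof.
apply: (bounded_compact_support (@segment_compact R (-1) 1)).
  apply: continuous_subspaceT => z; exact: (is_derive1_continuous (is_derive_tower j z smooth1_bump)).
move=> t /= h; apply: tower_bump_eq0; rewrite ltNge; apply/negP.
by rewrite ler_norml => h'; apply: h; rewrite in_itv.
Qed.

End smooth_step.

Lemma is_derive_bigprod (R : realType) (V : normedModType R) (J : eqType) (s : seq J)
    (f : J -> V -> R) (f' : J -> R) z v : uniq s ->
  (forall j, is_derive z v (f j) (f' j)) ->
  is_derive z v (fun y => \prod_(j <- s) f j y)
    (\sum_(j <- s) (f' j * \prod_(i <- s | i != j) f i z)).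
Proof.
move=> us df; elim: s us => [_|j s ih /= /andP[js us]].
  rewrite big_nil (_ : (fun y => _) = cst (1 : R)); first exact: is_derive_cst.
  by apply/funext => y; rewrite big_nil.
rewrite (_ : (fun y => _) = (fun y => f j y * \prod_(i <- s) f i y)); last first.
  by apply/funext => y; rewrite big_cons.
apply: (is_derive_eq (is_derive_mul (df j) (ih us))).
rewrite big_cons big_cons eqxx /=; congr (_ * _ + _).
  rewrite [LHS]big_seq [RHS]big_seq_cond; apply: eq_bigl => i.
  by case: (boolP (i \in s)) => //= si; symmetry; apply: contraNneq js => <-.
rewrite mulr_sumr [LHS]big_seq [RHS]big_seq; apply: eq_bigr => i si.
have ji : j != i by apply: contraNneq js => ->.
by rewrite big_cons ji mulrCA.
Qed.

Section partial_derivatives.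
Context (R : realType) (d : nat).
Local Notation V := 'rV[R]_d.
Local Notation smoothk := (smoothk (@basis_vec R d)).
Local Notation smoothoo := (smoothoo (@basis_vec R d)).
Implicit Types f g : V -> R.

Lemma pderivs_rcons (s : seq 'I_d) l f : pderivs (rcons s l) f = pderivs s ('D_(basis_vec l) f).
Proof. by rewrite /pderivs foldr_rcons. Qed.

Lemma smoothoo_D f l : smoothoo setT f -> smoothoo setT ('D_(basis_vec l) f).
Proof. by move=> sf k; exact: (smoothk_D l (sf k.+1)). Qed.

Lemma smoothoo_pderivs s f : smoothoo setT f -> smoothoo setT (pderivs s f).
Proof. by elim: s => //= l s ih /ih; exact: smoothoo_D. Qed.

Lemma smoothoo_is_derive f l z : smoothoo setT f ->
  is_derive z (basis_vec l) f ('D_(basis_vec l) f z).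
Proof. by move=> sf; exact: (smoothk_is_derive l (sf 1%N)). Qed.

Lemma smoothoo_continuous f : smoothoo setT f -> continuous f.
Proof. by move=> sf z; exact: (smoothk_cont (sf 0%N)). Qed.

Lemma pderivs_add s f g : smoothoo setT f -> smoothoo setT g ->
  pderivs s (fun z => f z + g z) = (fun z => pderivs s f z + pderivs s g z).
Proof.
move=> sf sg; elim: s => //= l s ->; apply/funext => z.
have [_ ->] := is_derive_add (smoothoo_is_derive l z (smoothoo_pderivs s sf))
  (smoothoo_is_derive l z (smoothoo_pderivs s sg)).
by [].
Qed.

Lemma pderivs_scale s c f : smoothoo setT f ->
  pderivs s (fun z => c * f z) = (fun z => c * pderivs s f z).
Proof.
move=> sf; elim: s => //= l s ->; apply/funext => z.
have [_ ->] := is_derive_mul (is_derive_cst c z (basis_vec l))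
  (smoothoo_is_derive l z (smoothoo_pderivs s sf)).
by rewrite mul0r add0r.
Qed.

Lemma pderivs_cst0 s : pderivs s (fun _ : V => 0 : R) = (fun _ => 0).
Proof. by elim: s => //= l s ->; apply/funext => z; rewrite (derive_cst (0 : R)). Qed.

Lemma pderivs_sum s (J : Type) (r : seq J) (f : J -> V -> R) :
  (forall j, smoothoo setT (f j)) ->
  pderivs s (fun z => \sum_(j <- r) f j z) = (fun z => \sum_(j <- r) pderivs s (f j) z).
Proof.
move=> sf; elim: r => [|j r ih].
  under eq_fun do rewrite big_nil; rewrite pderivs_cst0.
  by apply/funext => z; rewrite big_nil.
under eq_fun do rewrite big_cons; rewrite pderivs_add//; last first.
  by move=> k; apply: smoothk_sum => [|i]; [exact: openT|exact: sf].
by rewrite ih; apply/funext => z; rewrite big_cons.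
Qed.

End partial_derivatives.

(** * Derivatives of rescaled bumps *)

Section bump_derivatives.
Context (R : realType) (d q : nat) (U K : set 'rV[R]_d) (tau : 'I_q -> 'rV[R]_d -> R).
Local Notation V := 'rV[R]_d.
Local Notation smoothk := (smoothk (@basis_vec R d)).
Local Notation smoothoo := (smoothoo (@basis_vec R d)).
Hypotheses (oU : open U) (cK : compact K) (clK : closed K) (KU : K `<=` U).
Hypothesis stau : forall j, smoothoo U (tau j).

(* vanishing off [K] makes the product of such an [a] with a function that is
   smooth on [U] only smooth everywhere *)
Definition cutoff (a : V -> R) := smoothoo U a /\ forall z, ~ K z -> a z = 0.

Lemma cutoff_smooth a : cutoff a -> smoothoo setT a.
Proof.
move=> [sa a0] k; have -> : [set: V] = U `|` ~` K.
  by apply/seteqP; split=> // z _; have [/KU|] := pselect (K z); [left|right].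
apply: smoothk_union => //.
apply: smoothk_eq (smoothk_cst (@basis_vec R d) (closed_openC clK) k 0).
  exact: closed_openC.
by move=> z /= /a0 ->.
Qed.

Lemma cutoff_mul a psi : cutoff a -> smoothoo U psi -> cutoff (fun z => a z * psi z).
Proof.
move=> [sa a0] sp; split=> [k|z /a0 ->]; last by rewrite mul0r.
exact: smoothk_mul.
Qed.

Lemma cutoff_D0 a l z : cutoff a -> ~ K z -> 'D_(basis_vec l) a z = 0.
Proof.
move=> [_ a0] Kz; rewrite (@near_eq_derive _ _ _ _ (cst (0 : R))) ?derive_cst//.
have : nbhs z (~` K) by apply: open_nbhs_nbhs; split=> //; exact: closed_openC.
by apply: filterS => y /a0.
Qed.

Lemma cutoff_D a l : cutoff a -> cutoff ('D_(basis_vec l) a).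
Proof.
move=> ca; split=> [k|z]; last exact: cutoff_D0.
by have [/(_ k.+1) s _] := ca; exact: (smoothk_D l s).
Qed.

Lemma cutoff_bnd a : cutoff a -> exists2 C : R, 0 <= C & forall z, `|a z| <= C.
Proof.
move=> ca; have [_ a0] := ca; apply: (bounded_compact_support cK) => //.
by apply: continuous_subspaceT; exact: smoothoo_continuous (cutoff_smooth ca).
Qed.

(** These products form a class closed under differentiation: a derivative falls on the cutoff, or
    raises one entry of [kap] and produces N times a derivative of [tau], which joins the cutoff.
    Bounds obtained inside the class are uniform in the position [m]. *)
Definition bumpf (kap : 'I_q -> nat) (a : V -> R) (N : R) (m : 'I_q -> R) (z : V) : R :=
  a z * \prod_(j < q) tower (@bump R) (kap j) (N * tau j z - m j).

Lemma smooth_bump_factor kap N m :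
  smoothoo U (fun z => \prod_(j < q) tower (@bump R) (kap j) (N * tau j z - m j)).
Proof.
move=> k; apply: smoothk_prod => // j.
have sl : smoothk k U (fun z => N * tau j z - m j).
  apply: smoothk_sub => //; last exact: smoothk_cst.
  by apply: smoothk_scale => //; exact: stau.
exact: (smoothk_comp oU (fun i x => is_derive_tower i x (@smooth1_bump R)) sl (kap j)).
Qed.

Lemma cutoff_bumpf kap a N m : cutoff a -> cutoff (bumpf kap a N m).
Proof. by move=> ca; apply: cutoff_mul => //; exact: smooth_bump_factor. Qed.

Lemma D_bumpf kap a N m l : cutoff a -> 'D_(basis_vec l) (bumpf kap a N m) =
  (fun z => bumpf kap ('D_(basis_vec l) a) N m z +
    \sum_(j < q) N * bumpf (fun i => kap i + (i == j))%N
       (fun z => a z * 'D_(basis_vec l) (tau j) z) N m z).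
Proof.
move=> ca; apply/funext => z.
have [Uz|Uz] := pselect (U z); last first.
  have Kz : ~ K z by move=> /KU.
  rewrite (cutoff_D0 _ (cutoff_bumpf kap N m ca) Kz) /bumpf cutoff_D0// mul0r add0r.
  by rewrite big1// => j _; rewrite ca.2// !mul0r mulr0.
have da := smoothk_is_derive l (ca.1 1%N) Uz.
have dt j : is_derive z (basis_vec l) (fun z => tower (@bump R) (kap j) (N * tau j z - m j))
    (tower (@bump R) (kap j).+1 (N * tau j z - m j) * (N * 'D_(basis_vec l) (tau j) z)).
  have dtau := smoothk_is_derive l (stau j 1%N) Uz.
  have du : is_derive z (basis_vec l) (fun z => N * tau j z - m j) (N * 'D_(basis_vec l) (tau j) z).
    have h := is_derive_add (is_derive_mul (is_derive_cst N z (basis_vec l)) dtau)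
       (is_derive_cst (- m j) z (basis_vec l)).
    by apply: (is_derive_eq h); rewrite mul0r add0r addr0.
  exact: (is_derive_chain (is_derive_tower (kap j) _ (@smooth1_bump R)) du).
have dp := is_derive_bigprod (index_enum_uniq _) dt.
have [_ ->] := is_derive_mul da dp.
congr (_ + _); rewrite mulr_sumr; apply: eq_bigr => j _.
rewrite /bumpf; set T := tower (@bump R) (kap j).+1 _.
rewrite [in RHS](bigD1 j)//= eqxx addn1 -/T.
have -> : \prod_(i < q | i != j) tower (@bump R) (kap i + (i == j))%N (N * tau i z - m i) =
    \prod_(i < q | i != j) tower (@bump R) (kap i) (N * tau i z - m i).
  by apply: eq_bigr => i /negbTE ->; rewrite addn0.
move: (\prod_(_ | _) _) T ('D_(basis_vec l) (tau j) z) => P T D; ring.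
Qed.

(** Induction on the innermost derivative, the last entry of [s], with [kap] and the cutoff
    generalized: by [D_bumpf] it leaves a sum of functions of the same kind, at the price of at most
    one factor N. *)
Lemma bumpf_pderivs_seq (s : seq 'I_d) kap a : cutoff a -> exists2 C : R, 0 <= C &
  forall N m z, 1 <= N -> `|pderivs s (bumpf kap a N m) z| <= C * N ^+ size s.
Proof.
elim/last_ind: s kap a => [|s l ih] kap a ca.
  have [C C0 aC] := cutoff_bnd ca.
  have /choice[c c0] (j : 'I_q) : exists c : R, 0 <= c /\
      forall t, `|tower (@bump R) (kap j) t| <= c.
    by have [c c0 h] := @tower_bump_bnd R (kap j); exists c.
  exists (C * \prod_(j < q) c j) => [|N m z _].
    by rewrite mulr_ge0// prodr_ge0// => j _; have [] := c0 j.
  rewrite expr0 mulr1 normrM ler_pM// normr_prod ler_prod// => j _.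
  by rewrite normr_ge0; have [_] := c0 j; apply.
have [C0 C00 hC0] := ih kap _ (cutoff_D l ca).
have caj j : cutoff (fun z => a z * 'D_(basis_vec l) (tau j) z).
  by apply: cutoff_mul => // k; exact: (smoothk_D l (stau j k.+1)).
have /choice[c c0] (j : 'I_q) : exists c : R, 0 <= c /\ forall N m z, 1 <= N ->
   `|pderivs s (bumpf (fun i => kap i + (i == j))%N
       (fun z => a z * 'D_(basis_vec l) (tau j) z) N m) z| <= c * N ^+ size s.
  by have [c c0 h] := ih (fun i => kap i + (i == j))%N _ (caj j); exists c.
exists (C0 + \sum_j c j) => [|N m z N1].
  by rewrite addr_ge0// sumr_ge0// => j _; have [] := c0 j.
have N0 : 0 <= N by exact: le_trans N1.
rewrite pderivs_rcons D_bumpf// pderivs_add; last 2 first.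
- exact: cutoff_smooth (cutoff_bumpf _ _ _ (cutoff_D l ca)).
- move=> k; apply: smoothk_sum => [|j]; first exact: openT.
  by apply: smoothk_scale; [exact: openT|exact: cutoff_smooth (cutoff_bumpf _ _ _ (caj j)) k].
rewrite pderivs_sum => [|j k]; last first.
  by apply: smoothk_scale; [exact: openT|exact: cutoff_smooth (cutoff_bumpf _ _ _ (caj j)) k].
rewrite size_rcons exprS mulrDl; apply: le_trans (ler_normD _ _) _; apply: lerD.
  by apply: le_trans (hC0 N m z N1) _; rewrite ler_wpM2l// ler_peMl// exprn_ge0.
rewrite mulr_suml; apply: le_trans (ler_norm_sum _ _ _) _; apply: ler_sum => j _.
rewrite pderivs_scale; last exact: cutoff_smooth (cutoff_bumpf _ _ _ (caj j)).
rewrite normrM ger0_norm// mulrCA ler_wpM2l//.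
by have [_ /(_ N m z N1)] := c0 j.
Qed.

Lemma bumpf_pderivs kap a (k : nat) : cutoff a -> exists2 C : R, 0 <= C &
  forall N m z (s : seq 'I_d), 1 <= N -> (size s <= k)%N ->
  `|pderivs s (bumpf kap a N m) z| <= C * N ^+ k.
Proof.
move=> ca; have /choice[c c0] (s : seq 'I_d) : exists c : R, 0 <= c /\
    forall N m z, 1 <= N -> `|pderivs s (bumpf kap a N m) z| <= c * N ^+ size s.
  by have [c c0 h] := bumpf_pderivs_seq s kap ca; exists c.
have cp s : 0 <= c s by have [] := c0 s.
exists (\sum_(j < k.+1) \sum_(t : j.-tuple 'I_d) c t) => [|N m z s N1 sk].
  by apply: sumr_ge0 => j _; apply: sumr_ge0 => t _.
have N0 : 0 <= N by exact: le_trans N1.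
have [_ /(_ N m z N1) h] := c0 s; apply: le_trans h _; apply: ler_pM => //.
- by rewrite exprn_ge0.
- rewrite (bigD1 (Ordinal (sk : (size s < k.+1)%N)))//= (bigD1 (in_tuple s))//= -addrA lerDl.
  by rewrite addr_ge0// sumr_ge0// => j _; apply: sumr_ge0 => t _.
- by rewrite ler_weXn2l.
Qed.

End bump_derivatives.

(** * Sobolev and Hoelder norms of test functions *)

Section test_functions.
Context (R : realType) (n : nat).
Local Notation V := 'rV[R]_n.
Local Notation lm := (lam R n).
Local Notation smoothoo := (smoothoo (@basis_vec R n)).

Lemma dotp_basis_vec l (xi : V) : dotp (basis_vec l) xi = xi 0 l.
Proof.
rewrite /dotp (bigD1 l)//= big1 => [|i il]; first by rewrite mxE !eqxx mul1r addr0.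
by rewrite mxE (negbTE il) andbF mul0r.
Qed.

Lemma is_derive_dotp (xi z : V) l :
  is_derive z (basis_vec l) (fun z : V => 2 * pi * dotp z xi) (2 * pi * xi 0 l).
Proof.
apply/is_derive_line.
rewrite (_ : (fun h : R => _) = (fun y : R => 2 * pi * xi 0 l * y + cst (2 * pi * dotp z xi) y)).
  have := is_derive_add (is_derive1_linear (2 * pi * xi 0 l) (0 : R))
    (is_derive_cst (2 * pi * dotp z xi : R) (0 : R) (1 : R)).
  by rewrite addr0.
by apply/funext => y; rewrite dotpDl dotpZl dotp_basis_vec mulrDr; congr (_ + _); rewrite mulrCA mulrC.
Qed.

Lemma lipschitz_line (g g' : V -> R) (l : 'I_n) (D : R) :
  (forall z, is_derive z (basis_vec l) g (g' z)) -> (forall z, `|g' z| <= D) ->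
  forall (w : V) (c : R), `|g (w + c *: basis_vec l) - g w| <= D * `|c|.
Proof.
move=> dg gD w c.
have dl (h : R) : is_derive h (1 : R) (fun h : R => g (w + h *: basis_vec l)) (g' (w + h *: basis_vec l)).
  have /is_derive_line H := dg (w + h *: basis_vec l).
  have dsh : is_derive h (1 : R) (fun y : R => y - h) 1.
    by apply: (is_derive_eq (is_derive_add (is_derive_id h (1 : R)) (is_derive_cst (- h) h (1 : R)))); rewrite addr0.
  have := @is_derive1_chain _ (fun h0 : R => g (h0 *: basis_vec l + (w + h *: basis_vec l))) (fun y => y - h) h _ _ _ dsh.
  rewrite subrr => /(_ _ H); rewrite mulr1.
  rewrite (_ : (fun y => _) = (fun h0 : R => g (w + h0 *: basis_vec l)))//.
  by apply/funext => y; congr g; rewrite scalerBl addrCA subrK.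
have := is_derive1_lipschitz dl (fun x => gD _) c 0.
by rewrite scale0r addr0 subr0.
Qed.

Lemma lipschitz_pderiv (g : V -> R) (g' : 'I_n -> V -> R) (D : R) :
  (forall l z, is_derive z (basis_vec l) g (g' l z)) -> (forall l z, `|g' l z| <= D) ->
  forall z z', `|g z - g z'| <= n%:R * D * `|z - z'|.
Proof.
move=> dg gD z z'.
have line l := lipschitz_line (dg l) (gD l).
have path (s : seq 'I_n) (w : V) (c : 'I_n -> R) :
    `|g (w + \sum_(l <- s) c l *: basis_vec l) - g w| <= \sum_(l <- s) (D * `|c l|).
  elim: s w => [|l s ih] w; first by rewrite !big_nil addr0 subrr normr0.
  rewrite !big_cons addrA; apply: le_trans (ler_distD (g (w + c l *: basis_vec l)) _ _) _.
  by rewrite [leRHS]addrC lerD.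
have := path (index_enum _) z' (fun l => (z - z') 0 l).
have -> : \sum_l (z - z') 0 l *: basis_vec l = z - z' by rewrite -row_sum_delta.
rewrite (addrC z') subrK => h; apply: le_trans h _.
apply: (@le_trans _ _ (\sum_(l < n) (D * `|z - z'|))).
  apply: ler_sum => l _; rewrite ler_wpM2l ?rV_coord_le//.
  exact: le_trans (normr_ge0 _) (gD l z).
by rewrite sumr_const card_ord -mulrA [leRHS]mulr_natl.
Qed.

Lemma intg_indic_cbox r : intg lm \1_(@cbox R n r).
Proof.
apply: (@intg_cbox _ _ _ 1 r) => [|z|z zr].
- by apply: measurable_indic; exact: measurable_cbox.
- by rewrite indicE; case: (_ \in _); rewrite ?normr1 ?normr0.
- by rewrite indicE memNset// /cbox /= => h0; rewrite ltNge h0 in zr.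
Qed.

(** Difference quotients have integral zero by translation invariance. The bound on the derivative
    dominates them and the support bound confines them to a slightly larger box, so the integral
    passes to the limit. *)
Lemma Rint_partial_eq0 (h h' : borel V -> R) (l : 'I_n) (C r : R) :
  measurable_fun setT h -> (forall z : V, is_derive z (basis_vec l) (h : V -> R) (h' z)) ->
  intg lm h -> (forall z, `|h' z| <= C) ->
  (forall z : V, r < `|z| -> h z = 0) -> intg lm h' /\ \int[lm]_z h' z = 0.
Proof.
move=> mh dh hi hC hr.
have C0 : 0 <= C by exact: le_trans (normr_ge0 _) (hC 0).
pose t (k : nat) : R := k.+1%:R^-1.
have t0 k : 0 < t k by rewrite invr_gt0 ltr0n.
pose e := basis_vec l : V.
pose q k (z : borel V) : R := (t k)^-1 * (h (t k *: e + (z : V)) - h z).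
have qi k : intg lm (q k) by apply: intgZ; apply: intgB => //; exact: intg_shift.
have q0 k : \int[lm]_z q k z = 0.
  rewrite /q RintZ; last by apply: intgB => //; exact: intg_shift.
  by rewrite RintB//; [rewrite Rint_shift// subrr mulr0|exact: intg_shift].
have qcv z : q k z @[k --> \oo] --> h' z.
  have [dz dE] := dh z.
  have tc : t @ \oo --> (0 : R)^'.
    move=> A nA; have nA' : nbhs (0 : R) [set y | y != 0 -> A y] by [].
    have nh : \forall k \near \oo, [set y | y != 0 -> A y] (t k) := @cvg_harmonic R _ nA'.
    by apply: filterS nh => k; apply; rewrite gt_eqF.
  have := cvg_comp _ _ tc (dz : cvg _); rewrite -/(derive _ _ _) -dE.
  by apply: cvg_trans; apply: near_eq_cvg; near=> k.
have e1 : `|e| <= 1.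
  by apply: rV_norm_le => // i; rewrite mxE eqxx /=; case: (_ == _); rewrite ?normr1 ?normr0.
have qb k z : `|q k z| <= C * \1_(cbox (r + 1)) z.
  rewrite indicE; case: (boolP (z \in _)) => [_|].
    rewrite mulr1 /q normrM gtr0_norm ?invr_gt0// mulrC ler_pdivrMr//.
    by have := lipschitz_line dh hC z (t k); rewrite (gtr0_norm (t0 k)) [X in h X]addrC.
  rewrite notin_setE /cbox /= => /negP; rewrite -ltNge => zr.
  rewrite mulr0 /q !hr ?subrr ?mulr0 ?normr0//.
    by apply: lt_trans zr; rewrite ltrDl.
  have t1 : t k <= 1 by rewrite /t invf_le1 ?ltr0n// ler1n.
  have : `|z : V| <= `|t k *: e + (z : V)| + `|t k *: e|.
    by rewrite -[X in `|X| <= _](addKr (t k *: e)) addrC -(normrN (t k *: e)) ler_normD.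
  rewrite normrZ gtr0_norm//.
  have : t k * `|e| <= 1 by rewrite mulr_ile1// ltW.
  lra.
have gi : intg lm (fun z => C * \1_(cbox (r + 1)) z).
  by apply: intgZ; exact: intg_indic_cbox.
have [ih'] := Rint_dct (fun k => intg_meas (qi k)) qcv qb gi.
under eq_fun do rewrite q0.
by move=> /(cvg_unique (@Rhausdorff R) (cvg_cst (0 : R))) <-.
Unshelve. all: by end_near. Qed.

(** Integration by parts against cosine and sine: [key] integrates the derivative of f times phi(2
    pi z.xi) for both functions phi at once. *)
Lemma fourier_sqmod_partial (f f' : borel V -> R) (l : 'I_n) (D r : R) (xi : V) :
  measurable_fun setT f -> (forall z : V, is_derive z (basis_vec l) (f : V -> R) (f' z)) ->
  intg lm f -> (forall z, `|f z| <= D) -> (forall z, `|f' z| <= D) ->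
  (forall z : V, r < `|z| -> f z = 0) ->
  intg lm f' /\ fourier_sqmod f' xi = (2 * pi * xi 0 l) ^+ 2 * fourier_sqmod f xi.
Proof.
move=> mf df fi fD f'D fr; have [f'i _] := Rint_partial_eq0 mf df fi f'D fr.
split=> //; rewrite (fourier_sqmodE f'i) (fourier_sqmodE fi).
set c := 2 * pi * xi 0 l.
have key (phi phi' : R -> R) : (forall x, is_derive x (1 : R) phi (phi' x)) ->
    (forall x, `|phi x| <= 1) -> (forall x, `|phi' x| <= 1) ->
    intg lm (fun z => f z * phi (2 * pi * dotp z xi)) ->
    intg lm (fun z => f' z * phi (2 * pi * dotp z xi)) ->
    intg lm (fun z => f z * phi' (2 * pi * dotp z xi)) ->
    \int[lm]_z (f' z * phi (2 * pi * dotp z xi)) =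
      - (c * \int[lm]_z (f z * phi' (2 * pi * dotp z xi))).
  move=> dphi phi1 phi'1 i1 i2 i3.
  pose h (z : borel V) := f z * phi (2 * pi * dotp z xi).
  pose h' (z : borel V) := f' z * phi (2 * pi * dotp z xi) + c * (f z * phi' (2 * pi * dotp z xi)).
  have dh (z : V) : is_derive z (basis_vec l) (h : V -> R) (h' z).
    have dc := @is_derive_chain _ _ phi (fun z : V => 2 * pi * dotp z xi) z _ _ _
      (dphi _) (is_derive_dotp xi z l).
    apply: (is_derive_eq (is_derive_mul (df z) dc)); rewrite /h' -/c /=; ring.
  have bh z : `|h' z| <= D + `|c| * D.
    apply: le_trans (ler_normD _ _) _; rewrite !normrM lerD//.
      by apply: le_trans (f'D z); rewrite ler_piMr.
    by rewrite ler_wpM2l//; apply: le_trans (fD z); rewrite ler_piMr.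
  have hr (z : V) : r < `|z| -> h z = 0 by move=> /fr; rewrite /h => ->; rewrite mul0r.
  have [_] := Rint_partial_eq0 (intg_meas i1) dh i1 bh hr.
  by rewrite /h' RintD//; [rewrite RintZ// => /eqP; rewrite addr_eq0 => /eqP|exact: intgZ].
have cs := key cos (fun x => - sin x) (@is_derive_cos R) (@cos_max R).
have sn := key sin cos (@is_derive_sin R) (@sin_max R) (@cos_max R)
  (intg_sind fi xi) (intg_sind f'i xi) (intg_cosd fi xi).
have {}cs := cs _ (intg_cosd fi xi) (intg_cosd f'i xi) _.
rewrite /fcos /fsin cs.
- rewrite sn; under eq_Rint do rewrite mulrN.
  by rewrite RintN; [ring|exact: intg_sind].
- by move=> x; rewrite normrN sin_max.
- by have := intgN (intg_sind fi xi); apply: intg_eq => z; rewrite mulrN.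
Qed.

Lemma fourier_sqmod_le (f : borel V -> R) (xi : V) : intg lm f ->
  fourier_sqmod f xi <= 2 * (\int[lm]_z `|f z|) ^+ 2.
Proof.
move=> fi; rewrite fourier_sqmodE// mulr_natl mulr2n lerD//.
  by rewrite -[leLHS]real_normK ?num_real// lerXn2r ?nnegrE ?Rint_ge0 ?fcos_le.
by rewrite -[leLHS]real_normK ?num_real// lerXn2r ?nnegrE ?Rint_ge0 ?fsin_le.
Qed.

Lemma fourier_sqmod_cbox (g : borel V -> R) (D r : R) (xi : V) :
  (forall z, `|g z| <= D) -> (forall z : V, r < `|z| -> g z = 0) -> intg lm g ->
  fourier_sqmod g xi <= 2 * (D * fine (lm (cbox r))) ^+ 2.
Proof.
move=> gD gr gi; have D0 : 0 <= D by exact: le_trans (gD 0).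
apply: le_trans (fourier_sqmod_le _ gi) _.
rewrite ler_wpM2l// lerXn2r ?nnegrE ?Rint_ge0//; first by rewrite mulr_ge0// fine_ge0.
rewrite -Rint_indic; last exact: measurable_cbox.
rewrite -RintZ; last exact: intg_indic_cbox.
apply: Rint_le => [||z]; [exact: intg_norm gi|exact: intgZ (intg_indic_cbox r)|].
rewrite indicE; case: (boolP (z \in _)) => [_|]; first by rewrite mulr1.
by rewrite notin_setE /cbox /= => /negP; rewrite -ltNge => /gr ->; rewrite normr0 mulr0.
Qed.

Lemma pderivs_support (f : V -> R) (r : R) (s : seq 'I_n) :
  (forall z, r < `|z| -> f z = 0) -> forall z, r < `|z| -> pderivs s f z = 0.
Proof.
move=> fr; elim: s => //= l s ih z zr.
rewrite (@near_eq_derive _ _ _ _ (cst (0 : R))) ?derive_cst//.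
have oz : open [set z : V | r < `|z|].
  apply: (open_comp (f := fun z : V => `|z|) (D := [set y | r < y])) => [y _|].
    exact: norm_continuous.
  exact: open_gt.
by apply: filterS (open_nbhs_nbhs (conj oz zr)) => y /ih.
Qed.

(** The common currency of the estimates on atoms: a single bound of this type controls Sobolev
    norms of any order and Hoelder norms, and it passes to tensor products. *)
Definition test_bound (k : nat) (r D : R) (f : V -> R) :=
  [/\ smoothoo setT f, (forall z, r < `|z| -> f z = 0) &
      forall s z, (size s <= k)%N -> `|pderivs s f z| <= D].

Lemma test_bound_fourier (k : nat) (r D : R) (f : borel V -> R) (l : 'I_n) (xi : V) :
  test_bound k r D f ->
  (2 * pi * xi 0 l) ^+ (2 * k) * fourier_sqmod f xi <= 2 * (D * fine (lm (cbox r))) ^+ 2.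
Proof.
move=> [sf fr fD]; have D0 : 0 <= D by exact: le_trans (fD [::] 0 _).
have fi j : (j <= k)%N -> intg lm (pderivs (nseq j l) f : borel V -> R).
  move=> jk; apply: (@intg_cbox _ _ _ D r).
  - by apply: continuous_borel_real; exact: smoothoo_continuous (smoothoo_pderivs _ sf).
  - by move=> z; apply: fD; rewrite size_nseq.
  - exact: pderivs_support.
have E j : (j <= k)%N ->
    fourier_sqmod (pderivs (nseq j l) f) xi = (2 * pi * xi 0 l) ^+ (2 * j) * fourier_sqmod f xi.
  elim: j => [_|j ih jk]; first by rewrite muln0 expr0 mul1r.
  have [] := @fourier_sqmod_partial (pderivs (nseq j l) f) (pderivs (nseq j.+1 l) f) l D r xi.
  - exact: intg_meas (fi _ (ltnW jk)).
  - by move=> z; apply: smoothoo_is_derive; exact: smoothoo_pderivs.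
  - exact: fi (ltnW jk).
  - by move=> z; apply: fD; rewrite size_nseq ltnW.
  - by move=> z; apply: fD; rewrite size_nseq.
  - exact: pderivs_support.
  - by move=> _ ->; rewrite ih ?(ltnW jk)// mulrA -exprD mulnS.
rewrite -E//; apply: fourier_sqmod_cbox.
- by move=> z; apply: fD; rewrite size_nseq.
- exact: pderivs_support.
- exact: fi.
Qed.

Lemma test_bound_fourier_norm (k : nat) (r D : R) (f : borel V -> R) (xi : V) :
  test_bound k r D f -> fourier_sqmod f xi <= 2 * (D * fine (lm (cbox r))) ^+ 2.
Proof.
move=> [sf fr fD]; have fD0 z : `|f z| <= D by exact: (fD [::] z).
apply: fourier_sqmod_cbox => //; apply: (@intg_cbox _ _ _ D r) => //.
by apply: continuous_borel_real; exact: smoothoo_continuous sf.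
Qed.

(** One derivative beyond order k pays for the Hoelder quotient: at distance at most 1 it is a
    Lipschitz bound, at larger distances the two values are bounded separately. *)
Lemma test_bound_holder (k : nat) (b r D : R) (f : V -> R) : 0 <= b <= 1 ->
  test_bound k.+1 r D f -> (holder_norm_Rd k b f <= ((n%:R + 3) * D)%:E)%E.
Proof.
move=> /andP[b0 b1] [sf fr fD]; have D0 : 0 <= D by exact: le_trans (fD [::] 0 _).
rewrite (_ : (n%:R + 3) * D = D + (n%:R + 2) * D); last by ring.
rewrite EFinD; apply: leeD.
  apply: ge_ereal_sup => _ [a ak [z _ <-]]; rewrite lee_fin; apply: fD.
  by rewrite ltnW// ltnS.
rewrite ge_max lee_fin mulr_ge0 ?addr_ge0//=.
apply: ge_ereal_sup => _ [a [z [z' [ak ->]]]]; rewrite lee_fin.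
have [zz|zz] := eqVneq z z'; first by rewrite zz subrr normr0 mul0r mulr_ge0 ?addr_ge0.
have d0 : 0 < `|z - z'| by rewrite normr_gt0 subr_eq0.
rewrite ler_pdivrMr ?powR_gt0//.
have [d1|d1] := leP `|z - z'| 1.
  apply: (@le_trans _ _ (n%:R * D * `|z - z'|)).
    apply: (@lipschitz_pderiv _ (fun l => 'D_(basis_vec l) (pderivs a f))) => l w.
      by apply: smoothoo_is_derive; exact: smoothoo_pderivs.
    by apply: (fD (l :: a)); rewrite /= ak.
  apply: ler_pM; rewrite ?mulr_ge0//; first by rewrite ler_wpM2r// lerDl.
  by rewrite -[leLHS]powRr1// ger_powR// d0.
apply: (@le_trans _ _ (D + D)).
  by apply: le_trans (ler_normB _ _) _; rewrite lerD// fD// ak.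
rewrite -mulrA mulrDl -mulr2n -[X in X <= _]mulr_natl ler_wpDl// ?mulr_ge0 ?powR_ge0//.
by rewrite ler_wpM2l// ler_peMr// -(powRr0 `|z - z'|) ler_powR// ltW.
Qed.

End test_functions.

Section sobolev_test_bound.
Context (R : realType) (n : nat).
Local Notation V := 'rV[R]_n.
Local Notation lm := (lam R n).
Local Notation mu1 := (@lebesgue_measure R).

Let cauchy (t : R) : R := (1 + t ^+ 2)^-1.

Let cauchy_gt0 t : 0 < cauchy t.
Proof. by rewrite invr_gt0 ltr_wpDr ?sqr_ge0. Qed.

Lemma intg_cauchy : intg mu1 (fun t : R => (1 + t ^+ 2)^-1).
Proof.
have mc : measurable_fun setT cauchy.
  by apply: continuous_measurable_fun; exact: continuous_oneDsqrV.
pose g (t : R) := cauchy t * \1_(`[0, +oo[%classic : set R) t.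
have g0 t : 0 <= g t by rewrite mulr_ge0 ?(ltW (cauchy_gt0 t))// indicE.
have mg : measurable_fun setT g.
  by apply: measurable_funM => //; apply: measurable_indic; exact: measurable_itv.
have gi : intg mu1 g.
  apply: intg_le_lty => //.
  rewrite (_ : (\int[mu1]_t (g t)%:E = (pi / 2)%:E)%E) ?ltry//.
  rewrite -integral0y_oneDsqr [RHS]integral_mkcond; apply: eq_integral => t _.
  rewrite /g indicE patchE; case: (t \in _); rewrite ?mulr1 ?mulr0//.
have gi' : intg mu1 (fun t => g (- t)).
  apply: intg_le_lty => //; first by apply: measurableT_comp mg _; exact: oppr_measurable.
  have h := @integral_lebesgue_sym R true 0 (EFin \o g) ((measurable_EFinP _ _).2 mg)
    (fun y => eq_ind_r is_true (g0 y) (lee_fin _ _)).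
  rewrite [X in (X < _)%E](_ : _ = (\int[mu1]_t (EFin \o g) (0 + (-1) ^+ true * t)%R)%E).
    by rewrite -h -EFin_Rint// ltry.
  by apply: eq_integral => t _ /=; rewrite add0r expr1 mulN1r.
apply: intg_dom (intgD gi gi') => // t; rewrite ger0_norm ?(ltW (cauchy_gt0 t))//.
rewrite /g !indicE; have [t0|t0] := leP 0 t.
  rewrite mem_set/=; last by rewrite in_itv/= t0.
  by rewrite mulr1 lerDl mulr_ge0// ltW.
have -> : - t \in (`[0, +oo[%classic : set R).
  by rewrite mem_set//= in_itv/= oppr_ge0 ltW.
by rewrite mulr1 /cauchy sqrrN lerDr mulr_ge0// invr_ge0 addr_ge0 ?sqr_ge0.
Qed.

(* dominating the weight by [prod_l (1 + xi_l^2)^-1] up to one high power of a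
   single frequency *)
Lemma sobolev_weight_le (p : R) : 0 <= p -> exists (Q : nat) (C : R), 0 <= C /\
  forall xi : V, (1 + (2 * pi) ^+ 2 * dotp xi xi) `^ p * \prod_l (1 + xi 0 l ^+ 2) <=
    C * (1 + \sum_l (2 * pi * xi 0 l) ^+ (2 * Q)).
Proof.
(* [P] powers of the squared frequency dominate the Sobolev weight, and [n] further ones the product
   of the Cauchy factors. *)
move=> p0; pose P := (Num.truncn p).+1; pose Q := (P + n)%N.
have pP : p <= P%:R by rewrite ltW// truncnS_gt.
pose c := 1 + (2 * pi) ^+ 2 * n%:R : R.
have c1 : 1 <= c by rewrite lerDl mulr_ge0 ?sqr_ge0.
exists Q, (c ^+ P * 2 ^+ n); split=> [|xi]; first by rewrite mulr_ge0 ?exprn_ge0// (le_trans ler01).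
pose M := Num.max 1 `|xi|.
have M1 : 1 <= M by rewrite le_max lexx.
have M0 : 0 <= M by exact: le_trans M1.
have M2 : 1 <= M ^+ 2 by rewrite -[X in X <= _](expr1n _ 2) ler_sqr ?nnegrE.
have xM l : `|xi 0 l| <= M by rewrite le_max rV_coord_le orbT.
have x2 l : xi 0 l ^+ 2 <= M ^+ 2 by rewrite -[leLHS]real_normK ?num_real// ler_sqr ?nnegrE.
have w1 : 1 <= 1 + (2 * pi) ^+ 2 * dotp xi xi by rewrite lerDl mulr_ge0 ?sqr_ge0 ?dotp_ge0.
apply: (@le_trans _ _ ((c * M ^+ 2) ^+ P * (2 * M ^+ 2) ^+ n)).
  apply: ler_pM; rewrite ?powR_ge0//.
  - by apply: prodr_ge0 => l _; rewrite addr_ge0 ?sqr_ge0.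
  - apply: (@le_trans _ _ ((1 + (2 * pi) ^+ 2 * dotp xi xi) `^ P%:R)).
      by rewrite ler_powR.
    rewrite powR_mulrn ?(le_trans ler01)//; apply: lerXn2r; rewrite ?nnegrE ?(le_trans ler01 w1)//.
      by rewrite mulr_ge0 ?sqr_ge0// (le_trans ler01).
    rewrite [leRHS](_ : _ = M ^+ 2 + (2 * pi) ^+ 2 * (n%:R * M ^+ 2)); last by rewrite /c; ring.
    apply: lerD => //; rewrite ler_wpM2l ?sqr_ge0//.
    apply: le_trans (ler_sum _ (fun l _ => x2 l)) _.
    by rewrite sumr_const card_ord mulr_natl.
  - rewrite -[X in _ ^+ X]card_ord -prodr_const; apply: ler_prod => l _.
    rewrite addr_ge0 ?sqr_ge0//=; have := x2 l; lra.
rewrite !exprMn mulrACA ler_wpM2l ?mulr_ge0 ?exprn_ge0 ?(le_trans ler01 c1)//.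
rewrite [leLHS](_ : _ = (M ^+ 2) ^+ Q); last by rewrite expr2 exprMn !exprD; ring.
rewrite /M; case: (leP 1 `|xi|) => [x1|x1]; last first.
  by rewrite !expr1n lerDl sumr_ge0// => l _; rewrite exprM exprn_ge0 ?sqr_ge0.
have [l xl] : exists l, `|xi| <= `|xi 0 l|.
  apply: contrapT => /forallNP h.
  have : `|xi| < `|xi|; last by rewrite ltxx.
  apply: rV_norm_lt => [|l]; first exact: lt_le_trans x1.
  by rewrite ltNge; apply/negP; exact: h.
rewrite (bigD1 l)//= addrCA ler_wpDr//.
  by rewrite addr_ge0// sumr_ge0// => i _; rewrite exprM exprn_ge0 ?sqr_ge0.
rewrite exprM; apply: lerXn2r; rewrite ?nnegrE ?sqr_ge0//.
rewrite exprMn -(real_normK (num_real (xi 0 l))).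
apply: (@le_trans _ _ (`|xi 0 l| ^+ 2)); first by rewrite ler_sqr ?nnegrE.
rewrite ler_peMl ?sqr_ge0//; have := pi_ge2 R; nra.
Qed.

(** By [sobolev_weight_le] and the decay of the transform that [Q] derivatives in one direction
    give, the weighted transform lies below a multiple of a product of Cauchy densities, which is
    integrable. *)
Lemma test_bound_sobolev (p r : R) : 0 <= p -> exists (Q : nat) (C : R), 0 <= C /\
  forall (f : borel V -> R) D, test_bound Q r D f ->
    (sobolev_sqnorm_Rd p f <= (C * D ^+ 2)%:E)%E.
Proof.
move=> p0; have [Q [C [C0 hC]]] := sobolev_weight_le p0.
pose v := fine (lm (cbox r)); pose J : R := \int[lm]_z \prod_l cauchy (z 0 l).
have v0 : 0 <= v by rewrite fine_ge0.
have [ci _] := @integral_lam_prod R n (fun=> cauchy) (fun=> intg_meas intg_cauchy)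
  (fun _ t => ltW (cauchy_gt0 t)) (fun=> intg_cauchy).
have J0 : 0 <= J by apply: Rint_ge0 => z; apply: prodr_ge0 => l _; rewrite ltW.
exists Q, (C * (2 * v ^+ 2 * (1 + n%:R)) * J); split.
  by rewrite !mulr_ge0 ?sqr_ge0 ?addr_ge0.
move=> f D ft; have [sf fr fD] := ft; have D0 : 0 <= D by exact: le_trans (fD [::] 0 _).
have fi : intg lm f.
  apply: (@intg_cbox _ _ _ D r) => //; last by move=> z; exact: (fD [::] z).
  by apply: continuous_borel_real; exact: smoothoo_continuous sf.
have B (xi : borel V) : (1 + (2 * pi) ^+ 2 * dotp xi xi) `^ p * fourier_sqmod f xi <=
    C * (2 * v ^+ 2 * (1 + n%:R)) * D ^+ 2 * \prod_l cauchy (xi 0 l).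
  have F0 := fourier_sqmod_ge0 fi xi.
  have c0 : 0 < \prod_l (1 + (xi : V) 0 l ^+ 2) by apply: prodr_gt0 => l _; rewrite ltr_wpDr ?sqr_ge0.
  rewrite prodfV ler_pdivlMr// mulrAC.
  apply: le_trans (ler_wpM2r F0 (hC xi)) _; rewrite -[leLHS]mulrA -[leRHS]mulrA ler_wpM2l//.
  rewrite mulrDl mul1r mulr_suml.
  have Dv : (D * v) ^+ 2 *+ 2 = 2 * (v ^+ 2 * D ^+ 2) by ring.
  rewrite [leRHS](_ : _ = (D * v) ^+ 2 *+ 2 + \sum_(l < n) (D * v) ^+ 2 *+ 2); last first.
    by rewrite sumr_const card_ord -[X in _ + X]mulr_natl; ring.
  apply: lerD.
    by have := test_bound_fourier_norm xi ft; rewrite mulr_natl.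
  by apply: ler_sum => l _; have := test_bound_fourier l xi ft; rewrite [leRHS]mulr_natl.
have mw : measurable_fun setT (fun xi : borel V =>
    (1 + (2 * pi) ^+ 2 * dotp xi xi) `^ p * fourier_sqmod f xi).
  apply: measurable_funM; last exact: measurable_fourier_sqmod.
  apply: (measurableT_comp (measurable_powR p)); apply: measurable_funD => //.
  by apply: measurable_funM => //; exact: (@measurable_dotp2 _ _ _ _ id id).
have w0 (xi : borel V) : 0 <= (1 + (2 * pi) ^+ 2 * dotp xi xi) `^ p * fourier_sqmod f xi.
  by rewrite mulr_ge0 ?powR_ge0 ?fourier_sqmod_ge0.
rewrite /sobolev_sqnorm_Rd -lamE//; last exact/measurable_EFinP.
rewrite mulrAC -RintZ//.
have wi : intg lm (fun xi : borel V => (1 + (2 * pi) ^+ 2 * dotp xi xi) `^ p * fourier_sqmod f xi).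
  apply: intg_dom (intgZ (C * (2 * v ^+ 2 * (1 + n%:R)) * D ^+ 2) ci) => // xi.
  by rewrite ger0_norm.
by rewrite -EFin_Rint// lee_fin; apply: Rint_le => //; exact: intgZ.
Qed.

End sobolev_test_bound.

(** * Tensor products of functions and their derivatives *)

Section tensor_products.
Context (R : realType) (d d' : nat).
Local Notation V := 'rV[R]_d.
Local Notation V' := 'rV[R]_d'.
Local Notation W := 'rV[R]_(d + d').

Definition tensor (f : V -> R) (g : V' -> R) (z : W) : R := f (lsubmx z) * g (rsubmx z).

Lemma lsubmx_basis_vec l (h : R) (z : W) :
  lsubmx (h *: basis_vec (lshift d' l) + z) = h *: basis_vec l + lsubmx z.
Proof. by apply/rowP => i; rewrite !mxE !eqxx (inj_eq (@lshift_inj _ _)). Qed.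

Lemma rsubmx_basis_vecl l (h : R) (z : W) :
  rsubmx (h *: basis_vec (lshift d' l) + z) = rsubmx z.
Proof. by apply/rowP => i; rewrite !mxE eq_rlshift andbF mulr0 add0r. Qed.

Lemma rsubmx_basis_vec l (h : R) (z : W) :
  rsubmx (h *: basis_vec (rshift d l) + z) = h *: basis_vec l + rsubmx z.
Proof. by apply/rowP => i; rewrite !mxE !eqxx (inj_eq (@rshift_inj _ _)). Qed.

Lemma lsubmx_basis_vecr l (h : R) (z : W) :
  lsubmx (h *: basis_vec (rshift d l) + z) = lsubmx z.
Proof. by apply/rowP => i; rewrite !mxE eq_lrshift andbF mulr0 add0r. Qed.

(** A coordinate of the product space belongs to one factor only; [ltensor] and [rtensor] together
    differentiate that factor and leave the other one alone. *)
Definition ltensor (i : 'I_(d + d')) (f : V -> R) : V -> R :=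
  if fintype.split i is inl l then 'D_(basis_vec l) f else f.
Definition rtensor (i : 'I_(d + d')) (g : V' -> R) : V' -> R :=
  if fintype.split i is inr l then 'D_(basis_vec l) g else g.

Lemma smoothoo_ltensor i f : smoothoo (@basis_vec R d) setT f ->
  smoothoo (@basis_vec R d) setT (ltensor i f).
Proof. by rewrite /ltensor; case: fintype.split => // l; exact: smoothoo_D. Qed.

Lemma smoothoo_rtensor i g : smoothoo (@basis_vec R d') setT g ->
  smoothoo (@basis_vec R d') setT (rtensor i g).
Proof. by rewrite /rtensor; case: fintype.split => // l; exact: smoothoo_D. Qed.

Lemma is_derive_tensor f g i z :
  smoothoo (@basis_vec R d) setT f -> smoothoo (@basis_vec R d') setT g ->
  is_derive z (basis_vec i) (tensor f g) (tensor (ltensor i f) (rtensor i g) z).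
Proof.
move=> sf sg; apply/is_derive_line; rewrite /ltensor /rtensor /tensor.
rewrite -[i in basis_vec i](fintype.splitK i); case: (fintype.split i) => l /=.
  rewrite (_ : (fun h : R => _) = (fun h : R => f (h *: basis_vec l + lsubmx z) * cst (g (rsubmx z)) h)); last first.
    by apply/funext => h; rewrite lsubmx_basis_vec rsubmx_basis_vecl.
  have /is_derive_line df := smoothoo_is_derive l (lsubmx z) sf.
  apply: (is_derive_eq (is_derive1_mul df (is_derive_cst (g (rsubmx z)) (0 : R) (1 : R)))).
  by rewrite mulr0 addr0.
rewrite (_ : (fun h : R => _) = (fun h : R => cst (f (lsubmx z)) h * g (h *: basis_vec l + rsubmx z))); last first.
  by apply/funext => h; rewrite rsubmx_basis_vec lsubmx_basis_vecr.
have /is_derive_line dg := smoothoo_is_derive l (rsubmx z) sg.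
apply: (is_derive_eq (is_derive1_mul (is_derive_cst (f (lsubmx z)) (0 : R) (1 : R)) dg)).
by rewrite mul0r add0r.
Qed.

Lemma smoothoo_tensor f g : smoothoo (@basis_vec R d) setT f ->
  smoothoo (@basis_vec R d') setT g -> smoothoo (@basis_vec R (d + d')) setT (tensor f g).
Proof.
have ct f0 g0 : smoothoo (@basis_vec R d) setT f0 -> smoothoo (@basis_vec R d') setT g0 ->
    continuous (tensor f0 g0).
  move=> sf sg z; apply: continuousM; apply: continuous_comp.
  - exact: continuous_lsubmx.
  - exact: smoothoo_continuous.
  - exact: continuous_rsubmx.
  - exact: smoothoo_continuous.
move=> sf sg k; elim: k f g sf sg => [|k ih] f g sf sg.
  by split=> // z _; exact: ct.
apply: (@smoothk_der _ _ _ _ _ openT k _ (fun i => tensor (ltensor i f) (rtensor i g))).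
- by move=> z _; exact: ct.
- by move=> i z _; exact: is_derive_tensor.
- by move=> i; apply: ih; [exact: smoothoo_ltensor|exact: smoothoo_rtensor].
Qed.

Lemma pderivs_tensor (s : seq 'I_(d + d')) f g : smoothoo (@basis_vec R d) setT f ->
  smoothoo (@basis_vec R d') setT g -> exists a b, [/\ (size a <= size s)%N,
   (size b <= size s)%N & pderivs s (tensor f g) = tensor (pderivs a f) (pderivs b g)].
Proof.
move=> sf sg; elim: s => [|i s [a [b [sa sb E]]]]; first by exists [::], [::].
have D : pderivs (i :: s) (tensor f g) =
    tensor (ltensor i (pderivs a f)) (rtensor i (pderivs b g)).
  rewrite /= -/(pderivs s _) E; apply/funext => z.
  by have [_ ->] := is_derive_tensor i z (smoothoo_pderivs a sf) (smoothoo_pderivs b sg).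
rewrite D /ltensor /rtensor; case: fintype.split => l.
  by exists (l :: a), b; split; [exact: sa|exact: leqW|].
by exists a, (l :: b); split; [exact: leqW|exact: sb|].
Qed.

Lemma test_bound_tensor k r D D' f g : test_bound k r D f -> test_bound k r D' g ->
  test_bound k r (D * D') (tensor f g).
Proof.
move=> [sf fr fD] [sg gr gD]; split=> [|z zr|s z sk]; first exact: smoothoo_tensor.
  rewrite /tensor; have [/fr ->|lz] := ltP r `|lsubmx z|; first by rewrite mul0r.
  have [/gr ->|rz] := ltP r `|rsubmx z|; first by rewrite mulr0.
  have r0 : 0 <= r by exact: le_trans lz.
  have : `|z| <= r; last by rewrite leNgt zr.
  apply: rV_norm_le => // i; rewrite -(fintype.splitK i); case: (fintype.split i) => l /=.
    by have := rV_coord_le (lsubmx z) l; rewrite mxE => /le_trans; apply.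
  by have := rV_coord_le (rsubmx z) l; rewrite mxE => /le_trans; apply.
have [a [b [sa sb ->]]] := pderivs_tensor s sf sg.
by rewrite /tensor normrM ler_pM// ?fD ?gD// (leq_trans _ sk).
Qed.

Lemma smoothk_lsubmx k (U : set V) (W : set 'rV[R]_(d + d')) (f : V -> R) : open U -> open W ->
  (forall z, W z -> U (lsubmx z)) -> smoothk (@basis_vec R d) k U f ->
  smoothk (@basis_vec R (d + d')) k W (f \o lsubmx).
Proof.
move=> oU oW WU; have cc (h : V -> R) z : W z -> {for lsubmx z, continuous h} ->
    {for z, continuous (h \o lsubmx)}.
  by move=> Wz ch; apply: continuous_comp; [exact: continuous_lsubmx|exact: ch].
elim: k f => [|k ih] f sf.
  by split=> // z Wz; apply: cc => //; exact: (smoothk_cont sf (WU z Wz)).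
pose g (i : 'I_(d + d')) : 'rV[R]_(d + d') -> R :=
  if fintype.split i is inl l then 'D_(basis_vec l) f \o lsubmx else fun=> 0.
apply: (smoothk_der oW (g := g)) => [z Wz|i z Wz|i].
- by apply: cc => //; exact: (smoothk_cont sf (WU z Wz)).
- rewrite /g -[i in basis_vec i](fintype.splitK i); case: (fintype.split i) => l /=; apply/is_derive_line.
    rewrite (_ : (fun h : R => _) = (fun h : R => f (h *: basis_vec l + lsubmx z))).
      by apply/(is_derive_line f); exact: (smoothk_is_derive l sf (WU z Wz)).
    by apply/funext => h /=; rewrite lsubmx_basis_vec.
  rewrite (_ : (fun h : R => _) = cst (f (lsubmx z))); first exact: is_derive_cst.
  by apply/funext => h /=; rewrite lsubmx_basis_vecr.
- rewrite /g; case: (fintype.split i) => l; last exact: (@smoothk_cst _ _ _ _ _ oW k 0).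
  by apply: ih; exact: smoothk_D.
Qed.

Lemma smoothk_rsubmx k (U : set V') (W : set 'rV[R]_(d + d')) (f : V' -> R) : open U -> open W ->
  (forall z, W z -> U (rsubmx z)) -> smoothk (@basis_vec R d') k U f ->
  smoothk (@basis_vec R (d + d')) k W (f \o rsubmx).
Proof.
move=> oU oW WU; have cc (h : V' -> R) z : W z -> {for rsubmx z, continuous h} ->
    {for z, continuous (h \o rsubmx)}.
  by move=> Wz ch; apply: continuous_comp; [exact: continuous_rsubmx|exact: ch].
elim: k f => [|k ih] f sf.
  by split=> // z Wz; apply: cc => //; exact: (smoothk_cont sf (WU z Wz)).
pose g (i : 'I_(d + d')) : 'rV[R]_(d + d') -> R :=
  if fintype.split i is inr l then 'D_(basis_vec l) f \o rsubmx else fun=> 0.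
apply: (smoothk_der oW (g := g)) => [z Wz|i z Wz|i].
- by apply: cc => //; exact: (smoothk_cont sf (WU z Wz)).
- rewrite /g -[i in basis_vec i](fintype.splitK i); case: (fintype.split i) => l /=; apply/is_derive_line.
    rewrite (_ : (fun h : R => _) = cst (f (rsubmx z))); first exact: is_derive_cst.
    by apply/funext => h /=; rewrite rsubmx_basis_vecl.
  rewrite (_ : (fun h : R => _) = (fun h : R => f (h *: basis_vec l + rsubmx z))).
    by apply/(is_derive_line f); exact: (smoothk_is_derive l sf (WU z Wz)).
  by apply/funext => h /=; rewrite rsubmx_basis_vec.
- rewrite /g; case: (fintype.split i) => l; first exact: (@smoothk_cst _ _ _ _ _ oW k 0).
  by apply: ih; exact: smoothk_D.
Qed.

End tensor_products.

(** * Approximation by averages over the cells of a grid *)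

Section cell_averages.
Context (R : realType) (d : nat).
Local Notation V := 'rV[R]_d.
Local Notation lm := (lam R d).
Local Notation mu1 := (@lebesgue_measure R).
Variables (r0 N : nat).
Hypothesis N0 : (0 < N)%N.

(** Number of integers from -N r0 to N r0, enough for bumps at scale 1 / N to sum to one on the
    whole box of radius r0. *)
Definition grid := (2 * (N * r0)).+1.
Local Notation T := grid.

Definition offset (j : nat) : R := j%:R - (N * r0)%:R.

Definition grid_bump (m : {ffun 'I_d -> 'I_T}) (z : V) : R :=
  \prod_l bump (N%:R * z 0 l - offset (m l)).

Definition unit_ind (t : R) : R := ((0 <= t) && (t < 1))%R%:R.

Definition grid_cell (m : {ffun 'I_d -> 'I_T}) (y : V) : R :=
  \prod_l unit_ind (N%:R * y 0 l - offset (m l)).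

Definition window (t : R) : R := (`|t| <= 2 / N%:R)%R%:R.

Let N0' : 0 < N%:R :> R. Proof. by rewrite ltr0n. Qed.

Let Nn0 : N%:R != 0 :> R. Proof. by rewrite gt_eqF. Qed.

Lemma sum_unit_ind_le1 (t : R) (n : nat) : \sum_(j < n) unit_ind (t - j%:R) <= 1.
Proof.
have -> : \sum_(j < n) unit_ind (t - j%:R) = (0 <= t)%R%:R - (n%:R <= t)%R%:R.
  elim: n => [|n ih]; first by rewrite big_ord0 subrr.
  rewrite big_ord_recr/= ih /unit_ind subr_ge0 ltrBlDr nat1r.
  have h : n%:R <= n.+1%:R :> R by rewrite ler_nat.
  case: (leP n%:R t) => h1; case: (leP n.+1%:R t) => h2; case: (leP 0 t) => h3 /=;
    rewrite ?subr0 ?sub0r ?addr0 ?subrr ?addrN ?addNr ?add0r//; try lra;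
    by have := ler0n R n; lra.
by case: (0 <= t); case: (n%:R <= t) => /=; rewrite ?subr0 ?subrr ?sub0r; lra.
Qed.

Lemma bump_unit_ind_le (x y c : R) :
  `|bump (N%:R * x - c)| * unit_ind (N%:R * y - c) <= window (y - x) * unit_ind (N%:R * y - c).
Proof.
rewrite /unit_ind; have [/andP[y0 y1]|_] := boolP ((0 <= N%:R * y - c) && (N%:R * y - c < 1)); last by rewrite !mulr0.
rewrite !mulr1 /window; case: (leP `|y - x|) => [_|xy] /=; first exact: bump_norm_le1.
rewrite bump_eq0 ?normr0// ltNge; apply/negP; rewrite ler_norml => /andP[x0 x1].
move: xy; apply/negP; rewrite -leNgt ler_pdivlMr// -[X in _ * X](gtr0_norm N0') -normrM ler_norml.
by apply/andP; split; lra.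
Qed.

(** If the bump of index m is nonzero at z and y lies in the cell of index m, then all coordinates
    of y - z are at most 2 / N. For given y at most one cell counts, whence no multiplicity
    factor. *)
Lemma sum_grid_le (z y : V) :
  \sum_m `|grid_bump m z| * grid_cell m y <= \prod_l window (y 0 l - z 0 l).
Proof.
pose b l (j : 'I_T) := `|bump (N%:R * z 0 l - offset j)| * unit_ind (N%:R * y 0 l - offset j).
rewrite (eq_bigr (fun m : {ffun 'I_d -> 'I_T} => \prod_l b l (m l))); last first.
  by move=> m _; rewrite /grid_bump /grid_cell normr_prod -big_split.
rewrite -(bigA_distr_bigA b); apply: ler_prod => l _; apply/andP; split.
  by apply: sumr_ge0 => j _; rewrite mulr_ge0// ler0n.
suff h : \sum_j b l j <= window (y 0 l - z 0 l) by exact: h.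
apply: (@le_trans _ _ (\sum_(j < T) window (y 0 l - z 0 l) * unit_ind (N%:R * y 0 l - offset j))).
  by apply: ler_sum => j _; exact: bump_unit_ind_le.
rewrite -mulr_sumr ler_piMr ?ler0n//.
apply: le_trans (sum_unit_ind_le1 (N%:R * y 0 l + (N * r0)%:R) T).
by apply: ler_sum => j _; rewrite /offset opprB addrA.
Qed.

Lemma sum_grid_bump (z : V) : `|z| <= r0%:R -> \sum_m grid_bump m z = 1.
Proof.
move=> zr.
rewrite (_ : (\sum_m grid_bump m z) =
  \prod_(l < d) \sum_(j < T) bump (N%:R * z 0 l - offset j)); last first.
  by rewrite (bigA_distr_bigA (fun l (j : 'I_T) => bump (N%:R * z 0 l - offset j))).
rewrite big1// => l _.
have := bump_sum T (N%:R * z 0 l + (N * r0)%:R); rewrite big_mkord => E.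
rewrite (eq_bigr (fun j : 'I_T => bump (N%:R * z 0 l + (N * r0)%:R - j%:R))); last first.
  by move=> j _; rewrite /offset opprB addrA.
have : `|z 0 l| <= r0%:R by exact: le_trans (rV_coord_le z l) zr.
rewrite ler_norml => /andP[z1 z2]; rewrite E step_ge1 ?step_le0 ?subr0//.
  have -> : T%:R = 2 * (N%:R * r0%:R) + 1 :> R by rewrite /grid -natr1 !natrM.
  by rewrite natrM; have := ler_wpM2l (ltW N0') z2; lra.
by rewrite natrM; have := ler_wpM2l (ltW N0') z1; lra.
Qed.

Lemma measurable_unit_ind (c a : R) : measurable_fun setT (fun t : R => unit_ind (c * t - a)).
Proof.
rewrite (_ : (fun t => _) = \1_(`[0, 1[%classic : set R) \o (fun t : R => c * t - a)).
  apply: measurableT_comp; first by apply: measurable_indic; exact: measurable_itv.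
  by apply: measurable_funB => //; apply: measurable_funM.
by apply/funext => t; rewrite /= indicE /unit_ind; congr (_%:R); rewrite mem_setE in_itv.
Qed.

Lemma Rint_itv_indic (a b : R) : a <= b ->
  intg mu1 \1_(`[a, b]%classic : set R) /\ \int[mu1]_t \1_(`[a, b]%classic : set R) t = b - a.
Proof.
move=> ab; have E : (\int[mu1]_t (\1_(`[a, b]%classic : set R) t)%:E = (b - a)%:E)%E.
  rewrite integral_indic//= setIT lebesgue_measure_itv /= lte_fin.
  by case: ltP => // ba; rewrite (@le_anti _ _ a b) ?ab ?ba// subrr.
split; last by rewrite /Rintegral E.
apply: intg_le_lty; last by rewrite E ltry.
  by apply: measurable_indic; exact: measurable_itv.
by move=> t; rewrite indicE ler0n.
Qed.

Lemma Rint_unit_ind a : intg mu1 (fun t => unit_ind (N%:R * t - a)) /\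
  \int[mu1]_t unit_ind (N%:R * t - a) = N%:R^-1.
Proof.
have E : (\int[mu1]_t (unit_ind (N%:R * t - a))%:E = (N%:R^-1)%:E)%E.
  transitivity (\int[mu1]_t (\1_(`[a / N%:R, (a + 1) / N%:R[%classic : set R) t)%:E)%E; last first.
    rewrite integral_indic//= setIT lebesgue_measure_itv /= lte_fin ltr_pM2r ?invr_gt0//.
    by rewrite ltrDl ltr01 -EFinD; congr EFin; field.
  apply: eq_integral => t _; rewrite indicE /unit_ind; congr (_%:R%:E); rewrite mem_setE in_itv /=.
  by rewrite ler_pdivrMr// ltr_pdivlMr// subr_ge0 ltrBlDl mulrC.
split; last by rewrite /Rintegral E.
apply: intg_le_lty; [exact: measurable_unit_ind|by move=> t; rewrite ler0n|].
by rewrite E ltry.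
Qed.

(** The uniform density on the cube of radius 2 / N, that is, the product of the windows divided by
    (4 / N)^d. *)
Definition cell_kernel (u : borel V) : R := \prod_l (N%:R / 4 * \1_(`[- (2 / N%:R), 2 / N%:R]%classic : set R) (u 0 l)).

Lemma cell_kernelP : intg lm cell_kernel /\ \int[lm]_u cell_kernel u = 1.
Proof.
have ab : - (2 / N%:R) <= 2 / N%:R :> R by rewrite ge0_cp// divr_ge0.
have [ii iE] := Rint_itv_indic ab.
have [] := @integral_lam_prod R d
  (fun _ t => N%:R / 4 * \1_(`[- (2 / N%:R), 2 / N%:R]%classic : set R) t) _ _ _.
- by move=> l; exact: intg_meas (intgZ _ ii).
- by move=> l t; rewrite mulr_ge0 ?divr_ge0// indicE ler0n.
- by move=> l; exact: intgZ _ ii.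
move=> h1 h2; split=> //; rewrite h2 big1// => l _; rewrite RintZ// iE.
by field.
Qed.

Lemma cell_kernel_ge0 u : 0 <= cell_kernel u.
Proof. by apply: prodr_ge0 => l _; rewrite mulr_ge0 ?divr_ge0// indicE ler0n. Qed.

Lemma cell_kernel_le u : cell_kernel u <= (N%:R / 4) ^+ d.
Proof.
rewrite -[X in _ ^+ X]card_ord -prodr_const; apply: ler_prod => l _.
rewrite indicE; apply/andP; split; first by rewrite mulr_ge0 ?divr_ge0.
by case: (_ \in _); rewrite ?mulr1 ?mulr0// divr_ge0.
Qed.

Lemma window_kernel (z y : V) :
  \prod_l window (y 0 l - z 0 l) = (4 / N%:R) ^+ d * cell_kernel (y - z).
Proof.
rewrite /cell_kernel -[X in _ ^+ X]card_ord -prodr_const -big_split; apply: eq_bigr => l _ /=.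
rewrite mulrA (_ : 4 / N%:R * (N%:R / 4) = 1); last by field.
by rewrite mul1r indicE mem_setE in_itv /= -ler_norml !mxE.
Qed.

Lemma grid_cellP m : intg lm (grid_cell m : borel V -> R) /\
  \int[lm]_y grid_cell m y = N%:R ^- d.
Proof.
have [] := @integral_lam_prod R d (fun l t => unit_ind (N%:R * t - offset (m l))) _ _ _.
- by move=> l; exact: measurable_unit_ind.
- by move=> l t; rewrite ler0n.
- by move=> l; have [] := Rint_unit_ind (offset (m l)).
move=> h1 h2; split=> //; rewrite h2 (eq_bigr (fun=> N%:R^-1)).
  by rewrite prodr_const card_ord exprVn.
by move=> l _; have [] := Rint_unit_ind (offset (m l)).
Qed.

Variable f : borel V -> R.
Hypotheses (fi : intg lm f) (f2 : sqint lm f).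

Definition cell_avg m : R := N%:R ^+ d * \int[lm]_y (f y * grid_cell m y).

Lemma grid_cell01 m y : 0 <= grid_cell m y <= 1.
Proof.
apply/andP; split; first by apply: prodr_ge0 => l _; rewrite ler0n.
apply: prodr_ile1 => l _; rewrite /unit_ind ler0n /=.
by case: (_ && _); rewrite ?lexx ?ler01.
Qed.

Let fqi m : intg lm (fun y => f y * grid_cell m y).
Proof.
apply: intg_dom (intg_norm fi) => [|y].
  by apply: measurable_funM; [exact: intg_meas fi|exact: intg_meas (grid_cellP m).1].
by rewrite normrM ler_piMr//; have /andP[h0 h1] := grid_cell01 m y; rewrite ger0_norm.
Qed.

Lemma cell_avg_le m : `|cell_avg m| <= N%:R ^+ d * \int[lm]_y `|f y|.
Proof.
rewrite normrM ger0_norm ?exprn_ge0// ler_wpM2l ?exprn_ge0//.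
apply: le_trans (Rint_norm_le (fqi m)) _.
apply: Rint_le => [||y]; [exact: intg_norm|exact: intg_norm|].
by rewrite normrM ler_piMr//; have /andP[h0 h1] := grid_cell01 m y; rewrite ger0_norm.
Qed.

(** Since the bumps sum to one, the error at z combines the averages of f z - f y over cells near z,
    and [sum_grid_le] bounds it by a mollification error. The factor 4^d is the ratio of the volume
    of the window to that of a cell. *)
Lemma grid_approx_le (z : V) : `|z| <= r0%:R ->
  `|f z - \sum_m cell_avg m * grid_bump m z| <= 4 ^+ d * conv_err f cell_kernel z.
Proof.
move=> zr; have [ki k1] := cell_kernelP.
have di m : intg lm (fun y => (f z - f y) * grid_cell m y).
  have := intgB (intgZ (f z) (grid_cellP m).1) (fqi m); apply: intg_eq => y; ring.
have E : f z - \sum_m cell_avg m * grid_bump m z =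
    \sum_m (N%:R ^+ d * \int[lm]_y ((f z - f y) * grid_cell m y)) * grid_bump m z.
  rewrite -[X in X - _ = _]mulr1 -[X in _ * X - _ = _](sum_grid_bump zr) mulr_sumr -sumrB; apply: eq_bigr => m _.
  rewrite -mulrBl; congr (_ * _).
  transitivity (N%:R ^+ d * (f z * \int[lm]_y grid_cell m y - \int[lm]_y (f y * grid_cell m y))).
    rewrite (grid_cellP m).2 mulrBr mulrCA divff ?mulr1// expf_neq0// gt_eqF//.
  rewrite -RintZ; last exact: (grid_cellP m).1.
  rewrite -RintB//; last exact: intgZ _ (grid_cellP m).1.
  by congr (_ * _); apply: eq_Rint => y; rewrite mulrBl.
have ai m : intg lm (fun y => `|f z - f y| * grid_cell m y).
  apply: intg_eq (intg_norm (di m)) => y.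
  by rewrite normrM [X in _ = _ * X]ger0_norm//; have /andP[] := grid_cell01 m y.
rewrite E; apply: le_trans (ler_norm_sum _ _ _) _.
apply: (@le_trans _ _ (\sum_m N%:R ^+ d * \int[lm]_y (`|grid_bump m z| * (`|f z - f y| * grid_cell m y)))).
  apply: ler_sum => m _; rewrite !normrM (ger0_norm (exprn_ge0 _ (ltW N0'))) -mulrA.
  rewrite ler_wpM2l ?exprn_ge0// RintZ// mulrC ler_wpM2l//.
  apply: le_trans (Rint_norm_le (di m)) _; apply: Rint_le => // [|y]; first exact: intg_norm.
  by rewrite normrM [X in _ * X <= _]ger0_norm//; have /andP[] := grid_cell01 m y.
rewrite -mulr_sumr -Rint_sum => [|m]; last exact: intgZ.
have wE (y : borel V) : \prod_l window ((y : V) 0 l - z 0 l) = (4 / N%:R) ^+ d * cell_kernel ((y : V) - z).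
  exact: window_kernel.
have ck : intg lm (fun u => `|f z - f ((u : V) + z)| * cell_kernel u).
  exact: (intg_conv_err fi ki cell_kernel_ge0 cell_kernel_le).
have ksh : intg lm (fun y => `|f z - f y| * cell_kernel (- z + (y : V) : V)).
  apply: intg_eq (intg_shift (- z) ck) => y; congr (`|_ - f _| * _).
  by rewrite addrAC addNr add0r.
have CE : 4 ^+ d * conv_err f cell_kernel z =
   N%:R ^+ d * \int[lm]_y ((4 / N%:R) ^+ d * (`|f z - f y| * cell_kernel (- z + (y : V) : V))).
  rewrite RintZ// mulrA -exprMn mulrCA divff// mulr1; congr (_ * _).
  rewrite /conv_err -(Rint_shift (- z)); last exact: intg_meas ck.
  by apply: eq_Rint => y; congr (`|_ - f _| * _); rewrite addrAC addNr add0r.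
rewrite CE ler_wpM2l ?exprn_ge0//; apply: Rint_le => [||y].
- by apply: intg_sum => m; exact: intgZ.
- exact: intgZ.
- rewrite mulrCA -(addrC (y : V)) -wE; apply: le_trans (ler_wpM2l (normr_ge0 (f z - f y)) (sum_grid_le z y)).
  by rewrite mulr_sumr; apply: ler_sum => m _; rewrite mulrCA.
Qed.

Lemma measurable_grid_bump m : measurable_fun setT (grid_bump m : borel V -> R).
Proof.
apply: measurable_prod => l _; apply: (measurableT_comp (f := @bump R)).
  by apply: continuous_measurable_fun => t; exact: (smoothk_cont (@smooth1_bump R 0%N)).
by apply: measurable_funB => //; apply: measurable_funM => //; exact: measurable_coord.
Qed.

Lemma cell_kernel_eq0 (u : V) : 2 / N%:R < `|u| -> cell_kernel u = 0.
Proof.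
move=> uN; have [l ul] : exists l, 2 / N%:R < `|u 0 l|.
  apply: contrapT => /forallNP h; move: uN; apply/negP; rewrite -leNgt.
  by apply: rV_norm_le => [|l]; [rewrite divr_ge0|rewrite leNgt; apply/negP; exact: h].
rewrite /cell_kernel (bigD1 l)//= indicE memNset ?mulr0 ?mul0r//= in_itv /= -ler_norml.
by move/(lt_le_trans ul); rewrite ltxx.
Qed.

Lemma grid_approx_sqdist (K t : R) : 0 <= t -> 0 <= K ->
  (forall u : V, shift_sqdist f u <= K * (`|u| ^+ 2) `^ t) ->
  intg lm (fun z => \1_(cbox r0%:R) z * (f z - \sum_m cell_avg m * grid_bump m z) ^+ 2) /\
  \int[lm]_z (\1_(cbox r0%:R) z * (f z - \sum_m cell_avg m * grid_bump m z) ^+ 2) <=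
  16 ^+ d * (K * ((2 / N%:R) ^+ 2) `^ t).
Proof.
move=> t0 K0 fK; have [ki k1] := cell_kernelP.
have [ec2 ecle] := conv_sqdist_le fi f2 ki cell_kernel_ge0 cell_kernel_le k1.
have bd (z : borel V) : \1_(cbox r0%:R) z * (f z - \sum_m cell_avg m * grid_bump m z) ^+ 2 <=
    16 ^+ d * conv_err f cell_kernel z ^+ 2.
  rewrite indicE; case: (boolP (z \in _)) => [/set_mem zr|_]; last first.
    rewrite /= mul0r; apply: mulr_ge0; [exact: exprn_ge0|exact: sqr_ge0].
  rewrite /= mul1r -[leLHS]real_normK ?num_real//.
  rewrite (_ : 16 = 4 ^+ 2); last by ring.
  rewrite exprAC -exprMn lerXn2r ?nnegrE ?mulr_ge0 ?exprn_ge0 ?conv_err_ge0//.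
    exact: cell_kernel_ge0.
  exact: grid_approx_le.
have ii : intg lm (fun z => \1_(cbox r0%:R) z * (f z - \sum_m cell_avg m * grid_bump m z) ^+ 2).
  apply: intg_dom (intgZ (16 ^+ d) ec2.2) => [|z]; last first.
    by rewrite ger0_norm// mulr_ge0 ?sqr_ge0// indicE ler0n.
  apply: measurable_funM; first by apply: measurable_indic; exact: measurable_cbox.
  apply: measurable_funX; apply: measurable_funB; first exact: intg_meas fi.
  by apply: measurable_sum => m; apply: measurable_funM => //; exact: measurable_grid_bump.
split=> //; apply: (@le_trans _ _ (\int[lm]_z (16 ^+ d * conv_err f cell_kernel z ^+ 2))).
  by apply: Rint_le => //; exact: intgZ ec2.2.
rewrite RintZ ?ler_wpM2l ?exprn_ge0//; last exact: ec2.2.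
apply: le_trans ecle _.
rewrite -[leRHS]mulr1 -[X in _ <= _ * X]k1 -RintZ//; apply: Rint_le => [||u].
- exact: (intg_shift_sqdist fi f2 ki cell_kernel_ge0).
- exact: intgZ.
rewrite mulrC; have [uN|uN] := leP `|u : V| (2 / N%:R); last first.
  by rewrite cell_kernel_eq0// !mulr0.
rewrite ler_wpM2r ?cell_kernel_ge0//; apply: le_trans (fK u) _; rewrite ler_wpM2l//.
by apply: ge0_ler_powR; rewrite ?nnegrE ?sqr_ge0// ler_sqr ?nnegrE// divr_ge0.
Qed.

End cell_averages.

(** * Bumps on the manifold *)

Section charts.
Context {R : realType} (M : closedRiemannian R).
Local Notation X := (atlas M).
Local Notation d := (Defs.dim X).
Local Notation V := 'rV[R]_d.
Local Notation O i := (@codom_chart R M X i).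
Local Notation smoothoo := (smoothoo (@basis_vec R d)).

Definition chart_supp (i : idx X) : set M := closure [set x | chi i x != 0].

Lemma codom_chartP (i : idx X) z : O i z -> dom i (psi i z) /\ phi i (psi i z) = z.
Proof. by move=> [x dx <-]; rewrite chart_phiK. Qed.

Lemma codom_phi (i : idx X) x : dom i x -> O i (phi i x).
Proof. by move=> dx; exists x. Qed.

Lemma image_phi_setI (i : idx X) (A : set M) :
  phi i @` (dom i `&` A) = O i `&` psi i @^-1` A.
Proof.
apply/seteqP; split=> [z [x [dx Ax] <-]|z [Oz Az]]; first by split; [exact: codom_phi|rewrite /= chart_phiK].
by have [dz E] := codom_chartP Oz; exists (psi i z).
Qed.

Lemma open_chart_preimage (i : idx X) (A : set M) : open A -> open (O i `&` psi i @^-1` A).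
Proof.
move=> oA; rewrite openE => z [Oz Az]; apply: filterI.
  by apply: open_nbhs_nbhs; split=> //; exact: chart_codom_open.
exact: (chart_psi_continuous Oz) (open_nbhs_nbhs (conj oA Az)).
Qed.

Lemma smooth_funP (u : M -> R) : smooth_fun X u <-> forall i, smoothoo (O i) (u \o psi i).
Proof. by split=> h i k; apply/smoothk_Ck; exact: h. Qed.

Lemma smooth_fun_continuous (u : M -> R) : smooth_fun X u -> continuous u.
Proof.
move=> /smooth_funP su x; have [i dx] := chart_cover x.
have cf : {for x, continuous ((u \o psi i) \o phi i)}.
  apply: continuous_comp; first exact: chart_phi_continuous.
  exact: (smoothk_cont (su i 0%N) (codom_phi dx)).
rewrite /prop_for /continuous_at (_ : u x = ((u \o psi i) \o phi i) x); last by rewrite /= chart_phiK.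
apply: cvg_trans cf; apply: near_eq_cvg.
apply: filterS (open_nbhs_nbhs (conj (@chart_dom_open R M i) dx)) => y dy.
by rewrite /= chart_phiK.
Qed.

Lemma smooth_fun_eq (u v : M -> R) : u =1 v -> smooth_fun X u -> smooth_fun X v.
Proof. by move=> /funext ->. Qed.

Lemma smooth_fun_cst (c : R) : smooth_fun X (fun=> c).
Proof. by apply/smooth_funP => i k; exact: (@smoothk_cst _ _ _ _ _ (@chart_codom_open R M i) k c). Qed.

Lemma smooth_fun_add (u v : M -> R) : smooth_fun X u -> smooth_fun X v ->
  smooth_fun X (fun x => u x + v x).
Proof.
move=> /smooth_funP su /smooth_funP sv; apply/smooth_funP => i k.
exact: (@smoothk_add _ _ _ _ _ (@chart_codom_open R M i) k _ _ (su i k) (sv i k)).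
Qed.

Lemma smooth_fun_mul (u v : M -> R) : smooth_fun X u -> smooth_fun X v ->
  smooth_fun X (fun x => u x * v x).
Proof.
move=> /smooth_funP su /smooth_funP sv; apply/smooth_funP => i k.
exact: (@smoothk_mul _ _ _ _ _ (@chart_codom_open R M i) k _ _ (su i k) (sv i k)).
Qed.

Lemma smooth_fun_sum (J : Type) (s : seq J) (u : J -> M -> R) :
  (forall j, smooth_fun X (u j)) -> smooth_fun X (fun x => \sum_(j <- s) u j x).
Proof.
move=> su; apply/smooth_funP => i k.
have sj j : smoothk (@basis_vec R d) k (O i) (u j \o psi i) by have /smooth_funP := su j; apply.
exact: (@smoothk_sum _ _ _ _ _ (@chart_codom_open R M i) k _ s _ sj).
Qed.

Lemma smooth_fun_inv (u : M -> R) : (forall x, u x != 0) -> smooth_fun X u ->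
  smooth_fun X (fun x => (u x)^-1).
Proof.
move=> u0 /smooth_funP su; apply/smooth_funP => i k.
exact: (@smoothk_inv _ _ _ _ _ (@chart_codom_open R M i) k (u \o psi i) (fun z _ => u0 _) (su i k)).
Qed.

Definition chi_sqsum (x : M) : R := \sum_(i : idx X) chi i x ^+ 2.

Lemma chi_sqsum_gt0 x : 0 < chi_sqsum x.
Proof.
rewrite lt_neqAle sumr_ge0 ?andbT => [|i _]; last exact: sqr_ge0.
apply/eqP => /esym /psumr_eq0P h; have := chi_sum1 x; rewrite big1 => [/eqP|i _].
  by rewrite eq_sym oner_eq0.
by apply/eqP; rewrite -sqrf_eq0; apply/eqP; apply: h => // j _; exact: sqr_ge0.
Qed.

(* normalised so that [sum_i eta_i chi_i = 1] *)
Definition eta (i : idx X) (x : M) : R := chi i x / chi_sqsum x.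

Lemma eta_chi_sum x : \sum_(i : idx X) eta i x * chi i x = 1.
Proof.
rewrite /eta (eq_bigr (fun i => (chi_sqsum x)^-1 * chi i x ^+ 2)) => [|i _]; last by rewrite expr2; ring.
by rewrite -mulr_sumr mulVf// gt_eqF// chi_sqsum_gt0.
Qed.

Lemma smooth_fun_eta i : smooth_fun X (eta i).
Proof.
apply: smooth_fun_mul; first exact: chi_smooth.
apply: smooth_fun_inv => [x|]; first by rewrite gt_eqF// chi_sqsum_gt0.
apply: smooth_fun_sum => j; apply: smooth_fun_eq (smooth_fun_mul (@chi_smooth _ M j) (@chi_smooth _ M j)).
by move=> x; rewrite expr2.
Qed.

Lemma chi_supp_dom (i : idx X) x : chart_supp i x -> dom i x.
Proof. exact: chi_support. Qed.

Lemma chi_off_supp (i : idx X) x : ~ chart_supp i x -> chi i x = 0.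
Proof.
move=> h; apply/eqP; apply: contrapT => /negP hx; apply: h.
exact: subset_closure.
Qed.

Lemma eta_off_supp (i : idx X) x : ~ chart_supp i x -> eta i x = 0.
Proof. by move=> /chi_off_supp h; rewrite /eta h mul0r. Qed.

Lemma closed_chart_supp (i : idx X) : closed (chart_supp i).
Proof. exact: closed_closure. Qed.

Lemma compact_image_phi (i : idx X) (A : set M) : closed A -> A `<=` dom i ->
  compact (phi i @` A).
Proof.
move=> cA Ad; apply: continuous_compact.
  apply: continuous_in_subspaceT => x /set_mem /Ad dx; exact: chart_phi_continuous.
exact: subclosed_compact cA (@carrier_compact R M) _.
Qed.

Lemma closed_image_phi (i : idx X) (A : set M) : closed A -> A `<=` dom i ->
  closed (phi i @` A).
Proof. by move=> cA Ad; apply: compact_closed; [exact: norm_hausdorff|exact: compact_image_phi]. Qed.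

Lemma image_phi_codom (i : idx X) (A : set M) : A `<=` dom i -> phi i @` A `<=` O i.
Proof. by move=> Ad z [x /Ad dx <-]; exact: codom_phi. Qed.

Lemma compact_cbox (A : set V) : compact A -> exists2 r : nat, (0 < r)%N & forall z, A z -> `|z| <= r%:R.
Proof.
move=> /compact_bounded [r [_ /(_ (`|r| + 1))]]; rewrite (le_lt_trans (ler_norm r)) ?ltrDl// => /(_ isT) h.
exists (Num.truncn (`|r| + 1)).+1 => // z /h /le_trans; apply.
by rewrite ltW// truncnS_gt.
Qed.

Lemma charts_cbox : exists2 r : nat, (0 < r)%N & forall (i : idx X) z,
  (phi i @` chart_supp i) z -> `|z| <= r%:R.
Proof.
have /choice[r hr] (i : idx X) : exists r : nat, (0 < r)%N /\
    forall z, (phi i @` chart_supp i) z -> `|z| <= r%:R.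
  have [r r0 h] := compact_cbox (compact_image_phi (@closed_chart_supp i) (@chi_supp_dom i)).
  by exists r.
exists (\sum_i r i).+1 => // i z /(hr i).2 /le_trans; apply.
by rewrite ler_nat (bigD1 i)//=; apply: leq_trans (leqnSn _); exact: leq_addr.
Qed.

Section bump_family.
Variables (r0 N : nat).

(* the cutoff [eta i] makes the junk values of [phi i] off its domain harmless *)
Definition chart_bump (i : idx X) (m : {ffun 'I_d -> 'I_(grid r0 N)}) (x : M) : R :=
  eta i x * grid_bump m (phi i x).

Let tau (i j : idx X) (l : 'I_d) (z : V) : R := phi i (psi j z) 0 l.
Let U (i j : idx X) : set V := phi j @` (dom j `&` dom i).

Let oU i j : open (U i j).
Proof. by rewrite /U image_phi_setI; exact: open_chart_preimage (@chart_dom_open R M i). Qed.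

Let stau i j l : smoothoo (U i j) (tau i j l).
Proof. by move=> k; apply/smoothk_Ck; exact: (@chart_transition R M j i l k). Qed.

Let UO i j : U i j `<=` O j.
Proof. by rewrite /U image_phi_setI => z []. Qed.

(** Read in chart j, the domain is the union of two open sets: the overlap with chart i, where
    transition maps are smooth, and the complement of the support of [chi i], where the function
    vanishes. *)
Lemma smooth_fun_chart_bump i m : smooth_fun X (chart_bump i m).
Proof.
apply/smooth_funP => j k.
have E : O j = U i j `|` (O j `&` psi j @^-1` (~` chart_supp i)).
  rewrite /U image_phi_setI; apply/seteqP; split=> [z Oz|z [[]|[]]//].
  by have [/chi_supp_dom h|h] := pselect (chart_supp i (psi j z)); [left|right].
rewrite E; apply: smoothk_union.
  have s1 : smoothk (@basis_vec R d) k (U i j) (eta i \o psi j).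
    by have /smooth_funP/(_ j k) := smooth_fun_eta i; exact: smoothk_sub_dom (@UO i j).
  have s2 := smooth_bump_factor (@oU i j) (@stau i j) (fun=> 0%N) N%:R (fun l => offset R r0 N (m l)) k.
  exact: (@smoothk_mul _ _ _ _ _ (@oU i j) k _ _ s1 s2).
have oW := @open_chart_preimage j _ (closed_openC (@closed_chart_supp i)).
apply: smoothk_eq (smoothk_cst _ oW k 0) => // z [_ /eta_off_supp h].
by rewrite /= /chart_bump h mul0r.
Qed.

Lemma chart_bump_norm_le i m x : `|chart_bump i m x| <= `|eta i x|.
Proof.
rewrite normrM ler_piMr// normr_prod; apply: prodr_ile1 => l _.
by rewrite normr_ge0 bump_norm_le1.
Qed.

Lemma localize_chart_bump i j (m : {ffun 'I_d -> 'I_(grid r0 N)}) :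
  localize j (chart_bump i m) =
  bumpf (tau i j) (fun=> 0%N) (localize j (eta i)) N%:R (fun l => offset R r0 N (m l)).
Proof.
apply/funext => z; rewrite /localize /bumpf !patchE; case: ifPn => _; last by rewrite mul0r.
by rewrite /chart_bump mulrA.
Qed.

End bump_family.

Lemma smoothk_localize (j : idx X) (u : M -> R) : smooth_fun X u ->
  smoothoo (O j) (localize j u).
Proof.
move=> /smooth_funP su k0; have /smooth_funP sc := @chi_smooth _ M j.
apply: smoothk_eq (smoothk_mul (@chart_codom_open R M j) (sc j k0) (su j k0)).
  exact: chart_codom_open.
by move=> z Oz; rewrite /localize patchE mem_set.
Qed.

Lemma localize_off (j : idx X) (u : M -> R) z : ~ (phi j @` chart_supp j) z -> localize j u z = 0.
Proof.
move=> Kz; rewrite /localize patchE; case: ifPn => // /set_mem Oz.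
have [dz E] := codom_chartP Oz; rewrite chi_off_supp ?mul0r// => h; apply: Kz.
by exists (psi j z).
Qed.

Lemma cutoff_localize (j : idx X) (u : M -> R) : smooth_fun X u ->
  cutoff (O j) (phi j @` chart_supp j) (localize j u).
Proof. by move=> su; split; [exact: smoothk_localize|exact: localize_off]. Qed.

Lemma localize_smooth (j : idx X) (u : M -> R) : smooth_fun X u -> smoothoo setT (localize j u).
Proof.
move=> su; apply: (cutoff_smooth _ _ (@cutoff_localize j _ su)).
  exact: (closed_image_phi (@closed_chart_supp j) (@chi_supp_dom j)).
exact: (image_phi_codom (@chi_supp_dom j)).
Qed.

(** In chart j the function is a [bumpf] whose coordinate maps are the transition map and whose
    cutoff lives on the image of the intersection of the two supports, a compact subset of the
    overlap. There are finitely many pairs of charts, so the constants may be summed. *)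
Lemma chart_bump_test (k r0 : nat) : (forall (i : idx X) z,
    (phi i @` chart_supp i) z -> `|z| <= r0%:R) ->
  exists2 C : R, 0 <= C & forall (i j : idx X) (N : nat) (m : {ffun 'I_d -> 'I_(grid r0 N)}),
    (0 < N)%N -> test_bound k r0%:R (C * N%:R ^+ k) (localize j (chart_bump i m)).
Proof.
move=> hr; have /choice[C hC] (p : idx X * idx X) : exists C : R, 0 <= C /\
    forall (N : nat) (m : {ffun 'I_d -> 'I_(grid r0 N)}),
    (0 < N)%N -> test_bound k r0%:R (C * N%:R ^+ k) (localize p.2 (chart_bump p.1 m)).
  case: p => i j /=.
  pose A := chart_supp i `&` chart_supp j.
  have cA : closed A by apply: closedI; exact: closed_chart_supp.
  have Aj : A `<=` dom j by move=> x [_ /chi_supp_dom].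
  pose U := phi j @` (dom j `&` dom i).
  have oU : open U by rewrite /U image_phi_setI; exact: open_chart_preimage (@chart_dom_open R M i).
  have KU : phi j @` A `<=` U.
    by move=> _ [x [xi xj] <-]; exists x => //; split; exact: chi_supp_dom.
  have stau l : smoothoo U (fun z => phi i (psi j z) 0 l).
    by move=> k0; apply/smoothk_Ck; exact: (@chart_transition R M j i l k0).
  have ca : cutoff U (phi j @` A) (localize j (eta i)).
    split.
      move=> k0; apply: smoothk_sub_dom (@smoothk_localize j _ (smooth_fun_eta i) k0).
      by rewrite /U image_phi_setI => z [].
    move=> z Kz; rewrite /localize patchE; case: ifPn => // /set_mem Oz.
    have [dz E] := codom_chartP Oz.
    have [h1|h1] := pselect (chart_supp i (psi j z)); last by rewrite eta_off_supp ?mulr0.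
    have [h2|h2] := pselect (chart_supp j (psi j z)); last by rewrite chi_off_supp ?mul0r.
    by exfalso; apply: Kz; exists (psi j z).
  have [C C0 hC] := bumpf_pderivs oU (compact_image_phi cA Aj) (closed_image_phi cA Aj) KU stau
     (fun=> 0%N) k ca.
  exists C; split=> // N m N0; rewrite localize_chart_bump; split.
  - by rewrite -localize_chart_bump; apply: localize_smooth; exact: smooth_fun_chart_bump.
  - move=> z zr; rewrite -localize_chart_bump localize_off// => /hr.
    by rewrite leNgt zr.
  - by move=> s z sk; apply: hC => //; rewrite ler1n.
exists (\sum_p C p); first by apply: sumr_ge0 => p _; have [] := hC p.
move=> i j N m N0; have [C0 /(_ N m N0) [h1 h2 h3]] := hC (i, j); split=> // s z sk.
apply: le_trans (h3 s z sk) _; rewrite ler_wpM2r ?exprn_ge0//.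
by rewrite (bigD1 (i, j))//= lerDl sumr_ge0// => p _; have [] := hC p.
Qed.

Lemma test_bound_sub (n k : nat) (r D D' : R) (f g : 'rV[R]_n -> R) (c : R) :
  test_bound k r D f -> test_bound k r D' g ->
  test_bound k r (D + `|c| * D') (fun z => f z - c * g z).
Proof.
move=> [sf fr fD] [sg gr gD].
have E : (fun z => f z - c * g z) = (fun z => f z + (- c) * g z) by apply/funext => z; rewrite mulNr.
have scg k0 : smoothk (@basis_vec R n) k0 setT (fun z => (- c) * g z).
  by apply: smoothk_scale; [exact: openT|exact: sg].
rewrite E; split=> [k0|z zr|s z sk].
- by apply: smoothk_add; [exact: openT|exact: sf|exact: scg].
- by rewrite fr// gr// mulr0 addr0.
- rewrite pderivs_add// pderivs_scale//; apply: le_trans (ler_normD _ _) _.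
  by rewrite normrM normrN lerD ?fD// ler_wpM2l// gD.
Qed.

Lemma chi_test (k r0 : nat) : (forall (i : idx X) z,
    (phi i @` chart_supp i) z -> `|z| <= r0%:R) ->
  exists2 C : R, 0 <= C & forall j : idx X, test_bound k r0%:R C (localize j (fun=> 1)).
Proof.
move=> hr; have /choice[C hC] (j : idx X) : exists C : R, 0 <= C /\
    test_bound k r0%:R C (localize j (fun=> 1)).
  have ca := @cutoff_localize j _ (smooth_fun_cst 1).
  have KO := image_phi_codom (@chi_supp_dom j).
  (* With an empty index set [bumpf] has no bump factor and reduces to its cutoff. *)
  have [C C0 hC] := bumpf_pderivs (tau := fun _ : 'I_0 => fun=> 0) (@chart_codom_open R M j)
     (compact_image_phi (@closed_chart_supp j) (@chi_supp_dom j))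
     (closed_image_phi (@closed_chart_supp j) (@chi_supp_dom j)) KO
     (fun j0 => match j0 with Ordinal _ h => False_ind _ (notF h) end) (fun=> 0%N) k ca.
  exists C; split=> //; split.
  - exact: localize_smooth (smooth_fun_cst 1).
  - by move=> z zr; rewrite localize_off// => /hr; rewrite leNgt zr.
  - move=> s z sk; have := hC 1 (fun=> 0) z s (lexx 1) sk; rewrite expr1n mulr1.
    rewrite (_ : bumpf _ _ _ _ _ = localize j (fun=> 1))//.
    by apply/funext => w; rewrite /bumpf big_ord0 mulr1.
exists (\sum_p C p); first by apply: sumr_ge0 => p _; have [] := hC p.
move=> j; have [C0 [h1 h2 h3]] := hC j; split=> // s z sk.
apply: le_trans (h3 s z sk) _.
by rewrite (bigD1 j)//= lerDl sumr_ge0// => p _; have [] := hC p.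
Qed.

Lemma localize_sub_cst (j : idx X) (u : M -> R) (c : R) :
  localize j (fun x => u x - c) = (fun z => localize j u z - c * localize j (fun=> 1) z).
Proof.
apply/funext => z; rewrite /localize !patchE; case: ifPn => _; last by rewrite mulr0 subr0.
by ring.
Qed.

Lemma codom_chart2P (p : idx (atlas2 M)) (z : 'rV[R]_(d + d)) :
  codom_chart p z <-> O p.1 (lsubmx z) /\ O p.2 (rsubmx z).
Proof.
split=> [[[x y] /= [dx dy] <-]|[[x dx xE] [y dy yE]]].
  by rewrite row_mxKl row_mxKr; split; exact: codom_phi.
by exists (x, y) => //=; rewrite xE yE hsubmxK.
Qed.

Lemma localize_tensor (p : idx (atlas2 M)) (u v : M -> R) :
  localize p (fun q : M * M => u q.1 * v q.2) = tensor (localize p.1 u) (localize p.2 v).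
Proof.
apply/funext => z; rewrite /tensor /localize !patchE.
have [/codom_chart2P [h1 h2]|h] := pselect (codom_chart p z).
  by rewrite mem_set ?mem_set//=; [ring|exact/codom_chart2P].
rewrite memNset//; have [h1|h1] := pselect (O p.1 (lsubmx z)); last by rewrite memNset// mul0r.
have [h2|h2] := pselect (O p.2 (rsubmx z)); last by rewrite [X in _ * X]ifF ?mulr0// memNset.
by exfalso; apply: h; exact/codom_chart2P.
Qed.

Lemma codom_chart2_open (p : idx (atlas2 M)) : open (codom_chart p : set 'rV[R]_(d + d)).
Proof.
rewrite (_ : codom_chart p = (lsubmx @^-1` O p.1 : set 'rV[R]_(d + d)) `&` rsubmx @^-1` O p.2).
  apply: openI; apply: open_comp; try exact: chart_codom_open.
    by move=> z _; exact: continuous_lsubmx.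
  by move=> z _; exact: continuous_rsubmx.
by apply/seteqP; split=> z /codom_chart2P.
Qed.

Lemma smooth_fun_fst (u : M -> R) : smooth_fun X u -> smooth_fun (atlas2 M) (fun p : M * M => u p.1).
Proof.
move=> /smooth_funP su p k; apply/smoothk_Ck.
apply: (smoothk_lsubmx (@chart_codom_open R M p.1) (@codom_chart2_open p) _ (su p.1 k)).
by move=> z /codom_chart2P [].
Qed.

Lemma smooth_fun_snd (u : M -> R) : smooth_fun X u -> smooth_fun (atlas2 M) (fun p : M * M => u p.2).
Proof.
move=> /smooth_funP su p k; apply/smoothk_Ck.
apply: (smoothk_rsubmx (@chart_codom_open R M p.2) (@codom_chart2_open p) _ (su p.2 k)).
by move=> z /codom_chart2P [].
Qed.

Lemma smooth_fun_diff (u : M -> R) : smooth_fun X u ->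
  smooth_fun (atlas2 M) (fun p : M * M => u p.1 - u p.2).
Proof.
move=> su p k; apply/smoothk_Ck.
have /smoothk_Ck s1 := smooth_fun_fst su p k; have /smoothk_Ck s2 := smooth_fun_snd su p k.
exact: (@smoothk_sub _ _ _ _ _ (@codom_chart2_open p) k _ _ s1 s2).
Qed.

End charts.

(** * Riemannian volume in charts *)

Section positive_definite.
Context (R : realType) (n : nat).

(** Otherwise the characteristic polynomial of -g, whose value at 0 is det g, would be nonpositive
    at 0 and positive far away. A root x >= 0 provides v with v g = - x v, and the quadratic form at
    v would be nonpositive. *)
Lemma det_pos_def (g : 'M[R]_n) :
  (forall v : 'rV[R]_n, v != 0 -> 0 < (v *m g *m v^T) 0 0) -> 0 < \det g.
Proof.
move=> gpos; rewrite ltNge; apply/negP => g0.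
pose p := char_poly (- g).
have p0 : p.[0] <= 0.
  rewrite horner_coef0 char_poly_det -(scaleN1r g) detZ mulrA -exprMn mulrNN mulr1 expr1n.
  by rewrite mul1r.
have lp : 0 < lead_coef p by rewrite (eqP (char_poly_monic _)) ltr01.
have [b hb] := polyrcf.poly_pinfty_gt_lc lp.
have b0 : 0 <= Num.max b 0 by rewrite le_max lexx orbT.
have pb : 0 <= p.[Num.max b 0] by apply: le_trans (ltW lp) (hb _ _); rewrite le_max lexx.
have [|x /andP[x0 _]] := @poly_ivt R p 0 (Num.max b 0) b0; first by rewrite p0 pb.
rewrite -eigenvalue_root_char => /eigenvalueP [v vg v0].
have := gpos v v0; rewrite (_ : v *m g = (- x) *: v); last first.
  by rewrite scaleNr -vg mulmxN opprK.
rewrite -scalemxAl mxE mulNr oppr_gt0; apply/negP; rewrite -leNgt mulr_ge0//.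
by rewrite mxE; apply: sumr_ge0 => l _; rewrite mxE -expr2 sqr_ge0.
Qed.

End positive_definite.

Lemma compact_within_bounded (R : realType) (T : topologicalType) (K : set T) (f : T -> R) :
  compact K -> {within K, continuous f} -> exists2 C : R, 0 <= C & forall x, K x -> `|f x| <= C.
Proof.
move=> cK cf; have := compact_bounded (continuous_compact cf cK).
move=> [r [_ /(_ (`|r| + 1))]]; rewrite (le_lt_trans (ler_norm r)) ?ltrDl// => /(_ isT) h.
by exists (`|r| + 1) => [|x Kx]; [rewrite addr_ge0|apply: h; exists x].
Qed.

Lemma measurable_patch_preimage (T : ptopologicalType) (Y : topologicalType) (U : set T)
    (f : T -> Y) (y0 : Y) (W : set Y) : open U -> (forall x, U x -> {for x, continuous f}) ->
  open W -> measurable ((fun x : borel T => if x \in U then f x else y0) @^-1` W).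
Proof.
move=> oU cf oW; have mU : measurable (U : set (borel T)) by exact: borel_open.
have mI : measurable ((U `&` f @^-1` W) : set (borel T)).
  apply: borel_open; rewrite openE => x [Ux Wx]; apply: filterI.
    by apply: open_nbhs_nbhs; split.
  by apply: (cf x Ux); apply: open_nbhs_nbhs; split.
have [Wy|Wy] := pselect (W y0).
  rewrite (_ : _ @^-1` _ = (U `&` f @^-1` W) `|` ~` U).
    by apply: measurableU => //; exact: measurableC.
  apply/seteqP; split=> z /=.
    by case: ifPn => [/set_mem|/negP h]; [left|right => h'; apply: h; exact: mem_set].
  by case=> [[Oz Az]|Oz]; [rewrite mem_set|rewrite memNset].
rewrite (_ : _ @^-1` _ = U `&` f @^-1` W)//.
apply/seteqP; split=> z /=; first by case: ifPn => // /set_mem.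
by case=> Oz Az; rewrite mem_set.
Qed.

Lemma ge0_integral_mrestr d1 (T1 : measurableType d1) (R : realType) (m : {measure set T1 -> \bar R}) (D : set T1) (mD : measurable D)
    (f : T1 -> \bar R) : (forall x, (0 <= f x)%E) -> measurable_fun setT f ->
  (\int[mrestr m mD]_x f x = \int[m]_(x in D) f x)%E.
Proof.
move=> f0 mf; have mDC := measurableC mD.
rewrite -[in LHS](setUv D) ge0_integral_setU//=; last 2 first.
- by rewrite setUv.
- by rewrite disj_set2E setICr.
rewrite [X in (_ + X)%E]null_set_integral ?adde0//; last 2 first.
- exact: measurable_funTS.
- by transitivity (m (~` D `&` D)); [by []|rewrite setICl measure0].
by apply: eq_measure_integral => A mA AD; rewrite -[in RHS](setIidl AD).
Qed.

Section measure_comparison.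
Context d1 d2 (T1 : measurableType d1) (T2 : measurableType d2) (R : realType).
Variables (m1 : {measure set T1 -> \bar R}) (m2 : {measure set T2 -> \bar R}).
Variables (g : T2 -> T1) (F : set T1) (K : set T2) (C : R).
Hypotheses (mg : measurable_fun setT g) (mF : measurable F) (mK : measurable K) (C0 : 0 <= C).
Variable h : T1 -> R.
Hypotheses (mh : measurable_fun setT h) (h0 : forall x, 0 <= h x).

Let m2' : {measure set T1 -> \bar R} :=
  measure_function_pushforward__canonical__measure_function_Measure (mrestr m2 mK) mg.

Let m2'E : (\int[m2']_x (h x)%:E = \int[m2]_(y in K) (h (g y))%:E)%E.
Proof.
have mhE : measurable_fun setT (EFin \o h) by exact/measurable_EFinP.
rewrite /m2' (@ge0_integral_pushforward _ _ _ _ R _ mg _ setT (EFin \o h))//=.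
  rewrite preimage_setT; apply: ge0_integral_mrestr => [y|]; first by rewrite lee_fin.
  by apply/measurable_EFinP; exact: measurableT_comp mh mg.
by move=> y _; rewrite lee_fin.
Qed.

Lemma le_integral_mrestr :
  (forall A, measurable A -> m1 (A `&` F) <= C%:E * m2 (g @^-1` A `&` K))%E ->
  (\int[m1]_(x in F) (h x)%:E <= C%:E * \int[m2]_(y in K) (h (g y))%:E)%E.
Proof.
move=> hC; have mhE : measurable_fun setT (EFin \o h) by exact/measurable_EFinP.
rewrite -m2'E -(ge0_integral_mrestr m1 mF (f := EFin \o h))//.
have H := @ge0_le_measure_integral _ T1 R (mrestr m1 mF) (mscale (NngNum C0) m2') _ (EFin \o h) setT.
have hE0 x : (0 <= (EFin \o h) x)%E by rewrite lee_fin.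
have := H hC measurableT hE0 mhE; rewrite ge0_integral_mscale//.
Qed.

Lemma ge_integral_mrestr :
  (forall A, measurable A -> m2 (g @^-1` A `&` K) <= C%:E * m1 (A `&` F))%E ->
  (\int[m2]_(y in K) (h (g y))%:E <= C%:E * \int[m1]_(x in F) (h x)%:E)%E.
Proof.
move=> hC; have mhE : measurable_fun setT (EFin \o h) by exact/measurable_EFinP.
rewrite -m2'E -(ge0_integral_mrestr m1 mF (f := EFin \o h))//.
have H := @ge0_le_measure_integral _ T1 R m2' (mscale (NngNum C0) (mrestr m1 mF)) _ (EFin \o h) setT.
have hE0 x : (0 <= (EFin \o h) x)%E by rewrite lee_fin.
have := H hC measurableT hE0 mhE; rewrite ge0_integral_mscale//.
Qed.

End measure_comparison.

Section volume.
Context {R : realType} (M : closedRiemannian R).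
Local Notation X := (atlas M).
Local Notation d := (Defs.dim X).
Local Notation V := 'rV[R]_d.
Local Notation O i := (@codom_chart R M X i).
Local Notation F i := (chart_supp i).
Local Notation K i := (phi i @` chart_supp i).
Local Notation lm := (lam R d).

(** Inverse chart completed by a constant, so as to be Borel on the whole space; off the chart's
    image [psi] is arbitrary. *)
Definition chart_inv (i : idx X) (z : borel V) : borel M :=
  if z \in O i then psi i z else point.

Lemma chart_invE (i : idx X) z : O i z -> chart_inv i z = psi i z.
Proof. by move=> Oz; rewrite /chart_inv mem_set. Qed.

Lemma measurable_chart_inv (i : idx X) : measurable_fun setT (chart_inv i).
Proof.
apply: measurable_to_borel => A oA; apply: measurable_patch_preimage => //.
  exact: chart_codom_open.
by move=> z Oz; exact: chart_psi_continuous.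
Qed.

Lemma borel_chart_supp (i : idx X) : measurable (F i : set (borel M)).
Proof. by apply: borel_closed; exact: closed_chart_supp. Qed.

Lemma closed_K (i : idx X) : closed (K i : set V).
Proof. exact: (closed_image_phi (@closed_chart_supp R M i) (@chi_supp_dom R M i)). Qed.

Lemma borel_K (i : idx X) : measurable (K i : set (borel V)).
Proof. by apply: borel_closed; exact: closed_K. Qed.

Lemma K_sub_O (i : idx X) : K i `<=` O i.
Proof. exact: image_phi_codom (@chi_supp_dom R M i). Qed.

Lemma det_metric_gt0 (i : idx X) z : O i z -> 0 < \det (metric i z).
Proof. by move=> Oz; apply: det_pos_def => v v0; exact: metric_pos. Qed.

Lemma smoothk_det_metric (i : idx X) k :
  smoothk (@basis_vec R d) k (O i) (fun z => \det (metric i z)).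
Proof.
have oO := @chart_codom_open R M i.
rewrite /determinant; apply: smoothk_sum => // s; apply: smoothk_scale => //.
by apply: smoothk_prod => // l; apply/smoothk_Ck; exact: metric_smooth.
Qed.

Definition density (i : idx X) (z : V) : R := Num.sqrt (\det (metric i z)).

Lemma density_continuous (i : idx X) z : O i z -> {for z, continuous (density i)}.
Proof.
move=> Oz; apply: continuous_comp; first exact: (smoothk_cont (smoothk_det_metric i 0%N)).
exact: sqrt_continuous.
Qed.

Lemma density_gt0 (i : idx X) z : O i z -> 0 < density i z.
Proof. by move=> Oz; rewrite sqrtr_gt0 det_metric_gt0. Qed.

(** Both the density and its inverse are continuous on the compact images of the supports of the
    partition of unity; one constant is arranged to bound them all. *)
Lemma density_bounds : exists2 C : R, 1 <= C & forall (i : idx X) z, K i z ->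
  density i z <= C /\ 1 <= C * density i z.
Proof.
have /choice[C hC] (i : idx X) : exists C : R, 1 <= C /\ forall z, K i z ->
    density i z <= C /\ 1 <= C * density i z.
  have cK : compact (K i).
    exact: (compact_image_phi (@closed_chart_supp R M i) (@chi_supp_dom R M i)).
  have c1 : {within K i, continuous (density i)}.
    apply: continuous_in_subspaceT => z /set_mem /K_sub_O Oz; exact: density_continuous.
  have c2 : {within K i, continuous (fun z => (density i z)^-1)}.
    apply: continuous_in_subspaceT => z /set_mem /K_sub_O Oz; apply: continuousV.
      by rewrite gt_eqF// density_gt0.
    exact: density_continuous.
  have [C1 C10 h1] := compact_within_bounded cK c1.
  have [C2 C20 h2] := compact_within_bounded cK c2.
  exists (1 + C1 + C2); split=> [|z Kz]; first by rewrite -addrA lerDl addr_ge0.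
  have d0 := density_gt0 (K_sub_O Kz).
  have := h1 z Kz; rewrite gtr0_norm// => h1z; have := h2 z Kz; rewrite gtr0_norm ?invr_gt0// => h2z.
  split; first by lra.
  by rewrite -ler_pdivrMr// div1r; lra.
exists (\sum_i C i + 1) => [|i z Kz].
  by rewrite lerDr sumr_ge0// => i _; have [] := hC i; lra.
have [C1 /(_ z Kz) [h1 h2]] := hC i.
have le : C i <= \sum_j C j + 1.
  rewrite (bigD1 i)//= -addrA lerDl addr_ge0// sumr_ge0// => j _; have [] := hC j; lra.
split; first exact: le_trans le.
apply: le_trans h2 _; rewrite ler_wpM2r// ltW//; exact: density_gt0 (K_sub_O Kz).
Qed.

Lemma phi_image_chart_inv (i : idx X) (A : set M) :
  phi i @` (A `&` F i) = chart_inv i @^-1` A `&` K i.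
Proof.
apply/seteqP; split=> z.
  move=> [x [Ax Fx] <-]; split; last by exists x.
  have dx := chi_supp_dom Fx.
  by rewrite /= chart_invE ?chart_phiK//; exact: codom_phi.
move=> [Az [x Fx E]]; have dx := chi_supp_dom Fx.
exists x => //; split => //; move: Az; rewrite /= -E chart_invE ?chart_phiK//.
exact: codom_phi.
Qed.

Lemma measurable_chart_inv_preimage (i : idx X) (A : set (borel M)) : measurable A ->
  measurable (chart_inv i @^-1` A `&` K i : set (borel V)).
Proof.
move=> mA; apply: measurableI; last exact: borel_K.
by rewrite -[_ @^-1` _]setTI; exact: measurable_chart_inv.
Qed.

Lemma volE (i : idx X) (A : set (borel M)) : measurable A ->
  let S := chart_inv i @^-1` A `&` K i in
  measurable_fun setT (fun z : borel V => density i z * \1_S z) /\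
  @vol R M (A `&` F i) = (\int[lm]_z (density i z * \1_S z)%:E)%E.
Proof.
move=> mA S; have mS : measurable S by exact: measurable_chart_inv_preimage.
have mden : measurable_fun setT (fun z : borel V => if z \in O i then density i z else 0).
  apply: measurable_to_real => W oW; apply: measurable_patch_preimage => //.
    exact: chart_codom_open.
  by move=> z Oz; exact: density_continuous.
have m : measurable_fun setT (fun z : borel V => density i z * \1_S z).
  have mi : measurable_fun setT (\1_S : borel V -> R) by exact: measurable_indic.
  have := measurable_funM mden mi.
  apply: eq_measurable_fun => z _ /=; rewrite indicE.
  case: (boolP (z \in S)) => [/set_mem [_ /K_sub_O Oz]|_]; last by rewrite !mulr0.
  by rewrite mem_set.
split=> //; rewrite (@vol_chart R M i); last 2 first.
- by apply: measurableI => //; exact: borel_chart_supp.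
- by move=> x [_ /chi_supp_dom].
rewrite phi_image_chart_inv lamE//; first exact/measurable_EFinP.
by move=> z; rewrite lee_fin mulr_ge0 ?sqrtr_ge0// indicE ler0n.
Qed.

Lemma vol_lam_compare : exists2 C : R, 1 <= C & forall (i : idx X) (A : set (borel M)),
  measurable A ->
  (@vol R M (A `&` F i) <= C%:E * lm (chart_inv i @^-1` A `&` K i))%E /\
  (lm (chart_inv i @^-1` A `&` K i) <= C%:E * @vol R M (A `&` F i))%E.
Proof.
have [C C1 hC] := density_bounds; exists C => // i A mA.
have C0 : 0 <= C by exact: le_trans C1.
have [m ->] := volE i mA; move: m; set S : set (borel V) := _ `&` K i => m.
have mS : measurable S by exact: measurable_chart_inv_preimage.
have d0 (z : borel V) : (0 <= (density i z * \1_S z)%:E)%E.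
  by rewrite lee_fin mulr_ge0 ?sqrtr_ge0// indicE ler0n.
have i0 (z : borel V) : (0 <= (\1_S z : R)%:E)%E by rewrite lee_fin indicE ler0n.
have mi : measurable_fun setT (fun z : borel V => (\1_S z : R)%:E).
  by apply/measurable_EFinP; exact: measurable_indic.
have mE : measurable_fun setT (fun z : borel V => (density i z * \1_S z)%:E).
  exact/measurable_EFinP.
have -> : lm S = (\int[lm]_z (\1_S z)%:E)%E by rewrite integral_indic// setIT.
split.
  rewrite -ge0_integralZl// ?lee_fin//; apply: ge0_le_integral => //.
  - exact: measurable_funeM.
  - move=> z _; rewrite -EFinM lee_fin indicE; case: (boolP (z \in S)) => [/set_mem [_ Kz]|_].
      by rewrite !mulr1; have [] := hC i z Kz.
    by rewrite !mulr0.
rewrite -ge0_integralZl// ?lee_fin//; apply: ge0_le_integral => //.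
- exact: measurable_funeM.
- move=> z _; rewrite -EFinM lee_fin indicE; case: (boolP (z \in S)) => [/set_mem [_ Kz]|_].
    by rewrite !mulr1; have [] := hC i z Kz.
  by rewrite !mulr0.
Qed.

Lemma lam_K_lty (i : idx X) (A : set (borel V)) : measurable A -> (lm (A `&` K i) < +oo)%E.
Proof.
move=> mA; have [r _ hr] := charts_cbox M.
apply: le_lt_trans (lam_cbox_lty d r%:R); apply: le_measure; rewrite ?inE.
- by apply: measurableI => //; exact: borel_K.
- exact: measurable_cbox.
- by move=> z [_ /hr].
Qed.

Lemma vol_lty : (@vol R M setT < +oo)%E.
Proof.
have [C C1 hC] := vol_lam_compare.
have Fi (i : idx X) : (@vol R M (F i) < +oo)%E.
  have [h _] := hC i setT measurableT; rewrite setTI in h; apply: le_lt_trans h _.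
  have := @lam_K_lty i setT measurableT; rewrite preimage_setT setTI => h.
  by rewrite lte_mul_pinfty// lee_fin (le_trans ler01).
have cov : (setT : set (borel M)) `<=` \big[setU/set0]_(i <- index_enum (idx X)) (F i : set (borel M)).
  move=> x _; have [i hi] : exists i : idx X, chi i x != 0.
    apply: contrapT => /forallNP h; have := chi_sum1 x; rewrite big1 => [/eqP|i _].
      by rewrite eq_sym oner_eq0.
    by apply/eqP; apply: contrapT => /negP; exact: h.
  rewrite -bigcup_seq; exists i; first by rewrite /= mem_index_enum.
  exact: subset_closure.
have key (s : seq (idx X)) : measurable (\big[setU/set0]_(i <- s) (F i : set (borel M))) /\
    (@vol R M (\big[setU/set0]_(i <- s) (F i : set (borel M))) < +oo)%E.
  elim: s => [|i s [m ih]]; first by rewrite big_nil measure0; split.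
  rewrite big_cons; split; first by apply: measurableU => //; exact: borel_chart_supp.
  apply: (le_lt_trans (measureU2 _ (borel_chart_supp i) m)).
  by rewrite lte_add_pinfty//; exact: Fi.
have [m fin] := key (index_enum (idx X)).
by apply: le_lt_trans fin; apply: le_measure; rewrite ?inE.
Qed.

(** If the volume vanished, so would the Lebesgue measure of the image of the support of some
    [chi i]. Taking i with [chi i] nonzero at the base point, that image contains a cube. *)
Lemma vol_gt0 : (0 < @vol R M setT)%E.
Proof.
have [C C1 hC] := vol_lam_compare.
have [i ci] : exists i : idx X, chi i (point : M) != 0.
  apply: contrapT => /forallNP h; have := chi_sum1 (point : M); rewrite big1 => [/eqP|i _].
    by rewrite eq_sym oner_eq0.
  by apply/eqP; apply: contrapT => /negP; exact: h.
rewrite lt_neqAle measure_ge0 andbT; apply/eqP => v0.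
have vF : @vol R M (F i) = 0%E.
  apply/eqP; rewrite eq_le measure_ge0 andbT [X in (_ <= X)%E]v0.
  by apply: le_measure; rewrite ?inE//; exact: borel_chart_supp.
have [_] := hC i setT measurableT; rewrite setTI vF mule0 preimage_setT setTI => lK.
pose W : set M := [set x | chi i x != 0].
have oW : open W.
  rewrite (_ : W = chi i @^-1` [set y | y != 0]).
    apply: open_comp; last exact: open_neq.
    by move=> x _; exact: (smooth_fun_continuous (@chi_smooth R M i)).
  by [].
have oI : open (O i `&` psi i @^-1` W) by exact: open_chart_preimage.
have zI : (O i `&` psi i @^-1` W) (phi i (point : M)).
  have dp : dom i (point : M) by apply: chi_supp_dom; exact: subset_closure.
  by split; [exact: codom_phi|rewrite /= chart_phiK].
have [r r0 hr] : exists2 r : R, 0 < r & forall z : V, `|z - phi i (point : M)| <= r -> (K i) z.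
  have /nbhs_ballP[e e0 he] : nbhs (phi i (point : M)) (O i `&` psi i @^-1` W).
    by apply: open_nbhs_nbhs; split.
  exists (e / 2); first by rewrite divr_gt0.
  move=> z ze; have [Oz Wz] : (O i `&` psi i @^-1` W) z.
    apply: he; rewrite -ball_normE /= distrC; apply: le_lt_trans ze _.
    by rewrite ltr_pdivrMr// ltr_pMr// ltr1n.
  have [dz E] := codom_chartP Oz; exists (psi i z) => //.
  exact: subset_closure.
have lB : (lm (cbox r) <= 0)%E.
  apply: (le_trans _ lK).
  have eB : lm (cbox r) = (\int[lm]_z (\1_(cbox r) z)%:E)%E.
    by rewrite integral_indic ?setIT//; exact: measurable_cbox.
  have eK : lm (K i) = (\int[lm]_z (\1_(K i) z)%:E)%E.
    by rewrite integral_indic ?setIT//; exact: borel_K.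
  rewrite eB eK.
  rewrite (@integral_shift R d (- phi i (point : M)) (fun z => (\1_(cbox r) z)%:E)); last 2 first.
  - by apply/measurable_EFinP; apply: measurable_indic; exact: measurable_cbox.
  - by move=> z; rewrite lee_fin indicE ler0n.
  apply: ge0_le_integral => //.
  - apply/measurable_EFinP; apply: (measurableT_comp _ (measurable_shift (- phi i (point : M)))).
    by apply: measurable_indic; exact: measurable_cbox.
  - by apply/measurable_EFinP; apply: measurable_indic; exact: borel_K.
  - move=> z _; rewrite lee_fin !indicE; case: (boolP (_ \in cbox r)) => [/set_mem h|_]; last by rewrite ler0n.
    by rewrite mem_set//; apply: hr; rewrite addrC.
have rr : - r <= r by rewrite ge0_cp// ltW.
have [ii iE] := Rint_itv_indic rr.
have m1 (l : 'I_d) : measurable_fun setT (\1_(`[- r, r]%classic : set R) : R -> R).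
  by apply: measurable_indic; exact: measurable_itv.
have [] := @integral_lam_prod R d (fun _ => \1_(`[- r, r]%classic : set R)) m1
  (fun _ t => ler0n _ _) (fun=> ii).
set h := fun z => _; move=> hi hE.
have : \int[lm]_z h z <= \int[lm]_z \1_(cbox r) z.
  apply: Rint_le => // [|z]; first exact: intg_indic_cbox.
  rewrite indicE; case: (boolP (z \in cbox r)) => [_|zr].
    by apply: prodr_ile1 => l _; rewrite indicE ler0n lern1 leq_b1.
  have [l zl] : exists l, r < `|z 0 l|.
    apply: contrapT => /forallNP H; move: zr; rewrite notin_setE; apply; rewrite /cbox /=.
    by apply: rV_norm_le => [|l]; [exact: ltW|rewrite leNgt; apply/negP; exact: H].
  by rewrite /h (bigD1 l)//= indicE memNset ?mul0r//= in_itv /= -ler_norml leNgt zl.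
rewrite Rint_indic; last exact: measurable_cbox.
have -> : lm (cbox r) = 0%E by apply/eqP; rewrite eq_le lB measure_ge0.
rewrite hE /= leNgt prodr_gt0// => l _.
by rewrite iE opprK addr_gt0.
Qed.

Lemma dxE (A : set (borel M)) : dx M A = (@vol R M A * (fine (@vol R M setT))^-1%:E)%E.
Proof.
rewrite /dx /= /mnormalize ifF//; apply/negbTE; rewrite negb_or; apply/andP; split.
  by rewrite gt_eqF// vol_gt0.
by rewrite lt_eqF// vol_lty.
Qed.

Lemma dx_lam_compare : exists2 C : R, 0 <= C & forall (i : idx X) (A : set (borel M)),
  measurable A ->
  (dx M (A `&` F i) <= C%:E * lm (chart_inv i @^-1` A `&` K i))%E /\
  (lm (chart_inv i @^-1` A `&` K i) <= C%:E * dx M (A `&` F i))%E.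
Proof.
have [C C1 hC] := vol_lam_compare.
have C0 : 0 <= C by exact: le_trans C1.
set v := fine (@vol R M setT).
have v0 : 0 < v by rewrite fine_gt0// vol_gt0 vol_lty.
have vi0 : 0 <= v^-1 by rewrite invr_ge0 ltW.
exists (C * v^-1 + C * v) => [|i A mA]; first by rewrite addr_ge0// mulr_ge0// ltW.
have [h1 h2] := hC i A mA; rewrite dxE -/v; split.
  rewrite muleC; apply: (@le_trans _ _ (v^-1%:E * (C%:E * lm (chart_inv i @^-1` A `&` K i)))%E).
    by rewrite lee_wpmul2l// lee_fin.
  by rewrite muleA -EFinM lee_wpmul2r// lee_fin mulrC lerDl mulr_ge0// ltW.
apply: (le_trans h2); rewrite [(_ * (v^-1)%:E)%E]muleC muleA -EFinM lee_wpmul2r// lee_fin.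
by rewrite mulrDl mulfK ?gt_eqF// lerDr !mulr_ge0.
Qed.

(** The passage from a chart to the manifold transports approximation errors; the passage back shows
    that localized functions are square integrable. *)
Lemma integral_dx_lam : exists2 C : R, 0 <= C & forall (i : idx X) (h : borel M -> R),
  measurable_fun setT h -> (forall x, 0 <= h x) ->
  (intg lm (fun z => \1_(K i) z * h (chart_inv i z)) ->
   intg (dx M) (fun x => \1_(F i) x * h x) /\
   \int[dx M]_x (\1_(F i) x * h x) <= C * \int[lm]_z (\1_(K i) z * h (chart_inv i z))) /\
  (intg (dx M) (fun x => \1_(F i) x * h x) ->
   intg lm (fun z => \1_(K i) z * h (chart_inv i z))).
Proof.
have [C C0 hC] := dx_lam_compare; exists C => // i h mh h0.
have mF := borel_chart_supp i; have mK := borel_K i.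
have mg := measurable_chart_inv i.
have mhg : measurable_fun setT (h \o chart_inv i) by exact: measurableT_comp mh mg.
have e1 : (\int[dx M]_(x in F i) (h x)%:E = \int[dx M]_x (\1_(F i) x * h x)%:E)%E.
  rewrite integral_mkcond; apply: eq_integral => x _.
  by rewrite patchE indicE; case: (x \in _); rewrite ?mul1r ?mul0r.
have e2 : (\int[lm]_(z in K i) (h (chart_inv i z))%:E = \int[lm]_z (\1_(K i) z * h (chart_inv i z))%:E)%E.
  rewrite integral_mkcond; apply: eq_integral => x _.
  by rewrite patchE indicE; case: (x \in _); rewrite ?mul1r ?mul0r.
have l1 := le_integral_mrestr (m1 := dx M) (m2 := lm) mg mF mK C0 mh h0 (fun A mA => (hC i A mA).1).
have l2 := ge_integral_mrestr (m1 := dx M) (m2 := lm) mg mF mK C0 mh h0 (fun A mA => (hC i A mA).2).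
rewrite e1 e2 in l1 l2.
have m1 : measurable_fun setT (fun x : borel M => \1_(F i) x * h x).
  by apply: measurable_funM => //; exact: measurable_indic.
have m2 : measurable_fun setT (fun z : borel V => \1_(K i) z * h (chart_inv i z)).
  by apply: measurable_funM => //; exact: measurable_indic.
split=> [ii|ii].
  have di : intg (dx M) (fun x => \1_(F i) x * h x).
    apply: intg_le_lty => //; first by move=> x; rewrite mulr_ge0// indicE ler0n.
    by apply: le_lt_trans l1 _; rewrite -EFin_Rint// -EFinM ltry.
  split=> //; move: l1; rewrite -!EFin_Rint// -EFinM lee_fin; exact.
apply: intg_le_lty => //; first by move=> z; rewrite mulr_ge0// indicE ler0n.
by apply: le_lt_trans l2 _; rewrite -EFin_Rint// -EFinM ltry.
Qed.

End volume.

(** * Approximation by atoms *)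

Lemma sqr_sum_le (R : realType) (J : finType) (a : J -> R) :
  (\sum_i a i) ^+ 2 <= #|J|%:R * \sum_i a i ^+ 2.
Proof.
have E i : \sum_j (a i - a j) ^+ 2 =
    #|J|%:R * a i ^+ 2 + (\sum_j a j ^+ 2 - 2 * (\sum_j a j) * a i).
  transitivity (\sum_j (a i ^+ 2 + (a j ^+ 2 - 2 * a i * a j))).
    by apply: eq_bigr => j _; ring.
  by rewrite big_split/= sumr_const sumrB -mulr_sumr -mulr_natl; ring.
have : 0 <= \sum_i \sum_j (a i - a j) ^+ 2.
  by apply: sumr_ge0 => i _; apply: sumr_ge0 => j _; rewrite sqr_ge0.
under eq_bigr do rewrite E.
rewrite big_split/= -mulr_sumr sumrB sumr_const -mulr_sumr -[_ *+ #|_|]mulr_natl.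
by set q := \sum_i _ ^+ 2; set p := \sum_i _; lra.
Qed.

Section finite_combinations.
Context (R : realType) (T : Type).
Implicit Types (s : seq (T -> R)) (c : seq R).

(** [zip] truncates to the shorter list, so a coefficient list keeps its meaning when the family is
    prolonged, and the empty list stands for the zero combination. *)
Definition comb s c (x : T) : R := \sum_(p <- zip c s) p.1 * p.2 x.

Lemma comb_nil s x : comb s [::] x = 0.
Proof. by case: s => [|? ?]; rewrite /comb big_nil. Qed.

Lemma comb_cons u s a c x : comb (u :: s) (a :: c) x = a * u x + comb s c x.
Proof. by rewrite /comb /= big_cons. Qed.

Lemma comb_cat s s' c c' x : size c = size s ->
  comb (s ++ s') (c ++ c') x = comb s c x + comb s' c' x.
Proof. by move=> e; rewrite /comb zip_cat// big_cat. Qed.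

Lemma comb_prefix s s' c x : (size c <= size s)%N -> comb (s ++ s') c x = comb s c x.
Proof.
elim: s c => [|u s ih] [|a c]//= cs; rewrite ?comb_nil//.
by rewrite !comb_cons ih.
Qed.

Lemma comb0 s n x : comb s (nseq n 0) x = 0.
Proof.
by elim: s n => [|u s ih] [|n] /=; rewrite ?comb_nil ?comb_cons ?ih ?mul0r ?addr0// /comb big_nil.
Qed.

Lemma comb_map (J : Type) (r : seq J) (f : J -> T -> R) (c : J -> R) x :
  comb [seq f i | i <- r] [seq c i | i <- r] x = \sum_(i <- r) c i * f i x.
Proof.
by elim: r => [|i r ih]; rewrite /= ?comb_nil ?big_nil// comb_cons ih big_cons.
Qed.

End finite_combinations.

Lemma Rint_center_le d (T : measurableType d) (R : realType) (m : probability T R) (f : T -> R) :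
  sqint m f -> \int[m]_x ((f x - \int[m]_y f y) ^+ 2) <= \int[m]_x (f x ^+ 2).
Proof.
move=> fi; have f1 := sqint_intg fi; set a := \int[m]_y f y.
rewrite (_ : \int[m]_x _ = \int[m]_x (f x ^+ 2 - (2 * a * f x - a ^+ 2))); last first.
  by apply: eq_Rint => x; ring.
have i1 : intg m (fun x => 2 * a * f x - a ^+ 2) by apply: intgB; [exact: intgZ|exact: intg_cst].
rewrite RintB//; last exact: fi.2.
rewrite RintB; [|exact: intgZ|exact: intg_cst].
rewrite RintZ// Rint_cst.
by rewrite -/a; have := sqr_ge0 a; lra.
Qed.

(* [A] is approximated in L^2 at rate n^(-t/2) by combinations of the n-th
   family with coefficients of polynomial size. *)
Definition approx_rate d (T : measurableType d) (R : realType) (m : {measure set T -> \bar R})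
    (fam : nat -> seq (T -> R)) (Q : nat) (t : R) (A : T -> R) :=
  exists2 K : R, 0 <= K & forall n, (0 < n)%N -> exists c : seq R,
    [/\ size c = size (fam n), (forall a, a \in c -> `|a| <= K * n%:R ^+ Q) &
        \int[m]_x ((A x - comb (fam n) c x) ^+ 2) <= K * n%:R `^ (- t)].

Section approximation.
Context {R : realType} (M : closedRiemannian R).
Local Notation X := (atlas M).
Local Notation d := (Defs.dim X).
Local Notation V := 'rV[R]_d.
Local Notation F i := (chart_supp i).
Local Notation K i := (phi i @` chart_supp i).
Local Notation lm := (lam R d).
Local Notation dxM := (dx M).
Variable r0 : nat.
Hypothesis hr : forall (i : idx X) z, (phi i @` chart_supp i) z -> `|z| <= r0%:R.

Lemma continuous_bounded (u : M -> R) : continuous u ->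
  exists2 B : R, 0 <= B & forall x, `|u x| <= B.
Proof.
move=> cu; apply: (bounded_compact_support (@carrier_compact R M)); first exact: continuous_subspaceT.
by move=> x /(_ I).
Qed.

Lemma eta_bounded : exists2 B : R, 1 <= B & forall (i : idx X) x, `|eta i x| <= B.
Proof.
have /choice[B hB] (i : idx X) : exists B : R, 0 <= B /\ forall x, `|eta i x| <= B.
  have [B B0 h] := continuous_bounded (smooth_fun_continuous (@smooth_fun_eta R M i)).
  by exists B.
exists (1 + \sum_i B i) => [|i x].
  by rewrite lerDl sumr_ge0// => i _; have [] := hB i.
apply: le_trans ((hB i).2 x) _; rewrite (bigD1 i)//= addrCA lerDl addr_ge0// sumr_ge0// => j _.
by have [] := hB j.
Qed.

Lemma borel_smooth (u : M -> R) : smooth_fun X u -> measurable_fun setT (u : borel M -> R).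
Proof. by move=> su; apply: continuous_borel_real; exact: smooth_fun_continuous. Qed.

Definition chart_pull (i : idx X) (g : V -> R) (x : borel M) : R :=
  if x \in dom i then g (phi i x) else 0.

Lemma measurable_chart_pull (i : idx X) (g : V -> R) : continuous g ->
  measurable_fun setT (chart_pull i g).
Proof.
move=> cg; apply: measurable_to_real => W oW.
apply: (@measurable_patch_preimage _ _ (dom i) (g \o phi i) 0) => //.
  exact: chart_dom_open.
by move=> x dx; apply: continuous_comp; [exact: chart_phi_continuous|exact: cg].
Qed.

Lemma continuous_grid_bump N (m : {ffun 'I_d -> 'I_(grid r0 N)}) : continuous (@grid_bump R d r0 N m).
Proof.
have h (q : seq 'I_d) : continuous (fun z : V => \prod_(l <- q) bump (N%:R * z 0 l - offset R r0 N (m l))).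
  elim: q => [|l q ih] z; first by under eq_fun do rewrite big_nil; exact: cst_continuous.
  under eq_fun do rewrite big_cons; apply: (@continuousM R V); last exact: ih.
  apply: (@continuous_comp _ _ _ (fun z : V => N%:R * z 0 l - offset R r0 N (m l)) (@bump R)).
    apply: (@continuousB R _ V); last exact: cst_continuous.
    by apply: (@continuousM R V); [exact: cst_continuous|exact: coord_continuous].
  exact: (smoothk_cont (@smooth1_bump R 0%N)).
exact: h.
Qed.

Definition atom N (p : idx X * {ffun 'I_d -> 'I_(grid r0 N)}) (x : borel M) : R :=
  chart_bump p.1 p.2 x - \int[dxM]_y chart_bump p.1 p.2 y.

Definition atoms N : seq (borel M -> R) :=
  [seq atom p | p <- enum {: idx X * {ffun 'I_d -> 'I_(grid r0 N)}}].

(** All atoms of levels 1 to n, concatenated so that each family is a prefix of the later ones: a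
    combination of low level is literally a combination at every higher level. *)
Fixpoint fam n : seq (borel M -> R) := if n is n'.+1 then fam n' ++ atoms n else [::].

Lemma fam_prefix n n' : (n <= n')%N -> exists s, fam n' = fam n ++ s.
Proof.
elim: n' => [|n' ih]; first by rewrite leqn0 => /eqP ->; exists [::].
rewrite leq_eqVlt ltnS => /predU1P[->|/ih[s e]]; first by exists [::]; rewrite cats0.
by exists (s ++ atoms n'.+1); rewrite [LHS]/= e catA.
Qed.

Lemma fam_atom n u : u \in fam n -> exists N (p : idx X * {ffun 'I_d -> 'I_(grid r0 N)}),
  (0 < N <= n)%N /\ u = atom p.
Proof.
elim: n => // n ih; rewrite mem_cat => /orP[/ih[N [p [/andP[N0 Nn] e]]]|/mapP[p _ e]].
  by exists N, p; rewrite N0 (leqW Nn).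
by exists n.+1, p; split; rewrite ?leqnn.
Qed.

Lemma size_fam : exists2 C : R, 0 <= C & forall n, (size (fam n))%:R <= C * n%:R ^+ d.+1.
Proof.
exists (#|idx X|%:R * (2 * r0%:R + 1) ^+ d) => [|n].
  by rewrite mulr_ge0 ?ler0n// exprn_ge0// addr_ge0 ?mulr_ge0.
have sz N : (0 < N <= n)%N ->
    (size (atoms N))%:R <= #|idx X|%:R * (2 * r0%:R + 1) ^+ d * n%:R ^+ d :> R.
  move=> /andP[N0 Nn]; rewrite size_map -cardE card_prod card_ffun !card_ord natrM natrX.
  rewrite -mulrA -exprMn ler_wpM2l ?ler0n// lerXn2r ?nnegrE ?ler0n ?mulr_ge0 ?addr_ge0 ?mulr_ge0 ?ler0n//.
  rewrite /grid -natr1 !natrM.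
  have Nn' : N%:R <= n%:R :> R by rewrite ler_nat.
  have n1 : 1 <= n%:R :> R by rewrite ler1n (leq_trans N0).
  have r00 : 0 <= r0%:R :> R by [].
  by nra.
have h m : (m <= n)%N -> (size (fam m))%:R <=
    m%:R * (#|idx X|%:R * (2 * r0%:R + 1) ^+ d * n%:R ^+ d) :> R.
  elim: m => [|m ih] mn; first by rewrite mul0r.
  rewrite size_cat natrD -natr1 mulrDl mul1r lerD//; first by apply: ih; exact: ltnW.
  exact: sz.
by apply: le_trans (h n (leqnn n)) _; rewrite exprS mulrCA.
Qed.

Lemma smooth_atom N p : smooth_fun X (@atom N p).
Proof.
apply: (@smooth_fun_eq _ _ (fun x => chart_bump p.1 p.2 x + - \int[dxM]_y chart_bump p.1 p.2 y)) => //.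
by apply: smooth_fun_add; [exact: smooth_fun_chart_bump|exact: smooth_fun_cst].
Qed.

Lemma intg_chart_bump N i m : intg dxM (@chart_bump R M r0 N i m).
Proof.
have [B B1 hB] := eta_bounded.
apply: (@intg_bnd _ _ _ _ _ B); first by apply: borel_smooth; exact: smooth_fun_chart_bump.
by move=> x; exact: le_trans (chart_bump_norm_le _ _ _) (hB _ _).
Qed.

Lemma atom_mean N p : \int[dxM]_x @atom N p x = 0.
Proof.
rewrite RintB ?Rint_cst ?subrr//; [exact: intg_chart_bump|exact: intg_cst].
Qed.

Lemma atom_bounded : exists2 B : R, 0 <= B & forall N p x, `|@atom N p x| <= B.
Proof.
have [B B1 hB] := eta_bounded.
have hb N i m x : `|@chart_bump R M r0 N i m x| <= B.
  exact: le_trans (chart_bump_norm_le _ _ _) (hB _ _).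
exists (2 * B) => [|N p x]; first by rewrite mulr_ge0// (le_trans _ B1).
apply: le_trans (ler_normB _ _) _; rewrite mulr_natl lerD//.
apply: Rint_bnd => //; apply: borel_smooth; exact: smooth_fun_chart_bump.
Qed.

Variable A : borel M -> R.
Hypotheses (mA : measurable_fun setT A) (A2 : sqint dxM A) (Amean : \int[dxM]_x A x = 0).
Hypothesis fi : forall i : idx X, intg lm (localize i A) /\ sqint lm (localize i A).
Variables (K0 t : R).
Hypotheses (t01 : 0 < t <= 1) (K00 : 0 <= K0).
Hypothesis fK : forall (i : idx X) (u : V), shift_sqdist (localize i A) u <= K0 * (`|u| ^+ 2) `^ t.

Local Notation G N := {ffun 'I_d -> 'I_(grid r0 N)}.

(** Decompose A as the sum of eta_i chi_i A. Each chi_i A is approximated in its chart by cell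
    averages, multiplication by eta_i brings the bumps back to the manifold, and [integral_dx_lam]
    transports the error. The modulus of continuity at distance 2 / N gives the rate N^(-2 t) for
    the square. *)
Lemma chart_approx : exists2 C : R, 0 <= C & forall N, (0 < N)%N ->
  exists c : idx X -> G N -> R, (forall i m, `|c i m| <= C * N%:R ^+ d) /\
  sqint dxM (fun x => A x - \sum_i \sum_m c i m * chart_bump i m x) /\
  \int[dxM]_x ((A x - \sum_i \sum_m c i m * chart_bump i m x) ^+ 2) <=
    C * N%:R `^ (- (2 * t)).
Proof.
have [B B1 hB] := eta_bounded; have [C C0 hC] := integral_dx_lam M.
have B0 : 0 <= B by exact: le_trans B1.
pose nI : R := #|idx X|%:R.
pose L : R := \sum_i \int[lm]_z `|localize i A z|.
pose Kt : R := 16 ^+ d * (K0 * 4 `^ t).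
have L0 : 0 <= L by apply: sumr_ge0 => i _; apply: Rint_ge0.
have Kt0 : 0 <= Kt by rewrite mulr_ge0 ?exprn_ge0// mulr_ge0// powR_ge0.
exists (L + nI * B ^+ 2 * (nI * (C * Kt))) => [|N N0].
  by rewrite addr_ge0// !mulr_ge0 ?sqr_ge0// ler0n.
pose c i (m : G N) := cell_avg (localize i A) m.
exists c; split.
  move=> i m; apply: le_trans (cell_avg_le N0 (fi i).1 m) _.
  rewrite mulrC ler_wpM2r ?exprn_ge0//.
  have hL : \int[lm]_y `|localize i A y| <= L.
    by rewrite /L (bigD1 i)//= lerDl sumr_ge0// => j _; apply: Rint_ge0.
  by apply: le_trans hL _; rewrite lerDl !mulr_ge0 ?sqr_ge0// ler0n.
pose e i (x : borel M) := chi i x * A x - \sum_m c i m * chart_pull i (grid_bump m) x.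
have me i : measurable_fun setT (e i).
  apply: measurable_funB.
    by apply: measurable_funM => //; apply: borel_smooth; exact: chi_smooth.
  apply: measurable_sum => m; apply: measurable_funM => //.
  by apply: measurable_chart_pull; exact: continuous_grid_bump.
have E x : A x - \sum_i \sum_m c i m * chart_bump i m x = \sum_i eta i x * (\1_(F i) x * e i x).
  rewrite -[A x in LHS]mul1r -(eta_chi_sum x) mulr_suml -sumrB; apply: eq_bigr => i _.
  rewrite indicE; case: (boolP (x \in F i)) => [/set_mem Fx|].
    rewrite mul1r /e mulrBr mulrA; congr (_ - _); rewrite mulr_sumr; apply: eq_bigr => m _.
    by rewrite /chart_bump /chart_pull mem_set; [rewrite mulrCA|exact: chi_supp_dom].
  rewrite notin_setE => Fx; rewrite mul0r mulr0 eta_off_supp// !mul0r big1 ?subr0// => m _.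
  by rewrite /chart_bump eta_off_supp// mul0r mulr0.
have ei i : intg dxM (fun x => \1_(F i) x * e i x ^+ 2) /\
    \int[dxM]_x (\1_(F i) x * e i x ^+ 2) <= C * (Kt * N%:R `^ (- (2 * t))).
  have /andP[t0 t1] := t01.
  have [h1 h2] := @grid_approx_sqdist R d r0 N N0 _ (fi i).1 (fi i).2 _ _ (ltW t0) K00 (fK i).
  have eE z : K i z -> e i (chart_inv i z) = localize i A z - \sum_m c i m * grid_bump m z.
    move=> Kz; have Oz := K_sub_O Kz; have [dz pz] := codom_chartP Oz.
    rewrite /e chart_invE// /localize patchE mem_set//; congr (_ - _).
    by apply: eq_bigr => m _; rewrite /chart_pull mem_set// pz.
  have le z : \1_(K i) z * e i (chart_inv i z) ^+ 2 <=
     \1_(cbox r0%:R) z * (localize i A z - \sum_m c i m * grid_bump m z) ^+ 2.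
    rewrite !indicE; case: (boolP (z \in K i)) => [/set_mem Kz|_].
      by rewrite (mem_set (hr Kz : cbox r0%:R z)) eE.
    by rewrite mul0r mulr_ge0 ?sqr_ge0// ler0n.
  have ii : intg lm (fun z => \1_(K i) z * e i (chart_inv i z) ^+ 2).
    apply: intg_dom h1 => [|z]; last first.
      by rewrite ger0_norm ?le// mulr_ge0 ?sqr_ge0// indicE ler0n.
    apply: measurable_funM; first by apply: measurable_indic; exact: borel_K.
    by apply: measurable_funX; exact: (measurableT_comp (me i) (measurable_chart_inv i)).
  have [] := (hC i (fun x => e i x ^+ 2) (measurable_funX 2 (me i)) (fun x => sqr_ge0 _)).1 ii.
  move=> i1 i2; split=> //; apply: le_trans i2 _; rewrite ler_wpM2l//.
  apply: le_trans (Rint_le ii h1 le) _; apply: le_trans h2 _.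
  rewrite /Kt -!mulrA ler_wpM2l ?exprn_ge0// ler_wpM2l//.
  rewrite exprMn powRM ?sqr_ge0// ler_pM ?powR_ge0//.
    by rewrite (_ : 2 ^+ 2 = 4 :> R)//; ring.
  rewrite exprVn -powR_inv1 ?sqr_ge0// -powR_mulrn// -!powRrM.
  by rewrite (_ : 2%:R * (-1 * t) = - (2 * t))//; ring.
have Ele x : (A x - \sum_i \sum_m c i m * chart_bump i m x) ^+ 2 <=
    nI * B ^+ 2 * \sum_i (\1_(F i) x * e i x ^+ 2).
  rewrite E; apply: le_trans (sqr_sum_le _) _; rewrite -mulrA ler_wpM2l ?ler0n//.
  rewrite mulr_sumr ler_sum// => i _; rewrite [(eta i x * _) ^+ 2]exprMn ler_pM ?sqr_ge0//.
    by have := hB i x; rewrite ler_norml => /andP[? ?]; nra.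
  rewrite exprMn.
  by rewrite indicE; case: (x \in F i); rewrite /= ?expr1n// expr0n.
have mE : measurable_fun setT (fun x => A x - \sum_i \sum_m c i m * chart_bump i m x : R).
  apply: measurable_funB => //; apply: measurable_sum => i; apply: measurable_sum => m.
  by apply: measurable_funM => //; apply: borel_smooth; exact: smooth_fun_chart_bump.
have si : intg dxM (fun x => nI * B ^+ 2 * \sum_i (\1_(F i) x * e i x ^+ 2)).
  by apply: intgZ; apply: intg_sum => i; have [] := ei i.
have E2 : intg dxM (fun x => (A x - \sum_i \sum_m c i m * chart_bump i m x) ^+ 2).
  apply: intg_dom si => [|x]; first exact: measurable_funX.
  by rewrite ger0_norm ?sqr_ge0.
split; first by split.
apply: le_trans (Rint_le E2 si Ele) _; rewrite RintZ; last by apply: intg_sum => i; have [] := ei i.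
rewrite Rint_sum => [|i]; last by have [] := ei i.
apply: (@le_trans _ _ (nI * B ^+ 2 * \sum_(i : idx X) (C * (Kt * N%:R `^ (- (2 * t)))))).
  by rewrite ler_wpM2l ?mulr_ge0 ?sqr_ge0 ?ler0n// ler_sum// => i _; have [] := ei i.
have -> (q : R) : \sum_(i : idx X) q = nI * q by rewrite sumr_const mulr_natl.
by have := mulr_ge0 L0 (powR_ge0 N%:R (- (2 * t))); set w := N%:R `^ _; rewrite mulrDl !mulrA; lra.
Qed.

(** The coefficients of earlier levels are set to zero. Replacing bumps by centred atoms replaces
    the error by the error minus its mean, because [A] has mean zero, and centring does not increase
    an L^2 norm. *)
Lemma fam_approx : approx_rate dxM fam d (2 * t) A.
Proof.
have [C C0 hC] := chart_approx; exists C => // -[//|n] _.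
have [c [c1 [c2 c3]]] := hC n.+1 isT.
pose c' := nseq (size (fam n)) (0 : R) ++ [seq c p.1 p.2 | p <- enum {: idx X * G n.+1}].
exists c'; split.
- by rewrite /c' size_cat size_nseq [fam n.+1]/= size_cat !size_map.
- move=> a; rewrite mem_cat mem_nseq => /orP[/andP[_ /eqP->]|/mapP[p _ ->]//].
  by rewrite normr0 mulr_ge0 ?exprn_ge0.
pose E x := A x - \sum_i \sum_m c i m * chart_bump i m x.
have combE x : comb (fam n.+1) c' x = \sum_i \sum_m c i m * atom (i, m) x.
  rewrite /c' [fam n.+1]/= comb_cat ?size_nseq// comb0 add0r.
  by rewrite comb_map big_enum/= pair_big; apply: eq_bigr => -[i m].
have Em : \int[dxM]_x E x = - \sum_i \sum_m c i m * \int[dxM]_x chart_bump i m x.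
  rewrite /E RintB; [|exact: sqint_intg|]; last first.
    by apply: intg_sum => i; apply: intg_sum => m; apply: intgZ; exact: intg_chart_bump.
  rewrite Amean sub0r Rint_sum => [|i]; last first.
    by apply: intg_sum => m; apply: intgZ; exact: intg_chart_bump.
  congr (- _); apply: eq_bigr => i _; rewrite Rint_sum => [|m]; last first.
    by apply: intgZ; exact: intg_chart_bump.
  by apply: eq_bigr => m _; rewrite RintZ//; exact: intg_chart_bump.
have EE x : A x - comb (fam n.+1) c' x = E x - \int[dxM]_y E y.
  have -> : comb (fam n.+1) c' x = \sum_i \sum_m c i m * chart_bump i m x -
      \sum_i \sum_m c i m * \int[dxM]_x chart_bump i m x.
    rewrite combE -sumrB; apply: eq_bigr => i _; rewrite -sumrB; apply: eq_bigr => m _.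
    by rewrite /atom mulrBr.
  by rewrite Em /E; ring.
under eq_Rint do rewrite EE.
exact: le_trans (Rint_center_le c2) c3.
Qed.

End approximation.

Section function_class_membership.
Context (R : realType) (n : nat).
Local Notation V := 'rV[R]_n.
Local Notation lm := (lam R n).

Lemma intRd_ge0 m (f : 'rV[R]_m -> \bar R) : (forall z, (0 <= f z)%E) -> (0 <= intRd f)%E.
Proof.
elim: m f => [|m ih] f f0; first exact: f0.
by apply: integral_ge0 => t _; apply: ih => v; exact: f0.
Qed.

Lemma sobolev_sqnorm_Rd_ge0 s (f : V -> R) : (0 <= sobolev_sqnorm_Rd s f)%E.
Proof.
by apply: intRd_ge0 => z; rewrite lee_fin mulr_ge0 ?powR_ge0// addr_ge0 ?sqr_ge0.
Qed.

Lemma holder_norm_Rd_ge0 k b (f : V -> R) : (0 <= holder_norm_Rd k b f)%E.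
Proof.
apply: adde_ge0; last by rewrite le_max lexx.
apply: (@le_trans _ _ (`|pderivs [::] f 0|)%:E); first by rewrite lee_fin.
by apply: ereal_sup_ubound; exists [::] => //; exists 0.
Qed.

Lemma holder_norm_Rd_bound k b (f : V -> R) : (holder_norm_Rd k b f < +oo)%E ->
  exists H : R, 0 <= H /\ (forall s z, (size s <= k)%N -> `|pderivs s f z| <= H) /\
    (forall s z z', size s = k -> `|pderivs s f z - pderivs s f z'| <= H * `|z - z'| `^ b).
Proof.
move=> foo; have f0 := holder_norm_Rd_ge0 k b f.
have ff : holder_norm_Rd k b f \is a fin_num by rewrite ge0_fin_numE.
exists (fine (holder_norm_Rd k b f)); split; first exact: fine_ge0.
have h2 : (0 <= maxe 0 (ereal_sup [set y | exists (a : seq 'I_n) (z z' : V),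
     size a = k /\ y = (`|pderivs a f z - pderivs a f z'| / `|z - z'| `^ b)%:E]))%E.
  by rewrite le_max lexx.
have h1 s z : (size s <= k)%N -> ((`|pderivs s f z|)%:E <= ereal_sup [set (`|pderivs a f z|)%:E
               | a in [set a : seq 'I_n | (size a <= k)%N] & z in setT])%E.
  by move=> sk; apply: ereal_sup_ubound; exists s => //; exists z.
split=> [s z sk|s z z' sk].
  rewrite -lee_fin fineK//; apply: le_trans (h1 s z sk) _.
  by rewrite /holder_norm_Rd leeDl.
have [->|zz] := eqVneq z z'.
  by rewrite subrr normr0 mulr_ge0 ?powR_ge0// fine_ge0.
have d0 : 0 < `|z - z'| `^ b by rewrite powR_gt0// normr_gt0 subr_eq0.
rewrite -ler_pdivrMr// -lee_fin fineK//.
apply: (@le_trans _ _ (maxe 0 (ereal_sup [set y | exists (a : seq 'I_n) (z z' : V),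
     size a = k /\ y = (`|pderivs a f z - pderivs a f z'| / `|z - z'| `^ b)%:E]))%E); last first.
  rewrite /holder_norm_Rd leeDr//; apply: le_trans (h1 [::] 0 _) => //.
by rewrite le_max; apply/orP; right; apply: ereal_sup_ubound; exists s, z, z'.
Qed.

Lemma shift_sqdist_modulus (f : borel V -> R) (H b r : R) : 0 <= H -> measurable_fun setT f ->
  (forall z : V, r < `|z| -> f z = 0) ->
  (forall z z' : V, `|f z - f z'| <= H * `|z - z'| `^ b) ->
  forall u : V, shift_sqdist f u <=
    2 * H ^+ 2 * (\int[lm]_z \1_(@cbox R n r) z) * (`|u| ^+ 2) `^ b.
Proof.
move=> H0 mf fr fH u; have ic := @intg_indic_cbox R n r.
have is_ := intg_shift u ic.
have le (z : borel V) : (f z - f (u + (z : V))) ^+ 2 <=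
    H ^+ 2 * (`|u| ^+ 2) `^ b * (\1_(@cbox R n r) z + \1_(@cbox R n r) (u + (z : V))).
  have hz : (f z - f (u + (z : V))) ^+ 2 <= H ^+ 2 * (`|u| ^+ 2) `^ b.
    rewrite -real_normK ?num_real// powRM ?normr_ge0// -expr2 -exprMn.
    rewrite lerXn2r ?nnegrE ?mulr_ge0 ?powR_ge0//; apply: le_trans (fH _ _) _.
    by rewrite opprD addrCA subrr addr0 normrN.
  have hc : 0 <= H ^+ 2 * (`|u| ^+ 2) `^ b by rewrite mulr_ge0 ?sqr_ge0 ?powR_ge0.
  rewrite !indicE; case: (boolP (z \in _)) => [_|].
    by apply: le_trans hz _; rewrite ler_peMr// lerDl ler0n.
  rewrite notin_setE /cbox/= => /negP; rewrite -ltNge => z0.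
  case: (boolP (_ \in _)) => [_|]; first by rewrite add0r mulr1.
  rewrite notin_setE /cbox/= => /negP; rewrite -ltNge => z1.
  by rewrite !fr// subrr expr0n addr0 mulr0.
have i1 : intg lm (fun z => H ^+ 2 * (`|u| ^+ 2) `^ b *
    (\1_(@cbox R n r) z + \1_(@cbox R n r) (u + (z : V)))).
  by apply: intgZ; exact: intgD.
rewrite /shift_sqdist; apply: le_trans (Rint_le _ i1 le) _.
  apply: intg_dom i1 => [|z]; last by rewrite ger0_norm ?sqr_ge0.
  apply: measurable_funX; apply: measurable_funB => //.
  exact: (measurableT_comp mf (measurable_shift u)).
rewrite RintZ; last exact: intgD.
rewrite RintD// (Rint_shift u (f := \1_(@cbox R n r))); last first.
  exact: measurable_indic (measurable_cbox r).
by rewrite le_eqVlt; apply/orP; left; apply/eqP; ring.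
Qed.

End function_class_membership.

Section manifold_membership.
Context {R : realType} (M : closedRiemannian R).
Local Notation X := (atlas M).
Local Notation d := (Defs.dim X).
Local Notation V := 'rV[R]_d.
Local Notation F i := (chart_supp i).
Local Notation K i := (phi i @` chart_supp i).
Local Notation lm := (lam R d).
Local Notation dxM := (dx M).
Variable r0 : nat.
Hypothesis hr : forall (i : idx X) z, (phi i @` chart_supp i) z -> `|z| <= r0%:R.

Lemma localize_outside (i : idx X) (A : M -> R) (z : V) : r0%:R < `|z| -> localize i A z = 0.
Proof. by move=> z0; apply: localize_off => /hr; rewrite leNgt z0. Qed.

Lemma chi_le1 (i : idx X) x : chi i x <= 1.
Proof.
by rewrite -(@chi_sum1 R M x) (bigD1 i)//= lerDl sumr_ge0// => j _; exact: chi_ge0.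
Qed.

Lemma sqint_localize (i : idx X) (A : borel M -> R) : sqint dxM A ->
  intg lm (localize i A) /\ sqint lm (localize i A).
Proof.
move=> [mA A2]; have [C C0 hC] := integral_dx_lam M.
have E z : localize i A z = \1_(K i) z * (chi i (chart_inv i z) * A (chart_inv i z)).
  rewrite indicE; case: (boolP (z \in K i)) => [/set_mem Kz|].
    have Oz := K_sub_O Kz; rewrite chart_invE// mul1r /localize patchE mem_set//.
  by rewrite notin_setE => Kz; rewrite localize_off// mul0r.
have mchi : measurable_fun setT (chi i : borel M -> R).
  by apply: borel_smooth; exact: chi_smooth.
have mh : measurable_fun setT (fun x : borel M => chi i x * A x) by exact: measurable_funM.
have mL : measurable_fun setT (localize i A : borel V -> R).
  rewrite (_ : localize i A = (fun z => \1_(K i) z * (chi i (chart_inv i z) * A (chart_inv i z)))).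
    apply: measurable_funM; first by apply: measurable_indic; exact: borel_K.
    exact: (measurableT_comp mh (measurable_chart_inv i)).
  by apply/funext.
have sL : sqint lm (localize i A).
  split=> //; apply: (@intg_eq _ _ _ lm (fun z => \1_(K i) z * (chi i (chart_inv i z) * A (chart_inv i z)) ^+ 2)).
    move=> z; rewrite E exprMn; congr (_ * _); rewrite indicE.
    by case: (_ \in _); rewrite ?expr1n// expr0n.
  apply: ((hC i (fun x => (chi i x * A x) ^+ 2) (measurable_funX 2 mh) (fun x => sqr_ge0 _)).2 _).
  apply: intg_dom A2 => [|x].
    by apply: measurable_funM; [apply: measurable_indic; exact: borel_chart_supp|exact: measurable_funX].
  rewrite ger0_norm; last by rewrite mulr_ge0 ?sqr_ge0// indicE ler0n.
  have h : (chi i x * A x) ^+ 2 <= A x ^+ 2.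
    by rewrite exprMn ler_piMl ?sqr_ge0// exprn_ile1 ?chi_le1// chi_ge0.
  by rewrite indicE; case: (x \in F i); rewrite ?mul1r// mul0r sqr_ge0.
split=> //; apply: intg_dom (intgD (@intg_indic_cbox R d r0%:R) sL.2) => // z.
rewrite indicE; case: (boolP (z \in _)) => [_|].
  by have := sqr_ge0 (`|localize i A z| - 1); rewrite -[localize i A z ^+ 2]real_normK ?num_real//=; have := normr_ge0 (localize i A z); nra.
rewrite notin_setE /cbox/= => /negP; rewrite -ltNge => z0.
by rewrite localize_outside// normr0 expr0n addr0.
Qed.

Lemma sobolev_approx (s : R) (A : M -> R) : 0 < s -> fs_mem (sobolev0_M M s) A ->
  [/\ sqint dxM A, \int[dxM]_x A x = 0 &
      approx_rate dxM (fam M r0) d (2 * Num.min s 1) A].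
Proof.
move=> s0 [mA A2 Aoo Am]; have sA : sqint dxM A by [].
split=> //; have fi (i : idx X) := sqint_localize i sA.
have /choice[Ki hK] (i : idx X) : exists K1 : R, 0 <= K1 /\
    forall u : V, shift_sqdist (localize i A) u <= K1 * (`|u| ^+ 2) `^ (Num.min s 1).
  have [|K1 K10 h] := sobolev_modulus (fi i).1 (fi i).2 s0; last by exists K1.
  apply: le_lt_trans Aoo; rewrite /sobolev_sqnorm (bigD1 i)//= leeDl//.
  by apply: sume_ge0 => j _; exact: sobolev_sqnorm_Rd_ge0.
apply: (fam_approx hr mA sA Am fi (K0 := \sum_i Ki i)).
- by rewrite lt_min s0 ltr01 ge_min lexx orbT.
- by apply: sumr_ge0 => i _; exact: (hK i).1.
- move=> i u; apply: le_trans ((hK i).2 u) _; rewrite ler_wpM2r ?powR_ge0//.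
  by rewrite (bigD1 i)//= lerDl sumr_ge0// => j _; exact: (hK j).1.
Qed.

Lemma holder_approx (s : R) k (b : R) (A : M -> R) : holder_exponents s k b ->
  fs_mem (holder0_M M k b) A ->
  [/\ sqint dxM A, \int[dxM]_x A x = 0 &
      approx_rate dxM (fam M r0) d (2 * Num.min s 1) A].
Proof.
move=> [s0 sE /andP[b0 b1]] [Ak Aoo Am].
have ci (i : idx X) : continuous (localize i A : V -> R).
  by move=> z; apply: (smoothk_cont ((smoothk_Ck _ _ _).1 (Ak i))).
have bi (i : idx X) : (holder_norm_Rd k b (localize i A : V -> R) < +oo)%E.
  apply: le_lt_trans Aoo; rewrite /holder_norm (bigD1 i)//= leeDl//.
  by apply: sume_ge0 => j _; exact: holder_norm_Rd_ge0.
have /choice[H hH] (i : idx X) := holder_norm_Rd_bound (bi i).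
have AE x : A x = \sum_i chart_pull i (localize i A) x.
  rewrite -[LHS]mul1r -(@chi_sum1 R M x) mulr_suml; apply: eq_bigr => i _.
  rewrite /chart_pull; case: (boolP (x \in dom i)) => [/set_mem dxx|].
    by rewrite /localize patchE mem_set ?chart_phiK//; exact: codom_phi.
  by rewrite notin_setE => nd; rewrite chi_off_supp ?mul0r// => /chi_supp_dom.
have mA : measurable_fun setT (A : borel M -> R).
  rewrite (_ : A = fun x => \sum_i chart_pull i (localize i A) x); last exact/funext.
  by apply: measurable_sum => i; exact: measurable_chart_pull.
have sA : sqint dxM A.
  apply: (@sqint_bnd _ _ _ _ _ (\sum_i H i)) => // x; rewrite AE.
  apply: le_trans (ler_norm_sum _ _ _) _; apply: ler_sum => i _.
  rewrite /chart_pull; case: ifP => _; last by rewrite normr0; have [] := hH i.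
  by have [_ [h _]] := hH i; exact: (h [::]).
split=> //; have fi (i : idx X) := sqint_localize i sA.
have mL (i : idx X) : measurable_fun setT (localize i A : borel V -> R) by have [_ []] := fi i.
have t01 : 0 < Num.min s 1 <= 1 by rewrite lt_min s0 ltr01 ge_min lexx orbT.
suff /choice[Ki hK] (i : idx X) : exists K1 : R, 0 <= K1 /\
    forall u : V, shift_sqdist (localize i A) u <= K1 * (`|u| ^+ 2) `^ (Num.min s 1).
  apply: (fam_approx hr mA sA Am fi t01 (K0 := \sum_i Ki i)).
  - by apply: sumr_ge0 => i _; exact: (hK i).1.
  - move=> i u; apply: le_trans ((hK i).2 u) _; rewrite ler_wpM2r ?powR_ge0//.
    by rewrite (bigD1 i)//= lerDl sumr_ge0// => j _; exact: (hK j).1.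
have [H0 [h1 h2]] := hH i.
have gen (H' : R) : 0 <= H' ->
    (forall z z' : V, `|localize i A z - localize i A z'| <= H' * `|z - z'| `^ (Num.min s 1)) ->
    exists K1 : R, 0 <= K1 /\
    forall u : V, shift_sqdist (localize i A) u <= K1 * (`|u| ^+ 2) `^ (Num.min s 1).
  move=> H'0 h; eexists; split; last exact: (shift_sqdist_modulus H'0 (mL i) (@localize_outside i A) h).
  by rewrite !mulr_ge0 ?sqr_ge0//; apply: Rint_ge0 => z; rewrite indicE ler0n.
(* For k = 0 the exponent b is s itself; for k > 0 bounded first derivatives make the function
   Lipschitz, and min(s, 1) = 1. *)
case: k sE Ak h1 h2 {Am Aoo bi hH} => [|k] sE Ak h1 h2.
  apply: (gen (H i)) => // z z'; rewrite min_l; last by rewrite sE add0r.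
  by rewrite sE add0r; exact: (h2 [::]).
apply: (gen (d%:R * H i)); first by rewrite mulr_ge0.
move=> z z'; rewrite min_r ?powRr1//; last first.
  by rewrite sE -natr1 -addrA addrCA lerDl addr_ge0.
apply: (@lipschitz_pderiv _ _ _ (fun l => 'D_(basis_vec l) (localize i A))) => l w.
  by apply: (smoothk_is_derive (U := setT) (k := k)) => //; apply/smoothk_Ck; exact: Ak.
exact: (h1 [:: l]).
Qed.

End manifold_membership.

(** * Mixing of atoms *)

Section fubini_bounded.
Context d1 d2 (T1 : measurableType d1) (T2 : measurableType d2) (R : realType).
Variables (m1 : probability T1 R) (m2 : probability T2 R).
Variables (f : T1 * T2 -> R) (K : R).
Hypotheses (mf : measurable_fun setT f) (fK : forall z, `|f z| <= K).

Lemma intg_prod_bnd : intg (m1 \x m2)%E f.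
Proof.
apply: intg_eq (intg_tensor_kernel (intg_cst m1 1) (intg_cst m2 1) mf fK) => z.
by rewrite !mul1r.
Qed.

Lemma measurable_slice1 x : measurable_fun setT (fun y => f (x, y)).
Proof. exact: (measurableT_comp mf (measurable_pair1 x)). Qed.

Lemma intg_slice1 x : intg m2 (fun y => f (x, y)).
Proof. by apply: (@intg_bnd _ _ _ _ _ K) => //; exact: measurable_slice1. Qed.

Lemma Rint_prod1 : \int[(m1 \x m2)%E]_z f z = \int[m1]_x \int[m2]_y f (x, y).
Proof. by apply: Rint_fubini1; [exact: intg_prod_bnd|exact: intg_slice1]. Qed.

Lemma measurable_Rint1 : measurable_fun setT (fun x => \int[m2]_y f (x, y)).
Proof. by apply: intg_meas; apply: intg_Rint1; [exact: intg_prod_bnd|exact: intg_slice1]. Qed.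

Lemma Rint_slice_le x : `|\int[m2]_y f (x, y)| <= K.
Proof. by apply: Rint_bnd => //; exact: measurable_slice1. Qed.

End fubini_bounded.

Lemma Rint_tensor d1 d2 (T1 : measurableType d1) (T2 : measurableType d2) (R : realType)
    (m1 : probability T1 R) (m2 : probability T2 R) (u : T1 -> R) (v : T2 -> R) (K K' : R) :
  measurable_fun setT u -> measurable_fun setT v ->
  (forall x, `|u x| <= K) -> (forall y, `|v y| <= K') ->
  \int[(m1 \x m2)%E]_z (u z.1 * v z.2) = (\int[m1]_x u x) * \int[m2]_y v y.
Proof.
move=> mu mv uK vK; have iu := intg_bnd m1 mu uK; have iv := intg_bnd m2 mv vK.
have mf : measurable_fun setT (fun z : T1 * T2 => u z.1 * v z.2).
  by apply: measurable_funM; [exact: measurableT_comp|exact: measurableT_comp].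
have fK (z : T1 * T2) : `|u z.1 * v z.2| <= K * K' by rewrite normrM ler_pM.
rewrite (Rint_prod1 m1 m2 mf fK) /=.
under eq_Rint do rewrite RintZ//.
by under eq_Rint do rewrite mulrC; rewrite RintZ// mulrC.
Qed.

Section atom_mixing.
Context {R : realType} (M : closedRiemannian R).
Local Notation X := (atlas M).
Local Notation d := (Defs.dim X).
Local Notation V := 'rV[R]_d.
Local Notation dxM := (dx M).
Variable r0 : nat.
Hypothesis hr : forall (i : idx X) z, (phi i @` chart_supp i) z -> `|z| <= r0%:R.

Lemma test_boundW n k (r D D' : R) (f : 'rV[R]_n -> R) : D <= D' ->
  test_bound k r D f -> test_bound k r D' f.
Proof. by move=> DD [h1 h2 h3]; split=> // s z sk; exact: le_trans (h3 s z sk) DD. Qed.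

Lemma atom_test k : exists2 C : R, 0 <= C & forall N p (j : idx X), (0 < N)%N ->
  test_bound k r0%:R (C * N%:R ^+ k) (localize j (@atom R M r0 N p)).
Proof.
have [C C0 hC] := chart_bump_test k hr; have [C' C'0 hC'] := chi_test k hr.
have [B B1 hB] := eta_bounded M; have B0 : 0 <= B by exact: le_trans B1.
exists (C + B * C') => [|N p j N0]; first by rewrite addr_ge0// mulr_ge0.
rewrite /atom localize_sub_cst; apply: test_boundW (test_bound_sub _ (hC p.1 j N p.2 N0) (hC' j)).
rewrite mulrDl lerD2l; apply: (@le_trans _ _ (B * C')).
  rewrite ler_wpM2r//; apply: Rint_bnd.
    by apply: borel_smooth; exact: smooth_fun_chart_bump.
  by move=> x; exact: le_trans (chart_bump_norm_le _ _ _) (hB _ _).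
by rewrite ler_peMr ?mulr_ge0// exprn_ege1// ler1n.
Qed.

(** Each factor costs at most n^k for its derivatives up to order k, hence the exponent 2 k. *)
Lemma fam_tensor_test k : exists2 C : R, 0 <= C & forall n u v (q : idx (atlas2 M)), (0 < n)%N ->
  u \in fam M r0 n -> v \in fam M r0 n ->
  test_bound k r0%:R (C * n%:R ^+ (2 * k)) (localize q (fun z : M * M => u z.1 * v z.2)).
Proof.
have [C C0 hC] := atom_test k; exists (C ^+ 2) => [|n u v q n0]; first exact: sqr_ge0.
move=> /fam_atom[N [p [/andP[N0 Nn] ->]]] /fam_atom[N' [p' [/andP[N0' Nn'] ->]]].
rewrite localize_tensor; apply: test_boundW (test_bound_tensor (hC N p q.1 N0) (hC N' p' q.2 N0')).
rewrite (_ : C ^+ 2 * n%:R ^+ (2 * k) = (C * n%:R ^+ k) * (C * n%:R ^+ k)); last first.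
  by rewrite mulnC exprM; ring.
have le N1 : (N1 <= n)%N -> C * N1%:R ^+ k <= C * n%:R ^+ k.
  by move=> h; rewrite ler_wpM2l// lerXn2r ?nnegrE// ler_nat.
by rewrite ler_pM ?mulr_ge0 ?exprn_ge0// le.
Qed.

Lemma fam_props n u : u \in fam M r0 n ->
  [/\ smooth_fun X u, measurable_fun setT u & \int[dxM]_x u x = 0].
Proof.
move=> /fam_atom[N [p [_ ->]]]; split; [exact: smooth_atom| |exact: atom_mean].
by apply: borel_smooth; exact: smooth_atom.
Qed.

Lemma fam_bounded : exists2 B : R, 0 <= B & forall n u, u \in fam M r0 n -> forall x, `|u x| <= B.
Proof.
have [B B0 hB] := atom_bounded M r0; exists B => // n u /fam_atom[N [p [_ ->]]] x.
exact: hB.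
Qed.

Lemma fam_tensor_props n u v : u \in fam M r0 n -> v \in fam M r0 n ->
  [/\ measurable_fun setT (fun z : borel M * borel M => u z.1 * v z.2),
      (dxdy M).-integrable setT (fun z => ((u z.1 * v z.2) ^+ 2)%:E) &
      zero_mean (dxdy M) (fun z => u z.1 * v z.2)].
Proof.
move=> un vn; have [su mu u0] := fam_props un; have [sv mv v0] := fam_props vn.
have [B B0 hB] := fam_bounded.
have mf : measurable_fun setT (fun z : borel M * borel M => u z.1 * v z.2).
  by apply: measurable_funM; [exact: measurableT_comp|exact: measurableT_comp].
split=> //.
  apply: (@intg_prod_bnd _ _ _ _ R dxM dxM (fun z => (u z.1 * v z.2) ^+ 2) ((B * B) ^+ 2)).
    exact: measurable_funX.
  move=> z; rewrite normrX lerXn2r ?nnegrE ?mulr_ge0// normrM ler_pM//; [exact: hB un _|exact: hB vn _].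
rewrite /zero_mean /dxdy (Rint_tensor dxM dxM mu mv (hB _ _ un) (hB _ _ vn)).
by rewrite u0 mul0r.
Qed.

Lemma fam_sobolev (p : R) : 0 <= p -> exists C Q, 0 <= C /\
  forall n u v, (0 < n)%N -> u \in fam M r0 n -> v \in fam M r0 n ->
  let f := fun z : M * M => u z.1 * v z.2 in
  fs_mem (sobolev0_MM M p) f /\ fs_norm (sobolev0_MM M p) f <= C * n%:R ^+ Q.
Proof.
move=> p0; have [Q [C [C0 hC]]] := @test_bound_sobolev R (d + d) p r0%:R p0.
have [D D0 hD] := fam_tensor_test Q.
pose I2 : R := #|idx (atlas2 M)|%:R.
exists (Num.sqrt (I2 * C) * D), (2 * Q)%N; split; first by rewrite mulr_ge0// sqrtr_ge0.
move=> n u v n0 un vn f; have [mf f2 f0] := fam_tensor_props un vn.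
have sn : (sobolev_sqnorm (atlas2 M) p f <= (I2 * (C * (D * n%:R ^+ (2 * Q)) ^+ 2))%:E)%E.
  rewrite /sobolev_sqnorm.
  apply: (@le_trans _ _ (\sum_(q : idx (atlas2 M)) (C * (D * n%:R ^+ (2 * Q)) ^+ 2)%:E)%E).
    by apply: lee_sum => q _; apply: hC; exact: hD.
  by rewrite sumEFin lee_fin sumr_const mulr_natl.
have s0 : (0 <= sobolev_sqnorm (atlas2 M) p f)%E.
  by apply: sume_ge0 => q _; exact: sobolev_sqnorm_Rd_ge0.
have soo : (sobolev_sqnorm (atlas2 M) p f < +oo)%E by rewrite (le_lt_trans sn)// ltry.
split; first by split.
have -> : Num.sqrt (I2 * C) * D * n%:R ^+ (2 * Q) = Num.sqrt (I2 * (C * (D * n%:R ^+ (2 * Q)) ^+ 2)).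
  rewrite [X in _ = Num.sqrt X]mulrA [RHS]sqrtrM ?mulr_ge0 ?ler0n// sqrtr_sqr ger0_norm ?mulr_ge0 ?exprn_ge0//.
  by rewrite mulrA.
by rewrite /fs_norm/= ler_wsqrtr// -lee_fin fineK// ge0_fin_numE.
Qed.

Lemma fam_holder k (b : R) : 0 <= b <= 1 -> exists C Q, 0 <= C /\
  forall n u v, (0 < n)%N -> u \in fam M r0 n -> v \in fam M r0 n ->
  let f := fun z : M * M => u z.1 * v z.2 in
  fs_mem (holder0_MM M k b) f /\ fs_norm (holder0_MM M k b) f <= C * n%:R ^+ Q.
Proof.
move=> b01; have [D D0 hD] := fam_tensor_test k.+1.
pose I2 : R := #|idx (atlas2 M)|%:R.
exists (I2 * (((d + d)%:R + 3) * D)), (2 * k.+1)%N; split.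
  by rewrite !mulr_ge0 ?ler0n// addr_ge0.
move=> n u v n0 un vn f; have [mf f2 f0] := fam_tensor_props un vn.
have sn : (holder_norm (atlas2 M) k b f <= (I2 * (((d + d)%:R + 3) * (D * n%:R ^+ (2 * k.+1))))%:E)%E.
  apply: (@le_trans _ _ (\sum_(q : idx (atlas2 M)) (((d + d)%:R + 3) * (D * n%:R ^+ (2 * k.+1)))%:E)%E).
    by apply: lee_sum => q _; apply: test_bound_holder b01 (hD _ _ _ _ _ _ _).
  by rewrite sumEFin lee_fin sumr_const mulr_natl.
have s0 : (0 <= holder_norm (atlas2 M) k b f)%E.
  by apply: sume_ge0 => q _; exact: holder_norm_Rd_ge0.
have soo : (holder_norm (atlas2 M) k b f < +oo)%E by rewrite (le_lt_trans sn)// ltry.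
split; first split=> // q.
  by apply/smoothk_Ck; have [h _ _] := hD n u v q n0 un vn; exact: h.
by rewrite /fs_norm/= -mulrA -mulrA -lee_fin fineK// ge0_fin_numE.
Qed.

Variable P : probability (words M) R.

Lemma fam_mixing :
  (exists p : R, 0 <= p /\ annealed_exp_mixing P (dxdy M) (@rcomp2 R M) (sobolev0_MM M p)) \/
  (exists (alpha : R) (k : nat) (b : R), holder_exponents alpha k b /\
     annealed_exp_mixing P (dxdy M) (@rcomp2 R M) (holder0_MM M k b)) ->
  exists C Q (theta : R), [/\ 0 <= C, 0 < theta & forall n u u' v v', (0 < n)%N ->
    u \in fam M r0 n -> u' \in fam M r0 n -> v \in fam M r0 n -> v' \in fam M r0 n ->
    forall k, `|correlation P (dxdy M) (@rcomp2 R M)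
       (fun z => u z.1 * u' z.2) (fun z => v z.1 * v' z.2) k| <=
      C * n%:R ^+ Q * expR (- (theta * k%:R))].
Proof.
(* Common to both alternatives of the mixing hypothesis: tensor products of atoms belong to the
   space, with norms of polynomial growth in the level. *)
have gen (B : normedFunSpace (borel M * borel M)) (C0 : R) Q :
    annealed_exp_mixing P (dxdy M) (@rcomp2 R M) B -> 0 <= C0 ->
    (forall n u v, (0 < n)%N -> u \in fam M r0 n -> v \in fam M r0 n ->
      let f := fun z : M * M => u z.1 * v z.2 in
      fs_mem B f /\ fs_norm B f <= C0 * n%:R ^+ Q) ->
    (forall f, fs_mem B f -> 0 <= fs_norm B f) ->
    exists C Q (theta : R), [/\ 0 <= C, 0 < theta & forall n u u' v v', (0 < n)%N ->
    u \in fam M r0 n -> u' \in fam M r0 n -> v \in fam M r0 n -> v' \in fam M r0 n ->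
    forall k, `|correlation P (dxdy M) (@rcomp2 R M)
       (fun z => u z.1 * u' z.2) (fun z => v z.1 * v' z.2) k| <=
      C * n%:R ^+ Q * expR (- (theta * k%:R))].
  move=> [C1 [theta [C10 th h]]] C00 hB pos.
  exists (C1 * C0 ^+ 2), (Q * 2)%N, theta; split=> //; first by rewrite mulr_ge0// sqr_ge0.
  move=> n u u' v v' n0 un un' vn vn' k.
  have [m1 l1] := hB n u u' n0 un un'; have [m2 l2] := hB n v v' n0 vn vn'.
  apply: le_trans (h _ _ m1 m2 k) _; rewrite ler_wpM2r ?expR_ge0//.
  rewrite (_ : C1 * C0 ^+ 2 * _ = C1 * (C0 * n%:R ^+ Q) * (C0 * n%:R ^+ Q)).
    by rewrite !ler_pM ?mulr_ge0 ?pos.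
  by rewrite exprM; ring.
case=> [[p [p0 h]]|[alpha [k [b [[_ _ b01] h]]]]].
  have [C0 [Q [C00 hC]]] := fam_sobolev p0; apply: (gen _ _ _ h C00 hC) => f _.
  exact: sqrtr_ge0.
have [C0 [Q [C00 hC]]] := fam_holder k b01; apply: (gen _ _ _ h C00 hC) => f _.
by apply: fine_ge0; apply: sume_ge0 => q _; exact: holder_norm_Rd_ge0.
Qed.

End atom_mixing.

(** * Random compositions *)

Section evaluation_measurability.
Context {R : realType} (M : closedRiemannian R).
Local Notation X := (atlas M).
Local Notation d := (Defs.dim X).
Local Notation V := 'rV[R]_d.
Local Notation O i := (@codom_chart R M X i).

Lemma rat_box_open n (c : 'rV[rat]_n * nat) : open (@rat_box R n c).
Proof.
rewrite openE => z zc.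
suff : nbhs z [set w : 'rV[R]_n | forall l, `|w 0 l - ratr (c.1 0 l)| < c.2.+1%:R^-1] by [].
apply: (@filter_forall _ _ (fun l => [set w : 'rV[R]_n | `|w 0 l - ratr (c.1 0 l)| < c.2.+1%:R^-1]) (nbhs z) _) => l.
have e : [set t : R | `|t - ratr (c.1 0 l)| < c.2.+1%:R^-1] = ball (ratr (c.1 0 l) : R) c.2.+1%:R^-1.
  by apply/seteqP; split=> t /=; rewrite /ball/= distrC.
have h : nbhs (z 0 l) [set t : R | `|t - ratr (c.1 0 l)| < c.2.+1%:R^-1].
  by apply: open_nbhs_nbhs; split; [rewrite e; exact: ball_open|exact: zc].
exact: (@coord_continuous R 1 n 0 l z _ h).
Qed.

(** Rational boxes read through the finitely many charts: a countable basis of open sets of the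
    manifold. *)
Definition mbox (k : idx X * ('rV[rat]_d * nat)) : set M :=
  dom k.1 `&` phi k.1 @^-1` rat_box k.2.

Lemma mbox_open k : open (mbox k).
Proof.
rewrite openE => x [dx bx]; apply: filterI.
  by apply: open_nbhs_nbhs; split=> //; exact: chart_dom_open.
by apply: (chart_phi_continuous dx); apply: open_nbhs_nbhs; split=> //; exact: rat_box_open.
Qed.

Lemma chart_open_ball (U : set M) (j : idx X) (x : M) : open U -> U x -> dom j x ->
  exists2 e : R, 0 < e & forall y, dom j y -> `|phi j x - phi j y| < e -> U y.
Proof.
move=> oU Ux dx; have [|e e0 he] := open_rV_ball (@open_chart_preimage R M j U oU) (z := phi j x).
  by split; [exact: codom_phi|rewrite /= chart_phiK].
by exists e => // y dy /he[_]; rewrite /= chart_phiK.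
Qed.

Lemma mbox_basis (U : set M) x : open U -> U x -> exists2 k, mbox k x & mbox k `<=` U.
Proof.
move=> oU Ux; have [i dx] := chart_cover x.
have [e e0 he] := chart_open_ball oU Ux dx.
have [c cx hc] := rat_box_approx (phi i x) e0.
by exists (i, c) => // y [dy cy]; apply: he => //; exact: hc.
Qed.

Lemma mbox_regular (U : set M) x : open U -> U x -> exists2 k, mbox k x & closure (mbox k) `<=` U.
Proof.
move=> oU Ux; have Un : nbhs x U by exact: open_nbhs_nbhs.
have [B Bx BU] := compact_regular (@carrier_hausdorff R M) (@carrier_compact R M) (@filterT _ (nbhs x) _) Un.
move: Bx; rewrite nbhsE => -[W [oW Wx] WB].
have [k kx kW] := mbox_basis oW Wx; exists k => //.
by apply: subset_trans BU; apply: closure_subset; exact: subset_trans WB.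
Qed.

(** One point in every nonempty basic set, that is, a countable dense set; an empty basic set yields
    the default point, which is harmless. *)
Definition mpt k : M := xget point (mbox k).

Lemma diff_continuous (f : diff1_vol M) : continuous f.
Proof. by have [[]] := diff_funP f. Qed.

(** A singleton is an admissible compact set for the C^1 topology, so evaluation at a fixed point is
    continuous. *)
Lemma eval_open (y : M) (U : set M) : open U ->
  measurable ([set f : diff1_vol M | U (f y)] : set (borelDiff M)).
Proof.
move=> oU; apply: sub_sigma_algebra => f Uf.
have [i dy] := chart_cover y; have [j df] := chart_cover (f y).
have [e e0 he] := chart_open_ball oU Uf df.
exists 1%N, (fun=> C1_ball f i j [set y] e); split=> [_|h /(_ ord0 I) [hj hh]].
  exists i, j, [set y], e; split=> //; first exact: compact_set1.
    by move=> _ ->.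
  by move=> _ [_ -> <-].
have dh : dom j (h y) by apply: hj; exists y.
apply: he => //; apply: rV_norm_lt => // l.
have [] := hh y erefl l; rewrite /in_charts chart_phiK// distrC => h1 _.
by rewrite !mxE.
Qed.

(** f x lies in U exactly when there are a basic set k with closure inside U and a basic
    neighbourhood b of x such that f sends every marked point of b into the closure of k. Density of
    the marked points and continuity of f give the converse implication. Only countably many
    evaluations at fixed points are involved, which makes the condition measurable jointly in f and
    x. *)
Lemma measurable_eval :
  measurable_fun setT (fun p : borelDiff M * borel M => (p.1 : diff1_vol M) p.2 : borel M).
Proof.
apply: measurable_to_borel => U oU.
pose J := ((idx X * ('rV[rat]_d * nat)) * (idx X * ('rV[rat]_d * nat)))%type.
pose G (q : J) : set (borelDiff M * borel M) :=
  if `[< closure (mbox q.1) `<=` U >] then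
    (\bigcap_(l in [set l | mbox q.2 (mpt l)]) [set f : borelDiff M | closure (mbox q.1) ((f : diff1_vol M) (mpt l))])
      `*` mbox q.2
  else set0.
have mG q : measurable (G q).
  rewrite /G; case: asboolP => _; last exact: measurable0.
  apply: measurableX; last by apply: borel_open; exact: mbox_open.
  rewrite -[X in measurable X]setCK; apply: measurableC; rewrite setC_bigcap.
  rewrite bigcup_mkcond; apply: countable_bigcupT_measurable => [|l]; first exact: countableP.
  case: ifP => _; last exact: measurable0.
  have := @eval_open (mpt l) (~` closure (mbox q.1)) (closed_openC (@closed_closure _ _)).
  exact.
rewrite (_ : _ @^-1` U = \bigcup_q G q).
  by apply: countable_bigcupT_measurable => //; exact: countableP.
apply/seteqP; split=> [[f x] /= Ux|[f x] [[k b] _]].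
  have [k kx kU] := mbox_regular oU Ux.
  have ofk : open ((f : diff1_vol M) @^-1` mbox k).
    by have /continuousP := @diff_continuous f; apply; exact: mbox_open.
  have [b bx bk] := mbox_basis ofk kx.
  exists (k, b) => //; rewrite /G; case: asboolP => //= _; split=> //= l bl.
  by apply: subset_closure; exact: bk.
rewrite /G; case: asboolP => //= kU [h bx]; apply: kU; apply: contrapT => nk.
have oN : open (mbox b `&` (f : diff1_vol M) @^-1` (~` closure (mbox k))).
  apply: openI; first exact: mbox_open.
  have /continuousP := @diff_continuous f; apply; apply: closed_openC; exact: closed_closure.
have [l lx lN] := mbox_basis oN (conj bx nk).
have /lN[bl nl] : mbox l (mpt l) by apply: (@xgetPex _ point (mbox l)); exists x.
by apply: nl; exact: h.
Qed.

End evaluation_measurability.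

(** * Words: shift, concatenation, independence *)

Section words.
Context {R : realType} (M : closedRiemannian R).

Lemma measurable_letter n : measurable_fun setT (fun w : words M => w n : borelDiff M).
Proof.
move=> _ A mA; rewrite setTI; apply: sub_sigma_algebra.
by exists n, A.
Qed.

Lemma measurable_to_words d (T : measurableType d) (f : T -> words M) :
  (forall n, measurable_fun setT (fun t => f t n : borelDiff M)) -> measurable_fun setT f.
Proof.
move=> mf; have h := @measurability _ _ T (words M) setT f (@cylinders R M) erefl.
by apply: h => _ [_ [n [A [mA ->]]] <-]; rewrite setTI; have := mf n measurableT A mA; rewrite setTI.
Qed.

Definition shiftw (k : nat) (w : words M) : words M := fun n => w (k + n)%N.

Lemma measurable_shiftw k : measurable_fun setT (shiftw k).
Proof. by apply: measurable_to_words => n; exact: measurable_letter. Qed.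

Lemma measurable_rcomp n :
  measurable_fun setT (fun p : words M * borel M => rcomp p.1 n p.2 : borel M).
Proof.
elim: n => [|n ih] /=; first exact: measurable_snd.
apply: (@measurableT_comp _ _ _ _ _ _ (fun p : borelDiff M * borel M => (p.1 : diff1_vol M) p.2 : borel M) _
  (fun p : words M * borel M => (p.1 n : borelDiff M, rcomp p.1 n p.2 : borel M))).
  exact: measurable_eval.
apply: measurable_fun_pair => //.
exact: (measurableT_comp (@measurable_letter n)).
Qed.

Lemma rcompD (w : words M) n k x : rcomp w (n + k) x = rcomp (shiftw n w) k (rcomp w n x).
Proof. by elim: k => [|k ih]; rewrite ?addn0// addnS /= ih. Qed.

Definition agree (k : nat) (w w' : words M) := forall j, (j < k)%N -> w j = w' j.

Lemma rcomp_agree k w w' : agree k w w' -> rcomp w k =1 rcomp w' k.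
Proof.
elim: k => // k ih h x /=; rewrite h// ih// => j jk; apply: h; exact: ltnW.
Qed.

Lemma rcomp_preserves (w : words M) k (A : set (borel M)) : measurable A ->
  dx M (rcomp w k @^-1` A) = dx M A.
Proof.
elim: k A => // k ih A mA.
have [[cf _] _ inv] := diff_funP (w k : diff1_vol M).
rewrite -(inv A mA) -(ih ((w k : diff1_vol M) @^-1` A))//.
by rewrite -[_ @^-1` _]setTI; exact: (continuous_borel cf).
Qed.

Variable mu : probability (borelDiff M) R.
Variable P : probability (words M) R.
Hypothesis hP : is_product_power mu P.

Definition concatw k (p : words M * words M) : words M :=
  fun n => if (n < k)%N then p.1 n else p.2 (n - k)%N.

Lemma measurable_concatw k : measurable_fun setT (concatw k).
Proof.
apply: measurable_to_words => n; rewrite /concatw; case: (n < k)%N.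
  exact: (measurableT_comp (@measurable_letter n)).
exact: (measurableT_comp (@measurable_letter (n - k)%N)).
Qed.

Lemma agree_concatw k p : agree k (concatw k p) p.1.
Proof. by move=> j jk; rewrite /concatw jk. Qed.

Lemma shiftw_concatw k p : shiftw k (concatw k p) = p.2.
Proof. by apply/funext => n; rewrite /shiftw /concatw ltnNge leq_addr/= addKn. Qed.

Definition rectangles : set (set (words M)) :=
  [set B | exists (n : nat) (A : nat -> set (borelDiff M)), (forall k, measurable (A k)) /\
     B = [set w : words M | forall k, (k < n)%N -> A k (w k)]].

Lemma measurable_rectangle n (A : nat -> set (borelDiff M)) : (forall k, measurable (A k)) ->
  measurable [set w : words M | forall k, (k < n)%N -> A k (w k)].
Proof.
move=> mA; rewrite (_ : [set w | _] = \bigcap_(k in [set k | (k < n)%N]) [set w : words M | A k (w k)]).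
  apply: bigcap_measurableType => k _; have := measurable_letter k measurableT (mA k).
  by rewrite setTI.
by apply/seteqP; split=> w /= h k; exact: h.
Qed.

(** Replacing everything after the first k letters by an independent word does not change the law.
    Both measures agree on rectangles, a generating family stable under intersection. Independence
    of the first k letters from the shifted word is read off from this. *)
Lemma concatw_distribution k (B : set (words M)) : measurable B ->
  P B = (P \x P)%E (concatw k @^-1` B).
Proof.
move=> mB.
have mE : @measurable _ (words M) = <<s rectangles >>.
  apply/seteqP; split.
    apply: smallest_sub; first exact: smallest_sigma_algebra.
    move=> _ [n [A [mA ->]]]; apply: sub_sigma_algebra.
    exists n.+1, (fun j => if j == n then A else setT); split=> [j|].
      by case: ifP => // _; exact: measurableT.
    apply/seteqP; split=> w /= h; last by have := h n (ltnSn n); rewrite eqxx.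
    by move=> j _; case: eqP => // ->.
  apply: smallest_sub; first exact: sigma_algebra_measurable.
  by move=> _ [n [A [mA ->]]]; exact: measurable_rectangle.
have := @measure_unique _ R (words M) rectangles (fun=> setT) mE.
have mc := @measurable_concatw k.
move=> /(_ _ _ _ P (pushforward (P \x P)%E (concatw k)) _ _ B mB); apply.
- move=> _ _ [n [A [mA ->]]] [n' [A' [mA' ->]]].
  exists (maxn n n'), (fun j => (if (j < n)%N then A j else setT) `&` (if (j < n')%N then A' j else setT)).
  split=> [j|]; first by apply: measurableI; case: ifP.
  apply/seteqP; split=> w /=.
    by move=> [h h'] j _; split; case: ifP => // jn; [exact: h|exact: h'].
  move=> h; split=> j jn; have := h j; first by rewrite leq_max jn => /(_ isT)[].
  by rewrite leq_max jn orbT => /(_ isT)[].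
- by exists 0%N, (fun=> setT); split=> //; apply/seteqP; split.
- by apply/seteqP; split=> // w _; exists 0%N.
- move=> _ [n [A [mA ->]]]; rewrite /pushforward.
  transitivity (\prod_(0 <= k0 < n) fine (mu (A k0)))%:E; first exact: hP.
  transitivity ((P \x P)%E ([set w : words M | forall j, (j < minn n k)%N -> A j (w j)] `*`
    [set w : words M | forall j, (j < n - k)%N -> A (k + j)%N (w j)])); last first.
    congr ((P \x P)%E _); symmetry.
    apply/seteqP; split=> [[w w'] /= h|[w w'] /= [h h'] j jn].
      split=> j; first by rewrite leq_min => /andP[jn jk]; have := h j jn; rewrite /concatw jk.
      by rewrite ltn_subRL => /h; rewrite /concatw ltnNge leq_addr/= addKn.
    rewrite /concatw/=; case: ltnP => jk; first by apply: h; rewrite leq_min jn.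
    by have := h' (j - k)%N; rewrite ltn_sub2r ?(leq_ltn_trans jk)// subnKC//; apply.
  rewrite product_measure1E; 
    [|exact: (@measurable_rectangle (minn n k) A mA)|exact: (@measurable_rectangle (n - k)%N (fun j => A (k + j)%N) (fun j => mA _))].
  transitivity ((\prod_(0 <= j < minn n k) fine (mu (A j)))%:E *
      (\prod_(0 <= j < n - k) fine (mu (A (k + j)%N)))%:E)%E; last first.
    by congr (_ * _)%E; symmetry; [exact: hP|exact: (hP (n - k)%N (A := fun j => A (k + j)%N) (fun j => mA (k + j)%N))].
  rewrite -EFinM; congr (_%:E).
  have [nk|kn] := leqP n k.
    by rewrite (eqP nk) [X in _ * X]big_geq// mulr1.
  rewrite (@big_cat_nat _ _ _ k)//=; last exact: ltnW.
  congr (_ * _); rewrite -{1}[k]add0n big_addn; apply: eq_bigr => j _.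
  by rewrite addnC.
- by move=> _; rewrite (le_lt_trans (probability_le1 _ _))// ltry.
Qed.

Lemma Rint_concatw k (h : words M -> R) : measurable_fun setT h ->
  \int[P]_w h w = \int[(P \x P)%E]_p h (concatw k p).
Proof.
move=> mh; pose m' : {measure set (words M) -> \bar R} :=
  measure_function_pushforward__canonical__measure_function_Measure (P \x P)%E (@measurable_concatw k).
have e f : (\int[P]_w f w = \int[m']_w f w)%E.
  by apply: eq_measure_integral => A mA _; exact: concatw_distribution.
have := @Rint_transfer _ _ (words M * words M)%type (words M) R (P \x P)%E P (concatw k); apply=> // f mf f0; rewrite e.
by rewrite (@ge0_integral_pushforward _ _ _ _ R _ (@measurable_concatw k) _ setT f)//= => y _; exact: f0.
Qed.

Lemma shift_independence k (f g : words M -> R) (K : R) :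
  measurable_fun setT f -> measurable_fun setT g ->
  (forall w, `|f w| <= K) -> (forall w, `|g w| <= K) ->
  (forall w w', agree k w w' -> f w = f w') ->
  \int[P]_w (f w * g (shiftw k w)) = (\int[P]_w f w) * \int[P]_w g w.
Proof.
move=> mf mg fK gK fa; rewrite (Rint_concatw k); last first.
  by apply: measurable_funM => //; exact: (measurableT_comp mg (@measurable_shiftw k)).
rewrite -(Rint_tensor P P mf mg fK gK); apply: eq_Rint => p.
by rewrite shiftw_concatw (fa _ _ (@agree_concatw k p)).
Qed.

End words.

(** * Random dynamics *)

Section random_dynamics.
Context {R : realType} {dW dT : measure_display} {W : measurableType dW} {T : measurableType dT}.
Variables (P : probability W R) (m : probability T R).
Variables (F : W -> nat -> T -> T) (sh : nat -> W -> W) (agree : nat -> W -> W -> Prop).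

(** What the probabilistic part needs of the compositions. The relation [agree k] abstracts equality
    of the first k letters; being invariant under it expresses dependence on these letters alone. *)
Record random_dynamics : Prop := RandomDynamics {
  rd_measurable : forall n, measurable_fun setT (fun p : W * T => F p.1 n p.2);
  rd_preserves : forall w n A, measurable A -> m (F w n @^-1` A) = m A;
  rd_cocycle : forall w n k x, F w (n + k)%N x = F (sh n w) k (F w n x);
  rd_shift : forall n, measurable_fun setT (sh n);
  rd_shiftD : forall n k w, sh k (sh n w) = sh (n + k)%N w;
  rd_indep : forall k (f g : W -> R) (K : R),
    measurable_fun setT f -> measurable_fun setT g ->
    (forall w, `|f w| <= K) -> (forall w, `|g w| <= K) ->
    (forall w w', agree k w w' -> f w = f w') ->
    \int[P]_w (f w * g (sh k w)) = (\int[P]_w f w) * \int[P]_w g w;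
  rd_agree : forall k w w', agree k w w' -> F w k =1 F w' k }.

Hypothesis hD : random_dynamics.

Lemma measurable_F w n : measurable_fun setT (F w n).
Proof.
exact: (measurableT_comp (rd_measurable hD n) (measurable_pair1 w)).
Qed.

Lemma F_transfer w n (f : T -> \bar R) : measurable_fun setT f -> (forall y, (0 <= f y)%E) ->
  (\int[m]_y f y = \int[m]_x f (F w n x))%E.
Proof.
move=> mf f0; pose m' : {measure set T -> \bar R} :=
  measure_function_pushforward__canonical__measure_function_Measure m (measurable_F w n).
rewrite (_ : (\int[m]_y f y)%E = (\int[m']_y f y)%E).
  by rewrite (@ge0_integral_pushforward _ _ _ _ R _ (measurable_F w n) _ setT f)//= => y _; exact: f0.
by apply: eq_measure_integral => A mA _; exact: esym (rd_preserves hD w n mA).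
Qed.

Lemma Rint_F w n (f : T -> R) : measurable_fun setT f ->
  \int[m]_x f (F w n x) = \int[m]_x f x.
Proof.
move=> mf; symmetry.
by apply: (@Rint_transfer _ _ T T R m m (F w n)) => // g mg g0; exact: F_transfer.
Qed.

Lemma sqint_F w n (f : T -> R) : sqint m f -> sqint m (fun x => f (F w n x)).
Proof.
move=> [mf fi]; split; first exact: measurableT_comp mf (measurable_F w n).
apply/(@intg_transfer _ _ T T R m m (F w n) (measurable_F w n) _ (fun x => f x ^+ 2)) => //.
  by move=> g mg g0; exact: F_transfer.
exact: measurable_funX.
Qed.

Lemma Rint_shift_word n (h : W -> R) (K : R) : measurable_fun setT h -> (forall w, `|h w| <= K) ->
  \int[P]_w h (sh n w) = \int[P]_w h w.
Proof.
move=> mh hK.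
have := @rd_indep hD n (fun=> 1) h (Num.max K 1) _ mh; rewrite Rint_cst mul1r.
move=> <- //; first by apply: eq_Rint => w; rewrite mul1r.
- by move=> _; rewrite normr1 le_max lexx orbT.
- by move=> w; rewrite le_max hK.
Qed.

Section dependent_averages.
Variables (k : nat) (g : W -> R) (K : R).
Hypotheses (mg : measurable_fun setT g) (gK : forall w, `|g w| <= K).
Hypothesis gk : forall w w', agree k w w' -> g w = g w'.
Let e := \int[P]_w g w.
Let g0 w := g w - e.
Let v := \int[P]_w (g0 w ^+ 2).
Let X n w := g0 (sh n w).

Let mg0 : measurable_fun setT g0.
Proof. exact: measurable_funB. Qed.

Let g0K w : `|g0 w| <= K + K.
Proof. by apply: le_trans (ler_normB _ _) _; rewrite lerD//; exact: Rint_bnd. Qed.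

Let mX n : measurable_fun setT (X n).
Proof. exact: measurableT_comp mg0 (rd_shift hD n). Qed.

Let XK n w : `|X n w| <= K + K. Proof. exact: g0K. Qed.

Let sqX n : sqint P (X n).
Proof. exact: sqint_bnd (mX n) (XK n). Qed.

Let EX2 n : \int[P]_w (X n w ^+ 2) = v.
Proof.
apply: (@Rint_shift_word n (fun w => g0 w ^+ 2) ((K + K) ^+ 2)); first exact: measurable_funX.
by move=> w; rewrite normrX lerXn2r ?nnegrE// (le_trans _ (g0K w)).
Qed.

Let v0 : 0 <= v. Proof. by apply: Rint_ge0 => w; rewrite sqr_ge0. Qed.

(** Centred copies at distance at least k are independent, so their product has mean zero; for
    closer ones the arithmetic-geometric inequality and stationarity give the variance. *)
Let EX_cross n N : (n <= N)%N ->
  \int[P]_w (X n w * X N w) <= ((N < n + k)%N)%:R * v.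
Proof.
move=> nN; case: ltnP => nkN.
  rewrite mul1r; apply: (@le_trans _ _ (\int[P]_w (2^-1 * (X n w ^+ 2 + X N w ^+ 2)))).
    apply: Rint_le => [||w]; first exact: sqint_mul.
      by apply: intgZ; apply: intgD; [exact: (sqX n).2|exact: (sqX N).2].
    by have := sqr_ge0 (X n w - X N w); nra.
  rewrite RintZ ?RintD ?EX2; [|exact: (sqX n).2|exact: (sqX N).2|].
    by rewrite le_eqVlt; apply/orP; left; apply/eqP; field.
  by apply: intgD; [exact: (sqX n).2|exact: (sqX N).2].
rewrite mul0r le_eqVlt; apply/orP; left; apply/eqP.
pose h w := g0 w * X (N - (n + k))%N (sh k w).
have mh : measurable_fun setT h by apply: measurable_funM => //; exact: measurableT_comp (mX _) (rd_shift hD k).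
rewrite (_ : \int[P]_w _ = \int[P]_w h (sh n w)); last first.
  by apply: eq_Rint => w; rewrite /h /X !(rd_shiftD hD) addnA subnKC.
rewrite (@Rint_shift_word n h ((K + K) * (K + K)))// => [|w]; last by rewrite normrM ler_pM.
rewrite (@rd_indep hD k g0 (X (N - (n + k))%N) (K + K))//; last first.
  by move=> w w' /gk; rewrite /g0 => ->.
rewrite {1}/g0 RintB ?Rint_cst ?subrr ?mul0r//; [exact: intg_bnd mg gK|exact: intg_cst].
Qed.

Let count_le N (k0 : nat) : \sum_(i < N) ((N < i + k0)%N)%:R <= k0%:R :> R.
Proof.
rewrite -natr_sum ler_nat (reindex_inj rev_ord_inj)/=.
rewrite (eq_bigr (fun i : 'I_N => nat_of_bool (i.+1 < k0)%N)); last first.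
  by move=> i _; congr nat_of_bool; have := ltn_ord i; lia.
apply: (@leq_trans (minn N k0)); last exact: geq_minr.
suff h n : (\sum_(i < n) (i.+1 < k0) <= minn n k0)%N by exact: h.
elim: n => [|n ih]; first by rewrite big_ord0.
by rewrite big_ord_recr/=; apply: leq_trans (leq_add ih (leqnn _)) _; lia.
Qed.

(** Induction on N: the new term interacts with at most k of the earlier ones, each contributing
    twice the variance, and contributes its own variance once. *)
Lemma dependent_sum_var N :
  \int[P]_w ((\sum_(n < N) (g (sh n w) - e)) ^+ 2) <=
  (2 * k%:R + 1) * N%:R * \int[P]_w (g w ^+ 2).
Proof.
have vg : v <= \int[P]_w (g w ^+ 2) by apply: Rint_center_le; exact: sqint_bnd mg gK.
have k0 : 0 <= 2 * k%:R + 1 :> R by rewrite addr_ge0// mulr_ge0.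
apply: (@le_trans _ _ ((2 * k%:R + 1) * N%:R * v)); last by rewrite ler_wpM2l ?mulr_ge0.
elim: N => [|N ih].
  under eq_Rint do rewrite big_ord0 expr0n/=.
  by rewrite Rint0 mulr0 mul0r.
have sS : sqint P (fun w => \sum_(n < N) X n w) by apply: sqint_sum => i; exact: sqX.
rewrite (_ : \int[P]_w _ = \int[P]_w ((\sum_(n < N) X n w) ^+ 2 +
    (2 * (\sum_(n < N) (X n w * X N w)) + X N w ^+ 2))); last first.
  by apply: eq_Rint => w; rewrite big_ord_recr/= -mulr_suml /X /g0; ring.
have iXX : intg P (fun w => \sum_(n < N) (X n w * X N w)).
  by apply: intg_sum => i; exact: sqint_mul.
rewrite RintD; [|exact: sS.2|by apply: intgD; [exact: intgZ|exact: (sqX N).2]].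
rewrite RintD; [|exact: intgZ|exact: (sqX N).2].
rewrite RintZ// EX2 Rint_sum => [|i]; last exact: sqint_mul.
have := ih.
have h : \sum_(i < N) \int[P]_w (X i w * X N w) <= k%:R * v.
  apply: (@le_trans _ _ (\sum_(i < N) ((N < i + k)%N)%:R * v)).
    by apply: ler_sum => i _; apply: EX_cross; exact: ltnW.
  by rewrite -mulr_suml ler_wpM2r//; exact: count_le.
rewrite -natr1; set a := \int[P]_w _; set b := \sum_(i < N) _ in h *; nra.
Qed.

End dependent_averages.

End random_dynamics.

(** * Summability and almost sure finiteness of series *)

Section series_bounds.
Context (R : realType).

Lemma inv_sqr_tail (k0 N : nat) : (0 < k0)%N ->
  \sum_(k0 <= i < N) (i.+1%:R ^- 2) <= k0%:R^-1 :> R.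
Proof.
have key (x : R) : 0 < x -> (x + 1) ^- 2 <= x^-1 - (x + 1)^-1.
  move=> x0; rewrite (_ : x^-1 - (x + 1)^-1 = x^-1 * (x + 1)^-1).
    rewrite -exprVn expr2; apply: ler_wpM2r; first by rewrite invr_ge0 addr_ge0 ?ltW.
    by rewrite lef_pV2 ?posrE ?addr_gt0// lerDl.
  by field; rewrite !gt_eqF// addr_gt0.
move=> k00; have [h|h] := leqP N k0; first by rewrite big_geq// invr_ge0.
apply: (@le_trans _ _ (k0%:R^-1 - N%:R^-1)); last by rewrite gerBl invr_ge0.
elim: N h => // N ih; rewrite ltnS leq_eqVlt => /predU1P[<-|kN].
  by rewrite big_nat1 -natr1; apply: key; rewrite ltr0n.
rewrite big_nat_recr/=; last exact: ltnW.
have h : 0 < N%:R :> R by rewrite ltr0n (leq_trans _ kN).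
by have := ih kN; have := key _ h; rewrite -[N.+1%:R]natr1; lra.
Qed.

Lemma inv_sqr_sum (N : nat) : \sum_(i < N) (i.+1%:R ^- 2) <= 2 :> R.
Proof.
rewrite -(big_mkord xpredT (fun i => i.+1%:R ^- 2 : R)).
case: N => [|N]; first by rewrite big_geq.
rewrite big_ltn// expr1n invr1 -[X in _ <= X]/(1 + 1) lerD2l.
by have := @inv_sqr_tail 1 N.+1 isT; rewrite invr1.
Qed.

Lemma nneseries_le_bound (u : nat -> R) (c : R) : (forall i, 0 <= u i) ->
  (forall N, \sum_(i < N) u i <= c) -> (\sum_(i <oo) (u i)%:E <= c%:E)%E.
Proof.
move=> u0 uc; apply: lime_le; first by apply: is_cvg_nneseries => i _ _; rewrite lee_fin.
by apply: nearW => N; rewrite big_mkord sumEFin lee_fin.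
Qed.

Lemma nneseries_ge_term (u : nat -> \bar R) (i : nat) : (forall i, (0 <= u i)%E) ->
  (u i <= \sum_(i <oo) u i)%E.
Proof.
move=> u0; apply: (@le_trans _ _ (\sum_(0 <= j < i.+1) u j)%E).
  by rewrite big_nat_recr//= leeDr// sume_ge0.
by apply: nneseries_lim_ge => j _ _.
Qed.

(** The form of Borel-Cantelli used here: if the means are summable the random series is finite
    almost surely, so its terms are bounded and tend to zero. *)
Lemma ae_nneseries_lty d (W : measurableType d) (P : {measure set W -> \bar R})
    (f : nat -> W -> \bar R) (b : nat -> R) :
  (forall i, measurable_fun setT (f i)) -> (forall i w, (0 <= f i w)%E) ->
  (forall i, (\int[P]_w f i w <= (b i)%:E)%E) -> (\sum_(i <oo) (b i)%:E < +oo)%E ->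
  {ae P, forall w, (\sum_(i <oo) f i w < +oo)%E}.
Proof.
move=> mf f0 fb boo.
have mS : measurable_fun setT (fun w => (\sum_(i <oo) f i w)%E).
  by apply: ge0_emeasurable_sum => // i x _ _; exact: f0.
have S0 w : (0 <= \sum_(i <oo) f i w)%E by apply: nneseries_ge0 => i _ _.
have iS : P.-integrable setT (fun w => (\sum_(i <oo) f i w)%E).
  apply/integrableP; split=> //; under eq_integral do rewrite gee0_abs//.
  rewrite integral_nneseries//; apply: le_lt_trans boo.
  apply: lee_nneseries => i *; [exact: integral_ge0|exact: fb].
have := integrable_ae measurableT iS; apply: filterS => w h.
by move: (h I); rewrite ge0_fin_numE.
Qed.

End series_bounds.

(** * Quenched correlations *)

Section comb_sums.
Context (R : realType) (T : Type).
Implicit Types (s : seq (T -> R)) (c : seq R).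

Lemma comb_nth s c x : comb s c x = \sum_(i < size s) nth 0 c i * nth (fun=> 0) s i x.
Proof.
elim: s c => [|u s ih] [|a c] /=; rewrite ?comb_nil ?big_ord0 ?comb_cons ?big_ord_recl ?ih//=.
  by rewrite /comb big_nil.
by rewrite mul0r add0r big1// => i _; rewrite mul0r.
Qed.

Lemma nth_coef_le c (K : R) i : 0 <= K -> (forall a, a \in c -> `|a| <= K) -> `|nth 0 c i| <= K.
Proof.
move=> K0 h; have [ic|ic] := ltnP i (size c); first by apply: h; exact: mem_nth.
by rewrite nth_default// normr0.
Qed.

End comb_sums.

(** This is [flat_le] at the point 1 / (theta k). *)
Lemma poly_expR_le (R : realType) (D : nat) (theta : R) : 0 < theta -> exists2 C : R, 0 <= C &
  forall k : nat, (0 < k)%N -> k%:R ^+ D * expR (- (theta * k%:R)) <= C.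
Proof.
move=> th; exists (D`!%:R * theta ^- D) => [|k k0]; first by rewrite mulr_ge0// invr_ge0 exprn_ge0// ltW.
have tk : 0 < theta * k%:R by rewrite mulr_gt0// ltr0n.
have := @flat_le R D (theta * k%:R)^-1; rewrite /flat invr_gt0 tk invrK exprMn => h.
by rewrite ler_pdivlMr ?exprn_gt0// mulrC mulrA.
Qed.

Section l2_norm.
Context {R : realType} {d : measure_display} {T : measurableType d} (m : probability T R).

Definition nrm (f : T -> R) : R := Num.sqrt (\int[m]_x (f x ^+ 2)).

Lemma nrm_ge0 f : 0 <= nrm f. Proof. exact: sqrtr_ge0. Qed.

Lemma nrm_sqr f : nrm f ^+ 2 = \int[m]_x (f x ^+ 2).
Proof. by rewrite sqr_sqrtr//; apply: Rint_ge0 => x; rewrite sqr_ge0. Qed.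

Lemma Rint_mul_le_nrm f g : sqint m f -> sqint m g -> `|\int[m]_x (f x * g x)| <= nrm f * nrm g.
Proof.
move=> sf sg; rewrite -ler_sqr ?nnegrE ?mulr_ge0 ?nrm_ge0// real_normK ?num_real//.
by rewrite exprMn !nrm_sqr; exact: Rint_cauchy_schwarz.
Qed.

Lemma nrmD f g : sqint m f -> sqint m g -> nrm (fun x => f x + g x) <= nrm f + nrm g.
Proof.
move=> sf sg; rewrite -ler_sqr ?nnegrE ?addr_ge0 ?nrm_ge0// nrm_sqr.
rewrite (_ : \int[m]_x _ = \int[m]_x (f x ^+ 2 + (2 * (f x * g x) + g x ^+ 2))); last first.
  by apply: eq_Rint => x; ring.
have ifg := sqint_mul sf sg.
rewrite RintD; [|exact: sf.2|by apply: intgD; [exact: intgZ|exact: sg.2]].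
rewrite RintD; [|exact: intgZ|exact: sg.2].
rewrite RintZ// -!nrm_sqr; have := Rint_mul_le_nrm sf sg.
by rewrite ler_norml => /andP[_]; nra.
Qed.

Lemma Rint_norm_le_nrm f : sqint m f -> \int[m]_x `|f x| <= nrm f.
Proof.
move=> sf; have sn : sqint m (fun x => `|f x|).
  split; first exact: measurableT_comp sf.1.
  by apply: intg_eq sf.2 => x; rewrite real_normK ?num_real.
rewrite -[leLHS]ger0_norm; last exact: Rint_ge0.
rewrite -ler_sqr ?nnegrE ?nrm_ge0// real_normK ?num_real// nrm_sqr.
apply: le_trans (Rint_sqr_le sn) _; rewrite le_eqVlt; apply/orP; left; apply/eqP.
by apply: eq_Rint => x; rewrite real_normK ?num_real.
Qed.

Lemma nrmZ c f : sqint m f -> nrm (fun x => c * f x) = `|c| * nrm f.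
Proof.
move=> sf; rewrite /nrm -sqrtr_sqr -sqrtrM ?sqr_ge0//; congr Num.sqrt.
by rewrite -RintZ; [apply: eq_Rint => x; rewrite exprMn|exact: sf.2].
Qed.

Lemma nrmN f : nrm (fun x => - f x) = nrm f.
Proof. by congr Num.sqrt; apply: eq_Rint => x; rewrite sqrrN. Qed.

End l2_norm.

Section quenched_correlations.
Context {R : realType} {dW dT : measure_display} {W : measurableType dW} {T : measurableType dT}.
Variables (P : probability W R) (m : probability T R).
Variables (F : W -> nat -> T -> T) (sh : nat -> W -> W) (agree : nat -> W -> W -> Prop).
Hypothesis hD : random_dynamics P m F sh agree.

Definition qcorr (w : W) (k : nat) (u v : T -> R) : R := \int[m]_x (u x * v (F w k x)).

Lemma measurable_qcorr_bnd k (u v : T -> R) (K : R) : measurable_fun setT u -> measurable_fun setT v ->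
  (forall x, `|u x| <= K) -> (forall x, `|v x| <= K) ->
  measurable_fun setT (fun w => qcorr w k u v) /\ forall w, `|qcorr w k u v| <= K * K.
Proof.
move=> mu mv uK vK.
have mf : measurable_fun setT (fun p : W * T => u p.2 * v (F p.1 k p.2)).
  apply: measurable_funM; first exact: measurableT_comp.
  exact: measurableT_comp mv (rd_measurable hD k).
have fK (p : W * T) : `|u p.2 * v (F p.1 k p.2)| <= K * K by rewrite normrM ler_pM.
split; first exact: (measurable_Rint1 P m mf fK).
by move=> w; exact: (Rint_slice_le m mf fK w).
Qed.

Lemma qcorr_agree k u v w w' : agree k w w' -> qcorr w k u v = qcorr w' k u v.
Proof. by move=> /(rd_agree hD) h; apply: eq_Rint => x; rewrite h. Qed.

(** The square of an integral over x is a double integral over x and y, and both points are moved by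
    the same word. This is how the two-point motion controls fluctuations in the word. *)
Lemma qcorr_sqr k (u v : T -> R) (K : R) : measurable_fun setT u -> measurable_fun setT v ->
  (forall x, `|u x| <= K) -> (forall x, `|v x| <= K) ->
  \int[P]_w (qcorr w k u v ^+ 2) = correlation P (m \x m)%E
    (fun w n z => (F w n z.1, F w n z.2)) (fun z => u z.1 * u z.2) (fun z => v z.1 * v z.2) k.
Proof.
move=> mu mv uK vK; apply: eq_Rint => w.
have mf : measurable_fun setT (fun x => u x * v (F w k x)).
  by apply: measurable_funM => //; exact: measurableT_comp mv (measurable_F hD w k).
have fK x : `|u x * v (F w k x)| <= K * K by rewrite normrM ler_pM.
rewrite expr2 /qcorr -(Rint_tensor m m mf mf fK fK); apply: eq_Rint => z /=.
by ring.
Qed.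

Lemma qcorr_le w k u v : sqint m u -> sqint m v -> `|qcorr w k u v| <= nrm m u * nrm m v.
Proof.
move=> su sv; apply: le_trans (Rint_mul_le_nrm su (sqint_F hD w k sv)) _.
rewrite /nrm (@Rint_F _ _ _ _ _ P m F sh agree hD w k (fun x => v x ^+ 2))//.
exact: measurable_funX sv.1.
Qed.

Lemma qcorr_diag_sub w k u v : sqint m u -> sqint m v ->
  `|qcorr w k u u - qcorr w k v v| <= nrm m (fun x => u x - v x) * (nrm m u + nrm m v).
Proof.
move=> su sv; have sd := sqintB su sv.
have su' := sqint_F hD w k su; have sv' := sqint_F hD w k sv.
have -> : qcorr w k u u - qcorr w k v v =
    qcorr w k (fun x => u x - v x) u + qcorr w k v (fun x => u x - v x).
  rewrite /qcorr -RintB; [|exact: sqint_mul|exact: sqint_mul].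
  rewrite -RintD; [|exact: sqint_mul|exact: (sqint_mul sv (sqint_F hD w k sd))].
  by apply: eq_Rint => x; ring.
apply: le_trans (ler_normD _ _) _; rewrite mulrDr lerD//; first exact: qcorr_le.
by rewrite mulrC; exact: qcorr_le.
Qed.

(** All counts and bounds are polynomial in the level n, against an exponential decay in the time k;
    this allows the level to grow as a power of the time. *)
Record mixing_family (fam : nat -> seq (T -> R)) : Prop := MixingFamily {
  mf_bound : exists2 B : R, 0 <= B &
    forall n u, u \in fam n -> measurable_fun setT u /\ forall x, `|u x| <= B;
  mf_mean : forall n u, u \in fam n -> \int[m]_x u x = 0;
  mf_prefix : forall n n', (n <= n')%N -> exists s, fam n' = fam n ++ s;
  mf_size : exists C q, 0 <= C /\ forall n, (0 < n)%N -> (size (fam n))%:R <= C * n%:R ^+ q :> R;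
  mf_mixing : exists C Q (theta : R), [/\ 0 <= C, 0 < theta &
    forall n u v k, (0 < n)%N -> u \in fam n -> v \in fam n ->
    \int[P]_w (qcorr w k u v ^+ 2) <= C * n%:R ^+ Q * expR (- (theta * k%:R))] }.

Variable fam : nat -> seq (T -> R).
Hypothesis hF : mixing_family fam.
Variables a p : nat.

Local Notation elt n i := (nth (fun=> 0) (fam n) i).

(* total size of the time-k correlations between the atoms of level k^a,
   weighted by the size of the coefficients allowed at that level *)
Definition total_corr k w : R := (k ^ a)%:R ^+ (2 * p) *
  \sum_(i < size (fam (k ^ a))) \sum_(j < size (fam (k ^ a)))
    `|qcorr w k (elt (k ^ a) i) (elt (k ^ a) j)|.

Lemma total_corr_ge0 k w : 0 <= total_corr k w.
Proof. by rewrite mulr_ge0 ?exprn_ge0// sumr_ge0// => i _; exact: sumr_ge0. Qed.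

Lemma qcorr_elt n k (i j : 'I_(size (fam n))) : exists K : R,
  measurable_fun setT (fun w => qcorr w k (elt n i) (elt n j)) /\
  forall w, `|qcorr w k (elt n i) (elt n j)| <= K.
Proof.
have [B B0 hB] := mf_bound hF; exists (B * B).
have [m1 b1] := hB _ _ (mem_nth (fun=> 0) (ltn_ord i)).
have [m2 b2] := hB _ _ (mem_nth (fun=> 0) (ltn_ord j)).
exact: measurable_qcorr_bnd.
Qed.

Lemma measurable_total_corr k : measurable_fun setT (total_corr k).
Proof.
apply: measurable_funM => //; apply: measurable_sum => i; apply: measurable_sum => j.
by have [K [mq _]] := qcorr_elt k i j; exact: measurableT_comp.
Qed.

Lemma total_corr_bnd k : exists K : R, forall w, `|total_corr k w| <= K.
Proof.
set n := (k ^ a)%N.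
have /choice[K hK] (q : 'I_(size (fam n)) * 'I_(size (fam n))) : exists K : R,
    forall w, `|qcorr w k (elt n q.1) (elt n q.2)| <= K.
  by have [K [_ h]] := qcorr_elt k q.1 q.2; exists K.
exists (n%:R ^+ (2 * p) * \sum_i \sum_j K (i, j)) => w.
rewrite ger0_norm ?total_corr_ge0// ler_wpM2l ?exprn_ge0//.
by apply: ler_sum => i _; apply: ler_sum => j _; exact: (hK (i, j)).
Qed.

Lemma total_corr_agree k w w' : agree k w w' -> total_corr k w = total_corr k w'.
Proof.
move=> h; congr (_ * _); apply: eq_bigr => i _; apply: eq_bigr => j _.
by rewrite (qcorr_agree _ _ h).
Qed.

(** The square of the double sum is at most the number of pairs times the sum of squares, each
    decaying exponentially; everything else is polynomial in k. The exponent 7 is 4 + 1 + 2: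
    averages are to be O(k^-2), hence k^4 after squaring, the range of dependence costs k, and k^-2
    remains to be summed. *)
Lemma total_corr_moment : exists2 C : R, 0 <= C & forall k, (0 < k)%N ->
  \int[P]_w (total_corr k w ^+ 2) <= C * k%:R ^- 7.
Proof.
have [Cs [q [Cs0 hs]]] := mf_size hF; have [C [Q [theta [C0 th hC]]]] := mf_mixing hF.
pose E := (p * 4 + q * 4 + Q)%N.
have [D D0 hDD] := poly_expR_le (a * E + 7) th.
exists (Cs ^+ 4 * C * D) => [|k k0]; first by rewrite !mulr_ge0// exprn_ge0.
set n := (k ^ a)%N; have n0 : (0 < n)%N by rewrite expn_gt0 k0.
set S := size (fam n).
pose G w := \sum_(i < S) \sum_(j < S) qcorr w k (elt n i) (elt n j) ^+ 2.
have iq (i j : 'I_S) : intg P (fun w => qcorr w k (elt n i) (elt n j) ^+ 2).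
  by have [K [mq bq]] := qcorr_elt k i j; exact: (sqint_bnd P mq bq).2.
have iG : intg P G by apply: intg_sum => i; apply: intg_sum => j; exact: iq.
have le w : total_corr k w ^+ 2 <= n%:R ^+ (p * 4) * (S%:R * S%:R) * G w.
  rewrite /total_corr -/n -/S exprMn -exprM (_ : 2 * p * 2 = p * 4)%N; last by lia.
  rewrite -mulrA ler_wpM2l ?exprn_ge0//.
  rewrite pair_big/= /G (pair_big xpredT xpredT (fun i j : 'I_S => qcorr w k (elt n i) (elt n j) ^+ 2))/=.
  apply: le_trans (sqr_sum_le _) _; rewrite card_prod card_ord natrM ler_wpM2l ?mulr_ge0 ?ler0n//.
  by apply: ler_sum => -[i j] _ /=; rewrite real_normK ?num_real.
have [K hK] := total_corr_bnd k.
apply: (@le_trans _ _ (n%:R ^+ (p * 4) * (S%:R * S%:R) * \int[P]_w G w)).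
  rewrite -RintZ//; apply: Rint_le => //; last exact: intgZ.
  exact: (sqint_bnd P (measurable_total_corr k) hK).2.
have GE : \int[P]_w G w <= (S%:R * S%:R) * (C * n%:R ^+ Q * expR (- (theta * k%:R))).
  rewrite /G Rint_sum => [|i]; last by apply: intg_sum => j; exact: iq.
  apply: (@le_trans _ _ (\sum_(i < S) \sum_(j < S) (C * n%:R ^+ Q * expR (- (theta * k%:R))))).
    apply: ler_sum => i _; rewrite Rint_sum => [|j]; last exact: iq.
    by apply: ler_sum => j _; apply: hC => //; apply: mem_nth.
  by rewrite !sumr_const !card_ord -mulrnA -(mulr_natl (C * _ * _)) natrM.
have S0 : 0 <= S%:R :> R by [].
have hS : S%:R <= Cs * n%:R ^+ q by exact: hs.
have np : 0 <= n%:R ^+ (p * 4) :> R by rewrite exprn_ge0.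
apply: (@le_trans _ _ (n%:R ^+ (p * 4) * (S%:R ^+ 4) * (C * n%:R ^+ Q * expR (- (theta * k%:R))))).
  rewrite (_ : S%:R ^+ 4 = (S%:R * S%:R) * (S%:R * S%:R)); last by ring.
  apply: le_trans (ler_wpM2l _ GE) _; first by rewrite !mulr_ge0.
  by rewrite !mulrA.
apply: (@le_trans _ _ (n%:R ^+ (p * 4) * ((Cs * n%:R ^+ q) ^+ 4) * (C * n%:R ^+ Q * expR (- (theta * k%:R))))).
  rewrite ler_wpM2r ?mulr_ge0 ?expR_ge0 ?exprn_ge0// ler_wpM2l// lerXn2r ?nnegrE//.
  by rewrite mulr_ge0 ?exprn_ge0.
rewrite (_ : _ * _ = Cs ^+ 4 * C * (n%:R ^+ E * expR (- (theta * k%:R)))); last first.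
  by rewrite /E !exprD !exprMn -!exprM; ring.
rewrite -[X in _ <= X]mulrA ler_wpM2l ?mulr_ge0 ?exprn_ge0//.
rewrite ler_pdivlMr ?exprn_gt0 ?ltr0n// /n natrX -exprM mulrAC -exprD.
exact: hDD.
Qed.

End quenched_correlations.

(** * Almost sure averages of total correlations along the shift *)

Section average_correlations.
Context {R : realType} {dW dT : measure_display} {W : measurableType dW} {T : measurableType dT}.
Variables (P : probability W R) (m : probability T R).
Variables (F : W -> nat -> T -> T) (sh : nat -> W -> W) (agree : nat -> W -> W -> Prop).
Hypothesis hD : random_dynamics P m F sh agree.
Variable fam : nat -> seq (T -> R).
Hypothesis hF : mixing_family P m F fam.
Variables a p : nat.
Local Notation g k := (total_corr m F fam a p k).

(** Averages of nonnegative quantities need to be controlled only for square numbers of terms: every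
    N has a square between N and 4 N. *)
Lemma square_between (N : nat) : (0 < N)%N -> exists j, (N <= j.+1 ^ 2 <= 4 * N)%N.
Proof.
case: N => // N _; elim: N => [|N [j /andP[h1 h2]]]; first by exists 0%N.
have [h|h] := ltnP N.+1 (j.+1 ^ 2)%N; first by exists j; rewrite h (leq_trans h2)//; lia.
exists j.+1; have e : N.+1 = (j.+1 ^ 2)%N by apply/eqP; rewrite eqn_leq h1 h.
rewrite !e; move: (j) => i; rewrite -!mulnn; apply/andP; split; nia.
Qed.

Lemma total_corr_mean_le : exists2 C : R, 0 <= C & forall k, (0 < k)%N ->
  \int[P]_w g k w <= C * k%:R ^- 2.
Proof.
have [C C0 hC] := total_corr_moment hD hF a p.
exists (Num.sqrt C) => [|k k0]; first exact: sqrtr_ge0.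
have [K hK] := total_corr_bnd hD hF a p k.
have sg := sqint_bnd P (measurable_total_corr hD hF a p k) hK.
have k1 : 1 <= k%:R :> R by rewrite ler1n.
rewrite -[leLHS]ger0_norm; last by apply: Rint_ge0 => w; exact: total_corr_ge0.
rewrite -ler_sqr ?nnegrE ?mulr_ge0 ?sqrtr_ge0 ?invr_ge0 ?exprn_ge0//.
rewrite real_normK ?num_real//; apply: le_trans (Rint_sqr_le sg) _.
apply: le_trans (hC k k0) _; rewrite exprMn sqr_sqrtr// ler_wpM2l// exprVn -exprM.
by rewrite lef_pV2 ?posrE ?exprn_gt0 ?ltr0n// ler_weXn2l.
Qed.

(** The mean of [total_corr] is O(k^-2) by its second moment, and its centred sums over squares M
    are O(M k^-2) almost surely, uniformly in M and k, by summing the rescaled variances over both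
    indices. *)
Lemma avg_total_corr : {ae P, forall w, exists2 c : R, 0 <= c & forall N k, (0 < N)%N -> (0 < k)%N ->
  \sum_(n < N) g k (sh n w) <= c * N%:R * k%:R ^- 2}.
Proof.
have [C C0 hC] := total_corr_moment hD hF a p.
have [C1 C10 hC1] := total_corr_mean_le.
pose e k := \int[P]_w g k w.
pose S k N w := \sum_(n < N) (g k (sh n w) - e k).
(* Scaled so that a bound on [X] is the desired bound on the centred sum. With k = i + 1 and M = (j
   + 1)^2, the variance is at most 3 k M C k^-7, and the mean of X at most 3 C k^-2 (j + 1)^-2. *)
pose X i j w := i.+1%:R ^+ 4 * ((j.+1 ^ 2)%:R ^- 2 * S i.+1 (j.+1 ^ 2)%N w ^+ 2).
have X0 i j w : 0 <= X i j w by rewrite /X mulr_ge0 ?exprn_ge0// mulr_ge0 ?sqr_ge0// invr_ge0 exprn_ge0.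
have hS k N : sqint P (S k N).
  have [K hK] := total_corr_bnd hD hF a p k.
  have mg n : measurable_fun setT (fun w => g k (sh n w)).
    exact: measurableT_comp (measurable_total_corr hD hF a p k) (rd_shift hD n).
  apply: sqint_sum => n; apply: sqintB; first exact: sqint_bnd (mg n) (fun w => hK _).
  by apply: (@sqint_bnd _ _ _ _ _ `|e k|).
have iX i j : intg P (X i j).
  by apply: intgZ; apply: intgZ; exact: (hS _ _).2.
have EX i j : \int[P]_w X i j w <= 3 * C * i.+1%:R ^- 2 * j.+1%:R ^- 2.
  rewrite RintZ; last by apply: intgZ; exact: (hS _ _).2.
  rewrite RintZ; last exact: (hS _ _).2.
  have [K hK] := total_corr_bnd hD hF a p i.+1.
  have := @dependent_sum_var _ _ _ _ _ P m F sh agree hD i.+1 (g i.+1) K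
    (measurable_total_corr hD hF a p i.+1) hK (@total_corr_agree _ _ _ _ _ P m F sh agree hD fam a p i.+1)
    (j.+1 ^ 2)%N.
  rewrite -/(e i.+1) -/(S _ _) => h; have := hC i.+1 isT.
  set v := \int[P]_w _; set q := \int[P]_w _ in h *; move=> hv.
  have v0 : 0 <= v by apply: Rint_ge0 => w; rewrite sqr_ge0.
  have x1 : 1 <= i.+1%:R :> R by rewrite ler1n.
  have y1 : 1 <= j.+1%:R :> R by rewrite ler1n.
  rewrite natrX in h *; move: (i.+1%:R : R) (j.+1%:R : R) x1 y1 h hv => x y x1 y1 h hv.
  have x0 : 0 < x by exact: lt_le_trans x1.
  have y0 : 0 < y by exact: lt_le_trans y1.
  have hq : q <= 3 * x * y ^+ 2 * (C * x ^- 7).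
    apply: le_trans h _; apply: ler_pM => //; first by rewrite mulr_ge0 ?sqr_ge0//; lra.
    by rewrite ler_wpM2r ?sqr_ge0//; lra.
  apply: (@le_trans _ _ (x ^+ 4 * ((y ^+ 2) ^- 2 * (3 * x * y ^+ 2 * (C * x ^- 7))))).
    apply: ler_wpM2l; first by rewrite exprn_ge0// ltW.
    by apply: ler_wpM2l => //; rewrite invr_ge0 sqr_ge0.
  by rewrite le_eqVlt; apply/orP; left; apply/eqP; field; rewrite !gt_eqF.
pose f i w := (\sum_(j <oo) (X i j w)%:E)%E.
have mX i j : measurable_fun setT (fun w => (X i j w)%:E).
  by apply/measurable_EFinP; exact: intg_meas (iX i j).
have := @ae_nneseries_lty R _ W P f (fun i => 6 * C * i.+1%:R ^- 2).
case.
- move=> i; apply: ge0_emeasurable_sum => // j w _ _; by rewrite lee_fin.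
- by move=> i w; apply: nneseries_ge0 => j _ _; rewrite lee_fin.
- move=> i; rewrite /f integral_nneseries//; last by move=> j w _; rewrite lee_fin.
  apply: (@le_trans _ _ (\sum_(j <oo) (3 * C * i.+1%:R ^- 2 * j.+1%:R ^- 2)%:E)%E).
    apply: lee_nneseries => j *; first by apply: integral_ge0 => w _; rewrite lee_fin.
    by rewrite -EFin_Rint// lee_fin.
  apply: nneseries_le_bound => [j|N]; first by rewrite !mulr_ge0// invr_ge0 exprn_ge0.
  rewrite -mulr_sumr; have := inv_sqr_sum R N.
  have : 0 <= 3 * C * i.+1%:R ^- 2 by rewrite !mulr_ge0// invr_ge0 exprn_ge0.
  set u := \sum_(_ < _) _; set v := _ ^- 2; nra.
- apply: (@le_lt_trans _ _ (12 * C)%:E); last exact: ltry.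
  apply: nneseries_le_bound => [i|N]; first by rewrite !mulr_ge0// invr_ge0 exprn_ge0.
  by rewrite -mulr_sumr; have := inv_sqr_sum R N; set u := \sum_(_ < _) _; nra.
move=> A [mA PA sub]; exists A; split=> // w hw; apply: sub => hz; apply: hw.
pose Z := (\sum_(i <oo) f i w)%E; rewrite -/Z in hz.
have f0 i : (0 <= f i w)%E by apply: nneseries_ge0 => j _ _; rewrite lee_fin.
have Z0 : (0 <= Z)%E by apply: nneseries_ge0 => i _ _.
pose z := fine Z; have z0 : 0 <= z by exact: fine_ge0.
have Xz i j : X i j w <= z.
  rewrite -lee_fin fineK ?ge0_fin_numE//.
  apply: (@le_trans _ _ (f i w)); last exact: nneseries_ge_term.
  by apply: (nneseries_ge_term j (u := fun j => (X i j w)%:E)) => j'; rewrite lee_fin.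
exists (4 * (Num.sqrt z + C1)); first by rewrite mulr_ge0// addr_ge0// sqrtr_ge0.
move=> N [//|i] N0 _; have [j /andP[jN Nj]] := square_between N0.
set M := (j.+1 ^ 2)%N in jN Nj.
have M0 : 0 < M%:R :> R by rewrite ltr0n (leq_trans N0).
have x0 : 0 < i.+1%:R :> R by rewrite ltr0n.
apply: (@le_trans _ _ (\sum_(n < M) g i.+1 (sh n w))).
  rewrite (big_ord_widen M (fun n => g i.+1 (sh n w)))// big_mkcond/=.
  by apply: ler_sum => n _; case: ifP => // _; exact: total_corr_ge0.
have SE : \sum_(n < M) g i.+1 (sh n w) = S i.+1 M w + M%:R * e i.+1.
  by rewrite /S sumrB sumr_const card_ord mulr_natl subrK.
have SM : S i.+1 M w <= M%:R * i.+1%:R ^- 2 * Num.sqrt z.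
  apply: le_trans (ler_norm _) _.
  rewrite -ler_sqr ?nnegrE ?mulr_ge0 ?sqrtr_ge0 ?invr_ge0 ?exprn_ge0// real_normK ?num_real//.
  rewrite exprMn sqr_sqrtr//; have := Xz i j; rewrite /X -/M.
  move: (M%:R : R) (i.+1%:R : R) (S i.+1 M w) M0 x0 => y x s y0 x0 h.
  rewrite (_ : s ^+ 2 = (y * x ^- 2) ^+ 2 * (x ^+ 4 * (y ^- 2 * s ^+ 2))); last first.
    by field; rewrite !gt_eqF.
  by rewrite ler_wpM2l// sqr_ge0.
have eM : M%:R * e i.+1 <= M%:R * i.+1%:R ^- 2 * C1.
  by rewrite -mulrA ler_wpM2l// mulrC hC1.
rewrite SE; apply: le_trans (lerD SM eM) _; rewrite -mulrDr.
have MN : M%:R <= 4 * N%:R :> R by rewrite -natrM ler_nat.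
rewrite [leRHS](_ : _ = 4 * N%:R * i.+1%:R ^- 2 * (Num.sqrt z + C1)); last by ring.
by rewrite ler_wpM2r ?addr_ge0 ?sqrtr_ge0// ler_wpM2r// invr_ge0 exprn_ge0.
Qed.

End average_correlations.

Section real_sequences.
Context (R : realType).

Lemma cvg_epsP (u : nat -> R) (l : R) : u n @[n --> \oo] --> l <->
  forall e : R, 0 < e -> exists n0, forall n, (n0 <= n)%N -> `|u n - l| <= e.
Proof.
split=> [/cvgrPdist_le h e /h [n0 _ hn]|h].
  by exists n0 => n nn; rewrite distrC; exact: hn.
apply/cvgrPdist_le => e /h[n0 hn]; exists n0 => // n nn; rewrite distrC; exact: hn.
Qed.

Lemma div_nat_le (b e : R) : 0 <= b -> 0 < e -> exists2 k, (0 < k)%N & forall n, (k <= n)%N -> b / n%:R <= e.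
Proof.
move=> b0 e0; exists (Num.bound (b / e)).+1 => // n kn.
have n0 : 0 < n%:R :> R by rewrite ltr0n (leq_trans _ kn).
rewrite ler_pdivrMr// mulrC -ler_pdivrMr//.
apply: le_trans (ltW (archi_boundP _)) _; first by rewrite divr_ge0// ltW.
by rewrite ler_nat ltnW.
Qed.

Lemma cvg_tail (u : nat -> R) (b : R) : 0 <= b ->
  (forall n n', (0 < n)%N -> (n <= n')%N -> `|u n' - u n| <= b / n%:R) ->
  cvgn u /\ forall n, (0 < n)%N -> `|limn u - u n| <= b / n%:R.
Proof.
move=> b0 h; have cu : cvgn u.
  apply/cauchy_cvgP; apply/cauchy_exP => e e0.
  have [k k0 hk] := div_nat_le b0 (divr_gt0 e0 (ltr0n R 2)).
  exists (u k), k => // n kn; rewrite /ball/= distrC.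
  apply: le_lt_trans (h k n k0 kn) _; apply: le_lt_trans (hk k (leqnn k)) _.
  by rewrite ltr_pdivrMr// ltr_pMr// ltr1n.
split=> // n n0.
have c1 : (fun n' => `|u n' - u n|) @ \oo --> `|limn u - u n|.
  by apply: cvg_norm; apply: cvgB => //; exact: cvg_cst.
rewrite -(cvg_lim (@Rhausdorff R) c1); apply: limr_le; first by apply/cvg_ex; exists (`|limn u - u n|).
by exists n => // n' nn'; exact: h.
Qed.

End real_sequences.

(** * Correlations and block variances of approximable functions *)

Section approximable_functions.
Context {R : realType} {dW dT : measure_display} {W : measurableType dW} {T : measurableType dT}.
Variables (P : probability W R) (m : probability T R).
Variables (F : W -> nat -> T -> T) (sh : nat -> W -> W) (agree : nat -> W -> W -> Prop).
Hypothesis hD : random_dynamics P m F sh agree.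
Variable fam : nat -> seq (T -> R).
Hypothesis hF : mixing_family P m F fam.
Variables (a p : nat) (t : R).
Hypotheses (t0 : 0 < t) (at4 : 4 <= a%:R * t).
Local Notation g k := (total_corr m F fam a p k).
Local Notation nrm := (nrm m).
Local Notation qcorr := (qcorr m F).

(** A difference of two coefficient lists is allowed, possibly of different lengths, so that a
    function, its approximants and the differences between them all fit without adding lists. *)
Definition span_approx (K : R) (U : T -> R) := forall n, (0 < n)%N -> exists c c' : seq R,
  [/\ (forall x, x \in c -> `|x| <= K * n%:R ^+ p), (forall x, x \in c' -> `|x| <= K * n%:R ^+ p) &
      \int[m]_x ((U x - (comb (fam n) c x - comb (fam n) c' x)) ^+ 2) <= K * n%:R `^ (- t)].

Lemma comb_bnd n (c : seq R) : exists2 B : R, 0 <= B &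
  measurable_fun setT (comb (fam n) c) /\ forall x, `|comb (fam n) c x| <= B.
Proof.
have [B B0 hB] := mf_bound hF.
have E : comb (fam n) c = (fun x => \sum_(i < size (fam n)) nth 0 c i * nth (fun=> 0) (fam n) i x).
  by apply/funext => x; exact: comb_nth.
exists (\sum_(i < size (fam n)) `|nth 0 c i| * B).
  by apply: sumr_ge0 => i _; rewrite mulr_ge0.
rewrite E; split.
  apply: measurable_sum => i; apply: measurable_funM => //.
  by have [] := hB n _ (mem_nth (fun=> 0) (ltn_ord i)).
move=> x; apply: le_trans (ler_norm_sum _ _ _) _; apply: ler_sum => i _.
rewrite normrM ler_wpM2l//.
by have [_ h] := hB n _ (mem_nth (fun=> 0) (ltn_ord i)); exact: h.
Qed.

(** The approximant of level n = k^a. Its squared error is at most K k^(- a t) <= K k^-4, and its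
    coefficients are at most 2 K n^p, whose products the weight in [total_corr] accounts for. *)
Lemma span_level (K : R) U k : sqint m U -> 0 <= K -> span_approx K U -> (0 < k)%N -> exists (V : T -> R) (B : R),
  [/\ measurable_fun setT V, forall x, `|V x| <= B,
      nrm (fun x => U x - V x) <= Num.sqrt K * k%:R ^- 2 &
      forall w, `|qcorr w k V V| <= 4 * K ^+ 2 * g k w].
Proof.
move=> sU K0 hU k0; set n := (k ^ a)%N; have n0 : (0 < n)%N by rewrite expn_gt0 k0.
have [c [c' [hc hc' hE]]] := hU n n0.
have [B B0 [mc bc]] := comb_bnd n c; have [B' B'0 [mc' bc']] := comb_bnd n c'.
pose V x := comb (fam n) c x - comb (fam n) c' x.
exists V, (B + B'); split.
- exact: measurable_funB.
- by move=> x; apply: le_trans (ler_normB _ _) _; rewrite lerD.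
- rewrite -ler_sqr ?nnegrE ?nrm_ge0 ?mulr_ge0 ?sqrtr_ge0 ?invr_ge0 ?exprn_ge0// nrm_sqr.
  apply: le_trans hE _; rewrite exprMn sqr_sqrtr// ler_wpM2l// /n natrX -powR_mulrn//.
  rewrite -powRrM -exprVn -exprM -[leRHS]powR_mulrn ?invr_ge0// -powR_inv1// -powRrM.
  rewrite ler_powR ?ler1n//; have -> : (2 * 2)%:R = 4 :> R by rewrite natrM; ring.
  by rewrite mulrN; move: (a%:R * t) at4 => z zz; lra.
pose d i := nth 0 c i - nth 0 c' i.
have VE x : V x = \sum_(i < size (fam n)) d i * nth (fun=> 0) (fam n) i x.
  by rewrite /V !comb_nth -sumrB; apply: eq_bigr => i _; rewrite mulrBl.
have dK i : `|d i| <= 2 * (K * n%:R ^+ p).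
  have Kn : 0 <= K * n%:R ^+ p by rewrite mulr_ge0 ?exprn_ge0.
  by apply: le_trans (ler_normB _ _) _; rewrite mulr_natl lerD// nth_coef_le.
have [B1 B10 hB1] := mf_bound hF.
have selt (i : 'I_(size (fam n))) : sqint m (nth (fun=> 0) (fam n) i).
  by have [h1 h2] := hB1 n _ (mem_nth (fun=> 0) (ltn_ord i)); exact: sqint_bnd h1 h2.
move=> w; have -> : qcorr w k V V = \sum_(i < size (fam n)) \sum_(j < size (fam n))
    d i * d j * qcorr w k (nth (fun=> 0) (fam n) i) (nth (fun=> 0) (fam n) j).
  have ii (i j : 'I_(size (fam n))) : intg m (fun x => d i * d j *
      (nth (fun=> 0) (fam n) i x * nth (fun=> 0) (fam n) j (F w k x))).
    by apply: intgZ; apply: sqint_mul => //; exact: (sqint_F hD w k (selt j)).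
  transitivity (\int[m]_x \sum_(i < size (fam n)) \sum_(j < size (fam n))
      (d i * d j * (nth (fun=> 0) (fam n) i x * nth (fun=> 0) (fam n) j (F w k x)))).
    apply: eq_Rint => x; rewrite !VE big_distrl/=; apply: eq_bigr => i _.
    by rewrite big_distrr/=; apply: eq_bigr => j _; ring.
  rewrite Rint_sum => [|i]; last by apply: intg_sum => j; exact: ii.
  apply: eq_bigr => i _; rewrite Rint_sum => [|j]; last exact: ii.
  apply: eq_bigr => j _; rewrite RintZ//.
  by apply: sqint_mul => //; exact: (sqint_F hD w k (selt j)).
rewrite /total_corr -/n [leRHS](_ : _ = \sum_(i < size (fam n)) \sum_(j < size (fam n))
    (2 * (K * n%:R ^+ p)) * (2 * (K * n%:R ^+ p)) *
    `|qcorr w k (nth (fun=> 0) (fam n) i) (nth (fun=> 0) (fam n) j)|); last first.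
  rewrite !mulr_sumr; apply: eq_bigr => i _; rewrite !mulr_sumr; apply: eq_bigr => j _.
  by rewrite mulrA mulnC exprM; ring.
apply: le_trans (ler_norm_sum _ _ _) _; apply: ler_sum => i _.
apply: le_trans (ler_norm_sum _ _ _) _; apply: ler_sum => j _.
by rewrite !normrM ler_wpM2r// ler_pM.
Qed.

(** Holds for every word: the constant depends on [U] only through its approximation constant and a
    bound on its norm. This is where the uncountable family of observables is reduced to one random
    sequence. *)
Lemma qcorr_span_bound (K L : R) U : sqint m U -> 0 <= K -> span_approx K U -> nrm U <= L ->
  forall w k, (0 < k)%N -> `|qcorr w k U U| <=
    (4 * K ^+ 2 + Num.sqrt K * (2 * L + Num.sqrt K)) * (g k w + k%:R ^- 2).
Proof.
move=> sU K0 hU UL w k k0; have [V [B [mV bV VE hV]]] := span_level sU K0 hU k0.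
have sV : sqint m V by exact: sqint_bnd mV bV.
have x0 : 0 < k%:R ^- 2 :> R by rewrite invr_gt0 exprn_gt0// ltr0n.
have x1 : k%:R ^- 2 <= 1 :> R by rewrite invf_le1 ?exprn_gt0 ?ltr0n// exprn_ege1// ler1n.
have sK := sqrtr_ge0 K; have g0 : 0 <= g k w by exact: total_corr_ge0.
have nV : nrm V <= L + Num.sqrt K.
  have -> : V = (fun x => U x + - (U x - V x)) by apply/funext => x; ring.
  apply: le_trans (nrmD sU (sqintN (sqintB sU sV))) _; rewrite (nrmN m) lerD//.
  by apply: le_trans VE _; rewrite ler_piMr.
have L0 : 0 <= L by exact: le_trans (nrm_ge0 _ _) UL.
have h1 := qcorr_diag_sub hD w k sU sV.
have h2 : nrm (fun x => U x - V x) * (nrm U + nrm V) <= Num.sqrt K * k%:R ^- 2 * (2 * L + Num.sqrt K).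
  apply: ler_pM => //; rewrite ?nrm_ge0 ?addr_ge0 ?nrm_ge0//.
  by apply: le_trans (lerD UL nV) _; lra.
have -> : qcorr w k U U = qcorr w k V V + (qcorr w k U U - qcorr w k V V) by ring.
apply: le_trans (ler_normD _ _) _; apply: le_trans (lerD (hV w) (le_trans h1 h2)) _.
have K20 : 0 <= 4 * K ^+ 2 by rewrite mulr_ge0 ?sqr_ge0.
have q0 : 0 <= Num.sqrt K * (2 * L + Num.sqrt K) by rewrite mulr_ge0// addr_ge0// mulr_ge0.
rewrite (_ : Num.sqrt K * k%:R ^- 2 * _ = Num.sqrt K * (2 * L + Num.sqrt K) * k%:R ^- 2); last by ring.
move: (4 * K ^+ 2) (Num.sqrt K * (2 * L + Num.sqrt K)) (k%:R ^- 2) (g k w) K20 q0 x0 g0 => A B' x y A0 B0 x0 y0.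
by have := mulr_ge0 A0 (ltW x0); have := mulr_ge0 B0 y0; lra.
Qed.

(** Joint measurability yields this for bounded functions; the square integrable [U] is reached as
    an L^2 limit of bounded approximants, along which quenched correlations converge. *)
Lemma measurable_qcorr_span (K : R) U k : sqint m U -> 0 <= K -> span_approx K U ->
  measurable_fun setT (fun w => qcorr w k U U).
Proof.
move=> sU K0 hU.
have /choice[V hV] (j : nat) : exists V : T -> R, (exists B : R, measurable_fun setT V /\ forall x, `|V x| <= B) /\
    nrm (fun x => U x - V x) <= Num.sqrt K * j.+1%:R^-1.
  have [V [B [mV bV VE _]]] := span_level sU K0 hU (ltn0Sn j).
  exists V; split; first by exists B.
  apply: le_trans VE _; rewrite ler_wpM2l ?sqrtr_ge0// lef_pV2 ?posrE ?exprn_gt0 ?ltr0n//.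
  by rewrite expr2 ler_peMr// ler1n.
apply: (@measurable_fun_cvg _ _ _ setT (fun j w => qcorr w k (V j) (V j))).
  move=> j; have [[B [mV bV]] _] := hV j.
  by have [] := measurable_qcorr_bnd hD k mV mV bV bV.
move=> w _; apply/cvg_epsP => e e0.
have q0 : 0 <= Num.sqrt K * (2 * nrm U + Num.sqrt K).
  by rewrite mulr_ge0 ?sqrtr_ge0// addr_ge0 ?sqrtr_ge0// mulr_ge0// nrm_ge0.
have [n0 n00 hn] := div_nat_le q0 e0; exists n0 => n nn.
have [[B [mV bV]] VE] := hV n; have sV : sqint m (V n) by exact: sqint_bnd mV bV.
have x0 : 0 < n.+1%:R^-1 :> R by rewrite invr_gt0 ltr0n.
have x1 : n.+1%:R^-1 <= 1 :> R by rewrite invf_le1 ?ltr0n// ler1n.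
have sK := sqrtr_ge0 K.
have nV : nrm (V n) <= nrm U + Num.sqrt K.
  have -> : V n = (fun x => U x + - (U x - V n x)) by apply/funext => x; ring.
  apply: le_trans (nrmD sU (sqintN (sqintB sU sV))) _; rewrite (nrmN m) lerD//.
  by apply: le_trans VE _; rewrite ler_piMr.
rewrite distrC; apply: le_trans (qcorr_diag_sub hD w k sU sV) _.
apply: le_trans (hn n.+1 (leqW nn)).
apply: (@le_trans _ _ (Num.sqrt K * n.+1%:R^-1 * (2 * nrm U + Num.sqrt K))); last first.
  by rewrite mulrAC.
apply: ler_pM => //; rewrite ?nrm_ge0 ?addr_ge0 ?nrm_ge0//.
by apply: le_trans (lerD (lexx _) nV) _; lra.
Qed.

(* Stationarity: expand the square from its first term. *)
Lemma block_var_expand U w M L N : sqint m U -> (L <= N)%N ->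
  \int[m]_x ((\sum_(i < L) U (F w (M + i)%N x)) ^+ 2) <=
  \sum_(i < L) (nrm U ^+ 2 + 2 * \sum_(k < N) `|qcorr (sh (M + i) w) k.+1 U U|).
Proof.
move=> sU; elim: L M => [|L ih] M LN.
  by rewrite big_ord0; under eq_Rint do rewrite big_ord0 expr0n/=; rewrite Rint0.
have sF n : sqint m (fun x => U (F w n x)) by exact: (sqint_F hD).
pose S x := \sum_(i < L) U (F w (M.+1 + i)%N x).
have sS : sqint m S by apply: sqint_sum => i; exact: sF.
rewrite (_ : \int[m]_x _ = \int[m]_x (U (F w M x) ^+ 2 + (2 * (U (F w M x) * S x) + S x ^+ 2))); last first.
  apply: eq_Rint => x; rewrite big_ord_recl/= addn0.
  rewrite (_ : \sum_(i < L) _ = S x); last by apply: eq_bigr => i _; rewrite /bump/= addnA addn1.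
  by ring.
rewrite RintD; [|exact: (sF M).2|by apply: intgD; [by apply: intgZ; exact: sqint_mul|exact: sS.2]].
rewrite RintD; [|by apply: intgZ; exact: sqint_mul|exact: sS.2].
rewrite RintZ; last exact: sqint_mul.
rewrite [leRHS]big_ord_recl/= addn0 addrA; apply: lerD; last first.
  apply: le_trans (ih M.+1 (ltnW LN)) _; apply: ler_sum => i _.
  by rewrite /bump/= addnA addn1.
rewrite (Rint_F hD w M (f := fun x => U x ^+ 2)); last exact: measurable_funX sU.1.
rewrite nrm_sqr lerD2l ler_wpM2l//.
rewrite (_ : \int[m]_x _ = \sum_(i < L) qcorr (sh M w) i.+1 U U).
  apply: le_trans (ler_norm _) _; apply: le_trans (ler_norm_sum _ _ _) _.
  rewrite (big_ord_widen N (fun i => `|qcorr (sh M w) i.+1 U U|)); last exact: ltnW.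
  by rewrite big_mkcond/=; apply: ler_sum => i _; case: ifP.
transitivity (\int[m]_x \sum_(i < L) (U (F w M x) * U (F w (M.+1 + i)%N x))).
  by apply: eq_Rint => x; rewrite mulr_sumr.
rewrite Rint_sum => [|i]; last exact: sqint_mul.
apply: eq_bigr => i _; rewrite /qcorr.
rewrite -(Rint_F hD w M (f := fun x => U x * U (F (sh M w) i.+1 x))); last first.
  by apply: measurable_funM; [exact: sU.1|exact: measurableT_comp sU.1 (measurable_F hD _ _)].
by apply: eq_Rint => x; rewrite addSnnS (rd_cocycle hD).
Qed.

(** Correlations at times up to [k0] are bounded by the squared norm of [U]. Later ones are bounded
    on average by (c + 1) (M + L) k^-2, and the sum over k > k0 of k^-2 is at most 1 / k0. The total
    length M + L enters because the averages of [total_corr] start at time 0. *)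
Lemma block_var_bound U (K c : R) w : sqint m U -> 0 <= K -> 0 <= c ->
  (forall w' k, (0 < k)%N -> `|qcorr w' k U U| <= K * (g k w' + k%:R ^- 2)) ->
  (forall N k, (0 < N)%N -> (0 < k)%N -> \sum_(n < N) g k (sh n w) <= c * N%:R * k%:R ^- 2) ->
  forall M L k0, (0 < k0)%N ->
  \int[m]_x ((\sum_(i < L) U (F w (M + i)%N x)) ^+ 2) <=
  L%:R * ((1 + 2 * k0%:R) * nrm U ^+ 2) + 2 * K * (c + 1) * (M + L)%:R / k0%:R.
Proof.
move=> sU K0 c0 hU hw M L k0 k00.
have [->|L0] := posnP L.
  under eq_Rint do rewrite big_ord0 expr0n/=.
  by rewrite Rint0 mul0r add0r !mulr_ge0// ?addr_ge0// invr_ge0.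
apply: le_trans (block_var_expand w M sU (leq_addl k0 L)) _.
have q k i : `|qcorr (sh (M + i) w) k U U| <= nrm U ^+ 2 by rewrite expr2; exact: (qcorr_le hD).
rewrite big_split/= sumr_const card_ord -(mulr_natl (nrm U ^+ 2) L).
rewrite (_ : L%:R * ((1 + _) * _) = L%:R * nrm U ^+ 2 + L%:R * (2 * k0%:R * nrm U ^+ 2)); last by ring.
rewrite -[leRHS]addrA lerD2l.
rewrite -mulr_sumr (eq_bigr (fun i : 'I_L => \sum_(k < k0) `|qcorr (sh (M + i) w) k.+1 U U| +
   \sum_(j < L) `|qcorr (sh (M + i) w) (k0 + j).+1 U U|)); last first.
  by move=> i _; rewrite big_split_ord.
rewrite big_split/= mulrDr; apply: lerD.
  rewrite (_ : L%:R * (2 * k0%:R * nrm U ^+ 2) = 2 * \sum_(i < L) \sum_(k < k0) nrm U ^+ 2).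
    by rewrite ler_wpM2l//; apply: ler_sum => i _; apply: ler_sum => k _; exact: q.
  by rewrite !sumr_const !card_ord -mulrnA -(mulr_natl (nrm U ^+ 2)) natrM; ring.
rewrite -!mulrA ler_wpM2l// exchange_big/=.
have ML0 : 0 <= (M + L)%:R :> R by [].
apply: (@le_trans _ _ (\sum_(j < L) K * ((c + 1) * (M + L)%:R * (k0 + j).+1%:R ^- 2))).
  apply: ler_sum => j _.
  apply: (@le_trans _ _ (\sum_(i < L) K * (g (k0 + j).+1 (sh (M + i) w) + (k0 + j).+1%:R ^- 2))).
    by apply: ler_sum => i _; exact: hU.
  rewrite -mulr_sumr ler_wpM2l// big_split/= sumr_const card_ord mulrDl mul1r mulrDl lerD//.
    have MLp : (0 < M + L)%N by rewrite addn_gt0 L0 orbT.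
    apply: le_trans (hw _ _ MLp (ltn0Sn (k0 + j))); rewrite big_split_ord/= lerDr.
    by apply: sumr_ge0 => i _; exact: total_corr_ge0.
  by rewrite -[_ *+ L]mulr_natl ler_wpM2r ?invr_ge0 ?exprn_ge0// ler_nat leq_addl.
rewrite -mulr_sumr ler_wpM2l// -mulr_sumr -mulrA ler_wpM2l ?addr_ge0// ler_wpM2l//.
have := @inv_sqr_tail R k0 (k0 + L) k00; rewrite -{1}[k0]add0n big_addn addKn big_mkord.
by under eq_bigr do rewrite addnC.
Qed.

Lemma annealed_qcorr_bound U (K : R) k : sqint m U -> 0 <= K -> (0 < k)%N ->
  measurable_fun setT (fun w => qcorr w k U U) ->
  (forall w, `|qcorr w k U U| <= K * (g k w + k%:R ^- 2)) ->
  `|\int[P]_w qcorr w k U U| <= K * (\int[P]_w g k w + k%:R ^- 2).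
Proof.
move=> sU K0 k0 mq hq.
have iq : intg P (fun w => qcorr w k U U).
  by apply: (@intg_bnd _ _ _ P _ (nrm U * nrm U)) => // w; exact: (qcorr_le hD).
have [B hB] := total_corr_bnd hD hF a p k.
have ig : intg P (g k) by apply: (intg_bnd P (measurable_total_corr hD hF a p k) hB).
apply: le_trans (Rint_norm_le iq) _.
rewrite -[k%:R ^- 2](Rint_cst P) -RintD ?intg_cst// -RintZ; last by apply: intgD => //; exact: intg_cst.
apply: Rint_le => //; first exact: intg_norm.
by apply: intgZ; apply: intgD => //; exact: intg_cst.
Qed.

(** The rate depends on [U] only through [K], so truncating the variance at a fixed time is uniform
    along a sequence of approximants with a common constant. *)
Lemma asymp_variance_tail : exists2 C : R, 0 <= C & forall U (K : R), sqint m U -> 0 <= K ->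
  (forall k, measurable_fun setT (fun w => qcorr w k U U)) ->
  (forall w k, (0 < k)%N -> `|qcorr w k U U| <= K * (g k w + k%:R ^- 2)) ->
  cvgn (variance_partial P m F U) /\ forall n, (0 < n)%N ->
    `|asymp_variance P m F U - variance_partial P m F U n| <= K * C / n%:R.
Proof.
have [C C0 hC] := total_corr_mean_le hD hF a p.
exists (2 * (C + 1)) => [|U K sU K0 mq hq]; first by rewrite mulr_ge0// addr_ge0.
apply: cvg_tail => [|n n' n0 nn]; first by rewrite !mulr_ge0// addr_ge0.
rewrite /variance_partial (@big_cat_nat _ _ _ n.+1)//=.
rewrite (_ : _ - _ = 2 * \sum_(n.+1 <= k < n'.+1) correlation P m F U U k); last by ring.
rewrite normrM ger0_norm// (_ : K * _ / _ = 2 * (K * (C + 1) * n%:R^-1)); last by ring.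
rewrite ler_wpM2l//; apply: le_trans (ler_norm_sum _ _ _) _.
apply: (@le_trans _ _ (\sum_(n <= k < n') K * (C + 1) * k.+1%:R ^- 2)).
  rewrite big_add1/= big_nat_cond [leRHS]big_nat_cond; apply: ler_sum => k /andP[/andP[nk _] _].
  apply: le_trans (annealed_qcorr_bound sU K0 (ltn0Sn k) (mq _) (fun w => hq w _ (ltn0Sn k))) _.
  by rewrite -mulrA ler_wpM2l// mulrDl mul1r lerD2r hC.
by rewrite -mulr_sumr ler_wpM2l ?mulr_ge0 ?addr_ge0// inv_sqr_tail.
Qed.

End approximable_functions.

(** * Normalized Birkhoff sums *)

Section normalized_sums.
Context {R : realType} {dW dT : measure_display} {W : measurableType dW} {T : measurableType dT}.
Variables (P : probability W R) (m : probability T R).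
Variables (F : W -> nat -> T -> T) (sh : nat -> W -> W) (agree : nat -> W -> W -> Prop).
Hypothesis hD : random_dynamics P m F sh agree.
Local Notation nrm := (nrm m).
Local Notation qcorr := (qcorr m F).

Definition nsum (U : T -> R) (N : nat) (w : W) (x : T) : R :=
  (Num.sqrt N%:R)^-1 * birkhoff F U N x w.

Lemma birkhoff_split (U : T -> R) M L x w : birkhoff F U (M + L) x w =
  birkhoff F U M x w + \sum_(i < L) U (F w (M + i)%N x).
Proof. by rewrite /birkhoff !big_mkord big_split_ord. Qed.

Lemma sqint_birkhoff U N w : sqint m U -> sqint m (fun x => birkhoff F U N x w).
Proof. by move=> sU; apply: sqint_sum => n; exact: (sqint_F hD). Qed.

Lemma sqint_nsum U N w : sqint m U -> sqint m (nsum U N w).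
Proof. by move=> sU; apply: sqintZ; exact: sqint_birkhoff. Qed.

Lemma measurable_birkhoff2 (U : T -> R) N : measurable_fun setT U ->
  measurable_fun setT (fun p : W * T => birkhoff F U N p.2 p.1).
Proof.
by move=> mU; apply: measurable_sum => n; exact: measurableT_comp mU (rd_measurable hD n).
Qed.

Lemma measurable_nsum2 (U : T -> R) N : measurable_fun setT U ->
  measurable_fun setT (fun p : W * T => nsum U N p.1 p.2).
Proof. by move=> mU; apply: measurable_funM => //; exact: measurable_birkhoff2. Qed.

Lemma Rint_lipschitz_le (f : R -> R) (X Y : T -> R) : measurable_fun setT f ->
  (forall x, `|f x| <= 1) -> (forall x y, `|f x - f y| <= `|x - y|) -> sqint m X -> sqint m Y ->
  `|\int[m]_x f (X x) - \int[m]_x f (Y x)| <= nrm (fun x => X x - Y x).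
Proof.
move=> mf f1 fl sX sY.
have iX : intg m (fun x => f (X x)) by apply: (intg_bnd m (measurableT_comp mf sX.1)) => x; exact: f1.
have iY : intg m (fun x => f (Y x)) by apply: (intg_bnd m (measurableT_comp mf sY.1)) => x; exact: f1.
have sXY := sqintB sX sY.
rewrite -RintB//; apply: le_trans (Rint_norm_le (intgB iX iY)) _.
apply: le_trans (Rint_norm_le_nrm sXY); apply: Rint_le => //.
  by apply: intg_norm; exact: intgB.
by apply: intg_norm; exact: sqint_intg.
Qed.

Lemma one_plus_exp_le (n : nat) : exists2 b : R, 0 <= b &
  forall x : R, 0 <= x <= 1 -> (1 + x) ^+ n <= 1 + b * x.
Proof.
elim: n => [|n [b b0 hb]]; first by exists 0 => // x _; rewrite expr0 mul0r addr0.
exists (2 * b + 1) => [|x /andP[x0 x1]]; first by rewrite addr_ge0// mulr_ge0.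
rewrite exprS; have := hb x; rewrite x0 x1 => /(_ isT) h.
have h2 : (1 + x) * (1 + x) ^+ n <= (1 + x) * (1 + b * x) by rewrite ler_wpM2l// addr_ge0.
have := mulr_ge0 b0 x0; have := mulr_ge0 (mulr_ge0 b0 x0) (_ : 0 <= 1 - x).
by rewrite subr_ge0 => /(_ x1); nra.
Qed.

Lemma block_ratio (n : nat) (e : R) : 0 < e -> exists j0, forall j, (j0 <= j)%N ->
  (j.+2 ^ n)%:R - (j.+1 ^ n)%:R <= e * (j.+1 ^ n)%:R :> R.
Proof.
move=> e0; have [b b0 hb] := one_plus_exp_le n; have [k k0 hk] := div_nat_le b0 e0.
exists k => j kj; have j0 : 0 < j.+1%:R :> R by rewrite ltr0n.
have x1 : 0 <= (j.+1%:R^-1 : R) <= 1 by rewrite invr_ge0 ler0n/= invf_le1// ler1n.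
have := hk j.+1 (leqW kj); have := hb _ x1.
rewrite !natrX => h1 h2; rewrite lerBlDr (_ : e * _ + _ = (1 + e) * j.+1%:R ^+ n); last by ring.
have -> : j.+2%:R = j.+1%:R * (1 + j.+1%:R^-1) :> R.
  by rewrite mulrDr mulr1 divff ?gt_eqF// -natr1.
rewrite exprMn mulrC ler_wpM2r ?exprn_ge0//; apply: le_trans h1 _.
by rewrite lerD2l.
Qed.

Lemma block_index (n N : nat) : (0 < n)%N -> (0 < N)%N ->
  exists j, (j.+1 ^ n <= N < j.+2 ^ n)%N.
Proof.
move=> n0; elim: N => // N ih _; have [->|N0] := posnP N.
  by exists 0%N; rewrite exp1n/= -{1}(exp1n n) ltn_exp2r.
have [j /andP[h1 h2]] := ih N0; have [h|h] := ltnP N.+1 (j.+2 ^ n)%N.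
  by exists j; rewrite h (leq_trans h1).
by exists j.+1; rewrite h/=; apply: (leq_ltn_trans h2); rewrite ltn_exp2r.
Qed.

Section interpolation.
Variable fam : nat -> seq (T -> R).
Variables (a p : nat) (U : T -> R) (K c : R) (w : W).
Local Notation g k := (total_corr m F fam a p k).
Hypotheses (sU : sqint m U) (K0 : 0 <= K) (c0 : 0 <= c).
Hypothesis hU : forall w' k, (0 < k)%N -> `|qcorr w' k U U| <= K * (g k w' + k%:R ^- 2).
Hypothesis hw : forall N k, (0 < N)%N -> (0 < k)%N ->
  \sum_(n < N) g k (sh n w) <= c * N%:R * k%:R ^- 2.

Lemma nsum_sqr_le N k0 : (0 < N)%N -> (0 < k0)%N ->
  nrm (nsum U N w) ^+ 2 <= (1 + 2 * k0%:R) * nrm U ^+ 2 + 2 * K * (c + 1) / k0%:R.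
Proof.
move=> N0 k00; have N1 : 0 < N%:R :> R by rewrite ltr0n.
rewrite (nrmZ _ (sqint_birkhoff N w sU)) exprMn real_normK ?num_real// exprVn sqr_sqrtr//.
rewrite ler_pdivrMl// (nrm_sqr m (fun x => birkhoff F U N x w)).
have := block_var_bound hD sU K0 c0 hU hw 0 N k00; rewrite add0n => h.
have -> : \int[m]_x (birkhoff F U N x w ^+ 2) = \int[m]_x ((\sum_(i < N) U (F w (0 + i)%N x)) ^+ 2).
  by apply: eq_Rint => x; rewrite /birkhoff big_mkord.
by apply: le_trans h _; rewrite le_eqVlt; apply/orP; left; apply/eqP; ring.
Qed.

(** Between consecutive powers M and N the sum gains a block of length L <= r M and the
    normalization changes by a relative amount of at most r. [k0] first makes the late correlations
    small; [r], and thus the starting index, is chosen afterwards to beat the early ones. *)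
Lemma nsum_interpolation (n : nat) (e : R) : (0 < n)%N -> 0 < e ->
  exists j0, forall j N, (j0 <= j)%N -> (j.+1 ^ n <= N <= j.+2 ^ n)%N ->
  nrm (fun x => nsum U N w x - nsum U (j.+1 ^ n) w x) <= e.
Proof.
move=> n0 e0; pose B := 2 * K * (c + 1).
have B0 : 0 <= B by rewrite !mulr_ge0// addr_ge0.
have e1 : 0 < e ^+ 2 / 8 by rewrite divr_gt0// exprn_gt0.
have [k0 k00 hk0] := div_nat_le B0 e1.
pose A := (1 + 2 * k0%:R) * nrm U ^+ 2.
have A0 : 0 <= A by rewrite mulr_ge0 ?sqr_ge0// addr_ge0// mulr_ge0.
pose v := (1 + 2) * nrm U ^+ 2 + B.
have v0 : 0 <= v by rewrite addr_ge0// mulr_ge0 ?sqr_ge0// addr_ge0.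
pose r := Num.min (e ^+ 2 / 8 / (A + 1)) (e / 2 / (Num.sqrt v + 1)).
have A1 : 0 < A + 1 by rewrite ltr_wpDl.
have v1 : 0 < Num.sqrt v + 1 by rewrite ltr_wpDl// sqrtr_ge0.
have r0 : 0 < r by rewrite lt_min (divr_gt0 e1)// divr_gt0// divr_gt0.
have rA : r * A <= e ^+ 2 / 8.
  have : r * (A + 1) <= e ^+ 2 / 8 by rewrite -ler_pdivlMr// /r ge_min lexx.
  by rewrite mulrDr mulr1; lra.
have rv : r * Num.sqrt v <= e / 2.
  have : r * (Num.sqrt v + 1) <= e / 2 by rewrite -ler_pdivlMr// /r ge_min lexx orbT.
  by rewrite mulrDr mulr1; lra.
have [j0 hj] := block_ratio n r0; exists j0 => j N jj /andP[]; set M := (j.+1 ^ n)%N => MN Nn.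
have M0 : (0 < M)%N by rewrite expn_gt0.
have M1 : 0 < M%:R :> R by rewrite ltr0n.
pose L := (N - M)%N; have NE : N = (M + L)%N by rewrite /L subnKC.
have N1 : 0 < N%:R :> R by rewrite ltr0n (leq_trans M0).
have Lr : L%:R <= r * M%:R.
  apply: le_trans (hj j jj); rewrite /L natrB// lerB// ler_nat //.
have LN : L%:R <= r * N%:R.
  by apply: le_trans Lr _; apply: ler_wpM2l; [exact: ltW|rewrite ler_nat].
pose x := Num.sqrt M%:R : R; pose y := Num.sqrt N%:R : R.
have x0 : 0 < x by rewrite sqrtr_gt0.
have y0 : 0 < y by rewrite sqrtr_gt0.
have xx : x ^+ 2 = M%:R by rewrite sqr_sqrtr.
have yy : y ^+ 2 = N%:R by rewrite sqr_sqrtr.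
have xy : x <= y by rewrite ler_wsqrtr// ler_nat.
pose S z := \sum_(i < L) U (F w (M + i)%N z).
have sS : sqint m S by apply: sqint_sum => i; exact: (sqint_F hD).
(* New block, plus the effect of renormalizing the old sum. *)
have E z : nsum U N w z - nsum U M w z = y^-1 * S z + (- (x^-1 - y^-1)) * (x * nsum U M w z).
  rewrite /nsum -/x -/y {1}NE birkhoff_split -/(S z).
  by move: (birkhoff _ _ _ _ _) (S z) => b s; field; rewrite !gt_eqF.
under eq_fun do rewrite E.
have sM := sqint_nsum M w sU.
apply: le_trans (nrmD (sqintZ _ sS) (sqintZ _ (sqintZ x sM))) _.
rewrite (nrmZ _ sS) (nrmZ _ (sqintZ x sM)) (nrmZ _ sM).
rewrite (_ : e = e / 2 + e / 2); last by field.
apply: lerD.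
  have yi : 0 <= y^-1 by rewrite invr_ge0 (ltW y0).
  have ye : 0 <= y * (e / 2) by rewrite mulr_ge0 ?(ltW y0)// divr_ge0// (ltW e0).
  rewrite (ger0_norm yi) ler_pdivrMl// -ler_sqr ?nnegrE ?nrm_ge0// nrm_sqr.
  apply: le_trans (block_var_bound hD sU K0 c0 hU hw M L k00) _.
  rewrite -NE -/A -/B exprMn yy; have := hk0 k0 (leqnn k0) => hB.
  have h1 : L%:R * A <= e ^+ 2 / 8 * N%:R.
    apply: (@le_trans _ _ (r * N%:R * A)); first by rewrite ler_wpM2r.
    by rewrite mulrAC ler_wpM2r.
  have h2 : B * N%:R / k0%:R <= e ^+ 2 / 8 * N%:R by rewrite mulrAC ler_wpM2r.
  apply: le_trans (lerD h1 h2) _; rewrite le_eqVlt; apply/orP; left; apply/eqP.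
  by field.
have nM : nrm (nsum U M w) <= Num.sqrt v.
  rewrite -ler_sqr ?nnegrE ?nrm_ge0 ?sqrtr_ge0// (sqr_sqrtr v0).
  by have := nsum_sqr_le M0 (ltn0Sn 0); rewrite mulr1 divr1.
apply: le_trans rv; rewrite normrN (ger0_norm (ltW x0)) ger0_norm; last first.
  by rewrite subr_ge0 lef_pV2.
rewrite mulrA ler_pM ?nrm_ge0//.
  by rewrite mulr_ge0 ?(ltW x0)// subr_ge0 lef_pV2.
rewrite (_ : (x^-1 - y^-1) * x = (y - x) / y); last by field; rewrite !gt_eqF.
rewrite ler_pdivrMr//.
have Lxy : y ^+ 2 - x ^+ 2 <= r * x ^+ 2 by rewrite xx yy NE natrD addrAC subrr add0r.
rewrite -(ler_pM2r y0).
apply: (@le_trans _ _ (y ^+ 2 - x ^+ 2)); first by nra.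
apply: le_trans Lxy _; rewrite -mulrA -expr2; apply: ler_wpM2l; first exact: ltW.
by rewrite xx yy ler_nat.
Qed.

End interpolation.

Section subsequence.
Variables (f : T -> R) (B D : R).
Hypotheses (mf : measurable_fun setT f) (fB : forall x, `|f x| <= B).

(** Real part of the quenched characteristic function at frequency one; [sinm] is the imaginary
    part. Other frequencies are obtained by scaling the observable. *)
Definition cosm N w := \int[m]_x cos (nsum f N w x).
Definition sinm N w := \int[m]_x sin (nsum f N w x).

Lemma measurable_cosm N : measurable_fun setT (cosm N) /\ forall w, `|cosm N w| <= 1.
Proof.
have mg : measurable_fun setT (fun p : W * T => cos (nsum f N p.1 p.2)).
  apply: (measurableT_comp (f := @cos R)); first exact: measurable_cosR.
  exact: measurable_nsum2.
have g1 (p : W * T) : `|cos (nsum f N p.1 p.2)| <= 1 by exact: cos_max.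
split; first exact: (measurable_Rint1 P m mg g1).
by move=> w; exact: (Rint_slice_le m mg g1 w).
Qed.

Lemma measurable_sinm N : measurable_fun setT (sinm N) /\ forall w, `|sinm N w| <= 1.
Proof.
have mg : measurable_fun setT (fun p : W * T => sin (nsum f N p.1 p.2)).
  apply: (measurableT_comp (f := @sin R)); first exact: measurable_sinR.
  exact: measurable_nsum2.
have g1 (p : W * T) : `|sin (nsum f N p.1 p.2)| <= 1 by exact: sin_max.
split; first exact: (measurable_Rint1 P m mg g1).
by move=> w; exact: (Rint_slice_le m mg g1 w).
Qed.

Let c := expR (- (D / 2)).
Let X N w := (cosm N w - c) ^+ 2 + sinm N w ^+ 2.

Hypothesis rate : exists2 eta : R, 0 < eta & exists K : R, 0 <= K /\ exists N0, forall N, (N0 <= N)%N ->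
  (0 < N)%N -> \int[P]_w X N w <= K * N%:R `^ (- eta).

(** The power n is chosen with n eta >= 2, so that along N = (j + 1)^n the mean square errors are
    summable. *)
Lemma subsequence_cvg : exists2 n, (0 < n)%N & {ae P, forall w, X (j.+1 ^ n)%N w @[j --> \oo] --> (0 : R)}.
Proof.
have [eta eta0 [K [K0 [N0 hN]]]] := rate.
have [n n0 hn] := div_nat_le (ler0n R 2) eta0; exists n => //.
have n2 : 2 <= n%:R * eta.
  by have := hn n (leqnn n); rewrite ler_pdivrMr ?ltr0n// mulrC.
have iX N : intg P (X N).
  have [m1 b1] := measurable_cosm N; have [m2 b2] := measurable_sinm N.
  apply: intgD; last exact: (sqint_bnd P m2 b2).2.
  exact: (sqintB (sqint_bnd P m1 b1) (@sqint_bnd _ _ _ P _ `|c| (measurable_cst c) (fun=> lexx _))).2.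
have X0 N w : 0 <= X N w by rewrite addr_ge0 ?sqr_ge0.
(* Shifted by [N0], from which on the rate is valid; the shift is removed at the end. *)
pose g j w := X ((j + N0).+1 ^ n)%N w.
have := @ae_nneseries_lty R _ W P (fun j w => (g j w)%:E) (fun j => K * j.+1%:R ^- 2).
case.
- by move=> j; apply/measurable_EFinP; exact: intg_meas (iX _).
- by move=> j w; rewrite lee_fin; exact: X0.
- move=> j; rewrite -EFin_Rint ?lee_fin//; last exact: iX.
  have q0 : (0 < (j + N0).+1 ^ n)%N by rewrite expn_gt0.
  have q1 : (N0 <= (j + N0).+1 ^ n)%N.
    apply: (@leq_trans (j + N0).+1); first by rewrite leqW// leq_addl.
    by rewrite -{1}[_.+1]expn1 leq_pexp2l.
  apply: le_trans (hN _ q1 q0) _; rewrite ler_wpM2l//.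
  rewrite natrX -powR_mulrn// -powRrM.
  apply: (@le_trans _ _ ((j + N0).+1%:R `^ (- 2%:R))).
    by rewrite ler_powR ?ler1n// mulrN lerN2.
  rewrite powRN powR_mulrn// lef_pV2 ?posrE ?exprn_gt0 ?ltr0n//.
  by rewrite lerXn2r ?nnegrE// ler_nat ltnS leq_addr.
- apply: (@le_lt_trans _ _ (2 * K)%:E); last exact: ltry.
  apply: nneseries_le_bound => [i|N]; first by rewrite !mulr_ge0// invr_ge0 exprn_ge0.
  by rewrite -mulr_sumr; have := inv_sqr_sum R N; set u := \sum_(_ < _) _; nra.
move=> A [mA PA sub]; exists A; split=> // w hw; apply: sub => hz; apply: hw.
set Z := (\sum_(i <oo) (g i w)%:E)%E in hz.
have Z0 : (0 <= Z)%E by apply: nneseries_ge0 => i _ _; rewrite lee_fin X0.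
have cs : cvgn (series (fun j => g j w)).
  apply: nondecreasing_is_cvgn.
    by apply/nondecreasing_seqP => k; rewrite /series/= big_nat_recr//= lerDl X0.
  exists (fine Z) => _ [k _ <-]; rewrite -lee_fin fineK ?ge0_fin_numE// /series/= -sumEFin.
  by apply: nneseries_lim_ge => i _ _; rewrite lee_fin X0.
have := cvg_series_cvg_0 cs.
move=> h; change (X (j.+1 ^ n)%N w @[j --> \oo] --> (0 : R)).
by rewrite -(cvg_shiftn N0).
Qed.

End subsequence.

End normalized_sums.

Lemma ae_forall_count d (W : measurableType d) (R : realType) (P : {measure set W -> \bar R})
    (I : countType) (Q : I -> W -> Prop) :
  (forall i, {ae P, forall w, Q i w}) -> {ae P, forall w, forall i, Q i w}.
Proof.
move=> h; have h' (n : nat) : {ae P, forall w, if unpickle n is Some i then Q i w else True}.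
  by case: (unpickle n) => [i|]; [exact: h|exact: aeW].
have := ae_foralln h'; apply: filterS => w hw i.
by have := hw (pickle i); rewrite pickleK.
Qed.

Lemma normc_re_le (R : rcfType) (x y c : R) :
  `|x - c| <= ComplexField.Normc.normc (Complex x y - (c%:C)%C).
Proof.
rewrite /= -sqrtr_sqr ler_wsqrtr// lerDl sqr_ge0//.
Qed.

(** * From annealed limits for pairs to mean square convergence *)

Section annealed_rates.
Context {R : realType} {dW dT : measure_display} {W : measurableType dW} {T : measurableType dT}.
Variables (P : probability W R) (m : probability T R).
Variables (F : W -> nat -> T -> T) (sh : nat -> W -> W) (agree : nat -> W -> W -> Prop).
Hypothesis hD : random_dynamics P m F sh agree.
Local Notation mm := (m \x m)%E.
Local Notation F2 := (fun (w : W) (n : nat) (z : T * T) => (F w n z.1, F w n z.2)).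

Lemma Rint_fst (h : T -> R) (K : R) : measurable_fun setT h -> (forall x, `|h x| <= K) ->
  \int[mm]_z h z.1 = \int[m]_x h x.
Proof.
move=> mh hK; have := Rint_tensor m m mh (measurable_cst (1 : R)) hK (fun _ => lexx `|1 : R|).
by rewrite Rint_cst mulr1 => <-; apply: eq_Rint => z; rewrite mulr1.
Qed.

Lemma Rint_diff_diff (u v : T -> R) (K : R) : measurable_fun setT u -> measurable_fun setT v ->
  (forall x, `|u x| <= K) -> (forall x, `|v x| <= K) -> \int[m]_x u x = 0 ->
  \int[mm]_z ((u z.1 - u z.2) * (v z.1 - v z.2)) = 2 * \int[m]_x (u x * v x).
Proof.
move=> mu mv uK vK u0.
have m1 : measurable_fun setT (fun _ : T => 1 : R) by exact: measurable_cst.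
have b1 (x : T) : `|1 : R| <= 1 by rewrite normr1.
have muv : measurable_fun setT (fun x => u x * v x) by exact: measurable_funM.
have uvK x : `|u x * v x| <= K * K by rewrite normrM ler_pM.
have I (f g : T -> R) (A B : R) : measurable_fun setT f -> measurable_fun setT g ->
    (forall x, `|f x| <= A) -> (forall x, `|g x| <= B) -> intg mm (fun z => f z.1 * g z.2).
  move=> mf mg fA gB; apply: (@intg_prod_bnd _ _ _ _ R m m _ (A * B)).
    by apply: measurable_funM; [exact: measurableT_comp mf measurable_fst|exact: measurableT_comp mg measurable_snd].
  by move=> z; rewrite normrM ler_pM.
have i1 := I _ _ _ _ muv m1 uvK b1; have i2 := I _ _ _ _ mu mv uK vK.
have i3 := I _ _ _ _ mv mu vK uK; have i4 := I _ _ _ _ m1 muv b1 uvK.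
rewrite (eq_Rint mm (g := fun z => ((u z.1 * v z.1) * 1 - u z.1 * v z.2) - (v z.1 * u z.2 - 1 * (u z.2 * v z.2)))); last first.
  by move=> z; ring.
rewrite RintB; [|exact: intgB|exact: intgB]; rewrite RintB// RintB//.
rewrite (Rint_tensor m m muv m1 uvK b1) (Rint_tensor m m mu mv uK vK).
rewrite (Rint_tensor m m mv mu vK uK) (Rint_tensor m m m1 muv b1 uvK) u0 Rint_cst.
by ring.
Qed.

Variables (f : T -> R) (B : R).
Hypotheses (mf : measurable_fun setT f) (fB : forall x, `|f x| <= B).
Hypothesis f0 : \int[m]_x f x = 0.

Let mfF w k : measurable_fun setT (fun x => f (F w k x)).
Proof. exact: measurableT_comp mf (measurable_F hD w k). Qed.

Let f2B x y : `|f x * f y| <= B * B.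
Proof. by rewrite normrM ler_pM. Qed.

Lemma variance_partial_fst n :
  variance_partial P mm F2 (fun z => f z.1) n = variance_partial P m F f n.
Proof.
rewrite /variance_partial; congr (_ + 2 * _).
  apply: (Rint_fst (h := fun x => f x ^+ 2) (K := B * B)); first exact: measurable_funX.
  by move=> x; rewrite expr2.
apply: eq_bigr => k _; apply: eq_Rint => w /=.
by apply: (Rint_fst (h := fun x => f x * f (F w k x)) (K := B * B)) => //; exact: measurable_funM.
Qed.

(** The mixed terms factor into a product of means over x and y and vanish; the two remaining terms
    are equal. *)
Lemma variance_partial_diff n :
  variance_partial P mm F2 (fun z => f z.1 - f z.2) n = 2 * variance_partial P m F f n.
Proof.
rewrite /variance_partial mulrDr; congr (_ + _).
  rewrite -[RHS](Rint_diff_diff mf mf fB fB f0).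
  by apply: eq_Rint => z; rewrite expr2.
rewrite mulrCA; congr (2 * _); rewrite mulr_sumr; apply: eq_bigr => k _.
have [mq bq] := measurable_qcorr_bnd hD k mf mf fB fB.
rewrite /correlation -RintZ; last exact: (intg_bnd P mq bq).
by apply: eq_Rint => w /=; rewrite (Rint_diff_diff mf (mfF w k) fB (fun x => fB _) f0).
Qed.

Lemma asymp_variance_fst : asymp_variance P mm F2 (fun z => f z.1) = asymp_variance P m F f.
Proof. by rewrite /asymp_variance; congr (limn _); apply/funext => n; exact: variance_partial_fst. Qed.

Lemma asymp_variance_diff : cvgn (variance_partial P m F f) ->
  asymp_variance P mm F2 (fun z => f z.1 - f z.2) = 2 * asymp_variance P m F f.
Proof.
move=> cv; rewrite {1}/asymp_variance; apply/cvg_lim; first exact: Rhausdorff.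
rewrite (_ : variance_partial _ _ _ _ = (fun n => 2 * variance_partial P m F f n)).
  by apply: cvgM; [exact: cvg_cst|exact: cv].
by apply/funext => n; exact: variance_partial_diff.
Qed.

Let nsum_bnd_meas N w : measurable_fun setT (nsum F f N w).
Proof. exact: measurableT_comp (measurable_nsum2 hD N mf) (measurable_pair1 w). Qed.

Lemma charfun_fst N : exists y, annealed_charfun P mm F2 (fun z => f z.1) N 1 =
  Complex (\int[P]_w cosm m F f N w) y.
Proof.
eexists; rewrite /annealed_charfun; congr Complex; apply: eq_Rint => w.
transitivity (\int[mm]_z cos (nsum F f N w z.1)).
  by apply: eq_Rint => z; rewrite mul1r mulrC.
apply: (Rint_fst (h := fun x => cos (nsum F f N w x)) (K := 1)).
- apply: (measurableT_comp (f := @cos R)) => //.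
  exact: measurable_cosR.
- by move=> x; exact: cos_max.
Qed.

(** The exponential of the difference of two sums driven by the same word integrates over x and y to
    the squared modulus of the quenched characteristic function. *)
Lemma charfun_diff N : exists y, annealed_charfun P mm F2 (fun z => f z.1 - f z.2) N 1 =
  Complex (\int[P]_w (cosm m F f N w ^+ 2 + sinm m F f N w ^+ 2)) y.
Proof.
eexists; rewrite /annealed_charfun; congr Complex; apply: eq_Rint => w.
have mc : measurable_fun setT (fun x => cos (nsum F f N w x)).
  apply: (measurableT_comp (f := @cos R)) => //.
  exact: measurable_cosR.
have ms : measurable_fun setT (fun x => sin (nsum F f N w x)).
  apply: (measurableT_comp (f := @sin R)) => //.
  exact: measurable_sinR.
have c1 x : `|cos (nsum F f N w x)| <= 1 by exact: cos_max.
have s1 x : `|sin (nsum F f N w x)| <= 1 by exact: sin_max.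
have I (u : T -> R) : measurable_fun setT u -> (forall x, `|u x| <= 1) -> intg mm (fun z => u z.1 * u z.2).
  move=> mu u1; apply: (@intg_prod_bnd _ _ _ _ R m m _ (1 * 1)).
    by apply: measurable_funM; [exact: measurableT_comp mu measurable_fst|exact: measurableT_comp mu measurable_snd].
  by move=> z; rewrite normrM ler_pM.
rewrite /cosm /sinm !expr2 -(Rint_tensor m m mc mc c1 c1) -(Rint_tensor m m ms ms s1 s1).
rewrite -RintD; [|exact: (I _ mc c1)|exact: (I _ ms s1)]; apply: eq_Rint => z.
rewrite -cosB; congr cos; rewrite /nsum -mulrBr mul1r mulrC; congr (_ * _).
by rewrite /birkhoff -sumrB.
Qed.

(** Expand the mean square of phi - c, where c = exp(- D / 2), as the mean of |phi|^2 minus 2 c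
    times the mean of Re phi plus c^2. The function f(x) - f(y) has variance 2 D, so the first mean
    tends to c^2, the second to c, both at a polynomial rate. *)
Lemma annealed_rate : cvgn (variance_partial P m F f) ->
  annealed_CLT_rate P mm F2 (fun z => f z.1) ->
  annealed_CLT_rate P mm F2 (fun z => f z.1 - f z.2) ->
  exists2 eta : R, 0 < eta & exists K : R, 0 <= K /\ exists N0, forall N, (N0 <= N)%N -> (0 < N)%N ->
    \int[P]_w ((cosm m F f N w - expR (- (asymp_variance P m F f / 2))) ^+ 2 + sinm m F f N w ^+ 2)
      <= K * N%:R `^ (- eta).
Proof.
move=> cv [e1 e10 /(_ 1)[K1 [N1 _ h1]]] [e2 e20 /(_ 1)[K2 [N2 _ h2]]].
pose D := asymp_variance P m F f; pose c := expR (- (D / 2)).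
exists (Num.min e1 e2); first by rewrite lt_min e10.
exists (`|K2| + 2 * c * `|K1|); split.
  by rewrite addr_ge0// !mulr_ge0// expR_ge0.
exists (maxn N1 N2) => N; rewrite geq_max => /andP[n1 n2] N0.
have H1 : ComplexField.Normc.normc (annealed_charfun P mm F2 (fun z => f z.1) N 1
    - (expR (- (asymp_variance P mm F2 (fun z => f z.1) * 1 ^+ 2 / 2)))%:C%C) <= K1 * N%:R `^ (- e1).
  exact: h1 N n1.
have H2 : ComplexField.Normc.normc (annealed_charfun P mm F2 (fun z => f z.1 - f z.2) N 1
    - (expR (- (asymp_variance P mm F2 (fun z => f z.1 - f z.2) * 1 ^+ 2 / 2)))%:C%C) <= K2 * N%:R `^ (- e2).
  exact: h2 N n2.
have [y1 E1] := charfun_fst N; have [y2 E2] := charfun_diff N.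
rewrite E1 asymp_variance_fst expr1n mulr1 in H1.
rewrite E2 (asymp_variance_diff cv) expr1n mulr1 in H2.
have {}H1 := le_trans (normc_re_le _ _ _) H1; have {}H2 := le_trans (normc_re_le _ _ _) H2.
rewrite -/D -/c in H1; rewrite -/D (_ : expR (- (2 * D / 2)) = c ^+ 2) in H2; last first.
  by rewrite /c expr2 -expRD; congr expR; field.
have [mc bc] := measurable_cosm hD mf N; have [ms bs] := measurable_sinm hD mf N.
have sc := sqint_bnd P mc bc; have ss := sqint_bnd P ms bs.
have ic := sqint_intg sc.
rewrite (eq_Rint P (g := fun w => (cosm m F f N w ^+ 2 + sinm m F f N w ^+ 2) -
    (2 * c * cosm m F f N w - c ^+ 2))); last by move=> w; rewrite -/D -/c; ring.
have icc : intg P (fun w => 2 * c * cosm m F f N w - c ^+ 2).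
  by apply: intgB; [exact: intgZ|exact: intg_cst].
rewrite RintB//; last by apply: intgD; [exact: sc.2|exact: ss.2].
rewrite RintB; [|exact: intgZ|exact: intg_cst].
rewrite RintZ// Rint_cst.
have pw K e : Num.min e1 e2 <= e -> K * N%:R `^ (- e) <= `|K| * N%:R `^ (- Num.min e1 e2).
  move=> me; apply: (@le_trans _ _ (`|K| * N%:R `^ (- e))).
    by rewrite ler_wpM2r ?powR_ge0// ler_norm.
  by rewrite ler_wpM2l// ler_powR ?ler1n// lerN2.
have {}H1 := le_trans H1 (pw K1 e1 _); have {}H2 := le_trans H2 (pw K2 e2 _).
move: H1 H2; rewrite !ge_min !lexx orbT => /(_ isT) + /(_ isT).
rewrite !ler_norml => /andP[a1 a2] /andP[b1 b2].
have c0 : 0 <= 2 * c by rewrite mulr_ge0// expR_ge0.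
have := ler_wpM2l c0 a1.
by move: (N%:R `^ _) (\int[P]_w _) (\int[P]_w _) a1 a2 b1 b2 => q x y a1 a2 b1 b2; nra.
Qed.

End annealed_rates.

(** * Quenched characteristic functions *)

Lemma dist3 (R : realType) (x y z u e : R) : `|x - y| <= e / 3 -> `|y - z| <= e / 3 ->
  `|z - u| <= e / 3 -> `|x - u| <= e.
Proof.
rewrite !ler_norml => /andP[? ?] /andP[? ?] /andP[? ?]; apply/andP; split; lra.
Qed.

Section quenched_limit.
Context {R : realType} {dW dT : measure_display} {W : measurableType dW} {T : measurableType dT}.
Variables (P : probability W R) (m : probability T R).
Variables (F : W -> nat -> T -> T) (sh : nat -> W -> W) (agree : nat -> W -> W -> Prop).
Hypothesis hD : random_dynamics P m F sh agree.
Variable fam : nat -> seq (T -> R).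
Hypothesis hF : mixing_family P m F fam.
Variables (a p : nat) (t : R).
Hypotheses (t0 : 0 < t) (at4 : 4 <= a%:R * t).
Local Notation g k := (total_corr m F fam a p k).
Local Notation nrm := (nrm m).
Local Notation qcorr := (qcorr m F).
Local Notation asv := (asymp_variance P m F).
Local Notation vp := (variance_partial P m F).
Local Notation span_approx := (span_approx m fam p t).

Definition corr_bounded (K : R) (U : T -> R) :=
  forall w k, (0 < k)%N -> `|qcorr w k U U| <= K * (g k w + k%:R ^- 2).

Definition avg_bounded (c : R) (w : W) := forall N k, (0 < N)%N -> (0 < k)%N ->
  \sum_(n < N) g k (sh n w) <= c * N%:R * k%:R ^- 2.

Lemma subsequence_full f (D K c : R) w n : sqint m f -> 0 <= K -> 0 <= c -> corr_bounded K f ->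
  avg_bounded c w -> (0 < n)%N ->
  ((cosm m F f (j.+1 ^ n)%N w - expR (- (D / 2))) ^+ 2 + sinm m F f (j.+1 ^ n)%N w ^+ 2)
    @[j --> \oo] --> (0 : R) ->
  cosm m F f N w @[N --> \oo] --> expR (- (D / 2)) /\ sinm m F f N w @[N --> \oo] --> (0 : R).
Proof.
move=> sf K0 c0 hU hw n0 /cvg_epsP hX.
suff H (e : R) : 0 < e -> exists N0, forall N, (N0 <= N)%N ->
    `|cosm m F f N w - expR (- (D / 2))| <= e /\ `|sinm m F f N w - 0| <= e.
  by split; apply/cvg_epsP => e /H[N0 h]; exists N0 => N /h[].
move=> e0; have e2 : 0 < e / 2 by rewrite divr_gt0.
have [j0 h0] := nsum_interpolation hD sf K0 c0 hU hw n0 e2.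
have [j1 h1] := hX _ (exprn_gt0 2 e2).
exists ((maxn j0 j1).+2 ^ n)%N => N hN.
have N0 : (0 < N)%N by apply: leq_trans hN; rewrite expn_gt0.
have [j /andP[jN Nj]] := block_index n0 N0.
have jj : (maxn j0 j1 <= j)%N.
  by have := leq_ltn_trans hN Nj; rewrite ltn_exp2r// ltnS => /ltnW.
move: jj; rewrite geq_max => /andP[jj0 jj1].
have d := h0 j N jj0; rewrite jN (ltnW Nj) in d; have {}d := d isT.
have X := h1 j jj1; rewrite subr0 ger0_norm ?addr_ge0 ?sqr_ge0// in X.
have sN k : sqint m (nsum F f k w) by exact: (sqint_nsum hD).
have dc : `|cosm m F f N w - cosm m F f (j.+1 ^ n)%N w| <= e / 2.
  apply: le_trans d; apply: (Rint_lipschitz_le (f := @cos R)) => //.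
  - exact: measurable_cosR.
  - by move=> x; exact: cos_max.
  - exact: cos_lipschitz.
have ds : `|sinm m F f N w - sinm m F f (j.+1 ^ n)%N w| <= e / 2.
  apply: le_trans d; apply: (Rint_lipschitz_le (f := @sin R)) => //.
  - exact: measurable_sinR.
  - by move=> x; exact: sin_max.
  - exact: sin_lipschitz.
have small (y z : R) : y ^+ 2 + z ^+ 2 <= (e / 2) ^+ 2 -> `|y| <= e / 2.
  move=> h; rewrite -ler_sqr ?nnegrE ?(ltW e2)// real_normK ?num_real//.
  by apply: le_trans h; rewrite lerDl sqr_ge0.
have xc := small _ _ X; have xs : `|sinm m F f (j.+1 ^ n)%N w| <= e / 2.
  by apply: small; rewrite addrC; exact: X.
rewrite (_ : e = e / 2 + e / 2); last by field.
split.
  rewrite -(subrKA (cosm m F f (j.+1 ^ n)%N w)); apply: le_trans (ler_normD _ _) _.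
  by rewrite lerD.
rewrite subr0 -(subrK (sinm m F f (j.+1 ^ n)%N w) (sinm m F f N w)).
by apply: le_trans (ler_normD _ _) _; rewrite lerD.
Qed.

Lemma comb_mean0 n c : \int[m]_x comb (fam n) c x = 0.
Proof.
have [B B0 hB] := mf_bound hF.
have ie (i : 'I_(size (fam n))) : intg m (fun x => nth 0 c i * nth (fun=> 0) (fam n) i x).
  have [h1 h2] := hB n _ (mem_nth (fun=> 0) (ltn_ord i)).
  by apply: intgZ; exact: (intg_bnd m h1 h2).
rewrite (eq_Rint m (g := fun x => \sum_(i < size (fam n)) nth 0 c i * nth (fun=> 0) (fam n) i x)); last first.
  by move=> x; exact: comb_nth.
rewrite Rint_sum// big1// => i _; have [h1 h2] := hB n _ (mem_nth (fun=> 0) (ltn_ord i)).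
rewrite RintZ ?(mf_mean hF (mem_nth (fun=> 0) (ltn_ord i))) ?mulr0//.
exact: (intg_bnd m h1 h2).
Qed.

Lemma comb_level n n' c : (n <= n')%N -> size c = size (fam n) ->
  comb (fam n') c =1 comb (fam n) c.
Proof.
by move=> nn cs x; have [s ->] := mf_prefix hF nn; rewrite comb_prefix// cs.
Qed.

Lemma powRN_le (n n' : nat) : (0 < n)%N -> (n <= n')%N -> n'%:R `^ (- t) <= n%:R `^ (- t) :> R.
Proof.
move=> n0 nn; rewrite !powRN lef_pV2 ?posrE ?powR_gt0 ?ltr0n ?(leq_trans n0)//.
by rewrite ge0_ler_powR ?nnegrE ?(ltW t0)// ler_nat.
Qed.

(** From level n on the combination represents itself exactly. Below it the zero combination serves,
    and n^t in the constant compensates for the demanded rate. *)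
Lemma span_comb n c : (0 < n)%N -> size c = size (fam n) -> exists2 K : R, 0 <= K &
  span_approx K (comb (fam n) c).
Proof.
move=> n0 cs; have [B B0 [mc bc]] := comb_bnd hF n c.
pose I := \int[m]_x (comb (fam n) c x ^+ 2).
have I0 : 0 <= I by apply: Rint_ge0 => x; rewrite sqr_ge0.
exists (\sum_(x <- c) `|x| + I * n%:R `^ t) => [|k k0].
  by rewrite addr_ge0 ?sumr_ge0// mulr_ge0 ?powR_ge0.
have nt : n%:R `^ t * n%:R `^ (- t) = 1 :> R.
  by rewrite powRN divff// gt_eqF// powR_gt0// ltr0n.
have [nk|kn] := leqP n k.
  exists c, [::]; split=> //.
    move=> x xc; apply: (@le_trans _ _ (\sum_(y <- c) `|y|)).
      by rewrite (big_rem x)//= lerDl sumr_ge0.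
    apply: (@le_trans _ _ ((\sum_(x <- c) `|x| + I * n%:R `^ t) * 1)).
      by rewrite mulr1 lerDl mulr_ge0 ?powR_ge0.
    by rewrite ler_wpM2l ?addr_ge0 ?sumr_ge0// ?mulr_ge0 ?powR_ge0// exprn_ege1// ler1n.
  rewrite (eq_Rint m (g := fun=> 0)); last first.
    by move=> x; rewrite (comb_level nk cs) comb_nil subr0 subrr expr0n.
  by rewrite Rint0 mulr_ge0 ?powR_ge0// addr_ge0 ?sumr_ge0// mulr_ge0 ?powR_ge0.
exists [::], [::]; split=> //.
rewrite (eq_Rint m (g := fun x => comb (fam n) c x ^+ 2)); last first.
  by move=> x; rewrite !comb_nil !subr0.
rewrite -/I mulrDl; apply: ler_wpDl; first by rewrite mulr_ge0 ?powR_ge0// sumr_ge0.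
apply: (@le_trans _ _ (I * n%:R `^ t * n%:R `^ (- t))); first by rewrite -mulrA nt mulr1.
apply: ler_wpM2l; first by rewrite mulr_ge0 ?powR_ge0.
by apply: powRN_le => //; exact: ltnW.
Qed.

(** Rounding each coefficient by at most [d] moves the combination by at most d times the number of
    atoms times their bound, which is kept below n^(-t). Only countably many combinations remain. *)
Lemma rational_approx A : sqint m A -> approx_rate m fam p t A -> exists2 K : R, 0 <= K &
  forall n, (0 < n)%N -> exists q : seq rat, [/\ size q = size (fam n),
    (forall x, x \in [seq ratr y | y <- q] -> `|x| <= K * n%:R ^+ p :> R) &
    \int[m]_x ((A x - comb (fam n) [seq ratr y | y <- q] x) ^+ 2) <= K * n%:R `^ (- t)].
Proof.
move=> sA [K K0 hK]; have [B B0 hB] := mf_bound hF.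
exists (2 * K + 2) => [|n n0]; first by rewrite addr_ge0// mulr_ge0.
have [c [cs ck hc]] := hK n n0.
have n1 : 1 <= n%:R :> R by rewrite ler1n.
have nt1 : n%:R `^ (- t) <= 1 :> R.
  by rewrite -[leRHS](powRr0 (n%:R : R)) ler_powR// lerNl oppr0 ltW.
have nt0 : 0 < n%:R `^ (- t) :> R by rewrite powR_gt0// ltr0n.
pose S : R := (size (fam n))%:R * B.
have S0 : 0 <= S by rewrite mulr_ge0.
pose d := n%:R `^ (- t) / (S + 1).
have S1 : 0 < S + 1 by rewrite ltr_wpDl.
have d0 : 0 < d by rewrite divr_gt0.
have dS : d * S <= n%:R `^ (- t).
  have : d * (S + 1) = n%:R `^ (- t) by rewrite /d divfK ?gt_eqF.
  by rewrite mulrDr mulr1 => <-; rewrite lerDl ltW.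
have d1 : d <= 1.
  by rewrite /d ler_pdivrMr// mul1r (le_trans nt1)// lerDr.
have /choice[r hr] (x : R) : exists y : rat, `|x - ratr y| <= d.
  have [y] := rat_in_itvoo (ltr_pwDr d0 (lexx x)); rewrite in_itv/= => /andP[h1 h2].
  by exists y; rewrite ler_norml; apply/andP; split; lra.
pose q := [seq r x | x <- c]; exists q; split.
- by rewrite size_map.
- move=> x; rewrite -map_comp => /mapP[y yc ->] /=.
  rewrite -[ratr _](subrK y); apply: le_trans (ler_normD _ _) _.
  have := ck y yc; have := hr y; rewrite distrC => h1 h2.
  have : 1 <= n%:R ^+ p :> R by rewrite exprn_ege1.
  have := mulr_ge0 K0 (exprn_ge0 p (ler0n R n)); nra.
pose V x := A x - comb (fam n) c x.
pose E x := comb (fam n) c x - comb (fam n) [seq ratr y | y <- q] x.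
have [B1 _ [m1 b1]] := comb_bnd hF n c; have [B2 _ [m2 b2]] := comb_bnd hF n [seq ratr y | y <- q].
have sc := sqint_bnd m m1 b1; have sq := sqint_bnd m m2 b2.
have sV : sqint m V by exact: sqintB.
have sE : sqint m E by exact: sqintB.
have Eb x : `|E x| <= n%:R `^ (- t).
  apply: le_trans dS; rewrite /E !comb_nth -sumrB; apply: le_trans (ler_norm_sum _ _ _) _.
  rewrite /S mulrCA -[leRHS]/(_ * (d * B)).
  rewrite (_ : (size (fam n))%:R * (d * B) = \sum_(i < size (fam n)) d * B); last first.
    by rewrite sumr_const card_ord mulr_natl.
  apply: ler_sum => i _; rewrite -mulrBl normrM ler_pM//; last first.
    by have [_ h] := hB n _ (mem_nth (fun=> 0) (ltn_ord i)); exact: h.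
  by rewrite /q -map_comp (nth_map 0) ?cs//; exact: hr.
rewrite (eq_Rint m (g := fun x => (V x + E x) ^+ 2)); last by move=> x; rewrite /V /E addrA subrK.
apply: le_trans (Rint_sqrD sV sE) _.
rewrite [leRHS](_ : _ = 2 * (K * n%:R `^ (- t)) + 2 * n%:R `^ (- t)); last by ring.
apply: lerD; first by rewrite ler_wpM2l.
rewrite ler_wpM2l// -[leRHS](Rint_cst m); apply: Rint_le => [||x]; [exact: sE.2|exact: intg_cst|].
have := Eb x; rewrite ler_norml => /andP[h1 h2].
by move: (n%:R `^ _) nt0 nt1 h1 h2 => y y0 y1 h1 h2; nra.
Qed.

Lemma powRN_small (e : R) : 0 < e -> exists n0, forall n, (n0 <= n)%N -> (0 < n)%N -> n%:R `^ (- t) <= e.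
Proof.
move=> e0; exists (Num.bound ((e^-1) `^ (t^-1))) => n nb n0.
have np : 0 < n%:R `^ t :> R by rewrite powR_gt0// ltr0n.
rewrite powRN -[e]invrK lef_pV2 ?posrE ?invr_gt0//.
have -> : e^-1 = ((e^-1) `^ (t^-1)) `^ t.
  by rewrite -powRrM mulVf ?gt_eqF// powRr1// invr_ge0 ltW.
rewrite ge0_ler_powR ?nnegrE ?powR_ge0 ?(ltW t0)//.
apply: le_trans (ltW (archi_boundP _)) _; first exact: powR_ge0.
by rewrite ler_nat.
Qed.

Lemma variance_partial_sub A f n : sqint m A -> sqint m f ->
  (forall k, measurable_fun setT (fun w => qcorr w k A A)) ->
  (forall k, measurable_fun setT (fun w => qcorr w k f f)) ->
  `|vp A n - vp f n| <= nrm (fun x => A x - f x) * (nrm A + nrm f) * (1 + 2 * n%:R).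
Proof.
move=> sA sf mA mf; set q := _ * (nrm A + nrm f).
have sE := sqintB sA sf; have sS := sqintD sA sf.
have iq U k : sqint m U -> measurable_fun setT (fun w => qcorr w k U U) -> intg P (fun w => qcorr w k U U).
  by move=> sU mU; apply: (@intg_bnd _ _ _ P _ (nrm U * nrm U)) => // w; exact: (qcorr_le hD).
have h1 : `|\int[m]_x (A x ^+ 2) - \int[m]_x (f x ^+ 2)| <= q.
  rewrite -RintB; [|exact: sA.2|exact: sf.2].
  rewrite (eq_Rint m (g := fun x => (A x - f x) * (A x + f x))); last by move=> x; ring.
  apply: le_trans (Rint_mul_le_nrm sE sS) _; rewrite ler_wpM2l ?nrm_ge0//.
  exact: nrmD.
have h2 k : `|correlation P m F A A k - correlation P m F f f k| <= q.
  rewrite /correlation -RintB; [|exact: (iq A)|exact: (iq f)].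
  apply: Rint_bnd; first by apply: measurable_funB; [exact: mA|exact: mf].
  by move=> w; exact: (qcorr_diag_sub hD).
rewrite /variance_partial opprD addrACA -mulrBr -sumrB mulrDr mulr1.
apply: le_trans (ler_normD _ _) _; rewrite lerD// normrM ger0_norm//.
rewrite mulrCA ler_wpM2l//; apply: le_trans (ler_norm_sum _ _ _) _.
apply: (@le_trans _ _ (\sum_(1 <= k < n.+1) q)).
  by apply: ler_sum => k _; exact: h2.
by rewrite sumr_const_nat subSS subn0 mulr_natr.
Qed.

Hypothesis clt : forall n c, (0 < n)%N -> size c = size (fam n) ->
  annealed_CLT_rate P (m \x m)%E (fun w k z => (F w k z.1, F w k z.2)) (fun z => comb (fam n) c z.1) /\
  annealed_CLT_rate P (m \x m)%E (fun w k z => (F w k z.1, F w k z.2))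
    (fun z => comb (fam n) c z.1 - comb (fam n) c z.2).

(** The bound [b] on the averages is quantified after the word, so it may be random without
    enlarging the null set. *)
Lemma comb_quenched n c : (0 < n)%N -> size c = size (fam n) ->
  {ae P, forall w, forall b, 0 <= b -> avg_bounded b w ->
    cosm m F (comb (fam n) c) N w @[N --> \oo] --> expR (- (asv (comb (fam n) c) / 2)) /\
    sinm m F (comb (fam n) c) N w @[N --> \oo] --> (0 : R)}.
Proof.
move=> n0 cs; have [B B0 [mc bc]] := comb_bnd hF n c; have sc := sqint_bnd m mc bc.
have [K K0 hK] := span_comb n0 cs.
have hU := qcorr_span_bound hD hF at4 sc K0 hK (lexx _).
set K' := _ + _ in hU.
have K'0 : 0 <= K'.
  by rewrite addr_ge0 ?mulr_ge0 ?sqr_ge0 ?sqrtr_ge0// addr_ge0 ?sqrtr_ge0// mulr_ge0// nrm_ge0.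
have mq k := measurable_qcorr_span hD hF at4 k sc K0 hK.
have [C _ hC] := asymp_variance_tail hD hF a p.
have [cv _] := hC _ K' sc K'0 mq hU.
have [c1 c2] := clt n0 cs.
have rate := annealed_rate hD mc bc (comb_mean0 n c) cv c1 c2.
have [k k0] := subsequence_cvg hD mc rate.
apply: filterS => w hX b b0 hb.
exact: subsequence_full sc K'0 b0 hU hb k0 hX.
Qed.

(** Two full-measure events suffice: limits for all rational combinations, and a bound on the
    averaged correlations. On them the argument is deterministic, by approximation of [A]. *)
Theorem quenched_charfun : {ae P, forall w, forall A, sqint m A -> approx_rate m fam p t A ->
  [/\ cvgn (vp A), cosm m F A N w @[N --> \oo] --> expR (- (asv A / 2)),
      sinm m F A N w @[N --> \oo] --> (0 : R) &
      exists v : R, forall N, (0 < N)%N -> \int[m]_x (nsum F A N w x ^+ 2) <= v]}.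
Proof.
have good : {ae P, forall w, forall i : nat * seq rat, (0 < i.1)%N -> size i.2 = size (fam i.1) ->
    forall b, 0 <= b -> avg_bounded b w ->
    let f := comb (fam i.1) [seq ratr y | y <- i.2] in
    cosm m F f N w @[N --> \oo] --> expR (- (asv f / 2)) /\
    sinm m F f N w @[N --> \oo] --> (0 : R)}.
  apply: ae_forall_count => -[n q] /=.
  have [n0|n0] := posnP n; first by apply: aeW => w; rewrite n0.
  have [qs|qs] := eqVneq (size q) (size (fam n)); last first.
    by apply: aeW => w _ h; rewrite h eqxx in qs.
  have := @comb_quenched n [seq ratr y | y <- q] n0 _; rewrite size_map => /(_ qs).
  by apply: filterS => w h _ _; exact: h.
have := avg_total_corr hD hF a p; move: good; apply: filterS2 => w good [b b0 hb] A sA hA.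
have [K K0 hK] := rational_approx sA hA.
have /choice[q hq] (j : nat) := hK j.+1 isT.
pose c j : seq R := [seq ratr y | y <- q j].
pose f j := comb (fam j.+1) (c j).
have cs j : size (c j) = size (fam j.+1) by have [h _ _] := hq j; rewrite size_map.
have cK j x : x \in c j -> `|x| <= K * j.+1%:R ^+ p by have [_ h _] := hq j; exact: h.
have EK j : \int[m]_x ((A x - f j x) ^+ 2) <= K * j.+1%:R `^ (- t) by have [_ _ h] := hq j.
have sf j : sqint m (f j) by have [B _ [m1 b1]] := comb_bnd hF j.+1 (c j); exact: sqint_bnd m1 b1.
have sE j : sqint m (fun x => A x - f j x) := sqintB sA (sf j).
(* The constant 4 K suits A, all approximants f_j and all differences A - f_j. For f_j at a level
   below its own, the approximant of that level is used, and the squared error of a difference of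
   two errors costs the factor 4. *)
have K40 : 0 <= 4 * K by rewrite mulr_ge0.
have le4 (x : R) : 0 <= x -> K * x <= 4 * K * x.
  by move=> x0; rewrite ler_wpM2r//; lra.
have cK4 j k x : (j < k)%N -> x \in c j -> `|x| <= 4 * K * k%:R ^+ p.
  move=> jk /cK h; apply: le_trans h _; apply: (@le_trans _ _ (K * k%:R ^+ p)).
    by rewrite ler_wpM2l// lerXn2r ?nnegrE// ler_nat.
  by rewrite le4// exprn_ge0.
have lev j k : (j < k)%N -> comb (fam k) (c j) =1 f j by move=> jk; exact: comb_level.
have spanA : span_approx (4 * K) A.
  case=> // k _; exists (c k), [::]; split=> //; first by move=> x; exact: cK4.
  rewrite (eq_Rint m (g := fun x => (A x - f k x) ^+ 2)); last by move=> x; rewrite comb_nil subr0.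
  by apply: le_trans (EK k) _; rewrite le4 ?powR_ge0.
have spanf j : span_approx (4 * K) (f j).
  case=> // k _; have [jk|kj] := leqP j k.
    exists (c j), [::]; split=> //; first by move=> x; exact: cK4.
    rewrite (eq_Rint m (g := fun=> 0)) ?Rint0 ?mulr_ge0 ?powR_ge0// => x.
    by rewrite comb_nil lev// subr0 subrr expr0n.
  exists (c k), [::]; split=> //; first by move=> x; exact: cK4.
  rewrite (eq_Rint m (g := fun x => (- (A x - f j x) + (A x - f k x)) ^+ 2)); last first.
    by move=> x; rewrite comb_nil -/(f k); congr (_ ^+ 2); rewrite /f; ring.
  apply: le_trans (Rint_sqrD (sqintN (sE j)) (sE k)) _.
  have -> : \int[m]_x ((- (A x - f j x)) ^+ 2) = \int[m]_x ((A x - f j x) ^+ 2).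
    by apply: eq_Rint => x; rewrite sqrrN.
  have := EK j; have := EK k; have := ler_wpM2l K0 (@powRN_le k.+1 j.+1 isT (ltnW kj)).
  by move: (\int[m]_x _) (\int[m]_x _) => x y; lra.
have spanE j : span_approx (4 * K) (fun x => A x - f j x).
  case=> // k _; have [jk|kj] := leqP j k.
    exists (c k), (c j); split; [by move=> x; exact: cK4|by move=> x; exact: cK4|].
    rewrite (eq_Rint m (g := fun x => (A x - f k x) ^+ 2)); last first.
      by move=> x; rewrite !lev//; ring.
    by apply: le_trans (EK k) _; rewrite le4 ?powR_ge0.
  exists [::], [::]; split=> //.
  rewrite (eq_Rint m (g := fun x => (A x - f j x) ^+ 2)); last by move=> x; rewrite !comb_nil !subr0.
  apply: le_trans (EK j) _; apply: le_trans (le4 _ (powR_ge0 _ _)) _.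
  by rewrite ler_wpM2l// powRN_le// ltnW.
pose L := nrm A + Num.sqrt K.
have sK := sqrtr_ge0 K.
have nE j : nrm (fun x => A x - f j x) <= Num.sqrt (K * j.+1%:R `^ (- t)).
  by rewrite /nrm ler_wsqrtr.
have nt1 j : j.+1%:R `^ (- t) <= 1 :> R.
  by rewrite -[leRHS](powRr0 (j.+1%:R : R)) ler_powR ?ler1n// lerNl oppr0 ltW.
have nEK j : nrm (fun x => A x - f j x) <= Num.sqrt K.
  by apply: le_trans (nE j) _; rewrite ler_wsqrtr// ler_piMr.
have AL : nrm A <= L by rewrite lerDl.
have EL j : nrm (fun x => A x - f j x) <= L by apply: le_trans (nEK j) _; rewrite lerDr nrm_ge0.
have fL j : nrm (f j) <= L.
  have -> : f j = (fun x => A x + - (A x - f j x)) by apply/funext => x; ring.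
  by apply: le_trans (nrmD sA (sqintN (sE j))) _; rewrite (nrmN m) lerD2l.
have L0 : 0 <= L by rewrite addr_ge0 ?nrm_ge0.
(* Independent of j: this is what makes the estimates below uniform along the sequence. *)
pose K' := 4 * (4 * K) ^+ 2 + Num.sqrt (4 * K) * (2 * L + Num.sqrt (4 * K)).
have K'0 : 0 <= K'.
  by rewrite addr_ge0 ?mulr_ge0 ?sqr_ge0 ?sqrtr_ge0// addr_ge0 ?sqrtr_ge0// mulr_ge0.
have hUA : corr_bounded K' A := qcorr_span_bound hD hF at4 sA K40 spanA AL.
have hUf j : corr_bounded K' (f j) := qcorr_span_bound hD hF at4 (sf j) K40 (spanf j) (fL j).
have hUE j : corr_bounded K' (fun x => A x - f j x) :=
  qcorr_span_bound hD hF at4 (sE j) K40 (spanE j) (EL j).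
have mqA k := measurable_qcorr_span hD hF at4 k sA K40 spanA.
have mqf j k := measurable_qcorr_span hD hF at4 k (sf j) K40 (spanf j).
have [C C0 hC] := asymp_variance_tail hD hF a p.
have [cvA tA] := hC _ K' sA K'0 mqA hUA.
have Esmall (e : R) : 0 < e -> exists j0, forall j, (j0 <= j)%N -> nrm (fun x => A x - f j x) <= e.
  move=> e0; have K1 : 0 < K + 1 by rewrite ltr_wpDl.
  have [n0 hn] := powRN_small (divr_gt0 (exprn_gt0 2 e0) K1).
  exists n0 => j jn; apply: le_trans (nE j) _.
  rewrite -(ger0_norm (ltW e0)) -sqrtr_sqr ler_wsqrtr//.
  have := hn j.+1 (leqW jn) isT; rewrite ler_pdivlMr// => h.
  by apply: le_trans h; rewrite mulrC ler_wpM2l ?powR_ge0// lerDl.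
(* Truncate both series at one time k with uniformly small tails; finitely many correlations then
   converge with the L^2 norm. *)
have Dcvg : asv (f j) @[j --> \oo] --> asv A.
  apply/cvg_epsP => e e0; have e4 : 0 < e / 3 by rewrite divr_gt0.
  have [k k0 hk] := div_nat_le (mulr_ge0 K'0 C0) e4.
  pose s := 2 * L * (1 + 2 * k%:R) + 1.
  have s0 : 0 < s by rewrite ltr_wpDl// mulr_ge0// ?mulr_ge0// addr_ge0// mulr_ge0.
  have [j0 hj] := Esmall _ (divr_gt0 e4 s0); exists j0 => j jj.
  have [_ tf] := hC _ K' (sf j) K'0 (mqf j) (hUf j).
  have h1 := le_trans (tA k k0) (hk k (leqnn k)).
  have h2 := le_trans (tf k k0) (hk k (leqnn k)).
  have h3 := variance_partial_sub k sA (sf j) mqA (mqf j).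
  have h4 : nrm (fun x => A x - f j x) * (nrm A + nrm (f j)) * (1 + 2 * k%:R) <= e / 3.
    have := hj j jj; rewrite ler_pdivlMr// => h; apply: le_trans h; rewrite -mulrA ler_wpM2l ?nrm_ge0//.
    apply: (@le_trans _ _ (2 * L * (1 + 2 * k%:R))); last by rewrite lerDl.
    rewrite ler_wpM2r ?addr_ge0 ?mulr_ge0//; by rewrite mulr_natl; exact: lerD AL (fL j).
  rewrite distrC in h1; rewrite distrC; apply: dist3 (le_trans h3 h4) _; first by rewrite distrC.
  by rewrite distrC.
have ecvg : expR (- (asv (f j) / 2)) @[j --> \oo] --> expR (- (asv A / 2)).
  apply: (@cvg_comp _ _ _ (fun j => - (asv (f j) / 2)) (@expR R)); last exact: continuous_expR.
  by apply: cvgN; apply: cvgM => //; exact: cvg_cst.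
(* The cut k bounds the late correlations of A - f_j by the common constant; only then is j taken
   large, to make (1 + 2 k) times the squared norm small. The result is uniform in N. *)
have Nsmall (e : R) : 0 < e -> exists j0, forall j, (j0 <= j)%N -> forall N, (0 < N)%N ->
    nrm (fun x => nsum F A N w x - nsum F (f j) N w x) <= e.
  move=> e0; have e2 : 0 < e ^+ 2 / 2 by rewrite divr_gt0// exprn_gt0.
  have [k k0 hk] := div_nat_le (b := 2 * K' * (b + 1)) (mulr_ge0 (mulr_ge0 (ler0n R 2) K'0) (addr_ge0 b0 ler01)) e2.
  have k2 : 0 < 1 + 2 * k%:R :> R by rewrite ltr_wpDr// mulr_ge0.
  have q0 : 0 < Num.sqrt (e ^+ 2 / 2 / (1 + 2 * k%:R)) by rewrite sqrtr_gt0 divr_gt0.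
  have [j0 hj] := Esmall _ q0.
  exists j0 => j jj N N0.
  rewrite (_ : (fun x => _) = nsum F (fun x => A x - f j x) N w); last first.
    by apply/funext => x; rewrite /nsum -mulrBr /birkhoff -sumrB.
  rewrite -ler_sqr ?nnegrE ?nrm_ge0 ?(ltW e0)//.
  apply: le_trans (nsum_sqr_le hD (sE j) K'0 b0 (hUE j) hb N0 k0) _.
  rewrite (_ : e ^+ 2 = e ^+ 2 / 2 + e ^+ 2 / 2); last by field.
  apply: lerD; last exact: hk.
  have qq : 0 <= e ^+ 2 / 2 / (1 + 2 * k%:R) by rewrite divr_ge0 ?(ltW e2)// (ltW k2).
  have : nrm (fun x => A x - f j x) ^+ 2 <= e ^+ 2 / 2 / (1 + 2 * k%:R).
    by rewrite -[leRHS](sqr_sqrtr qq) ler_sqr ?nnegrE ?nrm_ge0 ?sqrtr_ge0//; exact: hj.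
  by rewrite ler_pdivlMr// mulrC.
have trans (h : R -> R) (l : nat -> R) (l0 : R) : measurable_fun setT h -> (forall x, `|h x| <= 1) ->
    (forall x y, `|h x - h y| <= `|x - y|) -> l j @[j --> \oo] --> l0 ->
    (forall j, \int[m]_x h (nsum F (f j) N w x) @[N --> \oo] --> l j) ->
    \int[m]_x h (nsum F A N w x) @[N --> \oo] --> l0.
  move=> mh h1 hl cl e; apply/cvg_epsP => d d0.
  have d3 : 0 < d / 3 by rewrite divr_gt0.
  have [j1 hj1] := (cvg_epsP _ _).1 cl _ d3; have [j2 hj2] := Nsmall _ d3.
  pose j := maxn j1 j2.
  have [N0 hN] := (cvg_epsP _ _).1 (e j) _ d3.
  exists (maxn N0 1) => N; rewrite geq_max => /andP[NN N1].
  apply: dist3 (hN N NN) (hj1 j (leq_maxl _ _)).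
  exact: le_trans (Rint_lipschitz_le mh h1 hl (sqint_nsum hD N w sA) (sqint_nsum hD N w (sf j)))
    (hj2 j (leq_maxr _ _) N N1).
have sq j : size (q j) = size (fam j.+1) by have [] := hq j.
have gf j := good (j.+1, q j) isT (sq j) b b0 hb.
split=> //.
- apply: (trans (@cos R) _ _ _ _ _ ecvg).
  + exact: measurable_cosR.
  + by move=> x; exact: cos_max.
  + exact: cos_lipschitz.
  + by move=> j; have [] := gf j.
- apply: (trans (@sin R) (fun=> 0)).
  + exact: measurable_sinR.
  + by move=> x; exact: sin_max.
  + exact: sin_lipschitz.
  + exact: cvg_cst.
  + by move=> j; have [] := gf j.
- exists ((1 + 2 * 1%:R) * nrm A ^+ 2 + 2 * K' * (b + 1) / 1%:R) => N N0.
  by rewrite -nrm_sqr; exact: (nsum_sqr_le hD sA K'0 b0 hUA hb N0 (ltn0Sn 0)).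
Qed.

End quenched_limit.

(** * Levy's continuity theorem *)

Section levy_continuity.
Context (R : realType).
Local Notation mu1 := (@lebesgue_measure R).
Local Notation npdf := (normal_pdf (0 : R)).

Let mcos := @measurable_cosR R.
Let msin := @measurable_sinR R.

Let cos1 (x : R) : `|cos x| <= 1. Proof. by exact: cos_max. Qed.

Let sin1 (x : R) : `|sin x| <= 1. Proof. by exact: sin_max. Qed.

(** Characteristic function of the centred normal law of deviation [s]. It is also, up to a
    constant, the normal density of deviation 1 / s, and the proof plays these two roles against
    each other. *)
Definition gker (s r : R) : R := expR (- (s ^+ 2 / 2) * r ^+ 2).

Lemma gker_norm_le (s r : R) : `|gker s r| <= 1.
Proof.
rewrite ger0_norm ?expR_ge0// -expR0 ler_expR mulNr oppr_le0.
by rewrite mulr_ge0 ?sqr_ge0// divr_ge0 ?sqr_ge0.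
Qed.

Lemma measurable_gker (s : R) : measurable_fun setT (gker s).
Proof.
by apply: measurableT_comp => //; apply: measurable_funM => //; exact: measurable_funX.
Qed.

Lemma npdf_gker (s r : R) : 0 < s -> npdf s r = normal_peak s * gker s^-1 r.
Proof.
move=> s0; rewrite normal_pdf0E ?gt_eqF// /gker.
by rewrite (_ : (s ^+ 2 *+ 2)^-1 = s^-1 ^+ 2 / 2)// exprVn -(mulr_natr (s ^+ 2) 2) invfM.
Qed.

Section one_variable.
Context d (T : measurableType d) (m : probability T R) (Z : T -> R).
Hypothesis mZ : measurable_fun setT Z.

Lemma Rint_cos_sub (t u : R) : \int[m]_x cos (t * (Z x - u)) =
  cos (t * u) * \int[m]_x cos (t * Z x) + sin (t * u) * \int[m]_x sin (t * Z x).
Proof.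
have mtZ : measurable_fun setT (fun x => t * Z x) by exact: measurable_funM.
have ic : intg m (fun x => cos (t * Z x)).
  by apply: (@intg_bnd _ _ _ m _ 1) => //; exact: measurableT_comp.
have si : intg m (fun x => sin (t * Z x)).
  by apply: (@intg_bnd _ _ _ m _ 1) => //; exact: measurableT_comp.
rewrite -!RintZ// -RintD; [|exact: intgZ|exact: intgZ].
by apply: eq_Rint => x; rewrite mulrBr cosB mulrC (mulrC (sin _)).
Qed.

(** A Gaussian kernel is a Gaussian mixture of cosines, so its mean under the law of [Z] is
    determined by the characteristic function of Z. *)
Lemma Rint_gker (s u : R) : s != 0 -> \int[m]_x gker s (Z x - u) =
  \int[mu1]_t (npdf s t * \int[m]_x cos (t * (Z x - u))).
Proof.
move=> s0; pose b (z : T * R) := cos (z.2 * (Z z.1 - u)).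
have mb : measurable_fun setT b.
  apply: measurableT_comp => //; apply: measurable_funM => //.
  by apply: measurable_funB => //; exact: measurableT_comp.
have bK z : `|b z| <= 1 by exact: cos1.
have := Rint_swap_kernel (intg_cst m 1) (intg_normal_pdf s) mb bK.
under [X in X = _]eq_Rint do rewrite mul1r.
under [X in _ = X -> _]eq_Rint do under eq_Rint do rewrite mul1r.
move=> <-; apply: eq_Rint => x; rewrite /gker -(Rint_cos_normal_pdf _ s0).
by apply: eq_Rint => t; rewrite /b/= mulrC mulrC mulrC (mulrC t).
Qed.

Lemma Rint_gker_swap (s : R) (k : R -> R) : intg mu1 k ->
  \int[m]_x \int[mu1]_u (k u * gker s (Z x - u)) =
  \int[mu1]_u (k u * \int[m]_x gker s (Z x - u)).
Proof.
move=> ik; pose b (z : T * R) := gker s (Z z.1 - z.2).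
have mb : measurable_fun setT b.
  apply: measurableT_comp; first exact: measurable_gker.
  by apply: measurable_funB => //; exact: measurableT_comp.
have bK z : `|b z| <= 1 by exact: gker_norm_le.
have := Rint_swap_kernel (intg_cst m 1) ik mb bK.
under [X in X = _]eq_Rint do rewrite mul1r.
by under [X in _ = X -> _]eq_Rint do under eq_Rint do rewrite mul1r.
Qed.

Lemma measurable_Rint_gker (s : R) (k : R -> R) : intg mu1 k ->
  measurable_fun setT (fun u => k u * \int[m]_x gker s (Z x - u)).
Proof.
move=> ik; pose b (z : R * T) := gker s (Z z.2 - z.1).
have mb : measurable_fun setT b.
  apply: measurableT_comp; first exact: measurable_gker.
  by apply: measurable_funB => //; exact: measurableT_comp.
have bK z : `|b z| <= 1 by exact: gker_norm_le.
have := intg_meas (intg_Rint_kernel ik (intg_cst m 1) mb bK).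
by under eq_fun do under eq_Rint do rewrite mul1r.
Qed.

End one_variable.

Definition gsmooth (k : R -> R) (s y : R) := \int[mu1]_u (k u * gker s (y - u)).

Lemma Rint_reflect1 (y : R) (f : R -> R) : measurable_fun setT f ->
  \int[mu1]_t f (y - t) = \int[mu1]_t f t.
Proof.
move=> mf; have mE := @integral_lebesgue_sym R true y.
rewrite [RHS](@Rint_transfer _ _ _ _ R mu1 mu1 _ mE)//.
by apply: eq_Rint => t; rewrite expr1 mulN1r.
Qed.

Lemma uniform_continuity (h : R -> R) (r e : R) : continuous h -> 0 < e ->
  exists2 a : R, 0 < a <= 1 & forall y t, `|y| <= r -> `|t| <= a -> `|h (y - t) - h y| <= e.
Proof.
move=> ch e0; have e2 : 0 < e / 2 by rewrite divr_gt0.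
have cK := (compact_near_coveringP `[- r, r]).1 (@segment_compact R (- r) r).
have := cK _ (nbhs (0 : R)) (fun t y => `|h (y - t) - h y| <= e) _ _.
case.
  move=> x _.
  have c1 : (h (p.1 - p.2) : R) @[p --> ((x, 0) : R * R)] --> h x.
    have c2 : (p.1 - p.2 : R) @[p --> ((x, 0) : R * R)] --> x.
      by rewrite -[X in _ --> X]subr0; apply: cvgB; [exact: cvg_fst|exact: cvg_snd].
    exact: (cvg_comp _ _ c2 (ch x)).
  have c3 : (h p.1 : R) @[p --> ((x, 0) : R * R)] --> h x.
    have c4 : (p.1 : R) @[p --> ((x, 0) : R * R)] --> x by exact: cvg_fst.
  exact: (cvg_comp _ _ c4 (ch x)).
  have n1 := @cvgr_dist_lt _ _ _ _ (nbhs_filter _) _ _ c1 _ e2.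
  have n3 := @cvgr_dist_lt _ _ _ _ (nbhs_filter _) _ _ c3 _ e2.
  have : \forall p \near (x, 0 : R), `|h (p.1 - p.2) - h p.1| <= e; last by [].
  apply: filterS2 n3 n1 => p h1 h2 /=.
  rewrite (le_trans (ler_distD (h x) _ _))// [e]splitr lerD//; last exact: ltW.
  by rewrite distrC ltW.
move=> a /= a0 ha; exists (Num.min (a / 2) 1).
  by rewrite lt_min (divr_gt0 a0) ?ltr01//= ge_min lexx orbT.
move=> y t yr; rewrite le_min => /andP[ta _].
have ht : ball (0 : R) a t by rewrite /ball/= sub0r normrN (le_lt_trans ta)// gtr_pMr// invf_lt1// ltr1n.
by apply: (ha t ht y); rewrite /= in_itv/= -ler_norml.
Qed.

Lemma gsmooth_npdf (k : R -> R) (s y : R) : 0 < s -> intg mu1 k ->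
  normal_peak s * gsmooth k s^-1 y = \int[mu1]_t (k (y - t) * npdf s t).
Proof.
move=> s0 ik; have mk := intg_meas ik; rewrite -(@Rint_reflect1 y (fun t => k (y - t) * npdf s t)); last first.
  apply: measurable_funM; last exact: measurable_npdf.
  by apply: measurableT_comp => //; exact: measurable_funB.
rewrite /gsmooth -RintZ; last first.
  apply: intg_dom (intg_norm ik); last first.
    by move=> u; rewrite normrM ler_piMr//; exact: gker_norm_le.
  apply: measurable_funM => //; apply: measurableT_comp; first exact: measurable_gker.
  exact: measurable_funB.
by apply: eq_Rint => u; rewrite npdf_gker// opprB addrCA subrr addr0 mulrCA.
Qed.

(** Cut [h] off outside [- r - 1, r + 1] and mollify. For shifts up to a <= 1 the cutoff is not felt
    on [- r, r] and uniform continuity applies; larger shifts are charged to the first moment of the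
    Gaussian. *)
Lemma gsmooth_approx (h : R -> R) (H r e : R) : continuous h -> (forall y, `|h y| <= H) ->
  0 < r -> 0 < e -> exists s k, [/\ 0 < s, intg mu1 k,
    forall y, `|normal_peak s * gsmooth k s^-1 y| <= H &
    forall y, `|y| <= r -> `|normal_peak s * gsmooth k s^-1 y - h y| <= e].
Proof.
move=> ch hH r0 e0; have e2 : 0 < e / 2 by rewrite divr_gt0.
have H0 : 0 <= H by rewrite (le_trans _ (hH 0)).
have [a /andP[a0 a1] ha] := uniform_continuity r ch e2.
(* With a first moment at most 2 s, the large shifts contribute (2 H / a) 2 s = (H / (H + 1)) e /
   2. *)
pose s := e / (8 * (H + 1) / a); have H1 : 0 < H + 1 by rewrite ltr_wpDl.
have s0 : 0 < s by rewrite !divr_gt0// mulr_gt0.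
pose I := (`[- r - 1, r + 1]%classic : set R).
pose k (u : R) : R := h u * \1_I u.
have mI : measurable_fun setT (\1_I : R -> R) by apply: measurable_indic; exact: measurable_itv.
have mh : measurable_fun setT h by exact: continuous_measurable_fun.
have mk : measurable_fun setT k by exact: measurable_funM.
have I01 u : 0 <= (\1_I u : R) <= 1 by rewrite indicE; case: (_ \in _); rewrite /= ?lexx ?ler01.
have kh u : `|k u| <= H * \1_I u.
  by case/andP: (I01 u) => i0 _; rewrite normrM (ger0_norm i0) ler_wpM2r.
have kH u : `|k u| <= H by rewrite (le_trans (kh u))// ler_piMr//; case/andP: (I01 u).
have ik : intg mu1 k.
  apply: (@intg_dom _ _ R mu1 _ k mk kh (intgZ H (Rint_itv_indic _).1)); lra.
have mky (y : R) : measurable_fun setT (fun t : R => k (y - t)).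
  by apply: measurableT_comp => //; exact: measurable_funB.
have iky (y : R) : intg mu1 (fun t => k (y - t) * npdf s t).
  apply: (@intg_dom _ _ R mu1 _ _ (measurable_funM (mky y) (measurable_npdf s)) _
    (intgZ H (intg_normal_pdf s))).
  by move=> t; rewrite normrM (ger0_norm (normal_pdf_ge0 _ _ _)) ler_wpM2r ?normal_pdf_ge0.
exists s, k; split=> // y.
- rewrite gsmooth_npdf// (le_trans (Rint_norm_le (iky y)))//.
  rewrite -[leRHS](mulr1 H) -(Rint_normal_pdf s) -RintZ; last exact: intg_normal_pdf.
  apply: Rint_le; [exact: intg_norm|exact: intgZ (intg_normal_pdf s)|].
  by move=> t; rewrite normrM (ger0_norm (normal_pdf_ge0 _ _ _)) ler_wpM2r ?normal_pdf_ge0.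
move=> yr; rewrite gsmooth_npdf// -[X in _ - X]mulr1 -(Rint_normal_pdf s).
have ip := intg_normal_pdf s.
have ipm := intg_normal_pdf_mean (lt0r_neq0 s0).
rewrite -RintZ// -RintB//; last exact: intgZ.
have id : intg mu1 (fun t => k (y - t) * npdf s t - h y * npdf s t) by apply: intgB => //; exact: intgZ.
apply: (le_trans (Rint_norm_le id)).
have i2 : intg mu1 (fun t => e / 2 * npdf s t + 2 * H / a * (`|t| * npdf s t)).
  by apply: intgD; exact: intgZ.
apply: (@le_trans _ _ (\int[mu1]_t (e / 2 * npdf s t + 2 * H / a * (`|t| * npdf s t)))).
  apply: Rint_le => [||t]; [exact: intg_norm|by []|].
  have p0 : 0 <= npdf s t by exact: normal_pdf_ge0.
  rewrite -mulrBl normrM (ger0_norm p0) mulrA -mulrDl ler_wpM2r//.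
  have t0 : 0 <= 2 * H / a * `|t| by rewrite mulr_ge0// divr_ge0 ?mulr_ge0// ltW.
  have [ta|ta] := leP `|t| a.
    have -> : k (y - t) = h (y - t).
      have Iyt : I (y - t).
        rewrite /I/= in_itv/=; move: yr ta a1; rewrite !ler_norml => /andP[q1 q2] /andP[q3 q4] q5.
        by clear -q1 q2 q3 q4 q5; apply/andP; split; lra.
      by rewrite /k indicE mem_set// mulr1.
    by rewrite (le_trans (ha _ _ yr ta))// lerDl.
  rewrite (@le_trans _ _ (2 * H))//.
    by rewrite (le_trans (ler_normB _ _))// mulr_natl mulr2n lerD.
  rewrite (@le_trans _ _ (2 * H / a * `|t|))//; last by rewrite lerDr ltW.
  by rewrite mulrAC ler_pdivlMr// ler_wpM2l ?mulr_ge0// ltW.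
rewrite RintD; [|exact: intgZ|exact: intgZ].
rewrite RintZ// RintZ// Rint_normal_pdf mulr1 [leRHS]splitr lerD2l.
have c0 : 0 <= 2 * H / a by rewrite divr_ge0 ?mulr_ge0// ltW.
apply: le_trans (ler_wpM2l c0 (Rint_norm_normal_pdf_le s0)) _.
have -> : 2 * H / a * (2 * s) = (H / (H + 1)) * (e / 2).
  by rewrite /s; field; rewrite !gt_eqF.
by rewrite ler_piMl ?(ltW e2)// ler_pdivrMr// mul1r lerDl.
Qed.

Section weak_convergence.
Context d (T : measurableType d) (m : probability T R).
Variables (nu : probability (measurableTypeR R) R) (Y : nat -> T -> R) (v : R).
Hypothesis mY : forall N, measurable_fun setT (Y N).
Hypothesis Y2 : forall N, (0 < N)%N -> intg m (fun x => Y N x ^+ 2) /\ \int[m]_x (Y N x ^+ 2) <= v.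
Hypothesis Ycos : forall t,
  \int[m]_x cos (t * Y N x) @[N --> \oo] --> \int[nu]_y cos (t * y).
Hypothesis Ysin : forall t,
  \int[m]_x sin (t * Y N x) @[N --> \oo] --> \int[nu]_y sin (t * y).

Let mid : measurable_fun setT (fun y : measurableTypeR R => y : R).
Proof. by []. Qed.

(** By [Rint_gker] both sides are integrals of characteristic functions against a normal density,
    which dominates. *)
Lemma cvg_Rint_gker (s u : R) : s != 0 ->
  \int[m]_x gker s (Y N x - u) @[N --> \oo] --> \int[nu]_y gker s (y - u).
Proof.
move=> s0; rewrite (Rint_gker nu mid u s0).
under eq_fun do rewrite (Rint_gker m (mY _) u s0).
refine (proj2 (@Rint_dct _ _ R mu1 (fun N t => npdf s t * \int[m]_x cos (t * (Y N x - u)))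
  (fun t => npdf s t * \int[nu]_x cos (t * (x - u))) (npdf s) _ _ _ (intg_normal_pdf s))).
- move=> N; pose b (z : R * T) := cos (z.1 * (Y N z.2 - u)).
  have mb : measurable_fun setT b.
    apply: measurableT_comp => //; apply: measurable_funM => //.
    by apply: measurable_funB => //; exact: measurableT_comp.
  have bK z : `|b z| <= 1 by exact: cos1.
  have := intg_meas (intg_Rint_kernel (intg_normal_pdf s) (intg_cst m 1) mb bK).
  by under eq_fun do under eq_Rint do rewrite mul1r.
- move=> t; apply: cvgMr; rewrite (Rint_cos_sub nu mid).
  under eq_fun do rewrite (Rint_cos_sub m (mY _)).
  by apply: cvgD; apply: cvgMr; [exact: Ycos|exact: Ysin].
- move=> N t; rewrite normrM (ger0_norm (normal_pdf_ge0 _ _ _)) ler_piMr ?normal_pdf_ge0//.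
  apply: Rint_bnd => //; apply: measurableT_comp => //; apply: measurable_funM => //.
  exact: measurable_funB.
Qed.

Lemma cvg_Rint_gsmooth (s : R) (k : R -> R) : s != 0 -> intg mu1 k ->
  \int[m]_x gsmooth k s (Y N x) @[N --> \oo] --> \int[nu]_y gsmooth k s y.
Proof.
move=> s0 ik; rewrite (Rint_gker_swap nu mid s ik).
under eq_fun do rewrite (Rint_gker_swap m (mY _) s ik).
refine (proj2 (@Rint_dct _ _ R mu1 (fun N u => k u * \int[m]_x gker s (Y N x - u))
  (fun u => k u * \int[nu]_x gker s (x - u)) (fun u => `|k u|) _ _ _ (intg_norm ik))).
- by move=> N; exact: measurable_Rint_gker.
- by move=> u; apply: cvgMr; exact: cvg_Rint_gker.
- move=> N u; rewrite normrM ler_piMr//; apply: Rint_bnd; last by move=> x; exact: gker_norm_le.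
  by apply: measurableT_comp; [exact: measurable_gker|exact: measurable_funB].
Qed.

Lemma nu_tail (e : R) : 0 < e -> exists n0 : nat, forall n, (n0 <= n)%N ->
  intg nu (fun y => \1_[set y | n%:R < `|y|] y : R) /\
  \int[nu]_y (\1_[set y | n%:R < `|y|] y : R) <= e.
Proof.
move=> e0.
have mtail n : measurable_fun setT (fun y : measurableTypeR R => \1_[set y : R | n%:R < `|y|] y : R).
  apply: measurable_indic.
  have := @normr_measurable R setT measurableT _ (measurable_itv `]n%:R, +oo[).
  by rewrite setTI; congr measurable; apply/seteqP; split=> y /=; rewrite in_itv/= andbT.
have b1 n (y : R) : `|\1_[set y : R | n%:R < `|y|] y : R| <= 1.
  by rewrite indicE; case: (_ \in _); rewrite ?normr1 ?normr0.
have ht : \int[nu]_y (\1_[set y | n%:R < `|y|] y : R) @[n --> \oo] --> (0 : R).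
  rewrite -(@Rint0 _ _ R nu).
  refine (proj2 (@Rint_dct _ _ R nu (fun n y => \1_[set y : R | n%:R < `|y|] y) (fun=> 0) (fun=> 1)
    mtail _ b1 (intg_cst nu 1))).
  move=> y; apply/cvg_epsP => z z0.
  exists (Num.bound `|y|) => n hn.
  rewrite indicE memNset ?subrr ?normr0 ?ltW//= => /lt_geF/negP; apply.
  by rewrite (le_trans (ltW (archi_boundP (normr_ge0 y))))// ler_nat.
have [n0 hn0] := (cvg_epsP _ _).1 ht _ e0.
exists n0 => n /hn0; rewrite subr0 => hn; split; first exact: (@intg_bnd _ _ _ nu _ 1).
exact: le_trans (ler_norm _) hn.
Qed.

(** Gaussian smoothings pass to the limit by convergence of characteristic functions. On a large
    interval they are uniformly close to [h]; outside it Chebyshev's inequality with the bound [v]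
    controls Y, and dominated convergence the limit law. The losses add up to 5 e / 8. *)
Theorem levy_continuity (h : R -> R) (K : R) : continuous h -> (forall y, `|h y| <= K) ->
  \int[m]_x h (Y N x) @[N --> \oo] --> \int[nu]_y h y.
Proof.
move=> ch hK; apply/cvg_epsP => e e0.
have K0 : 0 <= K by rewrite (le_trans _ (hK 0)).
have v0 : 0 <= v by rewrite (le_trans _ (Y2 (ltn0Sn 0)).2)// Rint_ge0// => x; exact: sqr_ge0.
have e8 : 0 < e / 8 by rewrite divr_gt0.
have K1 : 0 < 2 * K + 1 by rewrite ltr_wpDl// mulr_ge0.
have [n0 hn0] := nu_tail (divr_gt0 e8 K1).
pose n := (maxn n0 (Num.bound (2 * K * v / (e / 8)))).+1.
have nn0 : (n0 <= n)%N by rewrite leqW// leq_maxl.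
have n1 : 1 <= n%:R :> R by rewrite ler1n.
have nv : 2 * K * v / n%:R ^+ 2 <= e / 8.
  have n2 : 0 < n%:R ^+ 2 :> R by rewrite exprn_gt0// ltr0n.
  rewrite ler_pdivrMr// [leRHS]mulrC -ler_pdivrMr//.
  rewrite (@le_trans _ _ n%:R)//; last by rewrite expr2 ler_peMl// ler0n.
  rewrite (le_trans (ltW (archi_boundP _)))//.
    by rewrite divr_ge0 ?mulr_ge0// ltW.
  by rewrite ler_nat leqW// leq_maxr.
have [it ht] := hn0 n nn0.
have nr : 0 < n%:R :> R by rewrite ltr0n.
have [s [k [s0 ik qK qh]]] := gsmooth_approx ch hK nr e8.
pose q y := normal_peak s * gsmooth k s^-1 y.
have mh : measurable_fun setT h by exact: continuous_measurable_fun.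
have mq : measurable_fun setT q.
  apply: measurable_funM => //.
  pose b (z : R * R) := gker s^-1 (z.1 - z.2).
  have mb : measurable_fun setT b.
    by apply: measurableT_comp; [exact: measurable_gker|exact: measurable_funB].
  have bK z : `|b z| <= 1 by exact: gker_norm_le.
  have := intg_meas (intg_Rint_kernel (intg_cst nu 1) ik mb bK).
  by under eq_fun do rewrite mul1r.
have si : s^-1 != 0 by rewrite invr_neq0// gt_eqF.
have qc : \int[m]_x q (Y N x) @[N --> \oo] --> \int[nu]_y q y.
  have mg : measurable_fun setT (gsmooth k s^-1).
    rewrite (_ : gsmooth k s^-1 = fun y => (normal_peak s)^-1 * q y); first exact: measurable_funM.
    by apply/funext => y; rewrite /q mulrA mulVf ?mul1r// gt_eqF// normal_peak_gt0// gt_eqF.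
  have gb y : `|gsmooth k s^-1 y| <= \int[mu1]_u `|k u|.
    have ig : intg mu1 (fun u => k u * gker s^-1 (y - u)).
      apply: intg_dom (intg_norm ik); last first.
        by move=> u; rewrite normrM ler_piMr//; exact: gker_norm_le.
      apply: measurable_funM; first exact: intg_meas ik.
      by apply: measurableT_comp; [exact: measurable_gker|exact: measurable_funB].
    apply: le_trans (Rint_norm_le ig) _; apply: Rint_le; [exact: intg_norm|exact: intg_norm|].
    by move=> u; rewrite normrM ler_piMr//; exact: gker_norm_le.
  rewrite RintZ; last exact: (@intg_bnd _ _ _ nu _ _ mg gb).
  rewrite (_ : (fun N => _) = fun N => normal_peak s * \int[m]_x gsmooth k s^-1 (Y N x)); last first.
    apply/funext => N; rewrite -RintZ//.
    by apply: (@intg_bnd _ _ _ m _ (\int[mu1]_u `|k u|)) => //; exact: measurableT_comp.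
  by apply: cvgMr; exact: cvg_Rint_gsmooth.
have [N1 hN1] := (cvg_epsP _ _).1 qc _ e8.
have hq y : `|h y - q y| <= e / 8 + 2 * K * \1_[set y : R | n%:R < `|y|] y.
  rewrite indicE; have [yn|yn] := leP `|y| n%:R.
    by rewrite memNset/= ?mulr0 ?addr0 ?(distrC (h y)) ?qh//= => /lt_geF; rewrite yn.
  rewrite mem_set//= mulr1 (@le_trans _ _ (2 * K))//; last by rewrite lerDr ltW.
  by rewrite (le_trans (ler_normB _ _))// mulr_natl mulr2n lerD// qK.
have bnd d' (T' : measurableType d') (P : probability T' R) (Z : T' -> R) (g : T' -> R) :
    measurable_fun setT Z -> (forall x, \1_[set y : R | n%:R < `|y|] (Z x) <= g x) -> intg P g ->
    \int[P]_x g x * (2 * K) <= e / 8 ->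
    `|\int[P]_x h (Z x) - \int[P]_x q (Z x)| <= e / 8 + e / 8.
  move=> mZ Zg ig gK.
  have ih : intg P (fun x => h (Z x)).
    by apply: (@intg_bnd _ _ _ P _ K) => //; exact: measurableT_comp.
  have iq : intg P (fun x => q (Z x)).
    by apply: (@intg_bnd _ _ _ P _ K) => [|x]; [exact: measurableT_comp|exact: qK].
  have ib := intgD (intg_cst P (e / 8)) (intgZ (2 * K) ig).
  rewrite -RintB// (le_trans (Rint_norm_le (intgB ih iq)))//.
  apply: (@le_trans _ _ (\int[P]_x (e / 8 + 2 * K * g x))).
    apply: Rint_le => // [|x]; first by apply: intg_norm; exact: intgB.
    by rewrite (le_trans (hq _))// lerD2l ler_wpM2l// mulr_ge0.
  rewrite RintD; [|exact: intg_cst|exact: intgZ].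
  by rewrite Rint_cst RintZ// lerD2l mulrC.
exists (maxn N1 1) => N; rewrite geq_max => /andP[NN1 N0].
have [iY vY] := Y2 N0.
have b1 := bnd _ _ m (Y N) (fun x => n%:R ^- 2 * Y N x ^+ 2) (mY N).
have b2 := bnd _ _ nu id _ mid (fun=> lexx _) it.
have h1 : `|\int[m]_x h (Y N x) - \int[m]_x q (Y N x)| <= e / 8 + e / 8.
  apply: b1 => [x||].
  - rewrite indicE; case: (boolP (_ \in _)) => [|_]; last by rewrite mulr_ge0 ?sqr_ge0// invr_ge0 sqr_ge0.
    rewrite inE/= => nY; rewrite mulrC ler_pdivlMr ?exprn_gt0// mul1r -(real_normK (num_real (Y N x))).
    by rewrite ler_sqr ?nnegrE// ltW.
  - exact: intgZ.
  - rewrite RintZ//; apply: le_trans nv; rewrite mulrC mulrA -mulrA mulrCA mulrC.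
    by apply: ler_wpM2r; [rewrite invr_ge0 sqr_ge0|apply: ler_wpM2l => //; rewrite mulr_ge0].
have h2 : `|\int[nu]_y h y - \int[nu]_y q y| <= e / 8 + e / 8.
  apply: b2; rewrite (le_trans (ler_wpM2r _ ht)) ?mulr_ge0// mulrAC ler_pdivrMr//.
  by rewrite ler_wpM2l ?lerDl// ltW.
have h3 := hN1 N NN1.
have -> : \int[m]_x h (Y N x) - \int[nu]_y h y = (\int[m]_x h (Y N x) - \int[m]_x q (Y N x)) +
  (\int[m]_x q (Y N x) - \int[nu]_y q y) - (\int[nu]_y h y - \int[nu]_y q y) by ring.
rewrite (le_trans (ler_normB _ _))// (le_trans (lerD (ler_normD _ _) (lexx _)))//.
lra.
Qed.

End weak_convergence.

End levy_continuity.

(** * The quenched central limit theorem *)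

Section normal_law.
Context (R : realType).
Local Notation mu1 := (@lebesgue_measure R).
Local Notation npdf := (normal_pdf (0 : R)).

(** Identifies the Radon-Nikodym derivative with the Gaussian density through integrals over Borel
    sets, so that integrals against the normal law become Lebesgue integrals. *)
Lemma normal_prob_density (s : R) :
  ae_eq mu1 setT (Radon_Nikodym (charge_of_finite_measure (normal_prob 0 s)) mu1)
    (fun y => (npdf s y)%:E).
Proof.
have dom := normal_prob_dominates 0 s.
apply: integral_ae_eq => //.
- exact: Radon_Nikodym_integrable.
- by apply/measurable_EFinP; exact: measurable_npdf.
- by move=> A _ mA; rewrite -Radon_Nikodym_integral.
Qed.

Lemma Rint_normal_prob (s K : R) (h : R -> R) : measurable_fun setT h ->
  (forall y, `|h y| <= K) ->
  \int[normal_prob 0 s]_(y in [set: R]) h y = \int[mu1]_y (h y * npdf s y).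
Proof.
move=> mh hK; have ih := @intg_bnd _ _ _ (normal_prob 0 s) h K mh hK.
have dom := normal_prob_dominates 0 s.
have /integrableP[mRN _] : mu1.-integrable setT
    (Radon_Nikodym (charge_of_finite_measure (normal_prob 0 s)) mu1) by exact: Radon_Nikodym_integrable.
rewrite /Rintegral -(Radon_Nikodym_change_of_variables dom measurableT ih); congr fine.
under [RHS]eq_integral do rewrite EFinM.
apply: ae_eq_integral => //.
- apply: emeasurable_funM; first exact/measurable_EFinP.
  exact: mRN.
- apply: emeasurable_funM; first exact/measurable_EFinP.
  by apply/measurable_EFinP; exact: measurable_npdf.
- by apply: ae_eqe_mul2l; exact: normal_prob_density.
Qed.

(** The point mass at 0 stands for variance zero, which lets Levy's theorem treat the degenerate
    limit like the others. *)
Lemma gaussian_mean_law (v : R) : 0 <= v ->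
  exists nu : probability (measurableTypeR R) R, [/\
    forall t, \int[nu]_y cos (t * y) = expR (- (v * t ^+ 2 / 2)),
    forall t, \int[nu]_y sin (t * y) = 0 &
    forall h : R -> R, measurable_fun setT h -> (exists K : R, forall y, `|h y| <= K) ->
      gaussian_mean v h = \int[nu]_y h y].
Proof.
move=> v0; have [v1|v1] := eqVneq v 0.
  have dE (h : R -> R) : measurable_fun setT h ->
      \int[\d_(0 : measurableTypeR R)]_y h y = h 0.
    move=> mh; rewrite /Rintegral integral_dirac//=; last exact/measurable_EFinP.
    by rewrite indicT mul1r.
  have mt (t : R) : measurable_fun setT (fun y : R => t * y) by exact: measurable_funM.
  exists (\d_(0 : measurableTypeR R)); split=> [t|t|h mh _].
  - rewrite dE; first by rewrite mulr0 cos0 v1 !mul0r oppr0 expR0.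
    by apply: measurableT_comp => //; exact: measurable_cosR.
  - rewrite dE; first by rewrite mulr0 sin0.
    by apply: measurableT_comp => //; exact: measurable_sinR.
  - by rewrite dE// /gaussian_mean v1 eqxx.
have s0 : Num.sqrt v != 0 by rewrite gt_eqF// sqrtr_gt0 lt_neqAle eq_sym v1.
have mt (t : R) : measurable_fun setT (fun y : R => t * y) by exact: measurable_funM.
exists (normal_prob 0 (Num.sqrt v)); split=> [t|t|h mh [K hK]].
- rewrite (@Rint_normal_prob _ 1)//.
  + by rewrite Rint_cos_normal_pdf// sqr_sqrtr// mulNr mulrAC.
  + by apply: measurableT_comp => //; exact: measurable_cosR.
  + by move=> y; exact: cos_max.
- rewrite (@Rint_normal_prob _ 1)//.
  + by rewrite Rint_sin_normal_pdf.
  + by apply: measurableT_comp => //; exact: measurable_sinR.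
  + by move=> y; exact: sin_max.
- by rewrite /gaussian_mean (negbTE v1).
Qed.

End normal_law.

Lemma comb_scale (R : realType) (T : Type) (fam : seq (T -> R)) (k : R) (c : seq R) (x : T) :
  comb fam [seq k * y | y <- c] x = k * comb fam c x.
Proof.
elim: fam c => [|u s ih] [|y c]; rewrite ?comb_nil ?mulr0// /=.
  by rewrite /comb !big_nil mulr0.
by rewrite !comb_cons ih mulrDr mulrA.
Qed.

Section quenched_clt.
Context {R : realType} {dW dT : measure_display} {W : measurableType dW} {T : measurableType dT}.
Variables (P : probability W R) (m : probability T R).
Variables (F : W -> nat -> T -> T) (sh : nat -> W -> W) (agree : nat -> W -> W -> Prop).
Hypothesis hD : random_dynamics P m F sh agree.
Variable fam : nat -> seq (T -> R).
Hypothesis hF : mixing_family P m F fam.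
Variables (p : nat) (t : R).
Hypothesis t0 : 0 < t.
Local Notation asv := (asymp_variance P m F).
Local Notation vp := (variance_partial P m F).
Local Notation F2 := (fun (w : W) (n : nat) (z : T * T) => (F w n z.1, F w n z.2)).
Hypothesis clt : forall n c, (0 < n)%N -> size c = size (fam n) ->
  annealed_CLT_rate P (m \x m)%E F2 (fun z => comb (fam n) c z.1) /\
  annealed_CLT_rate P (m \x m)%E F2 (fun z => comb (fam n) c z.1 - comb (fam n) c z.2).

Lemma large_exponent : exists a : nat, 4 <= a%:R * t.
Proof.
exists (Num.bound (4 / t)); rewrite -ler_pdivrMr//.
by rewrite ltW// archi_boundP// divr_ge0// ltW.
Qed.

(** The frequency k for [A] is the frequency one for k A. As k A is approximable at the same rate,
    the same set of words serves all frequencies. *)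
Lemma approx_rate_scale (k : R) A : sqint m A -> approx_rate m fam p t A ->
  approx_rate m fam p t (fun x => k * A x).
Proof.
move=> sA [K K0 hK]; exists (Num.max `|k| (k ^+ 2) * K).
  by rewrite mulr_ge0// le_max normr_ge0.
move=> n n0; have [c [cs cK cA]] := hK n n0.
exists [seq k * y | y <- c]; split; first by rewrite size_map.
  move=> _ /mapP[y yc ->]; rewrite normrM -mulrA; apply: ler_pM => //; last exact: cK.
  by rewrite le_max lexx.
rewrite (eq_Rint m (g := fun x => k ^+ 2 * (A x - comb (fam n) c x) ^+ 2)); last first.
  by move=> x; rewrite comb_scale -mulrBr exprMn.
have [B _ [m1 b1]] := comb_bnd hF n c.
rewrite RintZ; last exact: (sqintB sA (sqint_bnd m m1 b1)).2.
have k2 : 0 <= k ^+ 2 := sqr_ge0 k.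
rewrite -(mulrA (Num.max _ _)); apply: ler_pM; [exact: k2| |by rewrite le_max lexx orbT|exact: cA].
by apply: Rint_ge0 => x; exact: sqr_ge0.
Qed.

Lemma nsum_scale (k : R) A N w x : nsum F (fun x => k * A x) N w x = k * nsum F A N w x.
Proof. by rewrite /nsum /birkhoff -mulr_sumr mulrCA. Qed.

Lemma variance_partial_scale (k : R) A n : sqint m A -> approx_rate m fam p t A ->
  vp (fun x => k * A x) n = k ^+ 2 * vp A n.
Proof.
move=> sA [K K0 hK]; have [a at4] := large_exponent.
have spanA : span_approx m fam p t K A.
  move=> n' n0; have [c [cs cK cA]] := hK n' n0; exists c, [::]; split=> //.
  by rewrite (eq_Rint m (g := fun x => (A x - comb (fam n') c x) ^+ 2))// => x; rewrite comb_nil subr0.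
rewrite /variance_partial mulrDr; congr (_ + _).
  rewrite -RintZ; last exact: sA.2.
  by apply: eq_Rint => x; rewrite exprMn.
rewrite mulrCA; congr (_ * _); rewrite mulr_sumr; apply: eq_bigr => j _.
rewrite /correlation -RintZ; last first.
  apply: (@intg_bnd _ _ _ P _ (nrm m A * nrm m A)); last by move=> w; exact: (qcorr_le hD).
  exact: (measurable_qcorr_span hD hF at4 j sA K0 spanA).
apply: eq_Rint => w; rewrite -RintZ; last exact: (sqint_mul sA (sqint_F hD w j sA)).
by apply: eq_Rint => x; rewrite mulrACA.
Qed.

(** Nonnegativity of the asymptotic variance comes out of the limit: exp(- D / 2) is a limit of
    integrals of cosines, none exceeding 1. The uniform second moment bound supplies the tightness
    in Levy's theorem. *)
Theorem quenched_clt : {ae P, forall w, forall A, sqint m A -> approx_rate m fam p t A ->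
  CLT_at P m F w A}.
Proof.
have [a at4] := large_exponent.
have := quenched_charfun hD hF p t0 at4 clt; apply: filterS => w hw A sA hA.
have [cv cA _ [v hv]] := hw A sA hA.
have asvZ k : asv (fun x => k * A x) = k ^+ 2 * asv A.
  rewrite /asymp_variance (_ : vp _ = fun n => k ^+ 2 * vp A n); last first.
    by apply/funext => n; exact: variance_partial_scale.
  by apply: cvg_lim => //; exact: cvgMr.
have D0 : 0 <= asv A.
  rewrite leNgt; apply/negP => D0.
  have : expR (- (asv A / 2)) <= 1.
    rewrite -(cvg_lim _ cA)//; apply: limr_le; first by apply/cvg_ex; eexists; exact: cA.
    apply: nearW => N; have [_ /(_ w)] := measurable_cosm hD sA.1 N.
    exact: le_trans (ler_norm _).
  by rewrite -expR0 ler_expR oppr_le0 leNgt pmulr_llt0 ?invr_gt0// D0.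
split=> // h ch [K hK].
have [nu [nc ns nh]] := gaussian_mean_law D0.
have mh : measurable_fun setT h by exact: continuous_measurable_fun.
rewrite nh//; last by exists K.
have mN N : measurable_fun setT (nsum F A N w) by exact: (sqint_nsum hD N w sA).1.
apply: (@levy_continuity _ _ _ m nu (nsum F A ^~ w) v mN _ _ _ h K ch hK).
- by move=> N N0; split; [exact: (sqint_nsum hD N w sA).2|exact: hv].
- move=> k; rewrite nc; have [_ + _ _] := hw _ (sqintZ k sA) (approx_rate_scale k sA hA).
  rewrite asvZ (mulrC (k ^+ 2)) /cosm.
  by under eq_fun do under eq_Rint do rewrite nsum_scale.
- move=> k; rewrite ns; have [_ _ + _] := hw _ (sqintZ k sA) (approx_rate_scale k sA hA).
  by rewrite /sinm; under eq_fun do under eq_Rint do rewrite nsum_scale.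
Qed.

End quenched_clt.

(** * Compositions of random diffeomorphisms as a random dynamics *)

Section manifold_dynamics.
Context {R : realType} (M : closedRiemannian R).
Local Notation X := (atlas M).
Local Notation d := (Defs.dim X).
Variables (mu : probability (borelDiff M) R) (P : probability (words M) R).
Hypothesis hP : is_product_power mu P.

Lemma rcomp_random_dynamics : random_dynamics P (dx M) (@rcomp R M) (@shiftw R M) (@agree R M).
Proof.
split.
- exact: measurable_rcomp.
- exact: rcomp_preserves.
- by move=> w n k x; exact: rcompD.
- exact: measurable_shiftw.
- by move=> n k w; apply/funext => j; rewrite /shiftw addnA.
- by move=> k f g K mf mg fK gK fa; exact: (shift_independence hP mf mg fK gK fa).
- exact: rcomp_agree.
Qed.

Variable r0 : nat.
Hypothesis hr : forall (i : idx X) z, (phi i @` chart_supp i) z -> `|z| <= r0%:R.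

Lemma fam_mixing_family :
  (exists p : R, 0 <= p /\ annealed_exp_mixing P (dxdy M) (@rcomp2 R M) (sobolev0_MM M p)) \/
  (exists (alpha : R) (k : nat) (b : R), holder_exponents alpha k b /\
     annealed_exp_mixing P (dxdy M) (@rcomp2 R M) (holder0_MM M k b)) ->
  mixing_family P (dx M) (@rcomp R M) (fam M r0).
Proof.
move=> mixing; have [B B0 hB] := fam_bounded M r0; split.
- exists B => // n u un; have [_ mu' _] := fam_props un; split=> //; exact: hB un.
- by move=> n u /fam_props[].
- by move=> n n'; exact: fam_prefix.
- by have [C C0 hC] := size_fam M r0; exists C, d.+1; split.
have [C [Q [th [C0 th0 hC]]]] := fam_mixing hr mixing.
exists C, Q, th; split=> // n u v k n0 un vn.
have [_ mu' _] := fam_props un; have [_ mv _] := fam_props vn.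
rewrite (qcorr_sqr rcomp_random_dynamics k mu' mv (hB _ _ un) (hB _ _ vn)).
exact: le_trans (ler_norm _) (hC n u u v v n0 un un vn vn k).
Qed.

Lemma fam_comb_clt n c : mixing_family P (dx M) (@rcomp R M) (fam M r0) ->
  (forall B : M * M -> R, smooth_fun (atlas2 M) B -> zero_mean (dxdy M) B ->
    annealed_CLT_rate P (dxdy M) (@rcomp2 R M) B) ->
  annealed_CLT_rate P (dx M \x dx M)%E (@rcomp2 R M) (fun z => comb (fam M r0 n) c z.1) /\
  annealed_CLT_rate P (dx M \x dx M)%E (@rcomp2 R M)
    (fun z => comb (fam M r0 n) c z.1 - comb (fam M r0 n) c z.2).
Proof.
move=> hF clt; pose f := comb (fam M r0 n) c.
have f0 : \int[dx M]_x f x = 0 := comb_mean0 hF n c.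
have [K _ [mf fK]] := comb_bnd hF n c.
have sf : smooth_fun X f.
  apply: smooth_fun_eq (fun x => esym (comb_nth _ c x)) _.
  apply: smooth_fun_sum => i; apply: smooth_fun_mul; first exact: smooth_fun_cst.
  by have [] := fam_props (mem_nth (fun=> 0) (ltn_ord i)).
have mf1 : measurable_fun setT (fun z : borel M * borel M => f z.1) by exact: measurableT_comp mf _.
have mf2 : measurable_fun setT (fun z : borel M * borel M => f z.2) by exact: measurableT_comp mf _.
have i1 := @intg_prod_bnd _ _ _ _ R (dx M) (dx M) _ K mf1 (fun z => fK z.1).
have i2 := @intg_prod_bnd _ _ _ _ R (dx M) (dx M) _ K mf2 (fun z => fK z.2).
have e1 : \int[(dx M \x dx M)%E]_z f z.1 = 0.
  have := Rint_tensor (dx M) (dx M) mf (measurable_cst (1 : R)) fK (fun _ => lexx `|1 : R|).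
  by rewrite f0 mul0r => e; rewrite -[RHS]e; apply: eq_Rint => z; rewrite mulr1.
have e2 : \int[(dx M \x dx M)%E]_z f z.2 = 0.
  have := Rint_tensor (dx M) (dx M) (measurable_cst (1 : R)) mf (fun _ => lexx `|1 : R|) fK.
  by rewrite f0 mulr0 => e; rewrite -[RHS]e; apply: eq_Rint => z; rewrite mul1r.
split; apply: clt.
- exact: smooth_fun_fst.
- exact: e1.
- exact: smooth_fun_diff.
- by rewrite /zero_mean RintB// e1 e2 subr0.
Qed.

End manifold_dynamics.

Theorem theorem1p7 (R : realType) (M : closedRiemannian R)
    (mu : probability (borelDiff M) R)
    (P : probability (words M) R) (hP : is_product_power mu P)
    (mixing :
       (exists p : R, 0 <= p /\
          annealed_exp_mixing P (dxdy M) (@rcomp2 R M) (sobolev0_MM M p)) \/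
       (exists (alpha : R) (k : nat) (b : R), holder_exponents alpha k b /\
          annealed_exp_mixing P (dxdy M) (@rcomp2 R M) (holder0_MM M k b)))
    (clt : forall B : M * M -> R,
       smooth_fun (atlas2 M) B -> zero_mean (dxdy M) B ->
       annealed_CLT_rate P (dxdy M) (@rcomp2 R M) B)
    (s : R) (hs : 0 < s) :
  {ae P, forall w, forall A, fs_mem (sobolev0_M M s) A ->
      CLT_at P (dx M) (@rcomp R M) w A} /\
  (forall (k : nat) (b : R), holder_exponents s k b ->
    {ae P, forall w, forall A, fs_mem (holder0_M M k b) A ->
      CLT_at P (dx M) (@rcomp R M) w A}).
Proof.
have [r0 _ hr] := charts_cbox M.
have hF := fam_mixing_family hP hr mixing.
(* The rate 2 min(s, 1) is common to the Sobolev and Hoelder classes, so one application of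
   [quenched_clt] yields both conclusions. *)
have t0 : 0 < 2 * Num.min s 1 by rewrite mulr_gt0// lt_min hs ltr01.
have key := quenched_clt (rcomp_random_dynamics hP) hF (Defs.dim (atlas M)) t0 (fun n c _ _ => fam_comb_clt n c hF clt).
split=> [|k b hb]; move: key; apply: filterS => w hw A mA.
  by have [sA _ aA] := sobolev_approx hr hs mA; exact: hw.
by have [sA _ aA] := holder_approx hr hb mA; exact: hw.
Qed.
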